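(* Let $M_t$ be the position at time $t$ of the rightmost particle in a standard binary branching Brownian motion (branching rate $1$) started from one particle at $0$. Then $$\liminf_{t\to\infty}\frac{M_t-\sqrt2\,t}{\log t} = -\frac{3}{2\sqrt2}\qquad\text{almost surely}$$ and $$\limsup_{t\to\infty}\frac{M_t-\sqrt2\,t}{\log t} = -\frac{1}{2\sqrt2}\qquad\text{almost surely},$$ where the limits are taken over continuous time $t\to\infty$.
   Context: Branching Brownian motion (BBM): the process begins with one particle at $0$ at time $0$, which moves like a standard one-dimensional Brownian motion until an independent exponentially distributed time with parameter $1$. At this time it dies and is replaced, at its current position, by two new particles which, relative to their birth time and position, behave like independent copies of their parent (moving as Brownian motions and branching at rate $1$ into two copies of themselves). $N(t)$ denotes the set of particles alive at time $t$; for $v\in N(t)$, $X_v(t)$ is the position of $v$ at time $t$. Define $M_t=\max_{v\in N(t)}X_v(t)$. *)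

(* Defs.v *)
From HB Require Import structures.
From mathcomp Require Export all_boot all_order all_algebra.
From mathcomp Require Export all_classical all_reals all_analysis.
Import Order.TTheory GRing.Theory Num.Theory.
Import numFieldNormedType.Exports.

Set Implicit Arguments.
Unset Strict Implicit.
Unset Printing Implicit Defensive.

Local Open Scope classical_set_scope.
Local Open Scope ring_scope.

Definition sigma_rv d (T : measurableType d) (R : realType) (X : T -> R) :
    set (set T) :=
  preimage_set_system setT X measurable.

(* A process is a family indexed by all of [R]; only its values at times
   [t >= 0] are ever used. *)
Definition sigma_process d (T : measurableType d) (R : realType)
    (W : R -> T -> R) : set (set T) :=
  <<s \bigcup_(t in `[0, +oo[) sigma_rv (W t) >>.

Definition mutually_independent d (T : measurableType d) (R : realType)
    (P : probability T R) (I : eqType) (G : I -> set (set T)) : Prop :=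
  forall (s : seq I) (A : I -> set T), uniq s ->
    (forall i, i \in s -> G i (A i)) ->
    P (\big[setI/setT]_(i <- s) A i) = (\prod_(i <- s) P (A i))%E.

(* The library's [normal_prob m s] is parametrized by the standard deviation
   [s]. *)
Record brownian_motion d (T : measurableType d) (R : realType)
    (P : probability T R) (W : R -> {RV P >-> R}) : Prop := {
  bm_start : {ae P, forall w, W 0 w = 0} ;
  bm_independent_increments : forall t : nat -> R,
    0 <= t 0%N -> {homo t : m n / (m <= n)%N >-> m <= n} ->
    mutually_independent P (fun i : nat => sigma_rv (W (t i.+1) \- W (t i))) ;
  bm_normal_increments : forall s t : R, 0 <= s -> s < t ->
    forall A : set R, measurable A ->
    P ((W t \- W s) @^-1` A) = normal_prob 0 (Num.sqrt (t - s)) A ;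
  bm_continuous : {ae P, forall w,
    {within `[0, +oo[, continuous (fun t : R => W t w)}}
}.

(* Particles carry Ulam-Harris labels: the root is [[::]] and the two children
   of [u] are [rcons u false] and [rcons u true], so the strict ancestors of
   [u] are the [take k u] with [k < size u].  [tau u] is the lifetime of [u]
   and [B u s] its displacement from its birth position when it has age [s];
   only ages up to [tau u] matter below. *)
Definition driving_sigma d (T : measurableType d) (R : realType)
    (tau : seq bool -> T -> R) (B : seq bool -> R -> T -> R)
    (i : seq bool + seq bool) : set (set T) :=
  match i with
  | inl u => sigma_rv (tau u)
  | inr u => sigma_process (B u)
  end.

Record branching_brownian_motion d (T : measurableType d) (R : realType)
    (P : probability T R) (tau : seq bool -> {RV P >-> R})
    (B : seq bool -> R -> {RV P >-> R}) : Prop := {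
  bbm_lifetime : forall (u : seq bool) (A : set R), measurable A ->
    distribution P (tau u) A = exponential_prob 1 A ;
  bbm_motion : forall u : seq bool, brownian_motion (B u) ;
  bbm_independent : mutually_independent P (driving_sigma tau B)
}.

Section particles.
Context {T : Type} {R : realType}.
Variables (tau : seq bool -> T -> R) (B : seq bool -> R -> T -> R).

Definition birth_time (u : seq bool) (w : T) : R :=
  \sum_(k < size u) tau (take k u) w.

Definition birth_position (u : seq bool) (w : T) : R :=
  \sum_(k < size u) B (take k u) (tau (take k u) w) w.

Definition alive (t : R) (w : T) : set (seq bool) :=
  [set u | birth_time u w <= t < birth_time u w + tau u w].

Definition position (u : seq bool) (t : R) (w : T) : R :=
  birth_position u w + B u (t - birth_time u w) w.

(* Almost surely [alive t w] is finite and nonempty for every [t >= 0], so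
   that this supremum is a maximum. *)
Definition max_position (t : R) (w : T) : R :=
  sup [set position u t w | u in alive t w].

Lemma max_positionE (t : R) (w : T) (v : seq bool) : alive t w v ->
  (forall u, alive t w u -> position u t w <= position v t w) ->
  max_position t w = position v t w.
Proof.
move=> av vmax; apply/eqP; rewrite eq_le; apply/andP; split.
  by apply: ge_sup; [exists (position v t w), v | move=> _ [u au <-]; exact: vmax].
apply: ub_le_sup; last by exists v.
by exists (position v t w) => _ [u au <-]; exact: vmax.
Qed.

End particles.

(* Main.v *)
(* Let [u s x] be the probability that the process started from [x] has, at time [s], a
   particle above a prescribed finite set of space-time targets. Splitting at the first
   branching time shows that [u] is a mild solution of the KPP equation
   [u_t = u_xx / 2 + u - u^2]. Hence [u] lies below the solution of the linear equation,
   and above a slightly damped one wherever the latter is small. In the frame of the line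
   of slope [c = sqrt 2], after the exponential tilt [exp (c x)], the linear equation is
   the heat equation; a barrier of logarithmic depth kills it and turns the factor
   [t^(-1/2)] of the free kernel into [t^(-3/2)] by the reflection principle. Up to factors
   [n^o(1)], the probability that the maximum exceeds [c n + y] is therefore
   [n^(-3/2) exp (- c y)], and the probability that it exceeds [c s + y] at one of about
   [n] well separated times [s] is [n^(-1/2) exp (- c y)].

   Conversely, a hitting probability which is polynomially small becomes a constant when
   one waits a time of order [log n] for the slightly subcritical speed, and then becomes
   overwhelming, because the [2^g] particles of generation [g = delta log n] have
   independent chances and are still close to the origin. The Borel-Cantelli lemma gives
   the four bounds: along all [n], or along [n = 2^k], or on grids of polynomially many
   times per unit interval. A chaining bound for all relevant Brownian paths shows that
   between two grid times particles stay within distance [1] of their ancestors, which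
   extends the two uniform bounds to continuous time. *)

Require Import Defs.
From mathcomp Require Import measurable_realfun ring lra.
Import Order.TTheory GRing.Theory Num.Theory.
Import numFieldNormedType.Exports.

Set Implicit Arguments.
Unset Strict Implicit.
Unset Printing Implicit Defensive.

Local Open Scope classical_set_scope.
Local Open Scope ring_scope.

(** * Generated sigma-algebras and independence *)

Section sigma_independence.
Context d (T : measurableType d) (R : realType) (P : probability T R).
Local Open Scope ereal_scope.

(** The mild equation behind the comparison involves several processes: the tree, its two subtrees,
    and the root aged by [s] under the law conditioned on its survival. Identifying their hitting
    probabilities would need uniqueness in law of the whole tree; instead each estimate is
    quantified over all regular processes on the same [T], and so applies to all of them at once.
    Ageing changes only the probability on [T], and freezing a component means shrinking the
    sigma-algebra.

    Barriers are not imposed on continuous paths. A killed flow is a difference of two heat flows,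
    by reflection, compared with the hitting probability at discrete times. For the upper bound, the
    trivial bound 1 on the killed side is dominated by the tilted constant [theta]. For the lower
    bound, the reflected difference is nonpositive under the barrier, where nothing is to be proved,
    and above it the tilt keeps it below [eta]. A depth [m] is covered in time [m^2], so depths of
    order [log n] cost only powers of [log n], invisible on the scale of the theorem. *)

Definition sigma_indep (G H : set (set T)) : Prop :=
  forall A B, G A -> H B -> P (A `&` B) = P A * P B.

Lemma sigma_indepC G H : sigma_indep G H -> sigma_indep H G.
Proof. by move=> GH A B HA GB; rewrite setIC muleC; exact: GH. Qed.

Lemma sub_g_sigma_algebra (G H : set (set T)) :
  sigma_algebra setT H -> G `<=` H -> <<s G >> `<=` H.
Proof. by move=> sH GH; apply: smallest_sub. Qed.

Lemma g_sigma_algebra_sub_measurable (G : set (set T)) :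
  G `<=` measurable -> <<s G >> `<=` measurable.
Proof. apply: sub_g_sigma_algebra; exact: sigma_algebra_measurable. Qed.

(** Dynkin argument: for fixed [B], the product rule is stable under complements and disjoint
    countable unions of [A], and [G] is a pi-system. *)
Lemma sigma_indep_genl (G H : set (set T)) :
  setI_closed G -> G `<=` measurable -> H `<=` measurable ->
  sigma_indep G H -> sigma_indep <<s G >> H.
Proof.
move=> GI mG mH GH A B sA HB.
have mGs := g_sigma_algebra_sub_measurable mG.
have mB : measurable B by exact: mH.
have Pfin C : measurable C -> P C \is a fin_num by move=> mC; exact: fin_num_measure.
pose Q (A : set T) := P (A `&` B) = P A * P B.
have QC (C : set T) : measurable C -> Q C -> Q (~` C).
  rewrite /Q => mC CB.
  have -> : P (~` C `&` B) = P B - P (C `&` B).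
    rewrite setIC -setDE measureD//; last by rewrite ltey_eq Pfin.
    by rewrite (setIC B).
  rewrite CB probability_setC// muleBl ?Pfin//.
  by rewrite mul1e.
have QU (F : (set T)^nat) : (forall n, measurable (F n)) -> trivIset setT F ->
    (forall n, Q (F n)) -> Q (\bigcup_k F k).
  rewrite /Q => mF tF FB.
  rewrite setI_bigcupl measure_bigcup//; last 2 first.
    by move=> k _; exact: measurableI.
    by apply: trivIset_setIr.
  have -> : P (\bigcup_k F k) = \sum_(0 <= k <oo | k \in [set: nat]) P (F k).
    by rewrite measure_bigcup.
  have PB : P B = (fine (P B))%:E by rewrite fineK// Pfin.
  rewrite [RHS]muleC PB -nneseriesZl//.
  by apply: eq_eseriesr => k _; rewrite -PB muleC; exact: FB.
move: A sA; apply: (@dynkin_induction _ (g_sigma_algebraType G) G Q) => //.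
- by rewrite /Q setTI probability_setT mul1e.
- by move=> A GA; exact: GH.
- by move=> A sA; apply: QC; exact: (mGs _ sA).
- by move=> F mF; apply: QU => n; exact: (mGs _ (mF n)).
Qed.

Lemma sigma_indep_gen (G H : set (set T)) :
  setI_closed G -> setI_closed H -> G `<=` measurable -> H `<=` measurable ->
  sigma_indep G H -> sigma_indep <<s G >> <<s H >>.
Proof.
move=> GI HI mG mH GH.
apply: sigma_indep_genl => //; first exact: g_sigma_algebra_sub_measurable.
apply/sigma_indepC/sigma_indep_genl => //; exact: sigma_indepC.
Qed.

Section cylinders.
Variables (I : eqType) (G : I -> set (set T)).
Hypothesis GI : forall i, setI_closed (G i).
Hypothesis GT : forall i, G i setT.
Hypothesis Gm : forall i, G i `<=` measurable.

Lemma in_bigsetI (s : seq I) (F : I -> set T) w :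
  (\big[setI/setT]_(i <- s) F i) w <-> (forall i, i \in s -> F i w).
Proof.
elim: s => [|j s IH]; first by rewrite big_nil.
rewrite big_cons; split=> [[Fj /IH Fs] i|h].
  by rewrite inE => /orP[/eqP ->//|/Fs].
split; first by apply: h; rewrite mem_head.
by apply/IH => i is_; apply: h; rewrite inE is_ orbT.
Qed.

(** A pi-system that generates the same sigma-algebra as the union of the [G i] over [J]. Asking for
    [G i (F i)] even outside [s] costs nothing, because [setT] belongs to each [G i], and lets two
    cylinders be merged by a case distinction. *)
Definition cylinders (J : set I) : set (set T) :=
  [set A | exists (s : seq I) (F : I -> set T), [/\ uniq s,
    forall i, i \in s -> J i, forall i, G i (F i)
    & A = \big[setI/setT]_(i <- s) F i]].

Lemma cylindersI J : setI_closed (cylinders J).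
Proof.
move=> _ _ [s [F [us sJ GF ->]]] [s' [F' [us' sJ' GF' ->]]].
exists (undup (s ++ s')), (fun i => (if i \in s then F i else setT) `&`
  (if i \in s' then F' i else setT)); split.
- exact: undup_uniq.
- by move=> i; rewrite mem_undup mem_cat => /orP[/sJ|/sJ'].
- by move=> i; apply: GI; case: ifP.
- rewrite predeqE => w; split.
    move=> [/in_bigsetI Fw /in_bigsetI F'w]; apply/in_bigsetI => i _; split.
      by case: ifP => // /Fw.
    by case: ifP => // /F'w.
  move=> /in_bigsetI h; split; apply/in_bigsetI => i is_.
    have /h [] : i \in undup (s ++ s') by rewrite mem_undup mem_cat is_.
    by rewrite is_.
  have /h [_] : i \in undup (s ++ s') by rewrite mem_undup mem_cat is_ orbT.
  by rewrite is_.
Qed.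

Lemma cylinders_measurable J : cylinders J `<=` measurable.
Proof.
move=> _ [s [F [us sJ GF ->]]]; apply: bigsetI_measurable => i _; exact/Gm.
Qed.

Lemma gen_sub_cylinders J : \bigcup_(i in J) G i `<=` cylinders J.
Proof.
move=> A [i Ji GA]; exists [:: i], (fun j => if j == i then A else setT).
split => //.
- by move=> j; rewrite inE => /eqP ->.
- by move=> j; case: eqP => [->|].
- by rewrite big_seq1 eqxx.
Qed.

End cylinders.

Section grouping.
Variables (I : eqType) (G : I -> set (set T)).
Hypothesis GI : forall i, setI_closed (G i).
Hypothesis GT : forall i, G i setT.
Hypothesis Gm : forall i, G i `<=` measurable.
Hypothesis indG : mutually_independent P G.

(** Cylinders over disjoint index sets meet in one finite intersection with distinct indices, which
    mutual independence factorizes; the pi-system criterion does the rest. *)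
Lemma mutually_independent_grouping (J J' : set I) : J `&` J' = set0 ->
  sigma_indep <<s \bigcup_(i in J) G i >> <<s \bigcup_(i in J') G i >>.
Proof.
move=> JJ' A B /(sub_sigma_algebra2 (gen_sub_cylinders GT (J := J))) sA.
move=> /(sub_sigma_algebra2 (gen_sub_cylinders GT (J := J'))) sB.
apply: (sigma_indep_gen _ _ _ _ _ sA sB).
- exact: cylindersI.
- exact: cylindersI.
- exact: cylinders_measurable.
- exact: cylinders_measurable.
move=> _ _ [s [F [us sJ GF ->]]] [s' [F' [us' sJ' GF' ->]]].
have disj i : i \in s -> i \notin s'.
  move=> is_; apply/negP => is'.
  have : (J `&` J') i by split; [exact: sJ|exact: sJ'].
  by rewrite JJ'.
pose H i := if i \in s then F i else F' i.
have eqs : \big[setI/setT]_(i <- s) F i = \big[setI/setT]_(i <- s) H i.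
  by apply: eq_big_seq => i is_; rewrite /H is_.
have eqs' : \big[setI/setT]_(i <- s') F' i = \big[setI/setT]_(i <- s') H i.
  apply: eq_big_seq => i is_; rewrite /H ifN//; apply/negP => /disj.
  by rewrite is_.
have GH i : G i (H i) by rewrite /H; case: ifP.
rewrite eqs eqs' -big_cat !indG// ?big_cat//= cat_uniq us us' andbT /=.
by apply/hasPn => i is_ /=; apply/negP => /disj; rewrite is_.
Qed.

(** Refines independence inside the coordinate [i0]. The use in view is a Brownian motion cut at
    time [s]: [H] is generated by its value at [s], [K] by the later increments, and all other
    coordinates are kept. *)
Lemma mutually_independent_split (i0 : I) (H K : set (set T)) :
  H `<=` G i0 -> K `<=` G i0 -> setI_closed H -> setI_closed K -> K setT ->
  sigma_indep H K ->
  sigma_indep H <<s \bigcup_i (if i == i0 then K else G i) >>.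
Proof.
move=> HG KG HI KI KT HK.
set G' := fun i => if i == i0 then K else G i.
have G'G i : G' i `<=` G i by move=> A; rewrite /G'; case: eqP => [-> /KG|].
have GI' i : setI_closed (G' i) by rewrite /G'; case: ifP.
have GT' i : G' i setT by rewrite /G'; case: ifP.
have Gm' i : G' i `<=` measurable by move=> A /G'G; exact: Gm.
suff HC : sigma_indep H (cylinders G' setT).
  move=> A B HA sB.
  have sA : <<s H >> A by exact: sub_sigma_algebra.
  have {}sB : <<s cylinders G' setT >> B.
    by apply: sub_sigma_algebra2 sB; exact: gen_sub_cylinders.
  apply: (sigma_indep_gen HI _ _ _ HC sA sB).
  - exact: cylindersI.
  - by move=> C /HG; exact: Gm.
  - exact: cylinders_measurable.
move=> A _ HA [s [F [us _ GF ->]]].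
pose r := [seq i <- s | i != i0].
pose F' i := if i == i0 then (if i0 \in s then F i0 else setT) else F i.
have ur : uniq (i0 :: r) by rewrite /= filter_uniq// mem_filter eqxx.
have big_r : \big[setI/setT]_(i <- s) F i = F' i0 `&` \big[setI/setT]_(i <- r) F i.
  rewrite predeqE => w; split.
    move=> /in_bigsetI Fs; split; first by rewrite /F' eqxx; case: ifP => // /Fs.
    by apply/in_bigsetI => i; rewrite mem_filter => /andP[_ /Fs].
  rewrite /F' eqxx => -[F0 /in_bigsetI Fr]; apply/in_bigsetI => i is_.
  have [ei|ni] := eqVneq i i0; first by move: F0; rewrite -ei is_.
  by apply: Fr; rewrite mem_filter ni.
have KF' : K (F' i0).
  rewrite /F' eqxx; case: ifP => // _.
  by have := GF i0; rewrite /G' eqxx.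
have prodE (C : set T) : G i0 C ->
    P (C `&` \big[setI/setT]_(i <- r) F i) = P C * \prod_(i <- r) P (F i).
  move=> GC; pose F2 i := if i == i0 then C else F i.
  have er : \big[setI/setT]_(i <- r) F i = \big[setI/setT]_(i <- r) F2 i.
    by apply: eq_big_seq => i; rewrite mem_filter /F2 => /andP[/negbTE ->].
  have -> : \prod_(i <- r) P (F i) = \prod_(i <- r) P (F2 i).
    by apply: eq_big_seq => i; rewrite mem_filter /F2 => /andP[/negbTE ->].
  have eC : C = F2 i0 by rewrite /F2 eqxx.
  rewrite er eC; have := @indG (i0 :: r) F2 ur; rewrite !big_cons; apply => i _.
  by rewrite /F2; case: eqP => [->|_] //; apply: G'G.
have GHF : G i0 (A `&` F' i0) by apply: GI; [exact: HG|exact: KG].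
rewrite big_r setIA prodE// prodE; last exact: KG.
by rewrite HK// muleA.
Qed.

End grouping.

End sigma_independence.

Section independent_integral.
Context d (T : measurableType d) (R : realType) (P : probability T R).
Context d1 d2 (T1 : measurableType d1) (T2 : measurableType d2).
Local Open Scope ereal_scope.

(** The joint law of [X] and [Y] is the product of their laws, so Fubini applies. Later [Y], and
    sometimes [X], is the identity from [T] to [T] with a smaller sigma-algebra, which freezes one
    component of the tree while another is integrated out. *)
Lemma ge0_integral_indep (X : T -> T1) (Y : T -> T2) (f : T1 * T2 -> \bar R) :
  measurable_fun setT X -> measurable_fun setT Y ->
  (forall A B, measurable A -> measurable B ->
    P (X @^-1` A `&` Y @^-1` B) = P (X @^-1` A) * P (Y @^-1` B)) ->
  measurable_fun [set: T1 * T2] f -> (forall z, 0 <= f z) ->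
  \int[P]_w f (X w, Y w) = \int[P]_w \int[P]_w' f (X w, Y w').
Proof.
move=> mX mY indXY mf f0.
pose X' : {mfun T >-> T1} := mfun_Sub (mem_set mX).
pose Y' : {mfun T >-> T2} := mfun_Sub (mem_set mY).
have mXY : measurable_fun setT (fun w => (X w, Y w)) by exact: measurable_fun_pair.
pose XY : {mfun T >-> (T1 * T2)%type} := mfun_Sub (mem_set mXY).
have E (D : set (T1 * T2)) : measurable D ->
    (distribution P X' \x distribution P Y') D = distribution P XY D.
  by apply: product_measure_unique => A B mA mB; exact: indXY.
transitivity (\int[distribution P XY]_z f z).
  by rewrite ge0_integral_distribution.
rewrite (eq_measure_integral (distribution P X' \x distribution P Y')%E); last first.
  by move=> D mD _; exact/esym/E.
rewrite fubini_tonelli1//= /fubini_F ge0_integral_distribution//=; last 2 first.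
- exact: measurable_fun_fubini_tonelli_F.
- by move=> y; apply: integral_ge0.
apply: eq_integral => w _ /=; rewrite ge0_integral_distribution//=.
exact: measurableT_comp.
Qed.

End independent_integral.

(** * The tree of particles *)

Section joint_measurability.
Context d (T : measurableType d) (R : realType).

(** The process is the limit of its values at the grid points [k / (n + 1)] just below [t]. The time
    is cut at 0 because continuity is available on the half-line only. *)
Lemma measurable_process (X : R -> T -> R) :
  (forall t, 0 <= t -> measurable_fun setT (X t)) ->
  (forall w, {within `[0, +oo[, continuous (fun t => X t w)}) ->
  measurable_fun [set: R * T] (fun z => X (Num.max z.1 0) z.2).
Proof.
move=> mX cX.
pose g (n : nat) (t : R) : R := Num.max t 0 * n.+1%:R.
have g0 n t : 0 <= g n t by rewrite mulr_ge0// le_max lexx orbT.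
pose a (n : nat) (t : R) : nat := Num.truncn (g n t).
pose h (n : nat) (z : R * T) := X ((a n z.1)%:R / n.+1%:R) z.2.
apply: (@measurable_fun_cvg _ _ _ _ h).
  move=> n _ Y mY; rewrite setTI.
  have -> : h n @^-1` Y = \bigcup_k
      (((fun z : R * T => g n z.1) @^-1` `[k%:R, k.+1%:R[) `&`
       ((fun z : R * T => X (k%:R / n.+1%:R) z.2) @^-1` Y)).
    apply/seteqP; split=> z /=.
      by move=> hz; exists (a n z.1); split => //=; rewrite in_itv/= truncn_itv.
    move=> [k _ [/= ]]; rewrite in_itv /= => /andP[k1 k2]; rewrite /h.
    suff -> : a n z.1 = k by [].
    by apply/eqP; rewrite eqn_leq truncn_le_nat k2 truncn_ge_nat.
  have mg : measurable_fun [set: R * T] (fun z => g n z.1).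
    apply: measurable_funM => //; apply: measurable_maxr => //.
  apply: bigcupT_measurable => k; apply: measurableI.
    by rewrite -[X in measurable X]setTI; exact: mg.
  rewrite -[X in measurable X]setTI.
  have : measurable_fun [set: R * T] (fun z => X (k%:R / n.+1%:R) z.2).
    have k0 : 0 <= k%:R / n.+1%:R :> R by rewrite divr_ge0.
    exact: (measurableT_comp (mX _ k0) measurable_snd).
  by apply.
move=> [t w] _ /=; rewrite /h /=.
have t0 : 0 <= Num.max t 0 by rewrite le_max lexx orbT.
have /subspace_continuousP /(_ (Num.max t 0)) := cX w.
rewrite /= in_itv /= andbT => /(_ t0) cXt.
have an : (a n t)%:R / n.+1%:R @[n --> \oo] --> Num.max t 0.
  apply/cvgrPdist_le => e e0; near=> n.
  have /andP[l1 l2] := truncn_itv (g0 n t).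
  rewrite ger0_norm; last by rewrite subr_ge0 ler_pdivrMr.
  rewrite lerBlDl -(@ler_pM2r _ n.+1%:R)// mulrDl mulfVK//.
  rewrite (le_trans (ltW l2))// -addn1 natrD lerD2l.
  rewrite -ler_pdivrMr// mul1r.
  apply/ltW; near: n; exact: (near_infty_natSinv_lt (PosNum e0)).
apply: (cvg_comp (fun n => (a n t)%:R / n.+1%:R) (fun s => X s w) _ cXt).
move=> U wU; change (\forall n \near \oo, U ((a n t)%:R / n.+1%:R)).
have : \forall n \near \oo, `[0, +oo[%classic ((a n t)%:R / n.+1%:R : R) ->
  U ((a n t)%:R / n.+1%:R) by exact: an wU.
apply: filterS => n; apply.
by rewrite /= in_itv /= andbT divr_ge0.
Unshelve. all: by end_near. Qed.

Lemma measurable_process_comp (X : R -> T -> R) d' (T' : measurableType d')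
    (f : T' -> R) (g : T' -> T) :
  (forall t, 0 <= t -> measurable_fun setT (X t)) ->
  (forall w, {within `[0, +oo[, continuous (fun t => X t w)}) ->
  measurable_fun setT f -> measurable_fun setT g ->
  measurable_fun setT (fun z => X (Num.max (f z) 0) (g z)).
Proof.
move=> mX cX mf mg.
apply: (@measurableT_comp _ _ _ _ _ _
  (fun z : R * T => X (Num.max z.1 0) z.2) setT (fun z => (f z, g z))).
  exact: measurable_process.
exact: measurable_fun_pair.
Qed.

End joint_measurability.

Section tree.
Context {T : Type} {R : realType}.
Implicit Types (tau : seq bool -> T -> R) (B : seq bool -> R -> T -> R).

Definition subtree (X : Type) (f : seq bool -> X) (b : bool) : seq bool -> X :=
  fun u => f (b :: u).

Lemma birth_time_nil tau w : birth_time tau [::] w = 0.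
Proof. by rewrite /birth_time big_ord0. Qed.

Lemma birth_time_cons tau b u w :
  birth_time tau (b :: u) w = tau [::] w + birth_time (subtree tau b) u w.
Proof. by rewrite /birth_time /= big_ord_recl /=. Qed.

Lemma birth_position_nil tau B w : birth_position tau B [::] w = 0.
Proof. by rewrite /birth_position big_ord0. Qed.

Lemma birth_position_cons tau B b u w :
  birth_position tau B (b :: u) w =
  B [::] (tau [::] w) w + birth_position (subtree tau b) (subtree B b) u w.
Proof. by rewrite /birth_position /= big_ord_recl /=. Qed.

Lemma alive_nil tau t w : alive tau t w [::] = (0 <= t < tau [::] w) :> Prop.
Proof. by rewrite /alive /= birth_time_nil add0r. Qed.

Lemma alive_cons tau t w b u :
  alive tau t w (b :: u) = alive (subtree tau b) (t - tau [::] w) w u.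
Proof.
by rewrite /alive /= birth_time_cons lerBrDl ltrBlDl addrA.
Qed.

Lemma position_nil tau B t w : position tau B [::] t w = B [::] t w.
Proof. by rewrite /position birth_position_nil birth_time_nil subr0 add0r. Qed.

Lemma position_cons tau B t w b u :
  position tau B (b :: u) t w = B [::] (tau [::] w) w +
  position (subtree tau b) (subtree B b) u (t - tau [::] w) w.
Proof.
by rewrite /position birth_position_cons birth_time_cons -addrA opprD (addrA t).
Qed.

(* Some pair [(r, l)] of [S] has a particle alive at time [r + s] which, when
   the root starts from [x], is at or above level [l] at that time. *)
Definition hit (S : seq (R * R)) tau B (s x : R) : set T :=
  [set w | exists a u, [/\ a \in S, alive tau (a.1 + s) w u &
    a.2 <= x + position tau B u (a.1 + s) w]].

Lemma hit_le S tau B s x y : x <= y -> hit S tau B s x `<=` hit S tau B s y.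
Proof.
move=> xy w [a [u [aS au h]]]; exists a, u; split => //.
by rewrite (le_trans h)// lerD2r.
Qed.

Lemma hit_sub S S' tau B s x : {subset S <= S'} ->
  hit S tau B s x `<=` hit S' tau B s x.
Proof. by move=> SS' w [a [u [aS au h]]]; exists a, u; split => //; exact: SS'. Qed.

Lemma hit_split S tau B s x w : (forall a, a \in S -> 0 <= a.1) ->
  (forall u, 0 < tau u w) -> 0 <= s -> tau [::] w <= s ->
  hit S tau B s x w <->
  exists b, hit S (subtree tau b) (subtree B b) (s - tau [::] w)
              (x + B [::] (tau [::] w) w) w.
Proof.
move=> S0 tau0 s0 ts; split.
  move=> [a [[|b u] [aS]]].
    rewrite alive_nil => /andP[_ /lt_le_trans/(_ ts)].
    by rewrite ltNge lerDr S0.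
  rewrite alive_cons position_cons addrA -(addrA a.1) => au h.
  by exists b, a, u.
move=> [b [a [u [aS au h]]]]; exists a, (b :: u); split => //.
  by rewrite alive_cons -addrA.
by rewrite position_cons addrA -(addrA a.1).
Qed.

End tree.

Section hit_measurable.
Context d (T : measurableType d) (R : realType).
Variables (tau : seq bool -> T -> R) (B : seq bool -> R -> T -> R).
Hypothesis mtau : forall u, measurable_fun setT (tau u).
Hypothesis mB : forall u t, 0 <= t -> measurable_fun setT (B u t).
Hypothesis cB : forall u w, {within `[0, +oo[, continuous (fun t => B u t w)}.

Let mB2 u d' (T' : measurableType d') (f : T' -> R) (g : T' -> T) :
  measurable_fun setT f -> measurable_fun setT g ->
  measurable_fun setT (fun z => B u (Num.max (f z) 0) (g z)).
Proof. exact: (measurable_process_comp (mB u) (@cB u)). Qed.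

Lemma measurable_birth_time u : measurable_fun setT (birth_time tau u).
Proof. by apply: measurable_sum => k; exact: mtau. Qed.

Hypothesis tau_gt0 : forall u w, 0 < tau u w.

Lemma measurable_birth_position u :
  measurable_fun setT (birth_position tau B u).
Proof.
apply: measurable_sum => k.
apply: (eq_measurable_fun (fun w => B (take k u) (Num.max (tau (take k u) w) 0) w)).
  by move=> w _; rewrite max_l// ltW.
exact: mB2.
Qed.

(** Labels are countable and targets finite in number. The sigma-algebra of [T] and the parameters
    [s], [x], [g] are arbitrary because the lemma is reused over the sigma-algebras of the
    descendants and of the aged process. *)
Lemma measurable_hit S d' (T' : measurableType d') (s x : T' -> R) (g : T' -> T) :
  measurable_fun setT s -> measurable_fun setT x -> measurable_fun setT g ->
  measurable [set z | hit S tau B (s z) (x z) (g z)].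
Proof.
move=> ms mx mg.
rewrite (_ : [set z | _] = \bigcup_(u : seq bool)
  \big[setU/set0]_(a <- S) [set z | alive tau (a.1 + s z) (g z) u /\
    a.2 <= x z + position tau B u (a.1 + s z) (g z)]); last first.
  apply/seteqP; split=> z.
    move=> [a [u [aS au h]]]; exists u => //; rewrite -bigcup_seq.
    by exists a.
  by move=> [u _]; rewrite -bigcup_seq => -[a /= aS [au h]]; exists a, u.
apply: countable_bigcupT_measurable => [|u]; first exact: countableP.
apply: bigsetU_measurable => a _.
have mt : measurable_fun setT (fun z => a.1 + s z) by exact: measurable_funD.
have mb : measurable_fun setT (fun z => birth_time tau u (g z)).
  exact: (measurableT_comp (measurable_birth_time u) mg).
have mbp : measurable_fun setT (fun z => birth_position tau B u (g z)).
  exact: (measurableT_comp (measurable_birth_position u) mg).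
have mtu : measurable_fun setT (fun z => tau u (g z)).
  exact: (measurableT_comp (mtau u) mg).
have mp : measurable_fun setT (fun z => birth_position tau B u (g z) +
    B u (Num.max (a.1 + s z - birth_time tau u (g z)) 0) (g z)).
  by apply: measurable_funD => //; apply: mB2 => //; exact: measurable_funB.
rewrite (_ : [set z | _ /\ _] = [set z | (birth_time tau u (g z) <= a.1 + s z) &&
   (a.1 + s z < birth_time tau u (g z) + tau u (g z)) &&
   (a.2 <= x z + (birth_position tau B u (g z) +
    B u (Num.max (a.1 + s z - birth_time tau u (g z)) 0) (g z)))]); last first.
  apply/seteqP; split=> z /=; rewrite /position.
    by move=> [/= /andP[b1 b2] h]; rewrite b1 b2/= max_l// subr_ge0.
  by move=> /andP[/andP[b1 b2]]; rewrite max_l ?subr_ge0// => h; split => //; apply/andP.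
rewrite -[X in measurable X]setTI.
have : measurable_fun setT (fun z => (birth_time tau u (g z) <= a.1 + s z) &&
   (a.1 + s z < birth_time tau u (g z) + tau u (g z)) &&
   (a.2 <= x z + (birth_position tau B u (g z) +
    B u (Num.max (a.1 + s z - birth_time tau u (g z)) 0) (g z)))).
  apply: measurable_and; first apply: measurable_and.
  - exact: measurable_fun_ler.
  - by apply: measurable_fun_ltr => //; exact: measurable_funD.
  - by apply: measurable_fun_ler => //; exact: measurable_funD.
by move=> /(_ measurableT [set true]); apply.
Qed.

End hit_measurable.

(** * Independence of the past and the future of a Brownian motion *)

Section process_past.
Context d (T : measurableType d) (R : realType) (P : probability T R).
Variable W : R -> {RV P >-> R}.
Hypothesis W0 : forall w, W 0 w = 0.
Hypothesis indW : forall t : nat -> R,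
    0 <= t 0%N -> {homo t : m n / (m <= n)%N >-> m <= n} ->
    mutually_independent P (fun i : nat => sigma_rv (W (t i.+1) \- W (t i))).

Lemma sigma_rv_setI (X : T -> R) : setI_closed (sigma_rv X).
Proof.
move=> _ _ [A mA <-] [C mC <-]; exists (A `&` C); first exact: measurableI.
by rewrite !setTI preimage_setI.
Qed.

Lemma sigma_rv_setT (X : T -> R) : sigma_rv X setT.
Proof. by exists setT => //; rewrite setTI preimage_setT. Qed.

Lemma sigma_rv_measurable (X : T -> R) :
  measurable_fun setT X -> sigma_rv X `<=` measurable.
Proof. by move=> mX _ [A mA <-]; exact: mX. Qed.

Lemma sigma_rvP (G : set (set T)) (X : T -> R) :
  sigma_rv X `<=` <<s G >> <-> measurable_fun setT (X : g_sigma_algebraType G -> R).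
Proof.
split=> [XG _ A mA|mX _ [A mA <-]]; last exact: mX.
by apply: XG; exists A.
Qed.

(** The extra 0 in front of the sorted offsets puts [s] at index 1, so that the first increment is
    [W s]. Beyond the list the default is the largest offset, which keeps the sequence monotone. *)
Let sorted_times (s : R) (rs : seq R) (n : nat) : R :=
  if n is m.+1 then
    s + nth (\big[Num.max/0]_(r <- rs) r) (0 :: sort <=%R rs) m
  else 0.

Let sorted_times_homo s rs : 0 <= s -> (forall r, r \in rs -> 0 <= r) ->
  {homo sorted_times s rs : m n / (m <= n)%N >-> m <= n}.
Proof.
move=> s0 rs0; apply: homo_leq => // [? ? ?|]; first exact: le_trans.
have M0 : 0 <= \big[Num.max/0]_(r <- rs) r by exact: bigmax_ge_id.
have M k : nth (\big[Num.max/0]_(r <- rs) r) (sort <=%R rs) k <=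
    \big[Num.max/0]_(r <- rs) r.
  have [ks|ks] := ltnP k (size (sort <=%R rs)); last by rewrite nth_default.
  apply: (@le_bigmax_seq _ _ _ rs 0 _ xpredT id) => //.
  by rewrite -(mem_sort <=%R) mem_nth.
move=> [|[|k]]; rewrite /sorted_times ?addr0//= ?lerDl ?lerD2l//.
  case E : (sort _ _) => [|r l] //=.
  by apply: rs0; rewrite -(mem_sort <=%R) E mem_head.
have [ks|ks] := ltnP k.+1 (size (sort <=%R rs)).
  apply: le_sorted_leq_nth => //; last by rewrite inE (ltn_trans _ ks).
  by apply: sort_sorted; exact: le_total.
by rewrite [leRHS]nth_default.
Qed.

(** Independence of increments is assumed along sequences. Finitely many future values are
    measurable with respect to the increments of [sorted_times] of index at least 1, while [W s] is
    the increment of index 0; a pi-system argument then reaches the whole future. *)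
Lemma sigma_indep_past_future s : 0 <= s ->
  sigma_indep P (sigma_rv (W s))
    (sigma_process (fun r => W (s + r) \- W s)).
Proof.
move=> s0.
pose V (r : R) : T -> R := W (s + r) \- W s.
pose cyl : set (set T) := [set A | exists (l : seq (R * set R)),
  (forall a, a \in l -> 0 <= a.1 /\ measurable a.2) /\
  A = \big[setI/setT]_(a <- l) (V a.1 @^-1` a.2)].
have mV r : measurable_fun setT (V r) by exact: measurable_funB.
have cylI : setI_closed cyl.
  move=> _ _ [l [l0 ->]] [l' [l0' ->]]; exists (l ++ l'); rewrite big_cat; split => //.
  by move=> a; rewrite mem_cat => /orP[/l0|/l0'].
have mcyl : cyl `<=` measurable.
  move=> _ [l [l0 ->]]; rewrite big_seq; apply: bigsetI_measurable => a /l0[_ ma].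
  by rewrite -[X in measurable X]setTI; exact: mV.
have mWs := @sigma_rv_measurable (W s) (measurable_funPT (W s)).
suff indc : sigma_indep P (sigma_rv (W s)) cyl.
  move=> A D As; rewrite /sigma_process => sD.
  apply: (sigma_indep_gen (@sigma_rv_setI (W s)) cylI mWs mcyl indc).
    exact: sub_sigma_algebra.
  apply: sub_sigma_algebra2 sD => _ [r /= r0 [C mC <-]].
  exists [:: (r, C)]; rewrite big_seq1 setTI; split => // a; rewrite inE => /eqP -> /=.
  by move: r0; rewrite in_itv /= andbT.
move=> A _ As [l [l0 ->]].
pose t := sorted_times s (map fst l).
have rs0 r : r \in map fst l -> 0 <= r by move=> /mapP[a /l0[a0 _] ->].
have ht := @sorted_times_homo s _ s0 rs0.
pose inc i : T -> R := W (t i.+1) \- W (t i).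
have minc i : sigma_rv (inc i) `<=` measurable.
  exact/sigma_rv_measurable/measurable_funB.
have ind := @mutually_independent_grouping _ _ _ P _ (fun i => sigma_rv (inc i))
  (fun i => @sigma_rv_setI (inc i)) (fun i => sigma_rv_setT (inc i)) minc
  (indW (lexx 0) ht) [set 0%N] [set n | (0 < n)%N].
apply: ind.
- by apply/seteqP; split=> // n /= [->].
- apply: sub_sigma_algebra; exists 0%N => //.
  rewrite (_ : inc 0%N = W s)//; apply/funext => w.
  by rewrite /inc /t /sorted_times /= addr0 W0 subr0.
set G := \bigcup_(i in _) _.
have mt k : measurable_fun setT
    ((W (t k.+1) \- W (t 1%N)) : g_sigma_algebraType G -> R).
  elim: k => [|k IH].
    rewrite (_ : _ \- _ = cst 0); first exact: measurable_cst.
    by apply/funext => w; rewrite /= subrr.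
  rewrite (_ : _ \- _ = inc k.+1 \+ (W (t k.+1) \- W (t 1%N))); last first.
    by apply/funext => w; rewrite /inc /= addrA subrK.
  apply: measurable_funD => //; apply/sigma_rvP => C hC.
  by apply: sub_sigma_algebra; exists k.+1.
rewrite big_seq; apply: (@bigsetI_measurable _ (g_sigma_algebraType G)).
move=> a al; have [a0 ma] := l0 _ al.
have [k ka] : exists k, t k.+1 = s + a.1.
  have /(nthP (\big[Num.max/0]_(r <- map fst l) r)) [k ks ka] :
    a.1 \in sort <=%R (map fst l) by rewrite mem_sort; apply: map_f.
  by exists k.+1; rewrite /t /sorted_times /= ka.
have := mt k; rewrite ka => /(_ measurableT _ ma); rewrite setTI.
by rewrite /t /sorted_times /= addr0.
Qed.

End process_past.

(** * Regular processes and their ageing *)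

Section conditioning.
Context d (T : measurableType d) (R : realType) (P : probability T R).
Variables (E : set T) (mE : measurable E).

Definition conditioned : probability T R := mnormalize (mrestr P mE) P.

Lemma conditionedE (p : R) A : P E = p%:E -> 0 < p ->
  conditioned A = (P (A `&` E) * (p^-1)%:E)%E.
Proof.
move=> PE p0; have mT : mrestr P mE setT = p%:E by rewrite /mrestr setTI.
by rewrite /conditioned /= /mnormalize/= mT eqe gt_eqF.
Qed.

End conditioning.

Section driving_sigma_theory.
Context d (T : measurableType d) (R : realType).
Implicit Types (tau : seq bool -> T -> R) (B : seq bool -> R -> T -> R).

Lemma sigma_process_rv (W : R -> T -> R) t : 0 <= t ->
  measurable_fun setT (W t : g_sigma_algebraType
    (\bigcup_(t in `[0, +oo[) sigma_rv (W t)) -> R).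
Proof.
move=> t0; apply/sigma_rvP => A WA; apply: sub_sigma_algebra; exists t => //=.
by rewrite in_itv /= andbT.
Qed.

Lemma sigma_process_incr (W : R -> T -> R) s t : 0 <= s -> 0 <= t ->
  sigma_rv (W t \- W s) `<=` sigma_process W.
Proof.
by move=> s0 t0; apply/sigma_rvP; apply: measurable_funB; exact: sigma_process_rv.
Qed.

Lemma sigma_process_measurable (W : R -> T -> R) :
  (forall t, 0 <= t -> measurable_fun setT (W t)) ->
  sigma_process W `<=` measurable.
Proof.
move=> mW; apply: g_sigma_algebra_sub_measurable => A [t /=].
by rewrite in_itv /= andbT => t0; apply: sigma_rv_measurable; exact: mW.
Qed.

Lemma driving_sigmaI tau B i : setI_closed (driving_sigma tau B i).
Proof.
case: i => u /=; first exact: sigma_rv_setI.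
move=> X Y; exact: (@measurableI _ (g_sigma_algebraType _)).
Qed.

Lemma driving_sigmaT tau B i : driving_sigma tau B i setT.
Proof.
case: i => u /=; first exact: sigma_rv_setT.
exact: (@measurableT _ (g_sigma_algebraType _)).
Qed.

Lemma driving_sigma_measurable tau B i :
  (forall u, measurable_fun setT (tau u)) ->
  (forall u t, 0 <= t -> measurable_fun setT (B u t)) ->
  driving_sigma tau B i `<=` measurable.
Proof.
move=> mtau mB; case: i => u /=; first exact: sigma_rv_measurable.
exact: (sigma_process_measurable (mB u)).
Qed.

Lemma mutually_independent_sub (P : probability T R) (I : eqType)
    (G G' : I -> set (set T)) : (forall i, G' i `<=` G i) ->
  mutually_independent P G -> mutually_independent P G'.
Proof. by move=> GG' ind l A ul GA; apply: ind => // i /GA /GG'. Qed.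

(** Used twice under a conditioned law that agrees with [P] on the events of [W]: with [s] the age
    of the root, and with [s = 0] for the other motions, where only the probability changes. *)
Lemma brownian_motion_shift (P P' : probability T R) (W : R -> {RV P >-> R})
    (W' : R -> {RV P' >-> R}) (s : R) : 0 <= s ->
  (forall r w, W' r w = W (s + r) w - W s w) ->
  (forall D, sigma_process (fun t => W t) D -> P' D = P D) ->
  (forall w, {within `[0, +oo[, continuous (fun t => W' t w)}) ->
  brownian_motion W -> brownian_motion W'.
Proof.
move=> s0 W'E PP' cW' [_ indW normW _].
have incE r t : (W' t \- W' r : T -> R) = W (s + t) \- W (s + r).
  by apply/funext => w; rewrite /= !W'E opprB addrA subrK.
split.
- by apply: aeW => w; rewrite W'E addr0 subrr.
- move=> t t0 ht l A ul GA.
  have t'0 : 0 <= s + t 0%N by rewrite addr_ge0.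
  have ht' : {homo (fun n => s + t n) : m n / (m <= n)%N >-> m <= n}.
    by move=> m n mn; rewrite lerD2l ht.
  have t'_ge0 n : 0 <= s + t n by rewrite (le_trans t'0)// ht'.
  have GW i : i \in l -> sigma_rv (W (s + t i.+1) \- W (s + t i)) (A i).
    by move=> /GA; rewrite incE.
  have GP i : i \in l -> sigma_process (fun t => W t) (A i).
    by move=> /GW; apply: sigma_process_incr.
  rewrite PP'; last first.
    rewrite big_seq; exact: (@bigsetI_measurable _ (g_sigma_algebraType _)).
  rewrite (indW _ t'0 ht')//; apply: eq_big_seq => i il.
  by rewrite PP'//; exact: GP.
- move=> r t r0 rt A mA; rewrite incE PP'; last first.
    apply: (@sigma_process_incr _ (s + r) (s + t)).
    + by rewrite addr_ge0.
    + by rewrite addr_ge0// (le_trans r0 (ltW rt)).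
    + by exists A => //; rewrite setTI.
  have -> : t - r = (s + t) - (s + r) by rewrite opprD addrACA subrr add0r.
  by apply: normW => //; [rewrite addr_ge0|rewrite ltrD2l].
- exact: aeW.
Qed.

End driving_sigma_theory.

Section regular.
Context d (T : measurableType d) (R : realType).

(** The almost sure properties are required for every [w], so that the recursive splitting of the
    tree and the joint measurability of the motions hold without exceptional sets. A modification on
    a null set covers the general case at the end. *)
Record regular_bbm (P : probability T R) (tau : seq bool -> {RV P >-> R})
    (B : seq bool -> R -> {RV P >-> R}) : Prop := RegularBBM {
  regular_is_bbm : branching_brownian_motion tau B ;
  lifetime_gt0 : forall u w, 0 < tau u w ;
  motion_start : forall u w, B u 0 w = 0 ;
  motion_continuous : forall u w,
    {within `[0, +oo[, continuous (fun t : R => B u t w)}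
}.

Lemma regular_subtree (P : probability T R) (tau : seq bool -> {RV P >-> R})
    (B : seq bool -> R -> {RV P >-> R}) b :
  regular_bbm tau B -> regular_bbm (subtree tau b) (subtree B b).
Proof.
case=> -[ltau mB ind] tau0 B0 cB; split=> [|u|u|u]; rewrite /subtree //.
split=> [u|u|]; [exact: ltau|exact: mB|].
pose f (i : seq bool + seq bool) : seq bool + seq bool :=
  match i with inl u => inl (b :: u) | inr u => inr (b :: u) end.
pose g (i : seq bool + seq bool) : seq bool + seq bool :=
  match i with inl u => inl (behead u) | inr u => inr (behead u) end.
have fK : cancel f g by case.
move=> l A ul GA.
have -> : \big[setI/setT]_(i <- l) A i = \big[setI/setT]_(j <- map f l) A (g j).
  by rewrite big_map; apply: eq_bigr => i _; rewrite fK.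
have -> : (\prod_(i <- l) P (A i) = \prod_(j <- map f l) P (A (g j)))%E.
  by rewrite big_map; apply: eq_bigr => i _; rewrite fK.
apply: ind; first by rewrite map_inj_uniq//; exact: can_inj fK.
by move=> _ /mapP[i il ->]; rewrite fK; have := GA i il; case: i {il}.
Qed.

Section lifetime.
Variables (P : probability T R) (tau : seq bool -> {RV P >-> R}).
Variable B : seq bool -> R -> {RV P >-> R}.
Hypothesis hB : regular_bbm tau B.

Lemma lifetime_tail u s : 0 <= s -> P [set w | s < tau u w] = (expR (- s))%:E.
Proof.
rewrite le_eqVlt => /predU1P[<-|s0].
  rewrite oppr0 expR0 (_ : [set w | _] = setT) ?probability_setT//.
  by apply/seteqP; split=> // w _ /=; exact: (lifetime_gt0 hB).
have -> : [set w | s < tau u w] = ~` (tau u @^-1` `[0, s]).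
  apply/seteqP; split=> w /=; rewrite in_itv /= ltW ?(lifetime_gt0 hB)//=.
    by rewrite ltNge => /negP.
  by move/negP; rewrite -ltNge.
rewrite probability_setC; last first.
  by rewrite -[X in measurable X]setTI; exact: measurable_funPT.
have := bbm_lifetime (regular_is_bbm hB) u (measurable_itv `[0, s]).
rewrite /distribution /pushforward => ->; rewrite exponential_prob_itv0c//.
transitivity ((1 - (1 - expR (- s)))%:E); first by rewrite mulN1r !EFinB.
by rewrite opprB addrC subrK.
Qed.

End lifetime.

End regular.

Section aging.
Context d (T : measurableType d) (R : realType) (P : probability T R).
Variables (tau : seq bool -> {RV P >-> R}) (B : seq bool -> R -> {RV P >-> R}).
Hypothesis hB : regular_bbm tau B.
Variable s : R.
Hypothesis s0 : 0 <= s.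

Definition survives : set T := [set w | s < tau [::] w].

Lemma measurable_survives : measurable survives.
Proof.
rewrite /survives -[X in measurable X]setTI.
have := measurable_fun_ltr (measurable_cst s) (measurable_funPT (tau [::])).
by move=> /(_ measurableT [set true]); apply.
Qed.

Definition aged_probability : probability T R := conditioned P measurable_survives.
Local Notation P' := aged_probability.

(* The value [1] keeps the residual lifetime positive on the null event that
   the root has already died. *)
Definition aged_lifetime (u : seq bool) : T -> R :=
  if u is [::] then fun w => if s < tau [::] w then tau [::] w - s else 1
  else tau u.

Definition aged_motion (u : seq bool) (r : R) : T -> R :=
  if u is [::] then B [::] (s + r) \- B [::] s else B u r.

Lemma measurable_aged_lifetime u : measurable_fun setT (aged_lifetime u).
Proof.
case: u => [|b u]; last exact: measurable_funPT.
apply: measurable_fun_ifT => //; first exact: measurable_fun_ltr.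
exact: measurable_funB.
Qed.

Lemma measurable_aged_motion u r : measurable_fun setT (aged_motion u r).
Proof.
case: u => [|b u]; last exact: measurable_funPT.
exact: measurable_funB.
Qed.

Definition aged_lifetime_rv u : {RV P' >-> R} :=
  mfun_Sub (mem_set (measurable_aged_lifetime u)).

Definition aged_motion_rv u r : {RV P' >-> R} :=
  mfun_Sub (mem_set (measurable_aged_motion u r)).

Local Notation G := (driving_sigma tau (fun u => B u)).
Let i0 : seq bool + seq bool := inl [::].

Lemma aged_probabilityE A : P' A = (P (A `&` survives) * (expR s)%:E)%E.
Proof.
rewrite /aged_probability.
have PE : P survives = (expR (- s))%:E by exact: (lifetime_tail hB).
by rewrite (conditionedE _ _ PE) ?expR_gt0// expRN invrK.
Qed.

Lemma indep_driving : mutually_independent P G.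
Proof. exact: (bbm_independent (regular_is_bbm hB)). Qed.

Lemma survives_driving : G i0 survives.
Proof.
exists `]s, +oo[%classic; first exact: measurable_itv.
by rewrite setTI; apply/seteqP; split=> w /=; rewrite in_itv /= andbT.
Qed.

Lemma aged_probability_driving i A : i != i0 -> G i A -> P' A = P A.
Proof.
move=> ni GA; rewrite aged_probabilityE.
pose F j := if j == i0 then survives else A.
have := @indep_driving [:: i; i0] F.
rewrite !big_cons !big_nil /F eqxx (negbTE ni) setIT => ->.
- rewrite mule1 (_ : P survives = (expR (- s))%:E); last exact: (lifetime_tail hB).
  by rewrite -muleA -EFinM -expRD addNr expR0 mule1.
- by rewrite /= inE ni.
- move=> j; rewrite !inE => /orP[/eqP ->|/eqP ->]; rewrite ?(negbTE ni) ?eqxx//.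
  exact: survives_driving.
Qed.

Lemma aged_lifetime_driving A : sigma_rv (aged_lifetime [::]) A ->
  G i0 (A `&` survives).
Proof.
move=> [C mC <-]; exists ((fun x => x - s) @^-1` C `&` `]s, +oo[%classic).
  apply: measurableI => //; rewrite -[X in measurable X]setTI.
  exact: (measurable_funB (@measurable_id _ _ setT) (measurable_cst s)).
rewrite !setTI; apply/seteqP; split=> w /=; rewrite in_itv /= andbT /survives /=.
  by move=> [Cw sw]; rewrite sw.
by move=> [+ sw]; rewrite sw.
Qed.

(** The conditioning event belongs to the coordinate [i0] alone, so it is absorbed into the factor
    of that index, which is added to the family when absent. The full motions [B] are kept, since
    the past of the root must be independent of the other coordinates as well. *)
Lemma aged_independent :
  mutually_independent P' (driving_sigma aged_lifetime (fun u => B u)).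
Proof.
move=> l A ul GA.
pose r := [seq i <- l | i != i0].
pose A' i := if i == i0 then (if i0 \in l then A i0 else setT) `&` survives else A i.
have ur : uniq (i0 :: r) by rewrite /= filter_uniq// mem_filter eqxx.
have GA0 i : i != i0 -> i \in l -> G i (A i).
  by move=> ni /GA; case: i ni => -[].
have GA' i : i \in i0 :: r -> G i (A' i).
  rewrite inE /A'; case: (eqVneq i i0) => [-> _|ni /=].
    case: ifPn => [il|_]; first exact: aged_lifetime_driving (GA _ il).
    by rewrite setTI; exact: survives_driving.
  by rewrite mem_filter ni /=; exact: GA0.
rewrite aged_probabilityE.
have -> : \big[setI/setT]_(i <- l) A i `&` survives =
    \big[setI/setT]_(i <- i0 :: r) A' i.
  rewrite predeqE => w; split.
    move=> [/in_bigsetI Aw sw]; apply/in_bigsetI => i; rewrite inE /A'.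
    case: (eqVneq i i0) => [-> _|ni /=]; last first.
      by rewrite mem_filter => /andP[_]; exact: Aw.
    by split => //; case: ifPn => // /Aw.
  move=> /in_bigsetI Aw; split.
    apply/in_bigsetI => i il; have [ei|ni] := eqVneq i i0.
      by have := Aw i0 (mem_head _ _); rewrite /A' eqxx -ei il => -[].
    by have := Aw i; rewrite inE mem_filter ni il /A' (negbTE ni) orbT; apply.
  by have := Aw i0 (mem_head _ _); rewrite /A' eqxx => -[].
rewrite indep_driving// big_cons.
have -> : (\prod_(i <- r) P (A' i) = \prod_(i <- r) P' (A i))%E.
  apply: eq_big_seq => i; rewrite mem_filter /A' => /andP[ni il].
  by rewrite (negbTE ni) (aged_probability_driving ni (GA0 _ ni il)).
rewrite muleAC; have [il|nil] := boolP (i0 \in l).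
  have pl : perm_eq l (i0 :: r).
    apply: uniq_perm => // i; rewrite inE mem_filter.
    by case: (eqVneq i i0) => [->|].
  by rewrite (perm_big _ pl) big_cons /A' eqxx il -aged_probabilityE.
have -> : r = l.
  by apply/all_filterP/allP => i il; apply: contraNneq nil => <-.
rewrite /A' eqxx (negbTE nil) setTI (_ : P survives = (expR (- s))%:E); last first.
  exact: (lifetime_tail hB).
by rewrite -EFinM -expRD addNr expR0 mul1e.
Qed.

Lemma aged_motion_sub u : sigma_process (aged_motion u) `<=` sigma_process (B u).
Proof.
case: u => [|b u] //=.
apply: sub_g_sigma_algebra.
  exact: (@sigma_algebra_measurable _ (g_sigma_algebraType _)).
move=> A [t /=]; rewrite in_itv /= andbT => t0.
by apply: sigma_process_incr => //; rewrite addr_ge0.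
Qed.

(** Memorylessness of the exponential law, checked on the half-lines []x, +oo[], a pi-system that
    generates the Borel sets. For [x < 0] the event is all of [survives], as the residual lifetime
    is positive there. *)
Lemma aged_lifetime_distribution u A : measurable A ->
  distribution P' (aged_lifetime_rv u) A = exponential_prob 1 A.
Proof.
case: u => [|b u] mA; last first.
  rewrite -(bbm_lifetime (regular_is_bbm hB) (b :: u) mA).
  by apply: (@aged_probability_driving (inl (b :: u))) => //; exists A; rewrite ?setTI.
rewrite -(bbm_lifetime (regular_is_bbm hB) [::] mA).
apply: (@measure_unique _ R _ (@RGenOInfty.G R) (fun n => `]- n%:R, +oo[%classic)
  _ _ _ _ (distribution P' (aged_lifetime_rv [::])) (distribution P (tau [::]))) => //.
- exact: RGenOInfty.measurableE.
- move=> _ _ [x ->] [y ->]; exists (Num.max x y).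
  by apply/seteqP; split=> z /=; rewrite !in_itv /= !andbT gt_max;
    [move=> [-> ->]|move=> /andP[]].
- by move=> n; exists (- n%:R).
- apply/seteqP; split=> // z _; exists (Num.bound `|z|) => //=.
  rewrite in_itv /= andbT ltrNl; apply: le_lt_trans (ler_norm _) _.
  by rewrite normrN; exact: archi_boundP.
- move=> _ [x ->].
  rewrite /distribution /pushforward /= aged_probabilityE.
  have [x0|x0] := leP 0 x.
    rewrite (_ : _ `&` _ = [set w | s + x < tau [::] w]); last first.
      apply/seteqP; split=> w /=; rewrite in_itv /= andbT /survives /=.
        by move=> [+ sw]; rewrite sw ltrBrDl.
      move=> sxw; have sw : s < tau [::] w by rewrite (le_lt_trans _ sxw)// lerDl.
      by rewrite sw ltrBrDl.
    rewrite (lifetime_tail hB) ?addr_ge0// -EFinM -expRD opprD addrAC addNr add0r.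
    rewrite -(lifetime_tail hB [::] x0); congr (P _).
    by apply/seteqP; split=> w /=; rewrite in_itv /= andbT.
  rewrite (_ : _ `&` _ = survives); last first.
    apply/seteqP; split=> w /=; rewrite in_itv /= andbT /survives /=; first by case.
    by move=> sw; rewrite sw; split => //; rewrite (lt_trans x0)// subr_gt0.
  rewrite (_ : P survives = (expR (- s))%:E); last exact: (lifetime_tail hB).
  rewrite -EFinM -expRD addNr expR0 -(probability_setT P); congr (P _).
  apply/seteqP; split=> w //= _; rewrite in_itv /= andbT.
  by rewrite (lt_trans x0)// (lifetime_gt0 hB).
- by move=> n; rewrite (le_lt_trans (probability_le1 _ _)) ?ltry.
Qed.

Lemma aged_motion_continuous u w :
  {within `[0, +oo[, continuous (fun t => aged_motion u t w)}.
Proof.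
case: u => [|b u]; last exact: (motion_continuous hB).
apply/subspace_continuousP => t /=; rewrite in_itv /= andbT => t0.
have /subspace_continuousP /(_ (s + t)) := @motion_continuous _ _ _ _ _ _ hB [::] w.
rewrite /= in_itv /= andbT addr_ge0// => /(_ isT) ct.
apply: (@cvgB _ R^o); last exact: cvg_cst.
apply: cvg_comp ct => U wU; rewrite /within /nbhs /=.
have : (s + r) @[r --> t] --> s + t by apply: cvgD; [exact: cvg_cst|exact: cvg_id].
move=> ct; change (\forall r \near t, `[0, +oo[%classic r -> U (s + r)).
have : \forall r \near t, `[0, +oo[%classic (s + r) -> U (s + r) := ct _ wU.
apply: filterS => r + r0; apply.
by move: r0; rewrite /= !in_itv /= !andbT => r0; rewrite addr_ge0.
Qed.

(** The Markov property of the root at a fixed age: given survival, the residual lifetime, the later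
    increments and the untouched subtrees are again a regular process, on the same [T] under another
    law. *)
Lemma regular_aged : regular_bbm aged_lifetime_rv aged_motion_rv.
Proof.
split.
- split.
  + exact: aged_lifetime_distribution.
  + move=> u; have bmu := bbm_motion (regular_is_bbm hB) u.
    have cu := @aged_motion_continuous u.
    case: u bmu cu => [|b u] bmu cu.
      apply: (@brownian_motion_shift _ _ _ P P' (B [::]) (aged_motion_rv [::]) s s0) => //.
      by move=> D; exact: (@aged_probability_driving (inr [::])).
    apply: (@brownian_motion_shift _ _ _ P P' (B (b :: u)) (aged_motion_rv (b :: u)) 0) => //.
      by move=> r w; rewrite add0r (motion_start hB) subr0.
    by move=> D; exact: (@aged_probability_driving (inr (b :: u))).
  + apply: mutually_independent_sub aged_independent => -[u|u] //=.
    exact: aged_motion_sub.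
- case=> [|b u] w /=; last exact: (lifetime_gt0 hB).
  by case: ifPn => // sw; rewrite subr_gt0.
- case=> [|b u] w /=; last exact: (motion_start hB).
  by rewrite addr0 subrr.
- exact: aged_motion_continuous.
Qed.

(** In the coordinate of the root's motion the past is split off from the future increments by
    [mutually_independent_split]; conditioning on the lifetime leaves the law of this coordinate
    unchanged. *)
Lemma aged_indep_past : sigma_indep P' (sigma_rv (B [::] s))
  <<s \bigcup_i driving_sigma aged_lifetime aged_motion i >>.
Proof.
have bm0 := bbm_motion (regular_is_bbm hB) [::].
have past := sigma_indep_past_future (motion_start hB [::])
  (bm_independent_increments bm0) s0.
pose G1 := driving_sigma aged_lifetime (fun u => B u).
have split := @mutually_independent_split _ _ _ P' _ G1
  (@driving_sigmaI _ _ _ _ _) (@driving_sigmaT _ _ _ _ _) _ aged_independent (inr [::])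
  (sigma_rv (B [::] s)) (sigma_process (aged_motion [::])).
move=> A D As sD; apply: split As _ => //.
- by move=> i; apply: driving_sigma_measurable => // u;
    exact: measurable_aged_lifetime.
- by apply/sigma_rvP; exact: sigma_process_rv.
- exact: aged_motion_sub.
- exact: sigma_rv_setI.
- move=> X Y; exact: (@measurableI _ (g_sigma_algebraType _)).
- exact: (@measurableT _ (g_sigma_algebraType _)).
- have PD X : sigma_process (B [::]) X -> P' X = P X.
    exact: (@aged_probability_driving (inr [::])).
  have s1 : sigma_rv (B [::] s) `<=` sigma_process (B [::]).
    by apply/sigma_rvP; exact: sigma_process_rv.
  move=> X Y HX HY; rewrite !PD; [exact: past|exact: aged_motion_sub|exact: s1|].
  apply: (@measurableI _ (g_sigma_algebraType _)); first exact: s1.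
  exact: aged_motion_sub.
- apply: sub_sigma_algebra2 sD => X [i _ iX]; exists i => //.
  case: i iX => [u|u] /=; first by [].
  by case: eqP => [[->]|] //; case: u => //.
Qed.

Lemma survives_aged_past A : sigma_rv (B [::] s) A -> P' A = P A.
Proof.
move=> HA; apply: (@aged_probability_driving (inr [::])) => //.
by move: A HA; apply/sigma_rvP; exact: sigma_process_rv.
Qed.

End aging.

(** * The heat semigroup and the splitting of the root *)

Section density.
Import HBNNSimple.
Context (R : realType).
Local Open Scope ereal_scope.
Local Notation mu := (@lebesgue_measure R).

Lemma ge0_integral_density (m : {measure set R -> \bar R}) (p : R -> R) :
  measurable_fun setT p -> (forall x, 0 <= p x)%R ->
  (forall A, measurable A -> m A = \int[mu]_(x in A) (p x)%:E) ->
  forall f : R -> \bar R, measurable_fun setT f -> (forall x, 0 <= f x) ->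
  \int[m]_x f x = \int[mu]_x (f x * (p x)%:E).
Proof.
move=> mp p0 mE f mf f0.
pose g := nnsfun_approx (@measurableT _ R) mf.
have mg n : measurable_fun setT (g n) by exact: measurable_funPT.
have cg x : EFin \o (g ^~ x) @ \oo --> f x by exact: cvg_nnsfun_approx.
have ndg x a b : (a <= b)%N -> (g a x <= g b x)%R.
  by move=> ab; exact/lefP/nd_nnsfun_approx.
have Eg n : \int[m]_x (g n x)%:E = \int[mu]_x ((g n x)%:E * (p x)%:E).
  rewrite integralT_nnsfun sintegralE.
  transitivity (\int[mu]_x (\sum_(y \in range (g n))
     (y * \1_(g n @^-1` [set y]) x * p x)%:E)); last first.
    apply: eq_integral => x _; rewrite -EFinM [in RHS](fimfunE (g n)).
    by rewrite fsumEFin// -mulr_fsuml.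
  rewrite ge0_integral_fsum//; last 2 first.
    move=> y; apply/measurable_EFinP; apply: measurable_funM => //.
    apply: measurable_funM => //; apply: measurable_indic.
    by rewrite -[X in measurable X]setTI; exact: mg.
    by move=> y x _; rewrite lee_fin mulr_ge0//; exact: nnfun_muleindic_ge0.
  apply: eq_fsbigr => y /set_mem[x _ gy].
  have y0 : (0 <= y)%R by rewrite -gy; exact: fun_ge0.
  rewrite mE; last by rewrite -[X in measurable X]setTI; exact: mg.
  have mA : measurable (g n @^-1` [set y]).
    by rewrite -[X in measurable X]setTI; exact: mg.
  have mpE : measurable_fun [set: R] (EFin \o p) by exact/measurable_EFinP.
  rewrite -ge0_integralZl//; last 2 first.
    exact: (measurable_funTS mpE).
    by move=> z _; rewrite lee_fin.
  rewrite [LHS]integral_mkcond; apply: eq_integral => z _; rewrite patchE indicE.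
  have [Az|nAz] := pselect ((g n @^-1` [set y]) z).
    by rewrite !mem_set// mulr1 EFinM.
  by rewrite !memNset// mulr0 mul0r.
have -> : \int[m]_x f x = limn (fun n => \int[m]_x (g n x)%:E).
  rewrite -monotone_convergence//; last 3 first.
  - by move=> n; exact/measurable_EFinP.
  - by move=> n x _; rewrite lee_fin.
  - by move=> x _ a b ab; rewrite lee_fin ndg.
  by apply: eq_integral => x _; apply/esym/cvg_lim => //; exact: cg.
have mgp n : measurable_fun [set: R] (fun x => (g n x)%:E * (p x)%:E).
  by apply: emeasurable_funM; exact/measurable_EFinP.
have -> : \int[mu]_x (f x * (p x)%:E) =
    limn (fun n => \int[mu]_x ((g n x)%:E * (p x)%:E)).
  rewrite -monotone_convergence//; last 2 first.
  - by move=> n x _; rewrite mule_ge0// lee_fin.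
  - by move=> x _ a b ab; rewrite lee_wpmul2r ?lee_fin// ndg.
  apply: eq_integral => x _; apply/esym/cvg_lim => //.
  by apply: cvgeZr => //; exact: cg.
by congr (limn _); apply/funext => n; exact: Eg.
Qed.

Let measurable_translation (a : R) :
  measurable_fun [set: measurableTypeR R] (fun x : R => a + x : measurableTypeR R)%R.
Proof. exact: measurable_funD. Qed.

Let translation (a : R) : {mfun measurableTypeR R >-> measurableTypeR R} :=
  @mfun_Sub _ _ (measurableTypeR R) (measurableTypeR R) (fun x : R => a + x)%R
    (mem_set (@measurable_translation a)).

Lemma lebesgue_measureD (a : R) (A : set R) : measurable A ->
  pushforward mu (translation a) A = mu A.
Proof.
move=> mA; apply/esym/lebesgue_measure_unique => //= _ [[b c]] _ <-.
rewrite /pushforward /=.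
rewrite (_ : _ @^-1` _ = `](b - a)%R, (c - a)%R]%classic); last first.
  by apply/seteqP; split=> x /=; rewrite !in_itv /= ltrBlDl lerBrDl.
rewrite !lebesgue_measure_itv/= !lte_fin ltrD2r.
by case: ifP => // _; rewrite -!EFinB opprB addrA subrK.
Qed.

Lemma ge0_integral_translation (a : R) (f : R -> \bar R) :
  measurable_fun setT f -> (forall x, 0 <= f x) ->
  \int[mu]_x f (a + x)%R = \int[mu]_x f x.
Proof.
move=> mf f0.
transitivity (\int[pushforward mu (translation a)]_x f x).
  by rewrite ge0_integral_pushforward.
by apply: eq_measure_integral => A mA _; exact: lebesgue_measureD.
Qed.

Let measurable_opp :
  measurable_fun [set: measurableTypeR R] (fun x : R => - x : measurableTypeR R)%R.
Proof. exact: oppr_measurable. Qed.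

Let opposite : {mfun measurableTypeR R >-> measurableTypeR R} :=
  @mfun_Sub _ _ (measurableTypeR R) (measurableTypeR R) (fun x : R => - x)%R
    (mem_set measurable_opp).

Lemma ge0_integral_opp (f : R -> \bar R) :
  measurable_fun setT f -> (forall x, 0 <= f x) ->
  \int[mu]_x f (- x)%R = \int[mu]_x f x.
Proof.
move=> mf f0.
transitivity (\int[pushforward mu opposite]_x f x).
  by rewrite ge0_integral_pushforward.
apply: eq_measure_integral => A mA _; exact: lebesgue_measureN.
Qed.

End density.

Section heat_semigroup.
Context (R : realType).
Local Open Scope ereal_scope.
Local Notation mu := (@lebesgue_measure R).

(* For [s = 0] the library's normal law degenerates to a uniform one, hence the
   case distinction. *)
Definition heat (s : R) (f : R -> \bar R) (x : R) : \bar R :=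
  if (s <= 0)%R then f x
  else \int[mu]_z ((normal_pdf x (Num.sqrt s) z)%:E * f z).

Lemma heat_ge0 s f x : (forall z, 0 <= f z) -> 0 <= heat s f x.
Proof.
move=> f0; rewrite /heat; case: ifP => // _; apply: integral_ge0 => z _.
by rewrite mule_ge0// lee_fin normal_pdf_ge0.
Qed.

Lemma normal_pdf_translation (x s y : R) :
  normal_pdf x s (x + y)%R = (if s == 0%R then \1_(`[0%R, 1%R]%classic : set R) (x + y)%R else normal_pdf 0%R s y) :> R.
Proof.
rewrite /normal_pdf; case: ifP => // _; congr (_ * _)%R.
by rewrite /normal_fun subr0 (addrAC x) subrr add0r.
Qed.

Lemma integral_heat d (T : measurableType d) (P : probability T R) (X : {mfun T >-> R})
    (s x : R) (f : R -> \bar R) : (0 < s)%R ->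
  (forall A, measurable A -> P (X @^-1` A) = normal_prob 0 (Num.sqrt s) A) ->
  measurable_fun setT f -> (forall z, 0 <= f z) ->
  \int[P]_w f (x + X w)%R = heat s f x.
Proof.
move=> s0 PX mf f0; rewrite /heat lt_geF//.
have mfx : measurable_fun setT (fun z => f (x + z)%R).
  by apply: measurableT_comp => //; exact: measurable_funD.
rewrite -(@ge0_integral_distribution _ _ _ _ _ P X (fun z => f (x + z)%R))//.
have m0 := measurable_normal_pdf (0 : R)%R (Num.sqrt s).
have p0 := normal_pdf_ge0 (0 : R)%R (Num.sqrt s).
have PX' A : measurable A -> distribution P X A =
    \int[mu]_(y in A) (normal_pdf 0 (Num.sqrt s) y)%:E by exact: PX.
have fx0 z : 0 <= f (x + z)%R by [].
rewrite (ge0_integral_density m0 p0 PX' mfx fx0).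
rewrite -[RHS](ge0_integral_translation x); last 2 first.
- by apply: emeasurable_funM => //; apply/measurable_EFinP; exact: measurable_normal_pdf.
- by move=> z; rewrite mule_ge0// lee_fin normal_pdf_ge0.
apply: eq_integral => z _; rewrite normal_pdf_translation gt_eqF ?sqrtr_gt0//.
by rewrite muleC.
Qed.

End heat_semigroup.

Section exponential_integral.
Context (R : realType).
Local Open Scope ereal_scope.
Local Notation mu := (@lebesgue_measure R).

Lemma integral_lifetime d (T : measurableType d) (P : probability T R) (X : {mfun T >-> R})
    (f : R -> \bar R) :
  (forall A, measurable A -> distribution P X A = exponential_prob 1 A) ->
  measurable_fun setT f -> (forall z, 0 <= f z) ->
  \int[P]_w f (X w) = \int[mu]_t (f t * (exponential_pdf 1 t)%:E).
Proof.
move=> PX mf f0.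
rewrite -(@ge0_integral_distribution _ _ _ _ _ P X f)//.
have m0 := measurable_exponential_pdf (1 : R)%R.
have p0 : forall z, (0 <= exponential_pdf (1 : R) z)%R.
  by move=> z; exact: exponential_pdf_ge0.
have PX' A : measurable A -> distribution P X A =
    \int[mu]_(y in A) (exponential_pdf 1 y)%:E by exact: PX.
by rewrite (ge0_integral_density m0 p0 PX' mf f0).
Qed.

End exponential_integral.

Section root_decomposition.
Context d (T : measurableType d) (R : realType) (P : probability T R).
Variables (tau : seq bool -> {RV P >-> R}) (B : seq bool -> R -> {RV P >-> R}).
Hypothesis hB : regular_bbm tau B.
Local Notation G := (driving_sigma tau (fun u => B u)).

Definition descendants (b : bool) : set (seq bool + seq bool) :=
  [set i | match i with inl u => exists v, u = b :: v
                      | inr u => exists v, u = b :: v end].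

Let indG : mutually_independent P G := bbm_independent (regular_is_bbm hB).
Let Gm i : G i `<=` measurable.
Proof. by apply: driving_sigma_measurable => *; exact: measurable_funPT. Qed.

Let group (J J' : set (seq bool + seq bool)) : J `&` J' = set0 ->
  sigma_indep P <<s \bigcup_(i in J) G i >> <<s \bigcup_(i in J') G i >>.
Proof.
exact: (mutually_independent_grouping (@driving_sigmaI _ _ _ _ _)
  (@driving_sigmaT _ _ _ _ _) Gm indG).
Qed.

Let measurable_inl J u : J (inl u) -> measurable_fun setT
  (tau u : g_sigma_algebraType (\bigcup_(i in J) G i) -> R).
Proof.
by move=> Ju; apply/sigma_rvP => A GA; apply: sub_sigma_algebra; exists (inl u).
Qed.

Let measurable_inr J u t : J (inr u) -> 0 <= t -> measurable_fun setT
  (B u t : g_sigma_algebraType (\bigcup_(i in J) G i) -> R).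
Proof.
move=> Ju t0; apply/sigma_rvP => A GA; apply: sub_sigma_algebra; exists (inr u) => //.
by apply: sub_sigma_algebra; exists t => //=; rewrite in_itv /= andbT.
Qed.

Lemma measurable_hit_descendants b J S d' (T' : measurableType d') (s x : T' -> R)
    (g : T' -> g_sigma_algebraType (\bigcup_(i in J) G i)) :
  descendants b `<=` J ->
  measurable_fun setT s -> measurable_fun setT x -> measurable_fun setT g ->
  measurable [set z | hit S (subtree tau b) (subtree B b) (s z) (x z) (g z)].
Proof.
move=> bJ ms mx mg.
apply: (@measurable_hit _ (g_sigma_algebraType (\bigcup_(i in J) G i)) R) => //.
- by move=> u; apply: measurable_inl; apply: bJ; exists u.
- by move=> u t t0; apply: measurable_inr => //; apply: bJ; exists u.
- by move=> u w; exact: (motion_continuous hB).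
- by move=> u w; exact: (lifetime_gt0 hB).
Qed.

Let roots : set (seq bool + seq bool) := [set i | i = inl [::] \/ i = inr [::]].

(* First the subtrees are integrated out for frozen data of the root, then the
   motion of the root for a frozen lifetime. *)
Lemma root_decomposition (E : bool -> set (R * R * T)) :
  (forall b J, descendants b `<=` J -> measurable
    (E b : set (R * R * g_sigma_algebraType (\bigcup_(i in J) G i)))) ->
  let H r y := (P [set w | E false (r, y, w)] * P [set w | E true (r, y, w)])%E in
  (P [set w | forall b, E b (tau [::] w, B [::] (tau [::] w) w, w)] =
   \int[lebesgue_measure]_t (heat t (H t) 0%R * (exponential_pdf 1 t)%:E))%E.
Proof.
move=> mE H.
pose J := descendants false `|` descendants true.
have disjR : roots `&` J = set0.
  by apply/seteqP; split=> // -[u|u] [[] // [->]] [] [].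
have disjb : descendants false `&` descendants true = set0.
  by apply/seteqP; split=> // -[u|u] [[v ->]] [].
have mE' b : measurable (E b : set (R * R * g_sigma_algebraType (\bigcup_(i in J) G i))).
  by apply: mE; case: b; [apply: subsetUr|apply: subsetUl].
pose gR : measurableType _ := g_sigma_algebraType (\bigcup_(i in roots) G i).
pose gJ : measurableType _ := g_sigma_algebraType (\bigcup_(i in J) G i).
have mid J' : measurable_fun setT
    (id : T -> g_sigma_algebraType (\bigcup_(i in J') G i)).
  move=> _ A sA; rewrite setTI.
  by apply: g_sigma_algebra_sub_measurable sA => C [i _]; exact: Gm.
have mtauR : measurable_fun setT (tau [::] : gR -> R).
  by apply: measurable_inl; left.
have mBR : measurable_fun setT ((fun w => B [::] (tau [::] w) w) : gR -> R).
  apply: (eq_measurable_fun (fun w : gR => B [::] (Num.max (tau [::] w) 0) w)).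
    by move=> w _; rewrite max_l// ltW// (lifetime_gt0 hB).
  apply: (@measurable_process_comp _ gR _ (B [::]) _ gR (tau [::]) id) => //.
    by move=> t t0; apply: measurable_inr => //; right.
  by move=> w; exact: (motion_continuous hB).
(* The root is read from [z.1] and the subtrees from [z.2]; on the diagonal [F] describes the event
   itself. *)
pose F (z : gR * gJ) : bool :=
  `[< E false (tau [::] z.1, B [::] (tau [::] z.1) z.1, z.2) >] &&
  `[< E true (tau [::] z.1, B [::] (tau [::] z.1) z.1, z.2) >].
have m12 : measurable_fun [set: gR * gJ]
    (fun z => (tau [::] z.1, B [::] (tau [::] z.1) z.1, z.2)).
  apply: measurable_fun_pair; last exact: measurable_snd.
  apply: measurable_fun_pair.
    exact: (measurableT_comp mtauR measurable_fst).
  exact: (measurableT_comp mBR measurable_fst).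
have mEb b : measurable_fun [set: gR * gJ]
    (fun z => `[< E b (tau [::] z.1, B [::] (tau [::] z.1) z.1, z.2) >]).
  apply: (measurable_fun_bool true); rewrite setTI.
  have := m12 measurableT _ (mE' b); rewrite setTI; congr (measurable _).
  by apply/seteqP; split=> z /=; [move=> h; exact/asboolP|move/asboolP].
have mF : measurable_fun setT F by exact: measurable_and.
pose f z := (if F z then 1 else 0 : R)%:E.
have mf : measurable_fun [set: gR * gJ] f.
  have mFR : measurable_fun [set: gR * gJ] (fun z => if F z then 1 else 0 : R).
    by apply: measurable_fun_ifT.
  exact/measurable_EFinP.
have f0 z : (0 <= f z)%E by rewrite /f; case: ifP; rewrite lee_fin.
have mP b t y : measurable [set w | E b (t, y, w)].
  have := (mid J) measurableT _ (measurable_xsection (t, y) (mE' b)).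
  by rewrite setTI xsectionE.
have PH t y : P ([set w | E false (t, y, w)] `&` [set w | E true (t, y, w)]) = H t y.
  apply: (group disjb).
    have := measurable_xsection (t, y) (mE false (descendants false) (@subset_refl _ _)).
    by rewrite xsectionE.
  have := measurable_xsection (t, y) (mE true (descendants true) (@subset_refl _ _)).
  by rewrite xsectionE.
have H0 t y : (0 <= H t y)%E by rewrite mule_ge0.
have mH : measurable_fun [set: R * R] (fun z => H z.1 z.2).
  have mET b : measurable (E b : set (R * R * T)).
    have m1 : measurable_fun [set: (R * R) * T] (fun z => (z.1, z.2 : gJ)).
      apply: measurable_fun_pair; first exact: measurable_fst.
      exact: (measurableT_comp (mid J) measurable_snd).
    have := m1 measurableT _ (mE' b); rewrite setTI; congr (measurable _).
    by apply/seteqP; split=> -[].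
  have mS b : measurable_fun [set: R * R] (fun z => P [set w | E b (z.1, z.2, w)]).
    have := @measurable_fun_xsection _ _ _ _ _ P _ (mET b).
    congr (measurable_fun _); apply/funext => -[t y] /=.
    by rewrite xsectionE.
  exact: emeasurable_funM.
have mHt (t : R) : measurable_fun [set: R] (H t).
  apply: (@measurableT_comp _ _ _ _ _ _ (fun z : R * R => H z.1 z.2) setT (pair t)) => //.
transitivity (\int[P]_w f (w, w))%E.
  pose A : set T := [set w : T | F (w, w)].
  have mA : measurable A.
    have mD : measurable_fun [set: T] (fun w => (w : gR, w : gJ)).
      by apply: measurable_fun_pair; exact: mid.
    have : measurable_fun setT (fun w : T => F (w, w)) by exact: (measurableT_comp mF mD).
    by move=> /(_ measurableT [set true]); rewrite setTI; apply.
  transitivity (\int[P]_w (\1_A w)%:E)%E; last first.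
    apply: eq_integral => w _; rewrite /f indicE.
    by case: ifPn => h; [rewrite mem_set|rewrite memNset//; exact/negP].
  rewrite integral_indic// setIT; congr (P _).
  apply/seteqP; split=> w; rewrite /A /F /=.
    by move=> h; apply/andP; split; apply/asboolP; exact: h.
  by move=> /andP[/asboolP h0 /asboolP h1] [].
(* First separation: the data of the root against all its descendants. *)
rewrite (@ge0_integral_indep _ _ _ P _ _ gR gJ id id f)//; last first.
  by move=> A D sA sD; exact: (group disjR).
pose K (z : R * T) := H z.1 (B [::] (Num.max z.1 0)%R z.2).
have inner w : (\int[P]_w' f (w, w') = K (tau [::] w, w))%E.
  rewrite /K /= max_l ?(ltW (lifetime_gt0 hB _ _))// -PH.
  rewrite -[X in P X]setIT -integral_indic//; last exact: measurableI.
  apply: eq_integral => w' _; rewrite /f /F /= indicE.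
  case: ifPn => h.
    by rewrite mem_set//; move: h => /andP[/asboolP h0 /asboolP h1].
  rewrite memNset// => -[h0 h1]; case/negP: h.
  by apply/andP; split; apply/asboolP.
transitivity (\int[P]_w K (tau [::] w, w))%E.
  by apply: eq_integral => w _; exact: inner.
(* Second separation, inside the root: its lifetime against its motion alone. *)
pose gP : measurableType _ := g_sigma_algebraType (\bigcup_(i in [set (inr [::] : seq bool + seq bool)]) G i).
have mK : measurable_fun [set: R * gP] K.
  apply: (@measurableT_comp _ _ _ _ _ _ (fun z => H z.1 z.2) setT
    (fun z : R * gP => (z.1, B [::] (Num.max z.1 0) z.2))) => //.
  apply: measurable_fun_pair; first exact: measurable_fst.
  apply: (@measurable_process_comp _ gP _ (B [::]) _ _ fst snd) => //.
    by move=> t t0; exact: measurable_inr.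
  by move=> w; exact: (motion_continuous hB).
have K0 z : (0 <= K z)%E by exact: H0.
rewrite (@ge0_integral_indep _ _ _ P _ _ R gP (tau [::]) id K)//; last first.
  move=> A D mA sD.
  have disjP : [set (inl [::] : seq bool + seq bool)] `&` [set inr [::]] = set0.
    by apply/seteqP; split=> // i [/= ->].
  apply: (group disjP) => //.
  apply: sub_sigma_algebra; exists (inl [::]) => //.
  by exists A => //; rewrite setTI.
pose L : R -> \bar R := fun t => (\int[P]_w' K (t, w'))%E.
have mL : measurable_fun setT L.
  have mKT : measurable_fun [set: R * T] K.
    have m1 : measurable_fun [set: R * T] (fun z => (z.1, z.2 : gP)).
      apply: measurable_fun_pair; first exact: measurable_fst.
      exact: (measurableT_comp (mid _) measurable_snd).
    apply: (eq_measurable_fun (K \o (fun z : R * T => (z.1, z.2 : gP)))).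
      by move=> -[].
    exact: (measurableT_comp mK m1).
  have mKF := @measurable_fun_fubini_tonelli_F _ _ R T R P K mKT K0.
  exact: mKF.
have L0 t : (0 <= L t)%E by apply: integral_ge0.
rewrite -/(L _) (integral_lifetime _ mL L0); last first.
  by move=> A mA; exact: (bbm_lifetime (regular_is_bbm hB)).
apply: eq_integral => t _; rewrite /exponential_pdf patchE.
case: ifPn => [/set_mem|_]; last by rewrite !mule0.
rewrite /= in_itv /= andbT => t0.
congr (_ * _)%E; rewrite /L /K /=.
rewrite max_l//; move: t0; rewrite le_eqVlt => /predU1P[t0|t0].
  rewrite /heat -t0 lexx.
  under eq_integral do rewrite (motion_start hB).
  by apply: (etrans (integral_cst P measurableT _)); rewrite /= probability_setT mule1.
have -> : (\int[P]_w' H t (B [::] t w') = \int[P]_w' H t (0 + B [::] t w')%R)%E.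
  by apply: eq_integral => w' _; rewrite add0r.
apply: integral_heat => //.
  move=> A mA; have bm0 := bbm_motion (regular_is_bbm hB) [::].
  rewrite -[t in RHS]subr0 -(bm_normal_increments bm0 (lexx 0) t0 mA).
  congr (P _); apply/seteqP; split=> w /=; rewrite (motion_start hB) subr0//.
Qed.

End root_decomposition.

Section gauss_kernel.
Context (R : realType).
Implicit Types s w x z : R.

Definition gauss s w : R := (Num.sqrt (s * pi *+ 2))^-1 * expR (- w ^+ 2 / (s *+ 2)).

Lemma gauss_ge0 s w : 0 <= gauss s w.
Proof. by rewrite mulr_ge0// ?invr_ge0 ?sqrtr_ge0// expR_ge0. Qed.

Lemma normal_pdf_gauss s x z : 0 < s -> normal_pdf x (Num.sqrt s) z = gauss s (z - x).
Proof.
move=> s0; have ss : Num.sqrt s != 0 by rewrite gt_eqF// sqrtr_gt0.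
rewrite normal_pdfE; last exact: ss.
by rewrite /normal_peak /normal_fun sqr_sqrtr// ltW.
Qed.

Lemma measurable_gauss d (T : measurableType d) (s w : T -> R) :
  measurable_fun setT s -> measurable_fun setT w -> (forall u, 0 < s u) ->
  measurable_fun setT (fun u => gauss (s u) (w u)).
Proof.
move=> ms mw s0.
apply: (eq_measurable_fun (fun u => expR (- (ln (s u * pi *+ 2) / 2)) *
   expR (- w u ^+ 2 * expR (- ln (s u *+ 2))))).
  move=> u _; rewrite /gauss; congr (_ * expR (_ * _)).
    have p0 : 0 < s u * pi *+ 2 by rewrite pmulrn_lgt0// mulr_gt0// pi_gt0.
    rewrite expRN -powR12_sqrt ?(ltW p0)// /powR (gt_eqF p0).
    by rewrite mulrC.
  by rewrite expRN lnK// posrE pmulrn_lgt0.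
apply: measurable_funM; apply: measurableT_comp => //.
  apply: (measurableT_comp (@oppr_measurable R setT)); apply: measurable_funM => //.
  apply: (measurableT_comp (@measurable_ln R)).
  apply: (eq_measurable_fun (fun u => s u * (pi *+ 2))); last exact: measurable_funM.
  by move=> u _; rewrite mulrnAr.
apply: measurable_funM.
  by apply: (measurableT_comp (@oppr_measurable R setT)); exact: measurable_funX.
apply: measurableT_comp => //; apply: (measurableT_comp (@oppr_measurable R setT)).
apply: (measurableT_comp (@measurable_ln R)).
apply: (eq_measurable_fun (fun u => s u * 2)); last exact: measurable_funM.
by move=> u _; rewrite mulr_natr.
Qed.

End gauss_kernel.

Section heat_theory.
Context (R : realType).
Local Open Scope ereal_scope.
Local Notation mu := (@lebesgue_measure R).
Implicit Types (s t x y z : R) (f g : R -> \bar R).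

Lemma heat0 f x : heat 0 f x = f x.
Proof. by rewrite /heat lexx. Qed.

Let measurable_kernel s x f : measurable_fun setT f ->
  measurable_fun [set: R] (fun z => (normal_pdf x (Num.sqrt s) z)%:E * f z).
Proof.
move=> mf; apply: emeasurable_funM => //; apply/measurable_EFinP.
exact: measurable_normal_pdf.
Qed.

Let kernel_ge0 s x f z : (forall z, 0 <= f z) ->
  0 <= (normal_pdf x (Num.sqrt s) z)%:E * f z.
Proof. by move=> f0; rewrite mule_ge0// lee_fin normal_pdf_ge0. Qed.

Lemma le_heat s f g x : measurable_fun setT f -> measurable_fun setT g ->
  (forall z, 0 <= f z) -> (forall z, f z <= g z) -> heat s f x <= heat s g x.
Proof.
move=> mf mg f0 fg; rewrite /heat; case: ifP => // _.
have g0 z : 0 <= g z by exact: le_trans (f0 z) (fg z).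
have mkf := measurable_kernel s x mf; have mkg := measurable_kernel s x mg.
apply: ge0_le_integral => //.
- by move=> z _; exact: kernel_ge0.
- by move=> z _; rewrite lee_wpmul2l// lee_fin normal_pdf_ge0.
Qed.

Lemma heatD s f g x : measurable_fun setT f -> measurable_fun setT g ->
  (forall z, 0 <= f z) -> (forall z, 0 <= g z) ->
  heat s (fun z => f z + g z) x = heat s f x + heat s g x.
Proof.
move=> mf mg f0 g0; rewrite /heat; case: ifP => // _.
have mkf := measurable_kernel s x mf; have mkg := measurable_kernel s x mg.
rewrite -ge0_integralD//; last 2 first.
- by move=> z _; exact: kernel_ge0.
- by move=> z _; exact: kernel_ge0.
by apply: eq_integral => z _; rewrite ge0_muleDr.
Qed.

Lemma heatZ s (k : R) f x : measurable_fun setT f -> (0 <= k)%R ->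
  (forall z, 0 <= f z) -> heat s (fun z => k%:E * f z) x = k%:E * heat s f x.
Proof.
move=> mf k0 f0; rewrite /heat; case: ifP => // _.
have mkf := measurable_kernel s x mf.
rewrite -ge0_integralZl//; last by move=> z _; exact: kernel_ge0.
by apply: eq_integral => z _; rewrite muleCA.
Qed.

Lemma heat_cst s (k : R) x : (0 <= k)%R -> heat s (cst k%:E) x = k%:E.
Proof.
move=> k0; rewrite /heat; case: ifP => // _.
have m : measurable_fun [set: R] (fun z => (normal_pdf x (Num.sqrt s) z)%:E).
  by apply/measurable_EFinP; exact: measurable_normal_pdf.
under eq_integral do rewrite muleC.
rewrite ge0_integralZl//; last by move=> z _; rewrite lee_fin normal_pdf_ge0.
by rewrite integral_normal_pdf mule1.
Qed.

Lemma heat_translation s a f x : measurable_fun setT f -> (forall z, 0 <= f z) ->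
  heat s (fun y => f (a + y)%R) x = heat s f (a + x)%R.
Proof.
move=> mf f0; rewrite /heat; have [s0|s0] := leP s 0%R; first by [].
have mkf := measurable_kernel s (a + x)%R mf.
have k0 z : 0 <= (normal_pdf (a + x) (Num.sqrt s) z)%:E * f z by exact: kernel_ge0.
rewrite -[RHS](ge0_integral_translation a mkf k0).
apply: eq_integral => z _; congr (_%:E * _).
have ss : Num.sqrt s != 0%R by rewrite gt_eqF// sqrtr_gt0.
rewrite !normal_pdfE; [|exact: ss|exact: ss].
by rewrite /normal_fun opprD addrACA subrr add0r.
Qed.

Lemma heat_opp s f x : measurable_fun setT f -> (forall z, 0 <= f z) ->
  heat s (fun y => f (- y)%R) x = heat s f (- x)%R.
Proof.
move=> mf f0; rewrite /heat; have [s0|s0] := leP s 0%R; first by [].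
have mkf := measurable_kernel s (- x)%R mf.
have k0 z : 0 <= (normal_pdf (- x) (Num.sqrt s) z)%:E * f z by exact: kernel_ge0.
rewrite -[RHS](ge0_integral_opp mkf k0).
apply: eq_integral => z _; congr (_%:E * _).
have ss : Num.sqrt s != 0%R by rewrite gt_eqF// sqrtr_gt0.
rewrite !normal_pdfE; [|exact: ss|exact: ss].
by rewrite /normal_fun -opprD sqrrN.
Qed.

Lemma heatE s f x : (0 < s)%R ->
  heat s f x = \int[mu]_z ((gauss s (z - x))%:E * f z).
Proof.
move=> s0; rewrite /heat lt_geF//; apply: eq_integral => z _.
by rewrite normal_pdf_gauss.
Qed.

Lemma measurable_heat d (T : measurableType d) (s x : T -> R) (k : (T * R)%type -> \bar R) :
  measurable_fun setT s -> measurable_fun setT x ->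
  measurable_fun setT k -> (forall z : (T * R)%type, 0 <= k z) ->
  measurable_fun setT (fun u => heat (s u) (fun z => k (u, z)) (x u)).
Proof.
move=> ms mx mk k0.
(* Where [s u <= 0] the other branch of [heat] applies; the value 1 only keeps the kernel a genuine
   Gaussian there. *)
pose s' (u : T) : R := if (s u <= 0)%R then 1%R else s u.
have ms' : measurable_fun setT s'.
  by apply: measurable_fun_ifT => //; exact: measurable_fun_ler.
have s'0 u : (0 < s' u)%R by rewrite /s'; have [|//] := leP (s u) 0%R; rewrite ltr01.
have mp : measurable_fun [set: (T * R)%type] (fun z : (T * R)%type => gauss (s' z.1) (z.2 - x z.1)).
  apply: measurable_gauss => [||[u v]]; last exact: s'0.
    exact: (measurableT_comp ms' measurable_fst).
  apply: measurable_funB; first exact: measurable_snd.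
  exact: (measurableT_comp mx measurable_fst).
pose h (z : T * measurableTypeR R) := (gauss (s' z.1) (z.2 - x z.1))%:E * k z.
have mh : measurable_fun setT h.
  have m1 : measurable_fun [set: (T * R)%type]
      (fun z : (T * R)%type => (gauss (s' z.1) (z.2 - x z.1))%:E * k z).
    by apply: emeasurable_funM => //; exact/measurable_EFinP.
  exact: m1.
have h0 (z : (T * R)%type) : 0 <= h z by rewrite mule_ge0// lee_fin gauss_ge0.
have mF := @measurable_fun_fubini_tonelli_F _ _ _ _ R mu h mh h0.
have mI : measurable_fun setT (fun u => if (s u <= 0)%R then k (u, x u)
    else \int[mu]_z h (u, z)).
  apply: measurable_fun_ifT => //; first exact: measurable_fun_ler.
  by apply: (measurableT_comp mk); exact: measurable_fun_pair.
apply: eq_measurable_fun mI => u _; rewrite /heat /h /s' /=.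
case: leP => // s0; apply: eq_integral => z _.
by rewrite normal_pdf_gauss.
Qed.

End heat_theory.

Section heat_brownian.
Context d (T : measurableType d) (R : realType) (P : probability T R).
Variables (tau : seq bool -> {RV P >-> R}) (B : seq bool -> R -> {RV P >-> R}).
Hypothesis hB : regular_bbm tau B.
Local Open Scope ereal_scope.

Lemma motion_increment s t (A : set R) : (0 <= s)%R -> (s < t)%R -> measurable A ->
  P ((B [::] t \- B [::] s)%R @^-1` A) = normal_prob 0 (Num.sqrt (t - s)) A.
Proof.
move=> s0 st mA.
exact: (@bm_normal_increments _ _ _ _ _ (bbm_motion (regular_is_bbm hB) [::]) s t s0 st A mA).
Qed.

Lemma integral_motion s x (f : R -> \bar R) : (0 <= s)%R -> measurable_fun setT f ->
  (forall z, 0 <= f z) -> \int[P]_w f (x + B [::] s w)%R = heat s f x.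
Proof.
move=> + mf f0; rewrite le_eqVlt => /predU1P[<-|s0].
  under eq_integral do rewrite (motion_start hB) addr0.
  rewrite heat0; apply: (etrans (integral_cst P measurableT _)).
  by rewrite /= probability_setT mule1.
apply: integral_heat => // A mA.
rewrite -[s in RHS]subr0 -(motion_increment (lexx 0%R) s0 mA).
by congr (P _); apply/seteqP; split=> w /=; rewrite (motion_start hB) subr0.
Qed.

(** Obtained from the independent increments of the root's motion rather than from a convolution of
    Gaussians. This is why later statements about the killed flow carry a regular process, or the
    existence of one, as a hypothesis. *)
Lemma heat_semigroup r q (f : R -> \bar R) x : (0 <= r)%R -> (0 <= q)%R ->
  measurable_fun setT f -> (forall z, 0 <= f z) ->
  heat r (heat q f) x = heat (r + q)%R f x.
Proof.
move=> r0; rewrite le_eqVlt => /predU1P[<-|q0] mf f0.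
  by rewrite addr0; congr heat; apply/funext => z; rewrite heat0.
have mhq : measurable_fun setT (heat q f).
  have mk : measurable_fun [set: (R * R)%type] (f \o snd).
    exact: (measurableT_comp mf measurable_snd).
  by apply: (@measurable_heat R _ R (cst q) id (f \o snd)) => // z; exact: f0.
have hq0 z : 0 <= heat q f z by exact: heat_ge0.
rewrite -(integral_motion x r0 mhq hq0).
rewrite -(integral_motion x (addr_ge0 r0 (ltW q0)) mf f0).
pose inc := (B [::] (r + q)%R \- B [::] r)%R.
pose F (z : R * R) := f (x + z.1 + z.2)%R.
have mF : measurable_fun [set: R * R] F.
  apply: (measurableT_comp mf); apply: measurable_funD => //.
  exact: measurable_funD.
transitivity (\int[P]_w F (B [::] r w, inc w)); last first.
  by apply: eq_integral => w _; rewrite /F /inc /= -addrA subrKC.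
have F0 z : 0 <= F z by exact: f0.
have minc : measurable_fun setT inc by exact: measurable_funB.
rewrite (@ge0_integral_indep _ _ _ P _ _ R R (B [::] r) inc F)//; last first.
  move=> A C mA mC.
  have bm0 := bbm_motion (regular_is_bbm hB) [::].
  apply: (sigma_indep_past_future (motion_start hB [::])
    (bm_independent_increments bm0) r0).
    by exists A => //; rewrite setTI.
  apply: sub_sigma_algebra; exists q => //=; first by rewrite in_itv /= andbT ltW.
  by exists C => //; rewrite setTI.
apply: eq_integral => w _; rewrite /F /=.
apply/esym; pose inc' : {mfun T >-> R} := mfun_Sub (mem_set minc).
apply: (integral_heat (X := inc')) => // A mA.
have rq : (r < r + q)%R by rewrite ltrDl.
have -> : q = ((r + q) - r)%R by rewrite addrAC subrr add0r.
exact: motion_increment.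
Qed.

End heat_brownian.

(** * The integral over the first branching time *)

Section branch_integral.
Context (R : realType).
Local Open Scope ereal_scope.
Local Notation mu := (@lebesgue_measure R).
Implicit Types (s x : R) (k : R -> R -> \bar R).

(* Expected value of [k (s - t) y] over the splitting time [t] and place [y] of
   a particle started from [x], on the event that it splits before time [s]. *)
Definition branch s k x : \bar R :=
  \int[mu]_t ((if (t <= s)%R then heat t (k (s - t)%R) x else 0) *
              (exponential_pdf 1 t)%:E).

Let weight s k x t := (if (t <= s)%R then heat t (k (s - t)%R) x else 0) *
              (exponential_pdf 1 t)%:E.

Let weight_ge0 s k x : (forall r y, 0 <= k r y) -> forall t, 0 <= weight s k x t.
Proof.
move=> k0 t; apply: mule_ge0; last by rewrite lee_fin exponential_pdf_ge0.
by case: ifP => // _; exact: heat_ge0.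
Qed.

Lemma branch_ge0 s k x : (forall r y, 0 <= k r y) -> 0 <= branch s k x.
Proof. by move=> k0; apply: integral_ge0 => t _; exact: weight_ge0. Qed.

Let measurable_weight s k x : (forall r y, 0 <= k r y) ->
  measurable_fun [set: R * R] (fun z => k z.1 z.2) ->
  measurable_fun [set: measurableTypeR R] (weight s k x).
Proof.
move=> k0 mk.
have m : measurable_fun [set: R] (weight s k x).
  apply: emeasurable_funM; last first.
    by apply/measurable_EFinP; exact: measurable_exponential_pdf.
  apply: measurable_fun_ifT => //; first exact: measurable_fun_ler.
  have mk' : measurable_fun [set: R * R] (fun z => k (s - z.1)%R z.2).
    apply: (@measurableT_comp _ _ _ _ _ _ (fun z : R * R => k z.1 z.2) setT
      (fun z : R * R => (s - z.1, z.2)%R)) => //.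
    apply: measurable_fun_pair; last exact: measurable_snd.
    by apply: measurable_funB => //; exact: measurable_fst.
  by apply: (@measurable_heat R _ R id (cst x) (fun z => k (s - z.1)%R z.2)).
exact: m.
Qed.

Let measurable_slice k r : measurable_fun [set: R * R] (fun z => k z.1 z.2) ->
  measurable_fun setT (k r).
Proof.
by move=> mk; apply: (@measurableT_comp _ _ _ _ _ _ (fun z : R * R => k z.1 z.2) setT (pair r)).
Qed.

Lemma branchD s k k' x : (forall r y, 0 <= k r y) -> (forall r y, 0 <= k' r y) ->
  measurable_fun [set: R * R] (fun z => k z.1 z.2) ->
  measurable_fun [set: R * R] (fun z => k' z.1 z.2) ->
  branch s (fun r y => k r y + k' r y) x = branch s k x + branch s k' x.
Proof.
move=> k0 k'0 mk mk'; rewrite /branch.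
have w0 t : [set: R] t -> 0 <= weight s k x t by move=> _; exact: weight_ge0.
have w0' t : [set: R] t -> 0 <= weight s k' x t by move=> _; exact: weight_ge0.
have mw := measurable_weight s x k0 mk; have mw' := measurable_weight s x k'0 mk'.
apply: (etrans _ (@ge0_integralD _ _ _ mu setT measurableT _ _ w0 mw w0' mw')).
apply: eq_integral => t _; rewrite /weight; case: ifP => _; last by rewrite !mul0e adde0.
rewrite heatD//; [|exact: measurable_slice|exact: measurable_slice].
by rewrite ge0_muleDl// heat_ge0.
Qed.

Lemma branchZ s (c : R) k x : (0 <= c)%R -> (forall r y, 0 <= k r y) ->
  measurable_fun [set: R * R] (fun z => k z.1 z.2) ->
  branch s (fun r y => c%:E * k r y) x = c%:E * branch s k x.
Proof.
move=> c0 k0 mk; rewrite /branch.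
have w0 t : [set: R] t -> 0 <= weight s k x t by move=> _; exact: weight_ge0.
have mw := measurable_weight s x k0 mk.
have cE0 : 0 <= c%:E by rewrite lee_fin.
apply: (etrans _ (@ge0_integralZl _ _ _ mu setT measurableT _ mw _ w0 cE0)).
apply: eq_integral => t _; rewrite /weight; case: ifP => _; last by rewrite !mul0e mule0.
by rewrite heatZ// ?muleA//; exact: measurable_slice.
Qed.

Lemma le_branch s k k' x : (forall r y, 0 <= k r y) ->
  measurable_fun [set: R * R] (fun z => k z.1 z.2) ->
  measurable_fun [set: R * R] (fun z => k' z.1 z.2) ->
  (forall r y, (0 <= r <= s)%R -> k r y <= k' r y) ->
  (forall r y, 0 <= k' r y) ->
  branch s k x <= branch s k' x.
Proof.
move=> k0 mk mk' kk' k'0.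
have w0 t : [set: R] t -> 0 <= weight s k x t by move=> _; exact: weight_ge0.
have mw := measurable_weight s x k0 mk; have mw' := measurable_weight s x k'0 mk'.
have w0' t : [set: R] t -> 0 <= weight s k' x t by move=> _; exact: weight_ge0.
apply: (@ge0_le_integral _ _ _ mu setT measurableT _ _ w0 mw mw') => t _.
rewrite /weight; have [t0|t0] := ltP t 0%R.
  by rewrite lt0_exponential_pdf// !mule0.
case: ifP => ts; last by rewrite !mul0e.
rewrite lee_wpmul2r ?lee_fin ?exponential_pdf_ge0//.
apply: le_heat => //; try exact: measurable_slice.
by move=> z; apply: kk'; rewrite subr_ge0 ts lerBlDr lerDl.
Qed.

Lemma integral_exponential_itv s c : (0 < s)%R -> (0 < c)%R ->
  \int[mu]_t ((if (t <= s)%R then expR (- ((c - 1) * t))%R else 0)%:E *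
     (exponential_pdf 1 t)%:E) = ((1 - expR (- c * s)) / c)%:E.
Proof.
move=> s0 c0.
have E (t : R) : (expR (- ((c - 1) * t)) * (1 * expR (-1 * t)) = c^-1 * (c * expR (- c * t)))%R.
  rewrite mul1r -expRD mulrA mulVf ?gt_eqF// mul1r; congr expR.
  by rewrite mulrBl mul1r opprB mulN1r addrAC subrr add0r mulNr.
transitivity (\int[mu]_(t in `[0%R, s]) ((c^-1)%:E * (exponential_pdf c t)%:E)).
  rewrite [RHS]integral_mkcond; apply: eq_integral => t _.
  rewrite patchE; have [t0|t0] := ltP t 0%R.
    rewrite lt0_exponential_pdf// mule0 memNset//= in_itv /= => /andP[].
    by rewrite leNgt t0.
  case: ifPn => ts; last first.
    by rewrite mul0e memNset//= in_itv /= (negbTE ts) andbF.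
  rewrite mem_set /= ?in_itv /= ?t0// !exponential_pdfE// -!EFinM.
  by congr EFin; exact: E.
have m : measurable_fun [set: R] (EFin \o exponential_pdf c).
  by apply/measurable_EFinP; exact: measurable_exponential_pdf.
have p0 t : 0 <= (exponential_pdf c t)%:E.
  by rewrite lee_fin exponential_pdf_ge0// ltW.
have cV : 0 <= (c^-1)%:E by rewrite lee_fin invr_ge0 ltW.
have mI := @measurable_funTS _ _ _ _ `[0%R, s]%classic _ m.
apply: (etrans (@ge0_integralZl _ _ _ mu `[0%R, s]%classic (measurable_itv `[0%R, s]) _ mI
  _ (fun t _ => p0 t) cV)).
have -> : \int[mu]_(t in `[0%R, s]) (exponential_pdf c t)%:E = (1 - expR (- c * s))%:E.
  exact: (exponential_prob_itv0c c s0).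
by rewrite -EFinM mulrC.
Qed.

(** By the semigroup property the integrand is [heat s f] up to an exponential in the branching
    time. Adding [expR (- s)] times [heat s f] to [c] times the result gives [expR ((c - 1) * s)]
    times [heat s f], which is thus the mild solution of the heat equation with growth rate
    [c - 1]. *)
Lemma branch_heat s c (f : R -> \bar R) x : (0 < s)%R -> (0 < c)%R ->
  (forall z, 0 <= f z) -> measurable_fun setT f ->
  (forall r q y, (0 <= r)%R -> (0 <= q)%R -> heat r (heat q f) y = heat (r + q)%R f y) ->
  branch s (fun r y => (expR ((c - 1) * r))%:E * heat r f y) x =
  ((expR ((c - 1) * s) - expR (- s)) / c)%:E * heat s f x.
Proof.
move=> s0 c0 f0 mf fsg.
have h0 : 0 <= heat s f x by exact: heat_ge0.
pose g t := (if (t <= s)%R then expR (- ((c - 1) * t)) else 0)%:E * (exponential_pdf 1 t)%:E.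
have mg : measurable_fun [set: measurableTypeR R] g.
  have m : measurable_fun [set: R] g.
    apply: emeasurable_funM; last first.
      by apply/measurable_EFinP; exact: measurable_exponential_pdf.
    apply/measurable_EFinP; apply: measurable_fun_ifT => //.
      exact: measurable_fun_ler.
    apply: measurableT_comp => //; apply: (measurableT_comp (@oppr_measurable R setT)).
    exact: measurable_funM.
  exact: m.
have g0 t : [set: R] t -> 0 <= g t.
  move=> _; rewrite mule_ge0// lee_fin ?exponential_pdf_ge0//.
  by case: ifP => // _; exact: expR_ge0.
transitivity (\int[mu]_t (((expR ((c - 1) * s))%:E * heat s f x) * g t)).
  apply: eq_integral => t _; rewrite /g muleA; have [t0|t0] := ltP t 0%R.
    by rewrite lt0_exponential_pdf// !mule0.
  congr (_ * _); case: ifP => ts; last by rewrite mule0.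
  have st0 : (0 <= s - t)%R by rewrite subr_ge0.
  have mh : measurable_fun [set: R] (heat (s - t) f).
    have mk : measurable_fun [set: (R * R)%type] (f \o snd).
      exact: (measurableT_comp mf measurable_snd).
    apply: (@measurable_heat R _ R (cst (s - t)%R) id (f \o snd)) => //.
    by move=> z; exact: f0.
  have hst0 z : 0 <= heat (s - t) f z by exact: heat_ge0.
  rewrite (heatZ t x mh (expR_ge0 _) hst0) (fsg _ _ _ t0 st0).
  have -> : (t + (s - t) = s)%R by rewrite addrC subrK.
  rewrite muleAC -EFinM -expRD; congr ((expR _)%:E * _).
  by rewrite mulrBr.
rewrite (@ge0_integralZl _ _ _ mu setT measurableT _ mg _ g0); last first.
  by rewrite mule_ge0// lee_fin expR_ge0.
rewrite /g integral_exponential_itv// muleAC -EFinM; congr (_%:E * _).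
rewrite mulrA mulrBr mulr1 -expRD; congr ((_ - expR _) / _)%R.
by rewrite mulrBl mul1r mulNr addrAC subrr add0r.
Qed.

(** With [c = 4] this carries the error term [expR (3 * s)] through the comparison arguments. *)
Lemma branch_cst s c (a : R) x : (0 < s)%R -> (0 < c)%R -> (0 <= a)%R ->
  branch s (fun r _ => (expR ((c - 1) * r))%:E * a%:E) x =
  ((expR ((c - 1) * s) - expR (- s)) / c)%:E * a%:E.
Proof.
move=> s0 c0 a0; have hc q : heat q (cst a%:E) = cst a%:E by apply/funext => z; rewrite heat_cst.
have := @branch_heat s c (cst a%:E) x s0 c0 (fun _ => a0) (measurable_cst _).
have sg r q y : (0 <= r)%R -> (0 <= q)%R ->
    heat r (heat q (cst a%:E)) y = heat (r + q)%R (cst a%:E) y by rewrite !hc.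
move=> /(_ sg); rewrite hc => <-; congr (branch s _ x).
by apply/funext => r; apply/funext => y; rewrite hc.
Qed.

End branch_integral.

(** * The KPP equation in mild form *)

Section hit_measurability.
Context d (T : measurableType d) (R : realType) (P : probability T R).
Variables (tau : seq bool -> {RV P >-> R}) (B : seq bool -> R -> {RV P >-> R}).
Implicit Types (S : seq (R * R)) (s x y : R).

Lemma hit_aged S s x w : (forall a, a \in S -> 0 <= a.1) -> 0 <= s ->
  s < tau [::] w ->
  hit S tau B s x w <->
  hit S (aged_lifetime tau s) (aged_motion B s) 0 (x + B [::] s w) w.
Proof.
move=> S0 s0 sw.
have agedE a u : a \in S ->
    (alive tau (a.1 + s) w u <-> alive (aged_lifetime tau s) (a.1 + 0) w u) /\
    (alive tau (a.1 + s) w u ->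
    position tau B u (a.1 + s) w = B [::] s w +
      position (aged_lifetime tau s) (aged_motion B s) u (a.1 + 0) w).
  move=> /S0 a0; rewrite addr0; case: u => [|b u].
    rewrite !alive_nil !position_nil /= sw; split.
      by rewrite ltrBrDr a0 addr_ge0.
    by rewrite (addrC s) [RHS]addrC subrK.
  rewrite !alive_cons !position_cons /= sw; split.
    by rewrite opprB addrA.
  have -> : a.1 - (tau [::] w - s) = a.1 + s - tau [::] w by ring.
  have -> : s + (tau [::] w - s) = tau [::] w by ring.
  by rewrite [RHS]addrA [B [::] s w + (_ - _)]addrC subrK.
split=> -[a [u [aS au h]]]; exists a, u; have [E1 E2] := agedE a u aS.
  by split => //; [exact/E1|rewrite -addrA -E2].
split => //; first exact/E1.
by rewrite E2; [rewrite addrA|exact/E1].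
Qed.

Hypothesis hB : regular_bbm tau B.

Lemma measurable_hit_probability S :
  measurable_fun [set: R * R] (fun z => P (hit S tau B z.1 z.2)).
Proof.
have mH : measurable [set z : (R * R) * T | hit S tau B z.1.1 z.1.2 z.2].
  apply: (@measurable_hit _ T R tau B _ _ _ _ S _ _
    (fun z : (R * R) * T => z.1.1) (fun z => z.1.2) snd).
  - by move=> u; exact: measurable_funPT.
  - by move=> u t _; exact: measurable_funPT.
  - by move=> u w; exact: (motion_continuous hB).
  - by move=> u w; exact: (lifetime_gt0 hB).
  - exact: (measurableT_comp measurable_fst measurable_fst).
  - exact: (measurableT_comp measurable_snd measurable_fst).
  - exact: measurable_snd.
have := @measurable_fun_xsection _ _ _ _ _ P _ mH.
congr (measurable_fun _); apply/funext => -[s x] /=.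
by rewrite xsectionE.
Qed.

Lemma measurable_hit_event S s x : measurable (hit S tau B s x).
Proof.
apply: (@measurable_hit _ T R tau B _ _ _ _ S _ _ (cst s) (cst x) id) => //.
- by move=> u w; exact: (motion_continuous hB).
- by move=> u w; exact: (lifetime_gt0 hB).
Qed.

Lemma measurable_hit_slice S s : measurable_fun [set: R] (fun x => P (hit S tau B s x)).
Proof.
exact: (@measurableT_comp _ _ _ _ _ _ (fun z : R * R => P (hit S tau B z.1 z.2)) setT
  (pair s) (measurable_hit_probability S)).
Qed.

End hit_measurability.

Section mild_equation.
Context d (T : measurableType d) (R : realType) (P : probability T R).
Variables (tau : seq bool -> {RV P >-> R}) (B : seq bool -> R -> {RV P >-> R}).
Hypothesis hB : regular_bbm tau B.
Implicit Types (S : seq (R * R)) (s x y : R).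

(** The predicate [D] selects the subtrees that must hit: one of them, or both. The cut at [s] in
    [branch] appears because for later branching times the event is empty. *)
Lemma hit_dead_decomposition (D : pred bool) S s x :
  (P [set w | (tau [::] w <= s)%R /\ forall b, D b ->
     hit S (subtree tau b) (subtree B b) (s - tau [::] w)
       (x + B [::] (tau [::] w) w)%R w] =
  branch s (fun r y =>
    (if D false then P (hit S (subtree tau false) (subtree B false) r y) else 1) *
    (if D true then P (hit S (subtree tau true) (subtree B true) r y) else 1)) x)%E.
Proof.
pose E b : set (R * R * T) := [set z | z.1.1 <= s /\ (D b ->
   hit S (subtree tau b) (subtree B b) (s - z.1.1) (x + z.1.2) z.2)].
transitivity (P [set w | forall b, E b (tau [::] w, B [::] (tau [::] w) w, w)]).
  congr (P _); apply/seteqP; split=> w /=.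
    by move=> [tw h] b; split => //; exact: h.
  by move=> h; split=> [|b]; [have [] := h false|have [_] := h b].
rewrite (@root_decomposition _ T R P tau B hB E).
  rewrite /branch; apply: eq_integral => t _; congr (_ * _)%E.
  case: ifPn => ts.
    pose k y := (((if D false then P (hit S (subtree tau false) (subtree B false) (s - t) y) else 1) *
      (if D true then P (hit S (subtree tau true) (subtree B true) (s - t) y) else 1)))%E.
    rewrite -[x in RHS]addr0 -(@heat_translation _ t x k).
    - congr heat; apply/funext => y; rewrite /k; congr (_ * _)%E.
      + case: ifPn => bD.
          by congr (P _); apply/seteqP; split=> w /=; rewrite /E /= ts bD;
            [move=> [_]; apply|].
        rewrite (_ : [set w | _] = setT) ?probability_setT//.
        by apply/seteqP; split=> // w _; rewrite /E /= ts (negbTE bD).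
      + case: ifPn => bD.
          by congr (P _); apply/seteqP; split=> w /=; rewrite /E /= ts bD;
            [move=> [_]; apply|].
        rewrite (_ : [set w | _] = setT) ?probability_setT//.
        by apply/seteqP; split=> // w _; rewrite /E /= ts (negbTE bD).
    - have mb b : measurable_fun [set: R] (fun y =>
          if D b then P (hit S (subtree tau b) (subtree B b) (s - t) y) else 1%E).
        case: (D b); last exact: measurable_cst.
        exact: (measurable_hit_slice (regular_subtree b hB) S).
      exact: emeasurable_funM.
    - by move=> z; rewrite mule_ge0//; case: ifP.
  rewrite (_ : (fun y => _) = cst 0%E) ?heat_cst//.
  apply/funext => y; rewrite (_ : [set w | _] = set0) ?measure0 ?mul0e//.
  by apply/seteqP; split=> // w; rewrite /E /= (negbTE ts) => -[].
move=> b J bJ; rewrite /E.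
have -> : [set z : R * R * T | z.1.1 <= s /\ (D b -> hit S (subtree tau b) (subtree B b)
    (s - z.1.1) (x + z.1.2) z.2)] = [set z | z.1.1 <= s] `&`
    (if D b then [set z | hit S (subtree tau b) (subtree B b)
    (s - z.1.1) (x + z.1.2) z.2] else setT).
  apply/seteqP; split=> z /= [h1 h2]; split => //; first by case: ifP => // /h2.
  by move=> bD; move: h2; rewrite bD.
pose gJ : measurableType _ := g_sigma_algebraType (\bigcup_(i in J)
  driving_sigma tau (fun u => B u) i).
have m11 : measurable_fun [set: (R * R) * gJ] (fun z => z.1.1).
  exact: (measurableT_comp measurable_fst measurable_fst).
have m12 : measurable_fun [set: (R * R) * gJ] (fun z => z.1.2).
  exact: (measurableT_comp measurable_snd measurable_fst).
apply: measurableI.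
  have := measurable_fun_ler m11 (measurable_cst s).
  by move=> /(_ measurableT [set true]); rewrite setTI; apply.
case: ifP => // _.
apply: (@measurable_hit_descendants _ T R P tau B hB b J S _ _
  (fun z : (R * R) * gJ => s - z.1.1) (fun z => x + z.1.2) snd bJ).
- exact: measurable_funB.
- exact: measurable_funD.
- exact: measurable_snd.
Qed.

(** Survival has probability [expR (- s)]; given survival, the displacement of the root is Gaussian
    and independent of the aged process, whose hitting probability is therefore averaged by
    [heat s]. *)
Lemma hit_alive_decomposition S s x : (forall a, a \in S -> 0 <= a.1) -> 0 <= s ->
  (P (hit S tau B s x `&` survives tau s) = (expR (- s))%:E *
   heat s (fun y => aged_probability tau s (hit S (aged_lifetime_rv tau s)
     (aged_motion_rv tau B s) 0%R y)) x)%E.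
Proof.
move=> S0 s0.
set P' := aged_probability tau s.
pose q y := P' (hit S (aged_lifetime_rv tau s) (aged_motion_rv tau B s) 0%R y).
have hA := regular_aged hB s0.
have mq : measurable_fun setT q := measurable_hit_slice hA S 0.
have q0 y : (0 <= q y)%E by [].
pose gA : measurableType _ := g_sigma_algebraType
  (\bigcup_i driving_sigma (aged_lifetime tau s) (aged_motion B s) i).
pose A : set (R * gA) := [set z | hit S (aged_lifetime tau s) (aged_motion B s) 0
  (x + z.1) z.2].
have mA : measurable A.
  apply: (@measurable_hit _ gA R (aged_lifetime tau s) (aged_motion B s) _ _ _ _ S _ _
    (cst 0) (fun z : R * gA => x + z.1) snd).
  - by move=> u; apply/sigma_rvP => C GC; apply: sub_sigma_algebra; exists (inl u).
  - move=> u t t0; apply/sigma_rvP => C GC; apply: sub_sigma_algebra; exists (inr u) => //.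
    by apply: sub_sigma_algebra; exists t => //=; rewrite in_itv /= andbT.
  - by move=> u w; exact: (motion_continuous hA).
  - by move=> u w; exact: (lifetime_gt0 hA).
  - exact: measurable_cst.
  - by apply: measurable_funD => //; exact: measurable_fst.
  - exact: measurable_snd.
have -> : P (hit S tau B s x `&` survives tau s) =
    ((expR (- s))%:E * P' [set w | A (B [::] s w, w)])%E.
  rewrite /P' (aged_probabilityE hB s0) muleCA -EFinM -expRD addNr expR0 mule1.
  congr (P _); apply/seteqP; split=> w [h sw]; split => //.
    exact: (proj1 (@hit_aged _ T R P tau B S s x w S0 s0 sw) h).
  exact: (proj2 (@hit_aged _ T R P tau B S s x w S0 s0 sw) h).
congr (_ * _)%E.
have mid : measurable_fun setT (id : T -> gA).
  move=> _ C sC; rewrite setTI; apply: g_sigma_algebra_sub_measurable sC => D [i _].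
  apply: driving_sigma_measurable => [u|u t _].
    exact: measurable_aged_lifetime.
  exact: measurable_aged_motion.
have mB : measurable_fun [set: T] (B [::] s) by exact: measurable_funPT.
pose f z := (\1_A z)%:E : \bar R.
have mf : measurable_fun [set: R * gA] f by apply/measurable_EFinP; exact: measurable_indic.
have f0 z : (0 <= f z)%E by rewrite lee_fin.
have mD : measurable_fun setT (fun w => (B [::] s w, w : gA)).
  exact: measurable_fun_pair.
transitivity (\int[P']_w f (B [::] s w, w))%E.
  have mA' := mD measurableT _ mA; rewrite setTI in mA'.
  rewrite -[X in P' X]setIT -(integral_indic P' measurableT mA').
  by apply: eq_integral => w _; rewrite /f !indicE.
rewrite (@ge0_integral_indep _ _ _ P' _ _ R gA (B [::] s) id f)//; last first.
  move=> C D mC sD; apply: (aged_indep_past hB s0) => //.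
  by exists C => //; rewrite setTI.
transitivity (\int[P']_w q (x + B [::] s w)%R)%E.
  apply: eq_integral => w _; rewrite /f /q.
  have mAw := measurable_xsection (B [::] s w) mA.
  have mAw' := mid measurableT _ mAw; rewrite setTI in mAw'.
  transitivity (\int[P']_w' (\1_(id @^-1` xsection A (B [::] s w)) w')%:E)%E.
    by apply: eq_integral => w' _; rewrite !indicE /= mem_xsection.
  rewrite (integral_indic P' measurableT mAw') setIT; congr (P' _).
  by rewrite xsectionE.
have [s_0|sn] := eqVneq s 0.
  have Bs0 w : B [::] s w = 0 by rewrite s_0 (motion_start hB).
  under eq_integral do rewrite Bs0 addr0.
  have hs : s <= 0 by rewrite s_0.
  rewrite /heat hs; apply: (etrans (integral_cst P' measurableT _)).
  have PT : P' setT = 1%E by exact: probability_setT.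
  by apply: (etrans (congr1 (mule _) PT)); exact: mule1.
have sp : 0 < s by rewrite lt_def sn.
apply: (@integral_heat _ _ _ P' (B [::] s)) => // C mC.
rewrite (survives_aged_past hB s0); last by exists C => //; rewrite setTI.
rewrite -[s in RHS]subr0 -(motion_increment hB (lexx 0%R) sp mC).
by congr (P _); apply/seteqP; split=> w /=; rewrite (motion_start hB) subr0.
Qed.

(** Inclusion-exclusion over the two subtrees when the root dies before [s], plus the case of
    survival. The product stands on the left so that no extended reals are subtracted. The two
    subtrees and the aged process keep their own probabilities, as no equality in law is proved. *)
Lemma mild_equation S s x : (forall a, a \in S -> 0 <= a.1) -> 0 <= s ->
  let u b r y := P (hit S (subtree tau b) (subtree B b) r y) in
  (P (hit S tau B s x) + branch s (fun r y => u false r y * u true r y) x =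
   (expR (- s))%:E * heat s (fun y => aged_probability tau s (hit S
      (aged_lifetime_rv tau s) (aged_motion_rv tau B s) 0%R y)) x +
   (branch s (u false) x + branch s (u true) x))%E.
Proof.
move=> S0 s0 u.
pose A b := [set w | (tau [::] w <= s)%R /\ hit S (subtree tau b) (subtree B b)
  (s - tau [::] w) (x + B [::] (tau [::] w) w)%R w].
have mH := measurable_hit_event hB S s x.
have msurv := measurable_survives tau s.
have PAb b : P (A b) = branch s (u b) x.
  transitivity (P [set w | (tau [::] w <= s)%R /\ forall c, pred1 b c ->
     hit S (subtree tau c) (subtree B c) (s - tau [::] w)
       (x + B [::] (tau [::] w) w)%R w]).
    congr (P _); apply/seteqP; split=> w [ts h]; split => //.
      by move=> c /eqP ->.
    by apply: h => /=.
  rewrite hit_dead_decomposition; congr (branch s _ x).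
  apply/funext => r; apply/funext => y.
  by case: b => /=; rewrite ?mul1e ?mule1.
have PA2 : P (A false `&` A true) = branch s (fun r y => u false r y * u true r y)%E x.
  transitivity (P [set w | (tau [::] w <= s)%R /\ forall c, xpredT c ->
     hit S (subtree tau c) (subtree B c) (s - tau [::] w)
       (x + B [::] (tau [::] w) w)%R w]).
    congr (P _); apply/seteqP; split=> w.
      by move=> [[ts h] [_ h']]; split=> // -[].
    by move=> [ts h]; split; split => //; exact: h.
  by rewrite hit_dead_decomposition; congr (branch s _ x).
have HA : hit S tau B s x `&` ~` survives tau s = A false `|` A true.
  have key w : tau [::] w <= s -> hit S tau B s x w <-> A false w \/ A true w.
    move=> ts; rewrite (@hit_split _ _ S tau B s x w S0 (fun v => lifetime_gt0 hB v w) s0 ts).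
    split=> [[[] h]|[[_ h]|[_ h]]]; [by right|by left|by exists false|by exists true].
  apply/seteqP; split=> w.
    move=> [h /negP]; rewrite -leNgt => ts; exact/key.
  move=> h; have ts : tau [::] w <= s by case: h => -[].
  by split; [exact/(key w ts)|apply/negP; rewrite -leNgt].
have mA b : measurable (A b).
  have mB : measurable_fun setT (fun w => B [::] (tau [::] w) w).
    apply: (eq_measurable_fun (fun w => B [::] (Num.max (tau [::] w) 0) w)).
      by move=> w _; rewrite max_l// ltW// (lifetime_gt0 hB).
    apply: (@measurable_process_comp _ T _ (B [::]) _ T (tau [::]) id) => //.
    by move=> w; exact: (motion_continuous hB).
  apply: measurableI.
    rewrite -[X in measurable X]setTI.
    have := measurable_fun_ler (measurable_funPT (tau [::])) (measurable_cst s).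
    by move=> /(_ measurableT [set true]); apply.
  have hb := regular_subtree b hB.
  apply: (@measurable_hit _ T R (subtree tau b) (subtree B b) _ _ _ _ S _ _
    (fun w => s - tau [::] w) (fun w => x + B [::] (tau [::] w) w) id) => //.
  - by move=> u' w; exact: (motion_continuous hb).
  - by move=> u' w; exact: (lifetime_gt0 hb).
  - exact: measurable_funB.
  - exact: measurable_funD.
rewrite -(hit_alive_decomposition x S0 s0) -!PAb -PA2.
have -> : P (hit S tau B s x) = (P (hit S tau B s x `&` survives tau s) +
    P (A false `|` A true))%E.
  rewrite -HA -measureU//.
  - by rewrite -setIUr setUv setIT.
  - exact: measurableI.
  - by apply: measurableI => //; exact: measurableC.
  - by rewrite setIACA setICr setI0.
rewrite -addeA; congr (_ + _)%E.
have mI := measurableI _ _ (mA false) (mA true).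
rewrite (measureUfinl (mA false) (mA true)).
  by rewrite subeK//; exact: (fin_num_measure P _ mI).
exact: (le_lt_trans (probability_le1 P (mA false)) (ltry _)).
Qed.

End mild_equation.

(** * Comparison with the linear equation *)

(** For [m = w - d > 0], the bound (1 - a)(1 - b) <= (1 - m)^2 yields a + b - ab >= 2m - m^2 >= (2 -
    e) m, because [m] is at most [a], [b] and [e]. This absorbs the quadratic term into the growth
    rate, [d] being the error of the iteration. *)
Lemma convex_pointwise (R : realDomainType) (e a b d w : R) :
  0 <= e <= 1 -> 0 <= a <= 1 -> 0 <= b <= 1 -> 0 <= d ->
  w <= e -> w <= a + d -> w <= b + d ->
  (2 - e) * w + a * b <= a + b + 2 * d.
Proof.
move=> /andP[e0 e1] /andP[a0 a1] /andP[b0 b1] d0 we wa wb.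
have [wd|wd] := leP w d.
  have : 0 <= a + b - a * b by nra.
  have [w0|w0] := leP 0 w; nra.
set m := w - d.
have m0 : 0 < m by rewrite /m subr_gt0.
have me : m <= e by rewrite /m; lra.
have am : m <= a by rewrite /m; lra.
have bm : m <= b by rewrite /m; lra.
have h1 : (1 - a) * (1 - b) <= (1 - m) * (1 - m).
  by apply: ler_pM; lra.
have h2 : m * m <= e * m by rewrite ler_pM2r.
have -> : w = m + d by rewrite /m subrK.
nra.
Qed.

Lemma convex_pointwise_ereal (R : realType) (e a b d : R) (w1 w2 : \bar R) :
  0 <= e <= 1 -> 0 <= a <= 1 -> 0 <= b <= 1 -> 0 <= d ->
  (0 <= w1)%E -> (0 <= w2)%E ->
  (w1 <= w2 + e%:E)%E -> (w1 <= a%:E + w2 + d%:E)%E -> (w1 <= b%:E + w2 + d%:E)%E ->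
  ((2 - e)%:E * w1 + a%:E * b%:E <= a%:E + b%:E + ((2 - e)%:E * w2 + 2%:E * d%:E))%E.
Proof.
move=> e01 a01 b01 d0; case: w2 => [w2||] //; last first.
  move=> _ _ _ _ _; have -> : ((2 - e)%:E * +oo = +oo :> \bar R)%E.
    by rewrite gt0_muley// lte_fin; case/andP: e01 => *; lra.
  by rewrite -EFinM -EFinD addye//= addey//= leey.
case: w1 => [w1||] //; rewrite -?EFinM -?EFinD ?lee_fin => _ _ h1 h2 h3.
have := @convex_pointwise _ e a b d (w1 - w2) e01 a01 b01 d0.
rewrite mulrBr => /(_ ltac:(lra) ltac:(lra) ltac:(lra)); lra.
Qed.

Lemma le_error (R : realType) (C : R) (a b : \bar R) : 0 <= C ->
  (forall k, (a <= b + C%:E * (2 ^- k)%:E)%E) -> forall e, 0 < e -> (a <= b + e%:E)%E.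
Proof.
move=> C0 h e e0.
have [k kC] : exists k : nat, C * 2 ^- k <= e.
  exists (Num.bound (C / e)); rewrite ler_pdivrMr ?exprn_gt0//.
  have Ce0 : 0 <= C / e by rewrite divr_ge0// ltW.
  rewrite mulrC -ler_pdivrMr//; apply: le_trans (ltW (archi_boundP Ce0)) _.
  by rewrite -natrX ler_nat ltnW// ltn_expl.
by apply: le_trans (h k) _; rewrite leeD2l// -EFinM lee_fin.
Qed.

Lemma le_rearranged (R : realDomainType) (U Q a b E E' : \bar R) : (E <= E')%E ->
  (U + Q + (a + (b + E)) <= U + (a + b) + E' + Q)%E.
Proof. by move=> EE'; rewrite addeAC leeD2r// (addeA a) addeA leeD2l. Qed.

Section comparison.
Context d (T : measurableType d) (R : realType).
Variable S : seq (R * R).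
Hypothesis S0 : forall a, a \in S -> 0 <= a.1.
Local Open Scope ereal_scope.

Let e21 : (2 - 1 = 1 :> R)%R. Proof. lra. Qed.
Let e41 : (4 - 1 = 3 :> R)%R. Proof. lra. Qed.

(** The induction hypothesis is applied to the two subtrees, and the initial bound to the aged
    process under another probability; quantifying over all processes on [T] covers them
    together. *)
Let for_all_bbm (Q : (R -> R -> \bar R) -> Prop) :=
  forall (P : probability T R) (tau : seq bool -> {RV P >-> R})
    (B : seq bool -> R -> {RV P >-> R}), regular_bbm tau B ->
  Q (fun s x => P (hit S tau B s x)).

Let measurable_scaled_heat (c : R) (f : R -> \bar R) :
  measurable_fun setT f -> (forall z, 0 <= f z) ->
  measurable_fun [set: R * R] (fun z => (expR (c * z.1))%:E * heat z.1 f z.2).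
Proof.
move=> mf f0; apply: emeasurable_funM.
  apply/measurable_EFinP; apply: measurableT_comp => //.
  by apply: measurable_funM => //; exact: measurable_fst.
have mk : measurable_fun [set: (R * R) * R] (f \o snd).
  exact: (measurableT_comp mf measurable_snd).
have ms : measurable_fun [set: R * R] (fst : R * R -> R) := measurable_fst.
have mx : measurable_fun [set: R * R] (snd : R * R -> R) := measurable_snd.
by apply: (measurable_heat ms mx mk) => z; exact: f0.
Qed.

Let measurable_scaled_cst (c a : R) :
  measurable_fun [set: R * R] (fun z : R * R => (expR (c * z.1))%:E * a%:E).
Proof.
apply: emeasurable_funM => //; apply/measurable_EFinP; apply: measurableT_comp => //.
by apply: measurable_funM => //; exact: measurable_fst.
Qed.

Let scaled_heat_ge0 (c s x : R) (f : R -> \bar R) : (forall z, 0 <= f z) ->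
  0 <= (expR (c * s))%:E * heat s f x.
Proof. by move=> f0; rewrite mule_ge0// ?heat_ge0// lee_fin expR_ge0. Qed.

Let scaled_cst_ge0 (c s a : R) : (0 <= a)%R -> 0 <= (expR (c * s))%:E * a%:E.
Proof. by move=> a0; rewrite -EFinM lee_fin mulr_ge0// expR_ge0. Qed.

Let sub_exp_ge0 (c s : R) : (0 <= s)%R -> (0 < c)%R ->
  (0 <= (expR ((c - 1) * s) - expR (- s)) / c)%R.
Proof.
move=> s0 c0; rewrite divr_ge0 ?(ltW c0)// subr_ge0 ler_expR.
by rewrite mulrBl mul1r lerDr mulr_ge0// ltW.
Qed.

(** The nonnegative product is dropped from the mild equation, and the inequality is iterated from
    the trivial bound 1. Applying [branch] to [expR (3 * r)] and doubling for the two subtrees costs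
    at most half of [expR (3 * s)], so the error halves in each round. *)
Lemma hit_upper (f : R -> \bar R) : measurable_fun setT f -> (forall z, 0 <= f z) ->
  for_all_bbm (fun u => forall x, u 0%R x <= f x) ->
  for_all_bbm (fun u => forall s x, (0 <= s)%R -> u s x <= (expR s)%:E * heat s f x).
Proof.
move=> mf f0 uf.
have claim k : for_all_bbm (fun u => forall s x, (0 <= s)%R ->
    u s x <= (expR s)%:E * heat s f x + (expR (3 * s))%:E * (2 ^- k)%:E).
  elim: k => [|k IH] P tau B hB s x s0.
    rewrite expr0 invr1 mule1 (le_trans (probability_le1 P _))//.
      exact: (measurable_hit_event hB).
    rewrite (@le_trans _ _ ((expR (3 * s))%:E))//.
      by rewrite lee_fin -expR0 ler_expR mulr_ge0.
    by rewrite leeDr// mule_ge0// ?heat_ge0// lee_fin expR_ge0.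
  have a0 n : (0 <= 2 ^- n :> R)%R by rewrite invr_ge0 exprn_ge0.
  move: s0; rewrite le_eqVlt => /predU1P[<-|s0].
    rewrite expR0 mul1e heat0; apply: (le_trans (uf _ _ _ hB x)).
    by apply: leeDl; rewrite mule_ge0// lee_fin ?expR_ge0.
  have s_ge0 := ltW s0.
  pose q y := aged_probability tau s (hit S (aged_lifetime_rv tau s)
     (aged_motion_rv tau B s) 0%R y).
  have hA := regular_aged hB s_ge0.
  have mq : measurable_fun setT q := measurable_hit_slice hA S 0%R.
  pose u b r y := P (hit S (subtree tau b) (subtree B b) r y).
  have mu b : measurable_fun [set: R * R] (fun z => u b z.1 z.2).
    exact: (measurable_hit_probability (regular_subtree b hB) S).
  (* Exponents in the form [c - 1] of [branch_heat] and [branch_cst]: [c = 2] for the solution,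
     [c = 4] for the error. *)
  have -> : expR s = expR ((2 - 1) * s) by congr expR; lra.
  have -> : expR (3 * s) = expR ((4 - 1) * s) by congr expR; lra.
  pose H := heat s f x.
  have H0 : 0 <= H by exact: heat_ge0.
  have ub b : branch s (u b) x <=
      ((expR ((2 - 1) * s) - expR (- s)) / 2)%:E * H +
      ((expR ((4 - 1) * s) - expR (- s)) / 4)%:E * (2 ^- k)%:E.
    rewrite -(@branch_heat _ s 2%R f x s0 _ f0 mf)//; last first.
      by move=> r q' y r0 q'0; exact: (heat_semigroup hB).
    have h4 : (0 < 4 :> R)%R by [].
    rewrite -(branch_cst x s0 h4 (a0 k)).
    rewrite -branchD; [|by move=> r y; exact: scaled_heat_ge0|
      by move=> r y; exact: scaled_cst_ge0|exact: measurable_scaled_heat|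
      exact: measurable_scaled_cst].
    apply: le_branch => //.
    - by apply: emeasurable_funD; [exact: measurable_scaled_heat|exact: measurable_scaled_cst].
    - move=> r y /andP[r0 _]; rewrite e21 e41 mul1r.
      exact: (IH _ _ _ (regular_subtree b hB) r y r0).
    - by move=> r y; rewrite adde_ge0// ?scaled_heat_ge0// ?scaled_cst_ge0.
  have mild : P (hit S tau B s x) + branch s (fun r y => u false r y * u true r y) x =
    (expR (- s))%:E * heat s q x + (branch s (u false) x + branch s (u true) x).
    exact: (mild_equation hB x S0 s_ge0).
  have uu0 : 0 <= branch s (fun r y => u false r y * u true r y) x.
    by apply: branch_ge0 => r y; rewrite mule_ge0.
  apply: (le_trans (leeDl _ uu0)); rewrite mild.
  have hq : heat s q x <= H by apply: le_heat => // z; exact: uf.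
  set al := ((expR ((2 - 1) * s) - expR (- s)) / 2)%R in ub.
  set be := ((expR ((4 - 1) * s) - expR (- s)) / 4)%R in ub.
  have al0 : (0 <= al)%R by exact: sub_exp_ge0.
  have be0 : (0 <= be)%R by exact: sub_exp_ge0.
  apply: (@le_trans _ _ ((expR (- s))%:E * H + ((al%:E * H + be%:E * (2 ^- k)%:E) +
     (al%:E * H + be%:E * (2 ^- k)%:E)))).
    by apply: leeD; [rewrite lee_wpmul2l// lee_fin expR_ge0|apply: leeD; exact: ub].
  rewrite addeACA -ge0_muleDl// ?lee_fin// -EFinM -!EFinD addeA -ge0_muleDl//;
    rewrite ?lee_fin ?expR_ge0 ?addr_ge0//.
  apply: leeD.
    by rewrite lee_wpmul2r// -EFinD lee_fin /al; lra.
  rewrite lee_fin exprS invfM.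
  have := expR_ge0 (- s); have := a0 k; rewrite /be; nra.
move=> P tau B hB s x s0; apply/lee_addgt0Pr => e e0.
apply: (@le_error _ _ _ _ (expR_ge0 (3 * s)) _ _ e0) => k; exact: claim.
Qed.

(* While the linear solution is below [eta], the term [- u^2] of the KPP equation is at
   least [- eta u] and can be absorbed into the growth rate [1 - eta]. *)
Lemma hit_lower (eta s0 : R) (f1 f2 : R -> \bar R) : (0 <= eta <= 1)%R ->
  measurable_fun setT f1 -> (forall z, 0 <= f1 z) ->
  measurable_fun setT f2 -> (forall z, 0 <= f2 z) ->
  (forall r x, (0 <= r <= s0)%R -> (expR ((1 - eta) * r))%:E * heat r f1 x <=
     (expR ((1 - eta) * r))%:E * heat r f2 x + eta%:E) ->
  for_all_bbm (fun u => forall x, f1 x <= u 0%R x + f2 x) ->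
  for_all_bbm (fun u => forall s x, (0 <= s <= s0)%R ->
    (expR ((1 - eta) * s))%:E * heat s f1 x <=
    u s x + (expR ((1 - eta) * s))%:E * heat s f2 x).
Proof.
move=> eta01 mf1 f10 mf2 f20 W12 uf.
have claim k : for_all_bbm (fun u => forall s x, (0 <= s <= s0)%R ->
    (expR ((1 - eta) * s))%:E * heat s f1 x <=
    u s x + (expR ((1 - eta) * s))%:E * heat s f2 x + (expR (3 * s))%:E * (2 ^- k)%:E).
  have a0 n : (0 <= 2 ^- n :> R)%R by rewrite invr_ge0 exprn_ge0.
  elim: k => [|k IH] P tau B hB s x /andP[s0' ss0].
    have ss : (0 <= s <= s0)%R by rewrite s0' ss0.
    rewrite (le_trans (W12 s x ss))// [P _ + _]addeC -addeA leeD2l//.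
    rewrite expr0 invr1 mule1 (le_trans _ (leeDr _ _))//.
    rewrite lee_fin (@le_trans _ _ 1%R)//; first by case/andP: eta01.
    by rewrite -expR0 ler_expR mulr_ge0.
  move: s0'; rewrite le_eqVlt => /predU1P[<-|sp].
    rewrite !mulr0 !expR0 !mul1e !heat0; apply: (le_trans (uf _ _ _ hB x)).
    by apply: leeDl; rewrite lee_fin.
  have s_ge0 := ltW sp.
  pose q y := aged_probability tau s (hit S (aged_lifetime_rv tau s)
     (aged_motion_rv tau B s) 0%R y).
  have hA := regular_aged hB s_ge0.
  have mq : measurable_fun setT q := measurable_hit_slice hA S 0%R.
  pose u b r y := P (hit S (subtree tau b) (subtree B b) r y).
  have mu b : measurable_fun [set: R * R] (fun z => u b z.1 z.2).
    exact: (measurable_hit_probability (regular_subtree b hB) S).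
  have u0 b r y : 0 <= u b r y by [].
  have uE b r y : u b r y = (fine (u b r y))%:E.
    rewrite fineK//; apply: (fin_num_measure P).
    exact: (measurable_hit_event (regular_subtree b hB)).
  have u01 b r y : (0 <= fine (u b r y) <= 1)%R.
    rewrite -!lee_fin -uE u0/=; apply: (probability_le1 P).
    exact: (measurable_hit_event (regular_subtree b hB)).
  pose c := (2 - eta)%R.
  have c0 : (0 < c)%R by rewrite /c; case/andP: eta01 => *; lra.
  have cE : (1 - eta = c - 1)%R by rewrite /c; lra.
  have c0E : (0 <= c)%R by exact: ltW.
  pose W f (r y : R) := (expR ((c - 1) * r))%:E * heat r f y.
  pose D (r _ : R) := (expR ((4 - 1) * r))%:E * (2 ^- k)%:E : \bar R.
  have W0 f (f0 : forall z, 0 <= f z) r y : 0 <= W f r y by exact: scaled_heat_ge0.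
  have D0 r y : 0 <= D r y by exact: scaled_cst_ge0.
  have mW f (f0 : forall z, 0 <= f z) : measurable_fun setT f ->
      measurable_fun [set: R * R] (fun z => W f z.1 z.2).
    by move=> mf; exact: measurable_scaled_heat.
  have mD : measurable_fun [set: R * R] (fun z => D z.1 z.2) by exact: measurable_scaled_cst.
  pose be := ((expR ((c - 1) * s) - expR (- s)) / c)%R.
  have branchW f : (forall z, 0 <= f z) -> measurable_fun setT f ->
      branch s (W f) x = be%:E * heat s f x.
    move=> f0 mf; apply: branch_heat => // r q' y r0 q'0.
    exact: (heat_semigroup hB).
  have branchD' : branch s D x = ((expR ((4 - 1) * s) - expR (- s)) / 4)%:E * (2 ^- k)%:E.
    exact: branch_cst.
  have cW0 f (f0 : forall z, 0 <= f z) r y : 0 <= c%:E * W f r y.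
    by rewrite mule_ge0// ?lee_fin// W0.
  have mcW f (f0 : forall z, 0 <= f z) : measurable_fun setT f ->
      measurable_fun [set: R * R] (fun z => c%:E * W f z.1 z.2).
    by move=> mf; apply: emeasurable_funM => //; exact: mW.
  have uu0 r y : 0 <= u false r y * u true r y by rewrite mule_ge0.
  have muu : measurable_fun [set: R * R] (fun z => u false z.1 z.2 * u true z.1 z.2).
    exact: emeasurable_funM.
  have D20 r y : 0 <= 2%:E * D r y by rewrite mule_ge0.
  have mD2 : measurable_fun [set: R * R] (fun z => 2%:E * D z.1 z.2).
    exact: emeasurable_funM.
  (* The pointwise convexity inequality, integrated over the time and place of branching; the signed
     solution [W f1 - W f2] is distributed over the two sides. *)
  have key : branch s (fun r y => c%:E * W f1 r y + u false r y * u true r y) x <=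
      branch s (fun r y => u false r y + u true r y + (c%:E * W f2 r y + 2%:E * D r y)) x.
    apply: le_branch.
    - by move=> r y; apply: adde_ge0; [exact: cW0|exact: uu0].
    - by apply: emeasurable_funD => //; exact: mcW.
    - apply: emeasurable_funD; first exact: emeasurable_funD.
      by apply: emeasurable_funD => //; exact: mcW.
    - move=> r y /andP[r0 rs]; rewrite (uE false) (uE true).
      have r01 : (0 <= r <= s0)%R by rewrite r0 (le_trans rs).
      have IHb b := IH _ _ _ (regular_subtree b hB) r y r01.
      apply: convex_pointwise_ereal => //.
      + exact: W0.
      + exact: W0.
      + by rewrite /W -cE; exact: W12.
      + by rewrite -uE /W -cE EFinM e41; exact: (IHb false).
      + by rewrite -uE /W -cE EFinM e41; exact: (IHb true).
    - by move=> r y; apply: adde_ge0; apply: adde_ge0; [exact: u0|exact: u0|exact: cW0|exact: D20].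
  rewrite branchD// in key; [|exact: cW0|exact: mcW].
  rewrite branchZ// in key; [|exact: W0|exact: mW].
  rewrite (@branchD _ s (fun r y => u false r y + u true r y)
    (fun r y => c%:E * W f2 r y + 2%:E * D r y)) in key; first last.
  - by apply: emeasurable_funD => //; exact: mcW.
  - exact: emeasurable_funD.
  - by move=> r y; rewrite adde_ge0//; exact: cW0.
  - by move=> r y; rewrite adde_ge0.
  rewrite (@branchD _ s (u false) (u true))// in key.
  rewrite (@branchD _ s (fun r y => c%:E * W f2 r y) (fun r y => 2%:E * D r y))// in key;
    [|exact: cW0|exact: mcW].
  rewrite branchZ// in key; [|exact: W0|exact: mW].
  rewrite branchZ// branchD' !branchW// in key.
  have mild : P (hit S tau B s x) + branch s (fun r y => u false r y * u true r y) x =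
    (expR (- s))%:E * heat s q x + (branch s (u false) x + branch s (u true) x).
    exact: (mild_equation hB x S0 s_ge0).
  set Q := branch s (fun r y => u false r y * u true r y) x in key mild.
  (* The product term must be cancelled on both sides, so its finiteness is needed: it is at most
     the [branch] of 1. *)
  have Qfin : Q \is a fin_num.
    have Q0 : 0 <= Q by exact: branch_ge0.
    rewrite ge0_fin_numE//.
    have : Q <= branch s (fun r _ : R => (expR ((1 - 1) * r))%:E * 1%:E) x.
      apply: le_branch => //.
      move=> r y _; rewrite subrr mul0r expR0 mule1.
      rewrite (uE false) (uE true) -EFinM lee_fin.
      by case/andP: (u01 false r y) => *; case/andP: (u01 true r y) => *; exact: mulr_ile1.
    by rewrite branch_cst// => /le_lt_trans; apply; rewrite -EFinM ltry.
  pose H1 := heat s f1 x; pose H2 := heat s f2 x.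
  have H10 : 0 <= H1 by exact: heat_ge0.
  have H20 : 0 <= H2 by exact: heat_ge0.
  have q0 z : 0 <= q z by [].
  have Hq0 : 0 <= heat s q x by exact: heat_ge0.
  have be0 : (0 <= be)%R by exact: sub_exp_ge0.
  have e0 : (0 <= expR (- s))%R by exact: expR_ge0.
  have eE : expR ((1 - eta) * s) = (expR (- s) + c * be)%R.
    by rewrite cE /be [(c * _)%R]mulrC divfK ?gt_eqF//; lra.
  have Hle : (expR (- s))%:E * H1 <= (expR (- s))%:E * (heat s q x + H2).
    rewrite lee_wpmul2l ?lee_fin// -heatD//; apply: le_heat => //.
      exact: emeasurable_funD.
    by move=> z; exact: uf.
  rewrite -/H1 -/H2 eE EFinD EFinM.
  have cb0 : 0 <= c%:E * be%:E by rewrite -EFinM lee_fin mulr_ge0.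
  rewrite !ge0_muleDl// -!muleA.
  set b1 := branch s (u false) x in key mild; set b2 := branch s (u true) x in key mild.
  set E := 2%:E * _ in key.
  have Ele : E <= (expR (3 * s))%:E * (2 ^- k.+1)%:E.
    rewrite /E -!EFinM lee_fin exprS invfM e41.
    by have := expR_ge0 (- s); have := a0 k; nra.
  rewrite -(leeD2rE _ _ Qfin).
  apply: (le_trans (leeD (leeD Hle (lexx _)) (lexx _))).
  rewrite -addeA; apply: (le_trans (leeD (lexx _) key)).
  rewrite ge0_muleDr//.
  have -> : (expR (- s))%:E * heat s q x + (expR (- s))%:E * H2 +
      (b1 + b2 + (c%:E * (be%:E * H2) + E)) =
      ((expR (- s))%:E * heat s q x + (b1 + b2)) +
      ((expR (- s))%:E * H2 + (c%:E * (be%:E * H2) + E)).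
    by rewrite addeACA.
  by rewrite -mild; exact: le_rearranged.
move=> P tau B hB s x s0'; apply/lee_addgt0Pr => e e0.
apply: (@le_error _ _ _ _ (expR_ge0 (3 * s)) _ _ e0) => k; exact: claim.
Qed.

End comparison.

(** * Exponential tilt and the frame of the critical line *)

Section tilt.
Context (R : realType).
Local Notation mu := (@lebesgue_measure R).

Lemma gauss_tilt (c s z x : R) : 0 < s ->
  gauss s (z - x) * expR (c * z) =
  expR (c * x + c ^+ 2 * s / 2) * gauss s (z - (x + c * s)).
Proof.
move=> s0; rewrite /gauss -[LHS]mulrA [RHS]mulrCA -!expRD; congr (_ * expR _).
by field; rewrite gt_eqF.
Qed.

(** The Cameron-Martin shift: completing the square trades the weight [expR (c * z)] for a drift
    [c * s] and a normalization. *)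
Lemma heat_tilt (c s x : R) (f : R -> \bar R) : 0 <= s ->
  measurable_fun setT f -> (forall z, 0 <= f z)%E ->
  heat s (fun z => (expR (c * z))%:E * f z)%E x =
  ((expR (c * x + c ^+ 2 * s / 2))%:E * heat s f (x + c * s))%E.
Proof.
rewrite le_eqVlt => /predU1P[<-|s0] mf f0.
  by rewrite !heat0 !mulr0 mul0r !addr0.
rewrite !heatE//.
have m : measurable_fun [set: R] (fun z => (gauss s (z - (x + c * s)))%:E * f z)%E.
  apply: emeasurable_funM => //; apply/measurable_EFinP.
  by apply: measurable_gauss => //; exact: measurable_funB.
have k0 z : (0 <= (gauss s (z - (x + c * s)))%:E * f z)%E.
  by rewrite mule_ge0// lee_fin gauss_ge0.
have e0 : (0 <= (expR (c * x + c ^+ 2 * s / 2))%:E)%E by rewrite lee_fin expR_ge0.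
apply: (etrans _ (@ge0_integralZl _ _ _ mu setT measurableT _ m _ (fun z _ => k0 z) e0)).
by apply: eq_integral => z _; rewrite !muleA -!EFinM gauss_tilt.
Qed.

End tilt.

Section bounded_heat.
Context (R : realType).
Implicit Types (s r x y l k : R) (F G : R -> R).

(** On this class the heat flow is finite, so that differences of flows, in particular the killed
    flow, can be formed in [R]. *)
Definition bounded_ge0 F : Prop :=
  measurable_fun setT F /\ exists K, forall y, 0 <= F y <= K.

Fact gs_key : unit. Proof. exact: tt. Qed.

(* Locked, because conversion would otherwise unfold the integral inside. *)
Definition gs : R -> (R -> R) -> R -> R :=
  locked_with gs_key (fun s F y => fine (heat s (EFin \o F) y)).

Lemma gs_unlock s F y : gs s F y = fine (heat s (EFin \o F) y).
Proof. by rewrite /gs unlock. Qed.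

Lemma bounded_ge0_measurable F : bounded_ge0 F -> measurable_fun setT (EFin \o F).
Proof. by move=> [mF _]; exact/measurable_EFinP. Qed.

Lemma bounded_ge0_ge0 F y : bounded_ge0 F -> (0 <= (EFin \o F) y)%E.
Proof. by move=> [_ [K h]]; rewrite lee_fin; have /andP[] := h y. Qed.

Lemma gsE s F y : bounded_ge0 F -> heat s (EFin \o F) y = (gs s F y)%:E.
Proof.
move=> bF; have [mF [K h]] := bF; rewrite gs_unlock fineK// ge0_fin_numE; last first.
  by apply: heat_ge0 => z; exact: bounded_ge0_ge0.
have K0 : 0 <= K by have /andP[] := h 0; exact: le_trans.
apply: (@le_lt_trans _ _ (heat s (cst K%:E) y)); last by rewrite heat_cst// ltry.
apply: le_heat => [|//|z|z].
- exact: bounded_ge0_measurable.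
- exact: bounded_ge0_ge0.
- by rewrite lee_fin; have /andP[] := h z.
Qed.

Lemma gs0 F y : gs 0 F y = F y. Proof. by rewrite gs_unlock heat0. Qed.

Lemma gs_ge0 s F y : bounded_ge0 F -> 0 <= gs s F y.
Proof.
by move=> bF; rewrite gs_unlock fine_ge0// heat_ge0// => z; exact: bounded_ge0_ge0.
Qed.

Lemma le_gs s F G y : bounded_ge0 F -> bounded_ge0 G -> (forall z, F z <= G z) ->
  gs s F y <= gs s G y.
Proof.
move=> bF bG FG; rewrite -lee_fin -!gsE//; apply: le_heat => [||z|z].
- exact: bounded_ge0_measurable.
- exact: bounded_ge0_measurable.
- exact: bounded_ge0_ge0.
- by rewrite lee_fin.
Qed.

Lemma bounded_ge0D F G : bounded_ge0 F -> bounded_ge0 G ->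
  bounded_ge0 (fun z => F z + G z).
Proof.
move=> [mF [K hF]] [mG [L hG]]; split; first exact: measurable_funD.
exists (K + L) => y; have /andP[? ?] := hF y; have /andP[? ?] := hG y.
by rewrite addr_ge0// lerD.
Qed.

Lemma bounded_ge0Z k F : 0 <= k -> bounded_ge0 F -> bounded_ge0 (fun z => k * F z).
Proof.
move=> k0 [mF [K hF]]; split; first exact: measurable_funM.
exists (k * K) => y; have /andP[? ?] := hF y.
by rewrite mulr_ge0// ler_wpM2l.
Qed.

Lemma bounded_ge0_cst k : 0 <= k -> bounded_ge0 (cst k).
Proof. by move=> k0; split; [exact: measurable_cst|exists k => y; rewrite k0 /=]. Qed.

Lemma bounded_ge0_indic (A : set R) : measurable A -> bounded_ge0 \1_A.
Proof.
move=> mA; split; first exact: measurable_indic.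
by exists 1 => y; rewrite indicE; case: (_ \in _); rewrite ?lexx ler01.
Qed.

Lemma bounded_ge0_refl l F : bounded_ge0 F -> bounded_ge0 (fun z => F (l - z)).
Proof.
move=> [mF [K hF]]; split; last by exists K => y.
by apply: measurableT_comp => //; exact: measurable_funB.
Qed.

Lemma bounded_ge0_gs s F : bounded_ge0 F -> bounded_ge0 (gs s F).
Proof.
move=> bF; have [mF [K h]] := bF; split.
  have mk : measurable_fun [set: R * R] ((EFin \o F) \o snd).
    by apply: (measurableT_comp _ measurable_snd); exact: bounded_ge0_measurable.
  have := @measurable_heat R _ R (cst s) id ((EFin \o F) \o snd)
    (measurable_cst _) (@measurable_id _ _ _) mk (fun z => bounded_ge0_ge0 z.2 bF).
  move=> mh; apply: eq_measurable_fun (measurableT_comp (fine_measurable measurableT) mh) => z _.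
  by rewrite gs_unlock.
have K0 : 0 <= K by have /andP[] := h 0; exact: le_trans.
exists K => y; rewrite gs_ge0//=.
have -> : K = gs s (cst K) y by rewrite gs_unlock (heat_cst s y K0).
by apply: le_gs => //; [exact: bounded_ge0_cst|move=> z; have /andP[] := h z].
Qed.

Lemma gsD s F G y : bounded_ge0 F -> bounded_ge0 G ->
  gs s (fun z => F z + G z) y = gs s F y + gs s G y.
Proof.
move=> bF bG; apply: EFin_inj; rewrite EFinD -!gsE//; last exact: bounded_ge0D.
rewrite -heatD//; [exact: bounded_ge0_measurable|exact: bounded_ge0_measurable| |].
- by move=> z; exact: bounded_ge0_ge0.
- by move=> z; exact: bounded_ge0_ge0.
Qed.

Lemma gsZ s k F y : 0 <= k -> bounded_ge0 F ->
  gs s (fun z => k * F z) y = k * gs s F y.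
Proof.
move=> k0 bF; apply: EFin_inj; rewrite EFinM -!gsE//; last exact: bounded_ge0Z.
rewrite -heatZ//; first exact: bounded_ge0_measurable.
by move=> z; exact: bounded_ge0_ge0.
Qed.

Lemma gs_cst s k y : 0 <= k -> gs s (cst k) y = k.
Proof. by move=> k0; rewrite gs_unlock (heat_cst s y k0). Qed.

Lemma gs_refl s l F y : bounded_ge0 F -> gs s (fun z => F (l - z)) y = gs s F (l - y).
Proof.
move=> bF; apply: EFin_inj; rewrite -!gsE//; last exact: bounded_ge0_refl.
have bFl : bounded_ge0 (fun z => F (l + z)).
  have := bounded_ge0_refl 0 (bounded_ge0_refl l bF).
  by congr bounded_ge0; apply/funext => z /=; rewrite sub0r opprK.
rewrite -(@heat_translation _ s l (EFin \o F)); last 2 first.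
- exact: bounded_ge0_measurable.
- by move=> z; exact: bounded_ge0_ge0.
rewrite -(@heat_opp _ s (EFin \o (fun z => F (l + z))))//.
- exact: bounded_ge0_measurable.
- by move=> z; exact: bounded_ge0_ge0.
Qed.

Lemma gs_tilt c s F x : 0 <= s -> bounded_ge0 F ->
  heat s (fun z => (expR (c * z) * F (- z))%:E) x =
  (expR (c * x + c ^+ 2 * s / 2) * gs s F (- x - c * s))%:E.
Proof.
move=> s0 bF; have bF' := bounded_ge0_refl 0 bF.
have -> : (fun z => (expR (c * z) * F (- z))%:E) =
    (fun z => (expR (c * z))%:E * (EFin \o (fun z : R => F (0 - z)%R)) z)%E.
  by apply/funext => z /=; rewrite EFinM sub0r.
rewrite heat_tilt//.
- rewrite (gsE s _ bF') -EFinM (gs_refl s 0 _ bF) sub0r opprD; by [].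
- exact: bounded_ge0_measurable.
- by move=> z; exact: bounded_ge0_ge0.
Qed.

End bounded_heat.

Section tilted_comparison.
Context d (T : measurableType d) (R : realType).
Variable S : seq (R * R).
Hypothesis S0 : forall a, a \in S -> 0 <= a.1.

(** Uniformity over all processes on [T] lets such a bound serve as the initial datum of a further
    evolution. *)
Definition hit_le_always s x (p : R) : Prop :=
  forall (P : probability T R) (tau : seq bool -> {RV P >-> R})
    (B : seq bool -> R -> {RV P >-> R}), regular_bbm tau B ->
  (P (hit S tau B s x) <= p%:E)%E.

Definition hit_ge_always s x (p : R) : Prop :=
  forall (P : probability T R) (tau : seq bool -> {RV P >-> R})
    (B : seq bool -> R -> {RV P >-> R}), regular_bbm tau B ->
  (p%:E <= P (hit S tau B s x))%E.

Variable c : R.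
Hypothesis c2 : c ^+ 2 = 2.

Let tilted F := (fun z => (expR (c * z) * F (- z))%:E : \bar R).

Let measurable_tilted F : bounded_ge0 F -> measurable_fun setT (tilted F).
Proof.
move=> bF; apply/measurable_EFinP; apply: measurable_funM.
  by apply: measurableT_comp => //; exact: measurable_funM.
have [mF _] := bounded_ge0_refl 0 bF; apply: eq_measurable_fun mF => z _.
by rewrite sub0r.
Qed.

Let tilted_ge0 F : bounded_ge0 F -> forall z, (0 <= tilted F z)%E.
Proof.
move=> [_ [K h]] z; rewrite lee_fin mulr_ge0 ?expR_ge0//.
by have /andP[] := h (- z).
Qed.

(** From [- (c * s) - y] a motion of speed [c] ends at [- y], so [y] is the depth under the critical
    line. Since [c^2 = 2], the tilt contributes [expR (- s)], which exactly cancels the branching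
    growth [expR s]. *)
Let heat_tilted (s y : R) F : 0 <= s -> bounded_ge0 F ->
  heat s (tilted F) (- (c * s) - y) = (expR (- s - c * y) * gs s F y)%:E.
Proof.
move=> s0 bF; rewrite /tilted (gs_tilt c _ s0 bF) c2.
have -> : - (- (c * s) - y) - c * s = y by lra.
have -> : c * (- (c * s) - y) + 2 * s / 2 = - s - c * y.
  by rewrite mulrBr mulrN mulrA -expr2 c2; lra.
by [].
Qed.

Lemma tilted_upper F s y : bounded_ge0 F -> 0 <= s ->
  (forall y, hit_le_always 0 (- y) (expR (- (c * y)) * F y)) ->
  hit_le_always s (- (c * s) - y) (expR (- (c * y)) * gs s F y).
Proof.
move=> bF s0 h P tau B hB.
have := @hit_upper _ T R S S0 _ (measurable_tilted bF) (tilted_ge0 bF) _ _ _ _ hB s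
  (- (c * s) - y) s0.
rewrite heat_tilted// -EFinM mulrA -expRD addrA addrN add0r; apply.
move=> P' tau' B' hB' x; have := h (- x) _ _ _ hB'.
by rewrite /tilted mulrN !opprK.
Qed.

(** In the applications [F2] is the reflection of [F1] in the barrier, and the difference of the two
    flows is the killed flow. The growth rate [1 - eta] of [hit_lower] leaves the damping
    [expR (- (eta * s))] once the tilt has cancelled the rate 1. *)
Lemma tilted_lower (eta s0 : R) F1 F2 : 0 <= eta <= 1 ->
  bounded_ge0 F1 -> bounded_ge0 F2 ->
  (forall r y, 0 <= r <= s0 -> expR (- (c * y)) * (gs r F1 y - gs r F2 y) <= eta) ->
  (forall y, hit_ge_always 0 (- y) (expR (- (c * y)) * (F1 y - F2 y))) ->
  forall s y, 0 <= s <= s0 ->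
  hit_ge_always s (- (c * s) - y)
    (expR (- (eta * s)) * (expR (- (c * y)) * (gs s F1 y - gs s F2 y))).
Proof.
move=> eta01 bF1 bF2 W12 h s y s01 P tau B hB; have /andP[s_ge0 _] := s01.
have WE r F x : 0 <= r -> bounded_ge0 F ->
  ((expR ((1 - eta) * r))%:E * heat r (tilted F) x =
   (expR (- (eta * r)) * (expR (- (c * (- x - c * r))) * gs r F (- x - c * r)))%:E)%E.
  move=> r0 bF; have [y' ->] : exists y', x = - (c * r) - y'.
    by exists (- x - c * r); lra.
  have -> : - (- (c * r) - y') - c * r = y' by lra.
  rewrite heat_tilted// -EFinM !mulrA -!expRD.
  by have -> : (1 - eta) * r + (- r - c * y') = - (eta * r) - c * y' by lra.
have := @hit_lower _ T R S S0 eta s0 _ _ eta01 (measurable_tilted bF1) (tilted_ge0 bF1)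
  (measurable_tilted bF2) (tilted_ge0 bF2) _ _ _ _ _ hB s (- (c * s) - y) s01.
rewrite !WE//; have -> : - (- (c * s) - y) - c * s = y by lra.
move=> H; have : (forall r x : R, (0 <= r <= s0)%R ->
     (expR ((1 - eta) * r))%:E * heat r (tilted F1) x <=
     (expR ((1 - eta) * r))%:E * heat r (tilted F2) x + eta%:E)%E.
  move=> r x r01; have /andP[r0 _] := r01; rewrite !WE// -EFinD lee_fin.
  have := W12 r (- x - c * r) r01.
  set A := gs r F1 _; set A' := gs r F2 _; set E := expR (- (c * _)).
  have := expR_ge0 (- (eta * r)).
  have : expR (- (eta * r)) <= 1.
    by rewrite -expR0 ler_expR oppr_le0 mulr_ge0//; case/andP: eta01.
  set e := expR _ => e1 e0 hE.
  case/andP: eta01 => eta0 _.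
  have : e * (E * (A - A')) <= eta.
    have [Ep|En] := leP 0 (E * (A - A')); last by nra.
    by apply: le_trans hE; rewrite ler_piMl.
  lra.
move=> /H {}H.
have : (forall (P0 : probability T R) (tau0 : seq bool -> {RV P0 >-> R})
    (B0 : seq bool -> R -> {RV P0 >-> R}), regular_bbm tau0 B0 -> forall x : R,
    tilted F1 x <= P0 (hit S tau0 B0 0 x) + tilted F2 x)%E.
  move=> P' tau' B' hB' x; have := h (- x) _ _ _ hB'.
  rewrite /tilted mulrN !opprK mulrBr EFinB leeBlDr//.
move=> /H; rewrite -leeBlDr// -EFinB.
by rewrite [in X in _ -> X]mulrBr [in X in _ -> X]mulrBr.
Qed.

End tilted_comparison.

(** * Killed heat kernels *)

Section window.
Context (R : realType).
Implicit Types (s t y z a b l : R) (F : R -> R).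
Local Notation mu := (@lebesgue_measure R).

Definition window a b : R -> R := \1_(`[a, b]%classic).

Lemma windowE a b z : window a b z = ((a <= z <= b)%R)%:R.
Proof.
rewrite /window indicE; case: (boolP (a <= z <= b)) => h.
  by rewrite mem_set//= in_itv.
by rewrite memNset//= in_itv /=; apply/negP.
Qed.

Lemma bounded_ge0_window a b : bounded_ge0 (window a b).
Proof. exact: bounded_ge0_indic. Qed.

Let measurable_kernelF t y F : 0 < t -> bounded_ge0 F ->
  measurable_fun [set: R] (fun z => (gauss t (z - y) * F z)%:E).
Proof.
move=> t0 [mF _]; apply/measurable_EFinP; apply: measurable_funM => //.
by apply: measurable_gauss => //; exact: measurable_funB.
Qed.

Lemma gs_integral t y F : 0 < t -> bounded_ge0 F ->
  (gs t F y)%:E = (\int[mu]_z (gauss t (z - y) * F z)%:E)%E.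
Proof.
by move=> t0 bF; rewrite -gsE// heatE//; apply: eq_integral => z _; rewrite EFinM.
Qed.

Lemma le_gs_kernel t k F y y' : 0 < t -> bounded_ge0 F -> 0 <= k ->
  (forall z, F z != 0 -> gauss t (z - y) <= k * gauss t (z - y')) ->
  gs t F y <= k * gs t F y'.
Proof.
move=> t0 bF k0 h; rewrite -gsZ// -lee_fin !gs_integral//; last exact: bounded_ge0Z.
have [_ [K hK]] := bF.
have F0 z : 0 <= F z by have /andP[] := hK z.
have m1 := measurable_kernelF y t0 bF.
have m2 := measurable_kernelF y' t0 (bounded_ge0Z k0 bF).
apply: (@ge0_le_integral _ _ _ mu setT measurableT _ _ _ m1 m2) => z _.
  by rewrite lee_fin mulr_ge0// gauss_ge0.
rewrite lee_fin mulrA (mulrC _ k); have [->|Fz] := eqVneq (F z) 0; first by rewrite !mulr0.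
by rewrite ler_wpM2r// h.
Qed.

Lemma integral_window a b m : a <= b -> 0 <= m ->
  (\int[mu]_z (m * window a b z)%:E = (m * (b - a))%:E)%E.
Proof.
move=> ab m0.
have mw : measurable_fun [set: R] (fun z => (window a b z)%:E).
  exact: (bounded_ge0_measurable (bounded_ge0_window a b)).
have w0 z : [set: R] z -> (0 <= (window a b z)%:E)%E.
  by move=> _; rewrite lee_fin windowE.
have m0E : (0 <= m%:E)%E by rewrite lee_fin.
transitivity (\int[mu]_z (m%:E * (window a b z)%:E))%E.
  by apply: eq_integral => z _; rewrite EFinM.
apply: (etrans (@ge0_integralZl _ _ _ mu setT measurableT _ mw _ w0 m0E)).
rewrite EFinM; congr (_ * _)%E.
have mi : measurable (`[a, b]%classic : set R) by [].
apply: (etrans (@integral_indic _ _ _ mu setT measurableT `[a, b]%classic mi)).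
apply: (etrans (congr1 mu (setIT _))).
rewrite lebesgue_measure_itv/= lte_fin -EFinB; case: ltP => // ba.
have ba' : b = a by lra.
by rewrite ba' subrr.
Qed.

Lemma gs_window_upper t a b y y' m : 0 < t -> a <= b -> 0 <= m ->
  (forall z, a <= z <= b -> gauss t (z - y) <= gauss t (z - y') + m) ->
  gs t (window a b) y <= gs t (window a b) y' + m * (b - a).
Proof.
move=> t0 ab m0 h; rewrite -lee_fin EFinD !gs_integral//; [|exact: bounded_ge0_window..].
rewrite -integral_window//.
have m1 := measurable_kernelF y t0 (bounded_ge0_window a b).
have m2 := measurable_kernelF y' t0 (bounded_ge0_window a b).
have m3 : measurable_fun [set: R] (fun z => (m * window a b z)%:E).
  exact: (bounded_ge0_measurable (bounded_ge0Z m0 (bounded_ge0_window a b))).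
have w0 z : 0 <= window a b z by rewrite windowE.
have p2 z : [set: R] z -> (0 <= (gauss t (z - y') * window a b z)%:E)%E.
  by move=> _; rewrite lee_fin mulr_ge0// gauss_ge0.
have p3 z : [set: R] z -> (0 <= (m * window a b z)%:E)%E.
  by move=> _; rewrite lee_fin mulr_ge0.
have E := @ge0_integralD _ _ _ mu setT measurableT _ _ p2 m2 p3 m3.
rewrite [leRHS](_ : _ = \int[mu]_z ((gauss t (z - y') * window a b z)%:E +
  (m * window a b z)%:E))%E; last exact: (esym E).
have m23 := emeasurable_funD m2 m3.
apply: (@ge0_le_integral _ _ _ mu setT measurableT _ _ _ m1 m23) => z _.
  by rewrite lee_fin mulr_ge0// gauss_ge0.
rewrite -EFinD lee_fin -mulrDl windowE; case: (boolP (a <= z <= b)) => [zab|_];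
  last by rewrite !mulr0.
by rewrite !mulr1 h.
Qed.

Lemma gs_window_lower t k a b y y' m : 0 < t -> a <= b -> 0 <= m -> 0 <= k ->
  (forall z, a <= z <= b -> k * gauss t (z - y') + m <= gauss t (z - y)) ->
  k * gs t (window a b) y' + m * (b - a) <= gs t (window a b) y.
Proof.
move=> t0 ab m0 k0 h; have bw := bounded_ge0_window a b; have bkw := bounded_ge0Z k0 bw.
rewrite -gsZ// -lee_fin EFinD (gs_integral _ t0 bw) (gs_integral _ t0 bkw).
rewrite -integral_window//.
have m1 := measurable_kernelF y t0 bw.
have m2 := measurable_kernelF y' t0 bkw.
have m3 : measurable_fun [set: R] (fun z => (m * window a b z)%:E).
  exact: (bounded_ge0_measurable (bounded_ge0Z m0 bw)).
have w0 z : 0 <= window a b z by rewrite windowE.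
have p2 z : [set: R] z -> (0 <= (gauss t (z - y') * (k * window a b z))%:E)%E.
  by move=> _; rewrite lee_fin mulr_ge0 ?gauss_ge0// mulr_ge0.
have p3 z : [set: R] z -> (0 <= (m * window a b z)%:E)%E.
  by move=> _; rewrite lee_fin mulr_ge0.
have E := @ge0_integralD _ _ _ mu setT measurableT _ _ p2 m2 p3 m3.
rewrite [leLHS](_ : _ = \int[mu]_z ((gauss t (z - y') * (k * window a b z))%:E +
  (m * window a b z)%:E))%E; last exact: (esym E).
have m23 := emeasurable_funD m2 m3.
apply: (@ge0_le_integral _ _ _ mu setT measurableT _ _ _ m23 m1) => z _.
  by rewrite adde_ge0// ?p2 ?p3.
rewrite -EFinD lee_fin windowE; case: (boolP (a <= z <= b)) => [zab|_].
  by rewrite !mulr1 mulrC h.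
by rewrite !mulr0 addr0.
Qed.

Lemma gs_window_le1 t a b y : gs t (window a b) y <= 1.
Proof.
rewrite -(@gs_cst _ t 1 y)//; apply: le_gs.
- exact: bounded_ge0_window.
- exact: bounded_ge0_cst.
- by move=> z; rewrite windowE; case: (_ <= _ <= _).
Qed.

(* The heat flow killed at the level [l], in the form given by the reflection
   principle; [l + z] and [l + y] below range over the half-line above [l]. *)
Definition killed l t F y : R := gs t F y - gs t F (2 * l - y).

Definition gauss0 : R := (Num.sqrt (pi *+ 2))^-1.

Lemma gauss0_gt0 : 0 < gauss0.
Proof. by rewrite invr_gt0 sqrtr_gt0 pmulrn_lgt0// pi_gt0. Qed.

Lemma gauss0_le : 2 * gauss0 <= 1.
Proof.
have p0 : 0 < Num.sqrt (pi *+ 2) :> R by rewrite sqrtr_gt0 pmulrn_lgt0// pi_gt0.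
rewrite /gauss0 ler_pdivrMr//.
rewrite mul1r.
have pi2 := pi_ge2 R.
rewrite -(@ler_pXn2r _ 2)// ?nnegrE ?sqrtr_ge0// sqr_sqrtr; first by rewrite expr2; lra.
by rewrite mulrn_wge0// pi_ge0.
Qed.

Lemma gaussE t w : 0 < t -> gauss t w = gauss0 / Num.sqrt t * expR (- w ^+ 2 / (t *+ 2)).
Proof.
by move=> t0; rewrite /gauss -mulrnAr sqrtrM ?ltW// invfM [X in X * _]mulrC.
Qed.

Lemma gauss_reflection t z y : 0 < t ->
  gauss t (z + y) = expR (- (2 * z * y / t)) * gauss t (z - y).
Proof.
move=> t0; rewrite /gauss mulrCA -expRD; congr (_ * expR _).
by field; rewrite gt_eqF.
Qed.

(** The two kernels have ratio exp(-2zy/t), and 1 - exp(-x) <= x. The extra factor zy/t is what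
    turns t^(-1/2) into t^(-3/2). *)
Lemma gauss_reflection_le t z y : 0 < t -> 0 <= z -> 0 <= y ->
  gauss t (z - y) <= gauss t (z + y) + gauss0 * 2 * (z * y) / (t * Num.sqrt t).
Proof.
move=> t0 z0 y0; rewrite (gauss_reflection z y t0) (gaussE (z - y) t0).
set u := z * y / t.
have u0 : 0 <= u by rewrite divr_ge0 ?mulr_ge0// ltW.
have -> : 2 * z * y / t = 2 * u by rewrite /u; lra.
have -> : gauss0 * 2 * (z * y) / (t * Num.sqrt t) = gauss0 / Num.sqrt t * (2 * u).
  by rewrite /u invfM; lra.
set A := gauss0 / _.
have A0 : 0 <= A by rewrite divr_ge0 ?sqrtr_ge0// ltW// gauss0_gt0.
set e := expR (- _ / _).
have e1 : e <= 1.
  by rewrite -expR0 ler_expR mulNr oppr_le0 divr_ge0 ?sqr_ge0// mulrn_wge0// ltW.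
have e0 : 0 <= e := expR_ge0 _.
have := expR_ge1Dx (- (2 * u)); set f := expR _ => hf.
have f0 : 0 <= f := expR_ge0 _.
have : e * (1 - f) <= 2 * u by nra.
nra.
Qed.

(** The converse bound, from 1 - exp(-x) >= x / (1 + x); [q] controls the Gaussian exponent. *)
Lemma gauss_reflection_ge t z y q : 0 < t -> 0 < z -> 0 <= y ->
  (z - y) ^+ 2 <= 2 * q * t ->
  gauss t (z + y) + gauss0 / Num.sqrt t * expR (- q) * (2 * z * y / (t + 2 * z * y)) <=
  gauss t (z - y).
Proof.
move=> t0 z0 y0 hq; rewrite (gauss_reflection z y t0) (gaussE (z - y) t0).
set A := gauss0 / _.
have A0 : 0 <= A by rewrite divr_ge0 ?sqrtr_ge0// ltW// gauss0_gt0.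
set e := expR (- _ / _).
have eq : expR (- q) <= e.
  rewrite ler_expR mulNr lerN2 ler_pdivrMr ?pmulrn_lgt0//; lra.
have q0 : 0 <= expR (- q) := expR_ge0 _.
set u := 2 * z * y.
have u0 : 0 <= u by rewrite !mulr_ge0// ltW.
have tu0 : 0 < t + u by rewrite ltr_wpDr.
have hf : expR (- (u / t)) <= 1 - u / (t + u).
  have -> : 1 - u / (t + u) = (1 + u / t)^-1.
    by field; rewrite !gt_eqF.
  rewrite expRN lef_pV2 ?posrE ?expR_gt0 ?expR_ge1Dx//.
  by rewrite ltr_wpDr// divr_ge0// ltW.
set f := expR (- (u / t)) in hf *.
have v0 : 0 <= u / (t + u) by rewrite divr_ge0// ltW.
have : expR (- q) * (u / (t + u)) <= e * (1 - f).
  by apply: ler_pM => //; lra.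
nra.
Qed.

(** exp(-2gg'/t) is the probability that a Brownian bridge between the heights [g] and [g'] above
    [l] touches [l]; it is read off the ratio of the reflected to the direct kernel. *)
Lemma killed_ge0_contraction l t g g' F y : 0 < t -> bounded_ge0 F -> 0 <= g -> 0 <= g' ->
  (forall z, F z != 0 -> l + g' <= z) -> l + g <= y ->
  gs t F (2 * l - y) <= expR (- (2 * g * g' / t)) * gs t F y.
Proof.
move=> t0 bF g0 g'0 supF gy; apply: le_gs_kernel => //.
move=> z /supF gz.
have -> : z - (2 * l - y) = (z - l) + (y - l) by lra.
have -> : z - y = (z - l) - (y - l) by lra.
rewrite (gauss_reflection (z - l) (y - l) t0) ler_wpM2r ?gauss_ge0// ler_expR lerN2.
rewrite ler_pM2r ?invr_gt0// [2 * _ * _]mulrAC; apply: ler_pM; rewrite ?mulr_ge0//; lra.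
Qed.

Lemma killed_window_le l t a b y : 0 < t -> l <= a -> a <= b -> l <= y ->
  killed l t (window a b) y <= (b - a) * (b - l) * (y - l) / (t * Num.sqrt t).
Proof.
move=> t0 la ab ly; rewrite /killed lerBlDl.
have ts0 : 0 < t * Num.sqrt t by rewrite mulr_gt0// sqrtr_gt0.
rewrite (_ : (b - a) * _ * _ / _ = ((b - l) * (y - l) / (t * Num.sqrt t)) * (b - a)); last by lra.
apply: gs_window_upper => //.
  by rewrite divr_ge0 ?(ltW ts0)// mulr_ge0//; lra.
move=> z /andP[az zb].
have -> : z - (2 * l - y) = (z - l) + (y - l) by lra.
have -> : z - y = (z - l) - (y - l) by lra.
apply: le_trans (gauss_reflection_le t0 _ _) _; [lra|lra|].
rewrite lerD2l ler_pM2r ?invr_gt0//.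
have := gauss0_le; have := gauss0_gt0.
have zy : (z - l) * (y - l) <= (b - l) * (y - l) by apply: ler_pM; lra.
have zy0 : 0 <= (z - l) * (y - l) by apply: mulr_ge0; lra.
nra.
Qed.

Lemma killed_window_ge l t a b y q : 0 < t -> l < a -> a <= b -> l <= y ->
  (forall z, a <= z <= b -> (z - y) ^+ 2 <= 2 * q * t) ->
  gauss0 * expR (- q) * (b - a) / Num.sqrt t *
    (2 * (a - l) * (y - l) / (t + 2 * (a - l) * (y - l))) <=
  killed l t (window a b) y.
Proof.
move=> t0 la ab ly hq; rewrite /killed lerBrDl.
set v := _ / (t + _).
rewrite (_ : gauss0 * _ * _ / _ * _ = gauss0 / Num.sqrt t * expR (- q) * v * (b - a)); last by lra.
rewrite -[X in X + _ <= _]mul1r.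
have v0 : 0 <= v.
  by rewrite divr_ge0// ?addr_ge0 ?mulr_ge0//; lra.
have A0 : 0 <= gauss0 / Num.sqrt t * expR (- q).
  by rewrite mulr_ge0 ?expR_ge0// divr_ge0 ?sqrtr_ge0// ltW// gauss0_gt0.
apply: gs_window_lower => //; first exact: mulr_ge0.
move=> z /andP[az zb]; rewrite mul1r.
have -> : z - (2 * l - y) = (z - l) + (y - l) by lra.
have zyE : z - y = (z - l) - (y - l) by lra.
rewrite zyE.
apply: le_trans (gauss_reflection_ge (q := q) t0 _ _ _); [|lra|lra|by rewrite -zyE hq// az zb].
rewrite lerD2l ler_wpM2l//.
rewrite /v; set u := 2 * (a - l) * (y - l); set u' := 2 * (z - l) * (y - l).
have uu' : u <= u' by apply: ler_pM; rewrite ?mulr_ge0//; lra.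
have u0 : 0 <= u by rewrite !mulr_ge0//; lra.
rewrite ler_pdivrMr; last by lra.
rewrite mulrAC ler_pdivlMr; last by lra.
nra.
Qed.

End window.

(** * Upper tail of the maximum *)

Section shift.
Context {T : Type} {R : realType}.
Implicit Types (tau : seq bool -> T -> R) (B : seq bool -> R -> T -> R).

(** Delaying the targets by [a] along the line of slope [c] amounts to evolving for a time [a]
    longer at the same depth. A bound at time [a] thus becomes an initial bound for the shifted
    targets, which is how the evolution is iterated. *)
Definition shift (c a : R) (S : seq (R * R)) : seq (R * R) :=
  [seq (p.1 + a, p.2 + c * a) | p <- S].

Lemma hit_shift c a S tau B s x :
  hit (shift c a S) tau B s x = hit S tau B (s + a) (x - c * a).
Proof.
apply/seteqP; split=> w.
  move=> [_ [u [/mapP[p pS ->] /= au h]]]; exists p, u; split => //.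
    by rewrite addrA addrAC.
  have -> : p.1 + (s + a) = p.1 + a + s by lra.
  lra.
move=> [p [u [pS au h]]]; exists (p.1 + a, p.2 + c * a), u; split.
- by apply/mapP; exists p.
- by rewrite /= addrAC -addrA.
- rewrite /= (_ : p.1 + a + s = p.1 + (s + a)); lra.
Qed.

Lemma shift_ge0 c a S : 0 <= a -> (forall p, p \in S -> 0 <= p.1) ->
  forall p, p \in shift c a S -> 0 <= p.1.
Proof. by move=> a0 S0 _ /mapP[p pS ->]; rewrite addr_ge0// S0. Qed.

End shift.

Lemma bounded_ge0_killed (R : realType) (l q : R) F (p : R -> bool) :
  measurable_fun setT p -> bounded_ge0 F -> (forall z, p z -> 0 <= killed l q F z) ->
  bounded_ge0 (fun z => if p z then killed l q F z else 0).
Proof.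
move=> mp bF kF; have [mw [K hK]] := bounded_ge0_gs q bF.
have [mw2 _] := bounded_ge0_refl (2 * l) (bounded_ge0_gs q bF).
split; first by apply: measurable_fun_ifT => //; exact: (measurable_funB mw mw2).
exists K => z; have /andP[h1 h2] := hK z; case: ifP => [/kF k0|_].
  by rewrite k0 /= /killed; have /andP[? ?] := hK (2 * l - z); lra.
by rewrite lexx (le_trans h1).
Qed.

Section killed_evolution.
Context d (T : measurableType d) (R : realType) (P : probability T R).
Variables (tau : seq bool -> {RV P >-> R}) (B : seq bool -> R -> {RV P >-> R}).
Hypothesis hB : regular_bbm tau B.

Lemma gs_semigroup (r q : R) F y : 0 <= r -> 0 <= q -> bounded_ge0 F ->
  gs r (gs q F) y = gs (r + q) F y.
Proof.
move=> r0 q0 bF; apply: EFin_inj; rewrite -!gsE//; last exact: bounded_ge0_gs.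
rewrite -(heat_semigroup hB)//; last 2 first.
- exact: bounded_ge0_measurable.
- by move=> z; exact: bounded_ge0_ge0.
by congr heat; apply/funext => z; rewrite gsE.
Qed.

(* [h] is the part above [l] of the killed evolution; reflecting it across [l]
   exchanges the free evolution with its reflection. *)
Lemma killed_semigroup (l r q : R) F y : 0 <= r -> 0 <= q -> bounded_ge0 F ->
  (forall z, l <= z -> 0 <= killed l q F z) ->
  let h z := if l < z then killed l q F z else 0 in
  killed l (r + q) F y = killed l r h y.
Proof.
move=> r0 q0 bF kF h.
have bw := bounded_ge0_gs q bF; have bw2 := bounded_ge0_refl (2 * l) bw.
have bh : bounded_ge0 h.
  apply: bounded_ge0_killed => [|//|z /ltW]; last exact: kF.
  exact: measurable_fun_ltr.
have E z : gs q F z + h (2 * l - z) = gs q F (2 * l - z) + h z.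
  rewrite /h /killed; case: (ltgtP l z) => lz.
  - have -> : (l < 2 * l - z) = false by apply/negbTE; rewrite -leNgt; lra.
    lra.
  - have -> : l < 2 * l - z by lra.
    have -> : 2 * l - (2 * l - z) = z by lra.
    lra.
  - have -> : 2 * l - z = z by lra.
    by rewrite lz ltxx.
have := congr1 (fun f => gs r f y) (funext E).
rewrite (gsD r y bw (bounded_ge0_refl (2 * l) bh)) (gsD r y bw2 bh).
rewrite (gs_refl r (2 * l) y bw) (gs_refl r (2 * l) y bh) !gs_semigroup//.
by rewrite /killed; lra.
Qed.

Lemma killed_ge0 (l t : R) F y : 0 <= t -> bounded_ge0 F ->
  (forall z, F z != 0 -> l < z) -> l <= y -> 0 <= killed l t F y.
Proof.
rewrite le_eqVlt => /predU1P[<-|t0] bF supF ly; rewrite /killed subr_ge0.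
  rewrite !gs0; have [->|/supF] := eqVneq (F (2 * l - y)) 0; last by lra.
  by have [_ [K /(_ y)/andP[]]] := bF.
apply: le_trans (killed_ge0_contraction t0 bF (lexx 0) (lexx 0) _ _) _.
- by move=> z /supF; lra.
- lra.
by rewrite mulr0 mul0r oppr0 expR0 mul1r.
Qed.

(** After the time [q] only the mass at height at least [g] above [l] is kept. Started and ended at
    such heights, the free flow over a time [r] exceeds the killed one only by the bridge factor,
    and the discarded mass contributes a nonnegative amount. *)
Lemma killed_cut (l g r q : R) F y : 0 < r -> 0 <= q -> 0 < g -> bounded_ge0 F ->
  (forall z, F z != 0 -> l < z) -> l + g <= y ->
  (1 - expR (- (2 * g * g / r))) *
    gs r (fun z => if l + g <= z then killed l q F z else 0) y <=
  killed l (r + q) F y.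
Proof.
move=> r0 q0 g0 bF supF gy.
have k0 z : l <= z -> 0 <= killed l q F z by exact: killed_ge0.
rewrite killed_semigroup ?(ltW r0)//.
pose h z := if l < z then killed l q F z else 0.
pose h1 z := if l + g <= z then killed l q F z else 0.
pose h2 z := if (l < z) && (z < l + g) then killed l q F z else 0.
have b1 : bounded_ge0 h1.
  apply: bounded_ge0_killed => [|//|z gz]; first exact: measurable_fun_ler.
  by apply: k0; lra.
have b2 : bounded_ge0 h2.
  apply: (@bounded_ge0_killed _ l q F (fun z => (l < z) && (z < l + g))) => //.
    by apply: measurable_and; exact: measurable_fun_ltr.
  by move=> z /andP[lz _]; rewrite k0// ltW.
rewrite -/h -/h1.
have -> : h = (fun z => h1 z + h2 z).
  apply/funext => z; rewrite /h /h1 /h2.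
  case: (leP (l + g) z) => lgz; case: (ltP l z) => lz /=; rewrite ?addr0 ?add0r//.
  by exfalso; lra.
rewrite /killed !gsD//.
have c1 := @killed_ge0_contraction _ l r g g h1 y r0 b1 (ltW g0) (ltW g0) _ gy.
have c2 := @killed_ge0_contraction _ l r 0 0 h2 y r0 b2 (lexx 0) (lexx 0) _ _.
rewrite !mulr0 mul0r oppr0 expR0 mul1r in c2.
have s1 z : h1 z != 0 -> l + g <= z by rewrite /h1; case: ifP => //; rewrite eqxx.
have s2 z : h2 z != 0 -> l + 0 <= z.
  rewrite /h2; case: ifP => [/andP[lz _] _|]; last by rewrite eqxx.
  by rewrite addr0 ltW.
have ly : l + 0 <= y by lra.
move: (c1 s1) (c2 s2 ly); move: (gs r h1 y) (gs r h2 y) (gs r h1 _) (gs r h2 _) (expR _).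
by move=> *; lra.
Qed.

End killed_evolution.

Section barrier_upper.
Context d (T : measurableType d) (R : realType).
Hypothesis exists_bbm : exists (P : probability T R) (tau : seq bool -> {RV P >-> R})
  (B : seq bool -> R -> {RV P >-> R}), regular_bbm tau B.
Variables (S : seq (R * R)) (c : R).
Hypothesis S0 : forall a, a \in S -> 0 <= a.1.
Hypothesis c2 : c ^+ 2 = 2.
Hypothesis c0 : 0 < c.

(** Each step lasts one unit of time. For [y <= - k] the probability is at most 1, which
    [expR (- (c * y)) * theta] dominates, and the heat flow preserves the constant [theta]. The free
    flow of the part above [- k] is then replaced by the flow killed at [- k - g], for which
    [killed_cut] charges [1 - expR (- (2 * g * g))] per step. *)
Lemma barrier_upper (k g L Q theta : R) : 0 < g -> 0 <= Q -> 0 <= theta ->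
  expR (- (c * k)) <= theta ->
  (forall y, - k <= y -> hit_le_always T S 0 (- y)
     (expR (- (c * y)) * (Q * window (- k) L y + theta))) ->
  forall (j : nat) y, - k <= y -> hit_le_always T S j%:R (- (c * j%:R) - y)
     (expR (- (c * y)) * ((1 - expR (- (2 * g * g))) ^- j *
        (Q * killed (- k - g) j%:R (window (- k) L) y) + theta)).
Proof.
move=> g0 Q0 th0 kth h0.
have [P0 [tau0 [B0 hB0]]] := exists_bbm.
set e := expR (- (2 * g * g)).
have e1 : e < 1 by rewrite -expR0 ltr_expR; nra.
have K0 j : 0 <= (1 - e) ^- j by rewrite invr_ge0 exprn_ge0// subr_ge0 ltW.
have supW z : window (- k) L z != 0 -> - k - g < z.
  by rewrite windowE; case: (boolP (_ <= _ <= _)) => [/andP[? _] _|_];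
    [lra|rewrite eqxx].
have bW := @bounded_ge0_window R (- k) L.
have trivial_bound s y x : y <= - k -> hit_le_always T S s x (expR (- (c * y)) * theta).
  move=> yk P tau B hB; apply: (le_trans (probability_le1 P _)).
    exact: (measurable_hit_event hB).
  rewrite lee_fin; apply: (@le_trans _ _ (expR (- (c * y)) * expR (- (c * k)))).
    rewrite -expRD -[X in X <= _]expR0 ler_expR -opprD oppr_ge0 -mulrDr pmulr_rle0//; lra.
  by rewrite ler_wpM2l// expR_ge0.
elim=> [|j IH] y ky.
  move=> P tau B hB; rewrite mulr0 oppr0 add0r.
  apply: le_trans (h0 y ky _ _ _ hB) _; rewrite lee_fin ler_wpM2l ?expR_ge0//.
  rewrite expr0 invr1 mul1r lerD2r ler_wpM2l// /killed !gs0.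
  have -> : window (- k) L (2 * (- k - g) - y) = 0; last by rewrite subr0.
  apply/eqP/negPn/negP => /supW; lra.
pose F z := (1 - e) ^- j * (Q *
  (if - k - g + g <= z then killed (- k - g) j%:R (window (- k) L) z else 0)) + theta.
have j0 : 0 <= j%:R :> R by [].
have kj0 z : - k - g <= z -> 0 <= killed (- k - g) j%:R (window (- k) L) z.
  exact: killed_ge0.
pose F0 z := if - k - g + g <= z then killed (- k - g) j%:R (window (- k) L) z else 0.
have bF0 : bounded_ge0 F0.
  apply: bounded_ge0_killed => [|//|z gz]; first exact: measurable_fun_ler.
  by apply: kj0; lra.
have bF1 : bounded_ge0 (fun z => (1 - e) ^- j * (Q * F0 z)).
  by apply: bounded_ge0Z => //; exact: bounded_ge0Z.
have bF : bounded_ge0 F by apply: bounded_ge0D => //; exact: bounded_ge0_cst.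
have S'0 := @shift_ge0 _ c _ _ j0 S0.
have hF z : hit_le_always T (shift c j%:R S) 0 (- z) (expR (- (c * z)) * F z).
  move=> P tau B hB; rewrite hit_shift add0r.
  have [kz|zk] := leP (- k) z.
    have -> : - z - c * j%:R = - (c * j%:R) - z by lra.
    apply: le_trans (IH z kz _ _ _ hB) _; rewrite lee_fin /F.
    by have -> : - k - g + g <= z by lra.
  apply: le_trans (trivial_bound _ z _ (ltW zk) _ _ _ hB) _; rewrite lee_fin /F.
  have -> : (- k - g + g <= z) = false by apply/negbTE; rewrite -ltNge; lra.
  by rewrite mulr0 mulr0 add0r.
move=> P tau B hB.
have := @tilted_upper _ T R _ S'0 c c2 F 1 y bF ler01 hF _ _ _ hB.
rewrite hit_shift mulr1 (_ : 1 + j%:R = j.+1%:R); last by rewrite -natr1 addrC.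
have -> : - c - y - c * j%:R = - (c * j.+1%:R) - y by rewrite -natr1; lra.
move=> /le_trans; apply; rewrite lee_fin ler_wpM2l ?expR_ge0//.
rewrite /F (gsD 1 y bF1 (bounded_ge0_cst th0)) gs_cst// lerD2r.
rewrite gsZ//; last exact: bounded_ge0Z.
rewrite gsZ// mulrCA [leRHS]mulrCA ler_wpM2l//.
have := killed_cut hB0 ltr01 j0 g0 bW supW (_ : - k - g + g <= y).
rewrite divr1 -/e (_ : 1 + j%:R = j.+1%:R); last by rewrite -natr1 addrC.
move=> /(_ ltac:(lra)) cut.
rewrite exprS invfM -mulrA mulrCA ler_wpM2l//.
rewrite mulrC ler_pdivlMr; last by lra.
by rewrite mulrC.
Qed.

End barrier_upper.

Lemma probability_bigsetU_le d (T : measurableType d) (R : realType)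
    (P : probability T R) (I : eqType) (l : seq I) (F : I -> set T) :
  (forall i, i \in l -> measurable (F i)) ->
  (P (\big[setU/set0]_(i <- l) F i) <= \sum_(i <- l) P (F i))%E.
Proof.
elim: l => [|a l IH] mF; first by rewrite !big_nil measure0.
rewrite !big_cons.
have mFa : measurable (F a) by apply: mF; rewrite mem_head.
have mFl i : i \in l -> measurable (F i) by move=> il; apply: mF; rewrite in_cons il orbT.
have mU : measurable (\big[setU/set0]_(i <- l) F i).
  by rewrite big_seq; exact: bigsetU_measurable.
apply: (le_trans (@measureU2 _ _ _ P _ _ mFa mU)).
by rewrite leeD2l// IH.
Qed.

Lemma bernoulli_le (R : realDomainType) (e : R) n : 0 <= e <= 1 ->
  1 - n%:R * e <= (1 - e) ^+ n.
Proof.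
move=> /andP[e0 e1]; elim: n => [|n IH]; first by rewrite mul0r subr0 expr0.
rewrite exprS -natr1; have n0 : 0 <= n%:R :> R by [].
have : (1 - e) * (1 - n%:R * e) <= (1 - e) * (1 - e) ^+ n by rewrite ler_wpM2l//; lra.
have : 0 <= n%:R * e * e by rewrite !mulr_ge0.
lra.
Qed.

Lemma ln_ge_of_bound (R : realType) (l0 : R) n : (Num.bound (expR l0) <= n)%N ->
  l0 <= ln (n%:R : R) /\ (n%:R : R) = expR (ln (n%:R : R)).
Proof.
move=> hn; have h : expR l0 <= n%:R.
  by apply: (le_trans (ltW (archi_boundP (expR_ge0 l0)))); rewrite ler_nat.
have n0 : 0 < n%:R :> R by exact: (lt_le_trans (expR_gt0 l0)).
by rewrite -[l0]expRK ler_ln ?posrE ?expR_gt0// lnK.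
Qed.

(** * First moment bounds *)

Section first_moment.
Context d (T : measurableType d) (R : realType).
Implicit Types (S : seq (R * R)) (s x y C : R).

Lemma hit_le_always_mono S s x p q : p <= q ->
  hit_le_always T S s x p -> hit_le_always T S s x q.
Proof. by move=> pq h P tau B hB; apply: (le_trans (h _ _ _ hB)); rewrite lee_fin. Qed.

Lemma hit_le_always1 S s x : hit_le_always T S s x 1.
Proof.
by move=> P tau B hB; apply: (probability_le1 P); exact: (measurable_hit_event hB).
Qed.

Lemma hit_origin (P : probability T R) (tau : seq bool -> {RV P >-> R})
    (B : seq bool -> R -> {RV P >-> R}) x w : regular_bbm tau B ->
  hit [:: (0, 0)] tau B 0 x w <-> 0 <= x.
Proof.
move=> hB; have bt b u : 0 < birth_time (fun u => tau u) (b :: u) w.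
  rewrite birth_time_cons ltr_wpDr ?(lifetime_gt0 hB)//.
  by apply: sumr_ge0 => k _; rewrite /subtree ltW// (lifetime_gt0 hB).
split.
  move=> [_ [[|b u] [/[!inE]/eqP-> /=]]]; rewrite ?addr0.
    by rewrite position_nil (motion_start hB) addr0.
  by move=> /andP[]; rewrite leNgt bt.
move=> x0; exists (0, 0), [::]; split; rewrite ?inE//= addr0.
  by rewrite alive_nil lexx (lifetime_gt0 hB).
by rewrite position_nil (motion_start hB) addr0.
Qed.

(** The linear solution started from [expR (C * z)], which dominates the indicator of the half-line.
    The slope [C] is free: a large one handles starting points far below the targets. *)
Lemma first_moment s x C : 0 <= s -> 0 <= C ->
  hit_le_always T [:: (0, 0)] s x (expR (s + C * x + C ^+ 2 * s / 2)).
Proof.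
move=> s0 C0 P tau B hB.
have S0 (a : R * R) : a \in [:: (0, 0)] -> 0 <= a.1 by rewrite inE => /eqP ->.
have mf : measurable_fun [set: R] (fun z : R => (expR (C * z))%:E : \bar R).
  by apply/measurable_EFinP; apply: measurableT_comp => //.
have f0 (z : R) : (0 <= (expR (C * z))%:E)%E by rewrite lee_fin expR_ge0.
have := @hit_upper _ T R _ S0 _ mf f0 _ _ _ _ hB s x s0.
have -> : (fun z : R => (expR (C * z))%:E) =
    (fun z => (expR (C * z))%:E * (cst 1%:E : R -> \bar R) z)%E.
  by apply/funext => z; rewrite mule1.
rewrite heat_tilt// heat_cst// mule1 -EFinM -expRD addrA; apply.
move=> P' tau' B' hB' z; have [z0|z0] := leP 0 z.
  apply: le_trans (hit_le_always1 _ _ _ hB') _.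
  by rewrite lee_fin -[1]expR0 ler_expR mulr_ge0.
have h0 : hit [:: (0, 0)] tau' B' 0 z = set0.
  by apply/seteqP; split=> // w /(hit_origin z w hB'); rewrite leNgt z0.
by rewrite h0 measure0 lee_fin expR_ge0.
Qed.

(** Each target is lowered to level 0 at its own time, at most 1; the number of targets is paid as a
    factor, which the choice of [C] beats later. *)
Lemma first_moment_union S x C : 0 <= C ->
  (forall a, a \in S -> 0 <= a.1 <= 1 /\ 0 <= a.2) ->
  hit_le_always T S 0 x ((size S)%:R * expR (1 + C * x + C ^+ 2 / 2)).
Proof.
move=> C0 HS P tau B hB.
have m1 a : measurable (hit [:: a] tau B 0 x) by exact: (measurable_hit_event hB).
have sub : hit S tau B 0 x = \big[setU/set0]_(a <- S) hit [:: a] tau B 0 x.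
  apply/seteqP; split=> w.
    move=> [a [u [aS au h]]]; rewrite -bigcup_seq; exists a => //.
    by exists a, u; rewrite inE.
  rewrite -bigcup_seq => -[a /= aS [b [u []]]].
  by rewrite inE => /eqP -> au h; exists a, u.
rewrite sub.
have m2 := @probability_bigsetU_le _ _ _ P _ S _ (fun a _ => m1 a).
apply: (le_trans m2); rewrite -sum1_size natr_sum mulr_suml -sumEFin.
rewrite big_seq [leRHS]big_seq; apply: lee_sum => a aS; rewrite mul1r.
have [/andP[a0 a1] a2] := HS a aS.
have sub1 : hit [:: a] tau B 0 x `<=` hit [:: (0, 0)] tau B a.1 x.
  move=> w [b [u []]]; rewrite inE => /eqP -> au h.
  exists (0, 0), u; split; rewrite ?inE//= add0r.
    by move: au; rewrite addr0.
  by move: h; rewrite addr0; exact: le_trans.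
apply: (@le_trans _ _ (P (hit [:: (0, 0)] tau B a.1 x))).
  by apply: le_measure => //; rewrite inE; [exact: m1|exact: (measurable_hit_event hB)].
apply: le_trans (first_moment x a0 C0 hB) _; rewrite lee_fin ler_expR.
have : C ^+ 2 * a.1 / 2 <= C ^+ 2 / 2.
  by rewrite ler_pM2r ?invr_gt0// ler_piMr// sqr_ge0.
lra.
Qed.

End first_moment.

Lemma killed_window_arith (R : realType) (delta l y : R) : 0 < delta <= 1 -> 0 < l ->
  y <= 2 * l -> - (10 * l) <= y ->
  (delta / 4 * l - - (10 * l)) * (delta / 4 * l - (- (10 * l) - l)) *
    (y - (- (10 * l) - l)) <= 1500 * l ^+ 3.
Proof.
move=> /andP[d0 d1] l0 y2 y10.
have dl : delta / 4 * l <= l / 4 by nra.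
have dl0 : 0 <= delta / 4 * l by nra.
have h1 : (delta / 4 * l - - (10 * l)) * (delta / 4 * l - (- (10 * l) - l)) <=
    (41 / 4 * l) * (45 / 4 * l) by apply: ler_pM; lra.
have h2 : (delta / 4 * l - - (10 * l)) * (delta / 4 * l - (- (10 * l) - l)) *
    (y - (- (10 * l) - l)) <= (41 / 4 * l) * (45 / 4 * l) * (13 * l).
  by apply: ler_pM => //; [apply: mulr_ge0; lra|lra|lra].
apply: (le_trans h2); rewrite exprS expr2.
have : 0 <= l * (l * l) by rewrite !mulr_ge0// ltW.
lra.
Qed.

(** In the application [l] is [log n] and [x] is [n]. All lengths are of order [l], so the three
    linear factors of the killed kernel cost only [l^3], while [x * Num.sqrt x] is exp(3l/2). *)
Lemma killed_tail (R : realType) (delta l y x : R) : 0 < delta <= 1 -> 2 <= l ->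
  - (10 * l) <= y <= 2 * l -> x = expR l ->
  killed (- (10 * l) - l) x (window (- (10 * l)) (delta / 4 * l)) y <=
  1500 * l ^+ 3 * expR (- (3 / 2 * l)).
Proof.
move=> d01 l2 /andP[y_ge y_le] xE; have /andP[d0 d1] := d01.
have x0 : 0 < x by rewrite xE expR_gt0.
have dl0 : 0 <= delta / 4 * l by rewrite mulr_ge0//; lra.
have h1 : - (10 * l) - l <= - (10 * l) by lra.
have h2 : - (10 * l) <= delta / 4 * l by lra.
have h3 : - (10 * l) - l <= y by lra.
apply: le_trans (killed_window_le x0 h1 h2 h3) _.
have -> : x * Num.sqrt x = expR (3 / 2 * l).
  rewrite xE (_ : expR l = expR (l / 2) ^+ 2); last by rewrite expr2 -expRD; congr expR; lra.
  rewrite sqrtr_sqr ger0_norm ?expR_ge0// expr2 -!expRD; congr expR; lra.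
rewrite expRN ler_pM2r ?invr_gt0 ?expR_gt0//.
by apply: killed_window_arith => //; lra.
Qed.

(** With the gap [g = l] the relative loss of a barrier step is [expR (- (2 * l * l))], so small
    that [n] steps together lose at most a factor 2. *)
Lemma expR_mul_inv_le (R : realType) (x l : R) : 2 <= l -> x = expR l ->
  0 <= expR (- (2 * l * l)) <= 1 /\ x * expR (- (2 * l * l)) <= 1 / 2.
Proof.
move=> l2 ->; split.
  rewrite expR_ge0 -[leRHS]expR0 ler_expR oppr_le0 !mulr_ge0//; lra.
rewrite -expRD; apply: (@le_trans _ _ (expR (-1))).
  by rewrite ler_expR; nra.
rewrite expRN -[leRHS]invf_div divr1 lef_pV2 ?posrE ?expR_gt0//.
by have := expR_ge1Dx (1 : R); lra.
Qed.

Lemma tilted_error_le (R : realType) (A E X Y L N Q K : R) :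
  0 <= A <= 2 -> 0 <= N -> 0 <= Q <= E -> 1 <= E -> 0 <= X -> 1 <= L ->
  (2 * N + 1) * L <= E -> K <= N * L * X -> Y <= X -> A * (Q * K) + Y <= E * E * X.
Proof.
move=> /andP[A0 A2] N0 /andP[Q0 QE] E1 X0 L1 hE KE YX.
have E0 : 0 <= E by lra.
have L0 : 0 <= L by lra.
have B0 : 0 <= N * L * X := mulr_ge0 (mulr_ge0 N0 L0) X0.
have QK : Q * K <= E * (N * L * X).
  by apply: (@le_trans _ _ (Q * (N * L * X))); [rewrite ler_wpM2l|rewrite ler_wpM2r].
have AQK : A * (Q * K) <= 2 * (E * (N * L * X)).
  exact: (le_trans (ler_wpM2l A0 QK) (ler_wpM2r (mulr_ge0 E0 B0) A2)).
have h1 : E * ((2 * N + 1) * L) * X <= E * E * X := ler_wpM2r X0 (ler_wpM2l E0 hE).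
have h2 : 1 * X <= E * L * X.
  by apply: (ler_wpM2r X0); apply: (le_trans E1); rewrite ler_peMr.
lra.
Qed.

Lemma upper_tail_arith (R : realType) (c delta l A K N : R) :
  0 <= A <= 2 -> c <= 2 -> 0 < delta <= 1 -> 2 <= l -> 0 <= N ->
  (2 * N + 1) * l ^+ 3 <= expR (delta / 2 * l) ->
  K <= N * l ^+ 3 * expR (- (3 / 2 * l)) ->
  A * (expR (c * (delta / 4 * l)) * K) + expR (- (10 * l)) <= expR ((delta - 3 / 2) * l).
Proof.
move=> A02 c2 /andP[d0 d1] l2 N0 hl3 KE.
have dl0 : 0 <= delta / 4 * l by rewrite mulr_ge0//; lra.
have -> : expR ((delta - 3 / 2) * l) =
    expR (delta / 2 * l) * expR (delta / 2 * l) * expR (- (3 / 2 * l)).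
  by rewrite -!expRD; congr expR; lra.
apply: tilted_error_le hl3 KE _ => //.
- rewrite expR_ge0 ler_expR (_ : delta / 2 * l = 2 * (delta / 4 * l)); last by lra.
  by rewrite ler_wpM2r.
- by rewrite -[leLHS]expR0 ler_expR; lra.
- by rewrite -(expr1n _ 3) lerXn2r ?nnegrE//; lra.
- by rewrite ler_expR; lra.
Qed.

Lemma expR_tilt_ge1 (R : realType) (c y q : R) : 0 <= c -> y <= q ->
  1 <= expR (- (c * y) + c * q).
Proof. by move=> c0 yq; rewrite -[leLHS]expR0 ler_expR addrC subr_ge0 ler_wpM2l. Qed.

Lemma half_le_subr1 (R : realType) (x : R) : x <= 1 / 2 -> 1 / 2 <= 1 - x.
Proof. lra. Qed.

Lemma norm_le2_itv (R : realType) (y l : R) : 0 < l -> `|y| <= 2 * l ->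
  - (10 * l) <= y /\ y <= 2 * l.
Proof. by rewrite ler_norml => l0 /andP[]; split; lra. Qed.

Section upper_tail.
Context d (T : measurableType d) (R : realType).
Hypothesis exists_bbm : exists (P : probability T R) (tau : seq bool -> {RV P >-> R})
  (B : seq bool -> R -> {RV P >-> R}), regular_bbm tau B.
Variable c : R.
Hypothesis c2 : c ^+ 2 = 2.
Hypothesis c0 : 0 < c.
Local Notation L := (fun n : nat => ln (n%:R : R)).

Let c12 : 1 <= c <= 2.
Proof.
apply/andP; split; rewrite -(@ler_pXn2r _ 2)// ?nnegrE ?(ltW c0)// c2.
  by rewrite expr1n; lra.
by rewrite expr2; lra.
Qed.

Lemma cube_le_expR (a : R) (K : R) : 0 < a -> 0 <= K -> exists x0 : R, 0 < x0 /\
  forall x, x0 <= x -> K * x ^+ 3 <= expR (a * x).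
Proof.
move=> a0 K0; exists (K * 24 / a ^+ 4 + 1); split.
  by rewrite ltr_wpDl// divr_ge0 ?mulr_ge0 ?exprn_ge0// ltW.
move=> x hx.
have x0 : 0 <= x.
  by apply: le_trans hx; rewrite addr_ge0// divr_ge0 ?mulr_ge0 ?exprn_ge0// ltW.
have ax0 : 0 <= a * x by rewrite mulr_ge0// ltW.
have := @expR_ge1Dxn _ _ 3 ax0; apply: le_trans.
rewrite exprMn (_ : (4`!)%:R = 24 :> R)//.
have a4 : 0 < a ^+ 4 by rewrite exprn_gt0.
have hx' : K * 24 <= x * a ^+ 4.
  have : K * 24 / a ^+ 4 <= x by lra.
  by rewrite ler_pdivrMr.
have x3 : 0 <= x ^+ 3 by rewrite exprn_ge0.
have : K * 24 * x ^+ 3 <= x * a ^+ 4 * x ^+ 3 by exact: ler_wpM2r.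
have -> : x * a ^+ 4 * x ^+ 3 = a ^+ 4 * x ^+ 4 by ring.
lra.
Qed.

(** With [l] for [log n], [barrier_upper] is applied with [k = 10 l], [g = l], window end
    [delta / 4 * l] and [theta = n^-10]. Inside the window the initial probability is bounded by 1,
    at the price [Q = expR (c * (delta / 4 * l))]; beyond it the first moment falls below the tilted
    [theta]. *)
Lemma upper_tail (delta : R) : 0 < delta <= 1 -> exists n0 : nat, forall n S y,
  (n0 <= n)%N -> (forall a, a \in S -> 0 <= a.1 <= 1 /\ 0 <= a.2) ->
  (size S)%:R <= expR (9 * L n) -> `|y| <= 2 * L n ->
  hit_le_always T S n%:R (- (c * n%:R) - y)
    (expR (- (c * y) + (delta - 3 / 2) * L n)).
Proof.
move=> /andP[d0 d1]; pose C := c + 80 / delta.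
have N0 : 0 <= 1500 :> R by exact: ler0n.
have N1 : 0 <= 2 * 1500 + 1 :> R := addr_ge0 (mulr_ge0 (ler0n _ 2) N0) ler01.
have [x0 [x00 hx0]] := @cube_le_expR (delta / 2) (2 * 1500 + 1) ltac:(lra) N1.
pose l0 := Num.max (Num.max x0 (1 + C ^+ 2)) 2.
exists (Num.bound (expR l0)) => n S y n0 HS hS hy.
have [] := ln_ge_of_bound n0; set l := L n in hS hy * => l0l nE.
have [lx0 lC l2] : [/\ x0 <= l, 1 + C ^+ 2 <= l & 2 <= l].
  by move: l0l; rewrite /l0 !ge_max => /andP[/andP[-> ->] ->].
have cc := c12; have /andP[c1 c2'] := cc.
have CE : (C - c) * (delta / 4) = 20 by rewrite /C; field; rewrite gt_eqF.
have dV : 0 < 80 / delta by rewrite divr_gt0.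
have Cc : c < C by rewrite /C ltrDl.
have C0 : 0 <= C by lra.
have e0 (x : R) : 0 < expR x := expR_gt0 x.
have S0 a : a \in S -> 0 <= a.1 by move=> /HS[/andP[]].
have th : expR (- (c * (10 * l))) <= expR (- (10 * l)) by rewrite ler_expR; nra.
have init y' : - (10 * l) <= y' -> hit_le_always T S 0 (- y') (expR (- (c * y')) *
    (expR (c * (delta / 4 * l)) * window (- (10 * l)) (delta / 4 * l) y' + expR (- (10 * l)))).
  move=> ky; rewrite windowE ky /=; have [yL|yL] := leP y' (delta / 4 * l).
    apply: hit_le_always_mono (hit_le_always1 _ _ _).
    rewrite mulr1 mulrDr -expRD -[X in X <= _]addr0; apply: lerD; last first.
      by rewrite mulr_ge0// ltW.
    exact: expR_tilt_ge1 (ltW c0) yL.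
  apply: hit_le_always_mono (first_moment_union (- y') C0 HS).
  rewrite mulr0 add0r -expRD.
  apply: (@le_trans _ _ (expR (9 * l) * expR (1 + C * - y' + C ^+ 2 / 2))).
    by rewrite ler_wpM2r// ltW.
  rewrite -expRD ler_expR.
  have : (C - c) * (delta / 4 * l) <= (C - c) * y' by rewrite ler_wpM2l ?ltW//; lra.
  rewrite mulrA CE; have := sqr_ge0 C; lra.
have l0' : 0 < l by exact: lt_le_trans l2.
have [y_ge y_le] := norm_le2_itv l0' hy.
have := barrier_upper exists_bbm S0 c2 c0 l0' (ltW (e0 _)) (ltW (e0 _)) th init n y_ge.
apply: hit_le_always_mono; rewrite expRD ler_wpM2l ?(ltW (e0 _))//.
have KE := @killed_tail _ delta l y n%:R (introT andP (conj d0 d1)) l2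
  (introT andP (conj y_ge y_le)) nE.
have [] := expR_mul_inv_le l2 nE; set e := expR (- (2 * l * l)) => e1 eh.
have e1' : 0 <= 1 - e by case/andP: e1 => _; rewrite subr_ge0.
have eV : (1 - e) ^- n <= 2.
  have h : 1 / 2 <= (1 - e) ^+ n.
    by apply: le_trans (bernoulli_le n e1); exact: half_le_subr1.
  have h' : 0 < (1 - e) ^+ n by apply: lt_le_trans h; rewrite divr_gt0.
  by rewrite -[leRHS]invrK lef_pV2 ?posrE// -[_^-1]mul1r.
have eV0 : 0 <= (1 - e) ^- n by rewrite invr_ge0 exprn_ge0.
by apply: (upper_tail_arith _ _ _ _ N0) => //; [rewrite eV0 eV|rewrite d0|exact: hx0].
Qed.

End upper_tail.

(** * Lower tail of the maximum *)

Section barrier_lower.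
Context d (T : measurableType d) (R : realType).
Hypothesis exists_bbm : exists (P : probability T R) (tau : seq bool -> {RV P >-> R})
  (B : seq bool -> R -> {RV P >-> R}), regular_bbm tau B.
Variable c : R.
Hypothesis c2 : c ^+ 2 = 2.
Hypothesis c0 : 0 < c.
Implicit Types (S : seq (R * R)) (s x y : R).

Lemma hit_ge_always_mono S s x p q : q <= p ->
  hit_ge_always T S s x p -> hit_ge_always T S s x q.
Proof. by move=> qp h P tau B hB; apply: (le_trans _ (h _ _ _ hB)); rewrite lee_fin. Qed.

Lemma hit_ge_always_sub S S' s x p : {subset S <= S'} ->
  hit_ge_always T S s x p -> hit_ge_always T S' s x p.
Proof.
move=> SS' h P tau B hB; apply: (le_trans (h _ _ _ hB)).
by apply: le_measure; rewrite ?inE; [exact: (measurable_hit_event hB)..|exact: hit_sub].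
Qed.

Lemma hit_ge_always0 S s x p : p <= 0 -> hit_ge_always T S s x p.
Proof. by move=> p0 P tau B hB; apply: le_trans (measure_ge0 P _); rewrite lee_fin. Qed.

Lemma hit_ge_always_le S s x x' p : x <= x' ->
  hit_ge_always T S s x p -> hit_ge_always T S s x' p.
Proof.
move=> xx' h P tau B hB; apply: (le_trans (h _ _ _ hB)).
by apply: le_measure; rewrite ?inE; [exact: (measurable_hit_event hB)..|exact: hit_le].
Qed.

Section mixture.
Variables (w t : nat -> R) (F : R -> R).
Hypothesis w0 : forall i, 0 <= w i.
Hypothesis t0 : forall i, 0 <= t i.
Hypothesis bF : bounded_ge0 F.

Let G j z := \sum_(i < j) w i * gs (t i) F z.

Lemma bounded_ge0_mixture j : bounded_ge0 (G j).
Proof.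
elim: j => [|j IH].
  have := @bounded_ge0_cst R 0 (lexx 0); congr bounded_ge0.
  by apply/funext => z; rewrite /G big_ord0.
have := bounded_ge0D IH (bounded_ge0Z (w0 j) (bounded_ge0_gs (t j) bF)).
by congr bounded_ge0; apply/funext => z; rewrite /G big_ord_recr.
Qed.

Lemma gs_mixture j s y : 0 <= s ->
  gs s (G j) y = \sum_(i < j) w i * gs (s + t i) F y.
Proof.
have [P0 [tau0 [B0 hB0]]] := exists_bbm.
move=> s0; elim: j => [|j IH].
  rewrite big_ord0 -(gs_cst s y (lexx 0)); congr gs.
  by apply/funext => z; rewrite /G big_ord0.
have bG := bounded_ge0_mixture j.
have bj := bounded_ge0_gs (t j) bF.
rewrite big_ord_recr /= -IH -(gs_semigroup hB0 y s0 (t0 j) bF) -(gsZ s y (w0 j) bj).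
rewrite -(gsD s y bG (bounded_ge0Z (w0 j) bj)); congr gs.
by apply/funext => z; rewrite /G big_ord_recr.
Qed.

Lemma killed_mixture j s l y : 0 <= s ->
  gs s (G j) y - gs s (fun z => G j (2 * l - z)) y =
  \sum_(i < j) w i * killed l (s + t i) F y.
Proof.
move=> s0; rewrite (gs_refl s (2 * l) y (bounded_ge0_mixture j)) !gs_mixture//.
by rewrite -sumrB; apply: eq_bigr => i _; rewrite -mulrBr.
Qed.

End mixture.

Variables (l D eta q a b : R).
Hypothesis D0 : 0 <= D.
Hypothesis eta01 : 0 <= eta <= 1.
Hypothesis q0 : 0 <= q.
Hypothesis la : l < a.

Let w (i : nat) := q * expR (- (eta * (i%:R * D))).
Let t (i : nat) := i%:R * D.
Let w0 i : 0 <= w i. Proof. by rewrite mulr_ge0// expR_ge0. Qed.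
Let t0 i : 0 <= t i. Proof. by rewrite mulr_ge0. Qed.
Let bW := bounded_ge0_window a b.

(** Candidate lower bound for hitting one of [j] targets spaced by [D]: killed kernels superposed,
    the farther ones damped. A plain sum, without correction for double hits, is possible because
    the damping [eta] already pays for the quadratic term. *)
Definition killed_sum j s y : R := \sum_(i < j) q * expR (- (eta * (i%:R * D))) *
  killed l (s + i%:R * D) (window a b) y.

Let w_le i : w i <= q.
Proof.
rewrite /w -[leRHS]mulr1 ler_wpM2l// -[leRHS]expR0 ler_expR oppr_le0.
by case/andP: eta01 => ? _; rewrite !mulr_ge0.
Qed.

Let supW z : window a b z != 0 -> l < z.
Proof.
by rewrite windowE; case: (boolP (_ <= _ <= _)) => [/andP[? _] _|_];
  [exact: lt_le_trans la _|rewrite eqxx].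
Qed.

Lemma killed_antisymmetric l' r F y : killed l' r F (2 * l' - y) = - killed l' r F y.
Proof.
have E : 2 * l' - (2 * l' - y) = y by lra.
by rewrite /killed E opprB.
Qed.

Let killed_window_ge0 r y : 0 <= r -> l <= y -> 0 <= killed l r (window a b) y.
Proof. by move=> r0 ly; exact: killed_ge0. Qed.

Lemma killed_sum_ge0 j s y : 0 <= s -> l <= y -> 0 <= killed_sum j s y.
Proof.
move=> s0 ly; apply: sumr_ge0 => i _; apply: mulr_ge0; first exact: w0.
by apply: killed_window_ge0 => //; rewrite addr_ge0// t0.
Qed.

Lemma killed_sum_le0 j s y : 0 <= s -> y <= l -> killed_sum j s y <= 0.
Proof.
move=> s0 yl; apply: sumr_le0 => i _; apply: mulr_ge0_le0; first exact: w0.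
rewrite -oppr_ge0 -killed_antisymmetric; apply: killed_window_ge0; last by lra.
by rewrite addr_ge0// t0.
Qed.

Lemma killed_sum_le j s y : l <= y -> killed_sum j s y <= q * j%:R.
Proof.
move=> ly; rewrite mulr_natr -[X in _ *+ X](card_ord j) -sumr_const; apply: ler_sum => i _.
apply: (@le_trans _ _ (w i * 1)); last by rewrite mulr1 w_le.
rewrite ler_wpM2l ?w0// /killed.
have := @gs_window_le1 R (s + i%:R * D) a b y.
have := gs_ge0 (s + i%:R * D) (2 * l - y) bW; lra.
Qed.

(** One target is added at the present time while the earlier ones move away by [D]. *)
Lemma killed_sum_step j s y : 0 <= s ->
  killed_sum j.+1 s y = q * killed l s (window a b) y +
    expR (- (eta * D)) * killed_sum j (s + D) y.
Proof.
move=> s0; rewrite /killed_sum big_ord_recl !mul0r mulr0 oppr0 expR0 mulr1 addr0.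
congr (_ + _); rewrite mulr_sumr; apply: eq_bigr => i _.
rewrite /= /bump /= add1n -natr1 mulrDl mul1r.
rewrite [in RHS]mulrCA mulrA -!mulrA; congr (_ * _).
rewrite mulrA -expRD; congr (expR _ * killed l _ _ _); lra.
Qed.

(** The sum is a mixture of heat flows minus its reflection in [l]. Under the barrier it is
    nonpositive; above it the tilt is at most [expR (- (c * l))] and each term at most [q], so the
    smallness demanded by [tilted_lower] is the hypothesis on [eta]. *)
Lemma killed_sum_evolution S j : (forall p, p \in S -> 0 <= p.1) ->
  q * j%:R * expR (- (c * l)) <= eta ->
  (forall y, hit_ge_always T S 0 (- y) (expR (- (c * y)) * killed_sum j 0 y)) ->
  forall s y, 0 <= s -> hit_ge_always T S s (- (c * s) - y)
    (expR (- (eta * s)) * (expR (- (c * y)) * killed_sum j s y)).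
Proof.
move=> S0 hq h s y s0.
have bG := @bounded_ge0_mixture w t _ w0 bW j.
have E r y' : 0 <= r -> gs r (fun z => \sum_(i < j) w i * gs (t i) (window a b) z) y' -
    gs r (fun z => \sum_(i < j) w i * gs (t i) (window a b) (2 * l - z)) y' =
    killed_sum j r y'.
  move=> r0; exact: (@killed_mixture w t _ w0 t0 bW j r l y' r0).
rewrite -E//.
apply: (@tilted_lower _ T R S S0 c c2 eta s _ _ eta01 bG (bounded_ge0_refl (2 * l) bG)).
- move=> r y' /andP[r0 _]; rewrite E//.
  have [yl|yl] := leP y' l.
    apply: (@le_trans _ _ 0); last by case/andP: eta01.
    by rewrite mulr_ge0_le0 ?expR_ge0// killed_sum_le0.
  apply: le_trans hq; rewrite [leRHS]mulrC; apply: ler_pM.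
  + exact: expR_ge0.
  + by apply: killed_sum_ge0 => //; exact: ltW.
  + by rewrite ler_expR lerN2 ler_pM2l// ltW.
  + by apply: killed_sum_le; exact: ltW.
- move=> y'; rewrite (_ : _ - _ = killed_sum j 0 y'); first exact: h.
  by rewrite -E// !gs0.
- by rewrite s0 lexx.
Qed.

(** Induction on the number of targets. In the window the initial bound is assumed. Elsewhere above
    [l] the new term is nonpositive at time 0, and the previous sum evolved over a time [D]
    suffices. Under [l] the claimed bound is nonpositive. *)
Lemma barrier_lower (N : nat) (S : nat -> seq (R * R)) :
  (forall j p, p \in S j -> 0 <= p.1) ->
  q * N%:R * expR (- (c * l)) <= eta ->
  (forall j, {subset shift c D (S j) <= S j.+1}) ->
  (forall j y, (0 < j <= N)%N -> a <= y <= b ->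
    hit_ge_always T (S j) 0 (- y) (expR (- (c * y)) * killed_sum j 0 y)) ->
  forall s y, 0 <= s -> hit_ge_always T (S N) s (- (c * s) - y)
    (expR (- (eta * s)) * (expR (- (c * y)) * killed_sum N s y)).
Proof.
move=> S0 hq hsub hwin s y s0; apply: killed_sum_evolution => //; first exact: S0.
have claim j : (j <= N)%N -> forall y, hit_ge_always T (S j) 0 (- y)
    (expR (- (c * y)) * killed_sum j 0 y).
  elim: j => [_ {}y|j IH jN {}y].
    by apply: hit_ge_always0; rewrite /killed_sum big_ord0 mulr0.
  have [yw|yw] := boolP (a <= y <= b); first by apply: hwin.
  have [yl|yl] := leP y l.
    by apply: hit_ge_always0; rewrite mulr_ge0_le0 ?expR_ge0// killed_sum_le0.
  have hqj : q * j%:R * expR (- (c * l)) <= eta.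
    apply: le_trans hq; rewrite ler_wpM2r ?expR_ge0// ler_wpM2l// ler_nat.
    exact: ltnW.
  have := @killed_sum_evolution (S j) j (S0 j) hqj (IH (ltnW jN)) D y D0.
  move=> ev; apply: (hit_ge_always_sub (hsub j)) => P tau B hB.
  rewrite hit_shift add0r (_ : - y - c * D = - (c * D) - y); last by lra.
  apply: le_trans (ev _ _ _ hB); rewrite lee_fin mulrCA ler_wpM2l ?expR_ge0//.
  rewrite killed_sum_step// add0r.
  have w0y : gs 0 (window a b) y = 0 by rewrite gs0 windowE (negbTE yw).
  have : 0 <= q * gs 0 (window a b) (2 * l - y) by rewrite mulr_ge0// gs_ge0.
  by rewrite /killed w0y; lra.
exact: claim.
Qed.

End barrier_lower.

Ltac positivity := repeat first [assumption | exact: expR_gt0 | exact: gauss0_gt0 |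
  apply: mulr_gt0 | rewrite invr_gt0 | rewrite sqrtr_gt0 | exact: ltr0Sn | by []].

(** * Lower bounds for killed kernels *)

Section kernel_estimates.
Context (R : realType).
Implicit Types (m t y : R).
Local Notation g0 := (@gauss0 R).

Lemma fraction_ge (k u v t : R) : 0 <= k -> 0 < t -> 0 < v -> v <= u -> u <= k * t ->
  v / ((k + 1) * t) <= u / (t + u).
Proof.
move=> k0 t0 v0 vu ut; have kt : 0 < (k + 1) * t by rewrite mulr_gt0//; lra.
rewrite ler_pdivrMr; last by lra.
rewrite mulrAC ler_pdivlMr; last by lra.
nra.
Qed.

Lemma sqrt_square_mul (x m : R) : 0 <= x -> 0 <= m ->
  Num.sqrt (x * (m * m)) = Num.sqrt x * m.
Proof. by move=> x0 m0; rewrite sqrtrM// -expr2 sqrtr_sqr ger0_norm. Qed.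

(** On the diffusive scale a depth [m] is covered in time [m^2]. For the leg between the targets and
    depth [m], killing costs a factor of order 1/m on top of the Gaussian 1/m. *)
Lemma killed_origin_ge m y : 1 <= m -> m <= y <= 2 * m ->
  g0 * expR (- (9 / 2)) * 2 / 9 / (m * m) <=
  killed (-2) (m * m) (window (-1) 0) y.
Proof.
move=> m1 /andP[my ym]; have m0 : 0 < m by lra.
have t0 : 0 < m * m by rewrite mulr_gt0.
have h (z : R) : -1 <= z <= 0 -> (z - y) ^+ 2 <= 2 * (9 / 2) * (m * m).
  move=> /andP[z1 z0]; have -> : 2 * (9 / 2) * (m * m) = (3 * m) ^+ 2 by rewrite expr2; lra.
  by rewrite -sqrrN lerXn2r ?nnegrE//; lra.
apply: le_trans (@killed_window_ge _ (-2) (m * m) (-1) 0 y (9 / 2) t0 _ _ _ h); [|lra|lra|lra].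
have f := @fraction_ge 8 (2 * (-1 - -2) * (y - -2)) (2 * m) (m * m) ltac:(lra) t0.
have {}f : 2 * m / ((8 + 1) * (m * m)) <= 2 * (-1 - -2) * (y - -2) / (m * m + 2 * (-1 - -2) * (y - -2)).
  by apply: f; nra.
have -> : Num.sqrt (m * m) = m by rewrite -[m * m]mul1r sqrt_square_mul ?(ltW m0)// sqrtr1 mul1r.
have A0 : 0 <= g0 * expR (- (9 / 2)) * (0 - -1) / m.
  by rewrite divr_ge0 ?(ltW m0)// !mulr_ge0 ?expR_ge0// ?(ltW (gauss0_gt0 R))//; lra.
apply: (le_trans _ (ler_wpM2l A0 f)).
rewrite le_eqVlt; apply/orP; left; apply/eqP; field; lra.
Qed.

(** The long leg, between depths of order [m] above a barrier at [m / 2]; it carries the decay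
    t^(-3/2). *)
Lemma killed_far_ge m t y : 1 <= m -> m * m <= t -> m <= y <= 2 * m ->
  g0 * expR (- (1 / 2)) * (m * m * m) / 10 / (t * Num.sqrt t) <=
  killed (m / 2) t (window m (2 * m)) y.
Proof.
move=> m1 mt /andP[my ym]; have m0 : 0 < m by lra.
have t0 : 0 < t by nra.
have h (z : R) : m <= z <= 2 * m -> (z - y) ^+ 2 <= 2 * (1 / 2) * t.
  move=> /andP[z1 z2]; apply: (@le_trans _ _ (m ^+ 2)); last by rewrite expr2; lra.
  by rewrite -real_normK ?num_real// lerXn2r ?nnegrE//; [lra|rewrite ler_norml; lra].
apply: le_trans (@killed_window_ge _ (m / 2) t m (2 * m) y (1 / 2) t0 _ _ _ h); [|lra|lra|lra].
have f := @fraction_ge 4 (2 * (m - m / 2) * (y - m / 2)) (m * m / 2) t ltac:(lra) t0.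
have {}f : m * m / 2 / ((4 + 1) * t) <= 2 * (m - m / 2) * (y - m / 2) / (t + 2 * (m - m / 2) * (y - m / 2)).
  by apply: f; nra.
have st0 : 0 < Num.sqrt t by rewrite sqrtr_gt0.
have A0 : 0 <= g0 * expR (- (1 / 2)) * (2 * m - m) / Num.sqrt t.
  by rewrite divr_ge0 ?(ltW st0)// !mulr_ge0 ?expR_ge0// ?(ltW (gauss0_gt0 R))//; lra.
apply: (le_trans _ (ler_wpM2l A0 f)).
rewrite le_eqVlt; apply/orP; left; apply/eqP; field.
by rewrite !gt_eqF.
Qed.

Lemma killed_descent_ge m y : 2 <= m -> 1 <= y <= 2 ->
  g0 * expR (- 2) * 2 / 5 / m <= killed 0 (m * m) (window m (2 * m)) y.
Proof.
move=> m2 /andP[y1 y2]; have m0 : 0 < m by lra.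
have t0 : 0 < m * m by rewrite mulr_gt0.
have h (z : R) : m <= z <= 2 * m -> (z - y) ^+ 2 <= 2 * 2 * (m * m).
  move=> /andP[z1 z2]; have -> : 2 * 2 * (m * m) = (2 * m) ^+ 2 by rewrite expr2; lra.
  by rewrite lerXn2r ?nnegrE//; lra.
apply: le_trans (@killed_window_ge _ 0 (m * m) m (2 * m) y 2 t0 _ _ _ h); [|lra|lra|lra].
have f := @fraction_ge 4 (2 * (m - 0) * (y - 0)) (2 * m) (m * m) ltac:(lra) t0.
have {}f : 2 * m / ((4 + 1) * (m * m)) <= 2 * (m - 0) * (y - 0) / (m * m + 2 * (m - 0) * (y - 0)).
  by apply: f; nra.
have -> : Num.sqrt (m * m) = m by rewrite -[m * m]mul1r sqrt_square_mul ?(ltW m0)// sqrtr1 mul1r.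
have A0 : 0 <= g0 * expR (- 2) * (2 * m - m) / m.
  by rewrite divr_ge0 ?(ltW m0)// !mulr_ge0 ?expR_ge0// ?(ltW (gauss0_gt0 R))//; lra.
apply: (le_trans _ (ler_wpM2l A0 f)).
rewrite le_eqVlt; apply/orP; left; apply/eqP; field; lra.
Qed.

(** Telescoping: each new term is at most the decrease of 2/sqrt. Convergence of this series keeps
    the superposition of arbitrarily many targets bounded. *)
Lemma sum_inv_three_halves j :
  \sum_(i < j.+1) ((i.+1)%:R * Num.sqrt (i.+1)%:R)^-1 <= 3 - 2 / Num.sqrt (j.+1)%:R :> R.
Proof.
elim: j => [|j IH]; first by rewrite big_ord1 sqrtr1 mulr1 !invr1; lra.
rewrite big_ord_recr /=; apply: (le_trans (lerD IH (lexx _))).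
set a := Num.sqrt (j.+1)%:R; set b := Num.sqrt (j.+2)%:R.
have a0 : 0 < a by rewrite sqrtr_gt0.
have b0 : 0 < b by rewrite sqrtr_gt0.
have a2 : a * a = j.+1%:R by rewrite -expr2 sqr_sqrtr.
have b2 : b * b = j.+2%:R by rewrite -expr2 sqr_sqrtr.
have ab : b * b = a * a + 1 by rewrite a2 b2 -natr1.
rewrite -b2.
have h : (b * b * b)^-1 <= 2 / a - 2 / b.
  have -> : 2 / a - 2 / b = (2 * (b - a)) / (a * b) by field; rewrite !gt_eqF.
  rewrite -[leLHS]mul1r ler_pdivrMr ?mulr_gt0// mulrAC ler_pdivlMr ?mulr_gt0//.
  have -> : 1 * (a * b) = (b - a) * (b + a) * (a * b) by congr (_ * _); lra.
  have ba : 0 < b - a by nra.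
  have : (b + a) * a <= 2 * (b * b) by nra.
  move=> k; rewrite -(@ler_pM2l _ (b - a))// in k.
  have := ler_wpM2r (ltW b0) k; lra.
lra.
Qed.

End kernel_estimates.

Section lower_tail.
Context d (T : measurableType d) (R : realType).
Hypothesis exists_bbm : exists (P : probability T R) (tau : seq bool -> {RV P >-> R})
  (B : seq bool -> R -> {RV P >-> R}), regular_bbm tau B.
Variable c : R.
Hypothesis c2 : c ^+ 2 = 2.
Hypothesis c0 : 0 < c.
Local Notation g0 := (@gauss0 R).

Let c12 : 1 <= c <= 2.
Proof.
apply/andP; split; rewrite -(@ler_pXn2r _ 2)// ?nnegrE ?(ltW c0)// c2.
  by rewrite expr1n; lra.
by rewrite expr2; lra.
Qed.

Lemma window_evolution (S : seq (R * R)) (l a b eta q : R) :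
  (forall p, p \in S -> 0 <= p.1) -> 0 <= eta <= 1 -> 0 <= q -> l < a ->
  q * expR (- (c * l)) <= eta ->
  (forall y, a <= y <= b -> hit_ge_always T S 0 (- y) (expR (- (c * y)) * q)) ->
  forall s y, 0 <= s -> hit_ge_always T S s (- (c * s) - y)
    (expR (- (eta * s)) * (expR (- (c * y)) * (q * killed l s (window a b) y))).
Proof.
move=> S0 eta01 q0 la hq h s y s0.
have E1 s' y' : killed_sum l 0 eta q a b 1 s' y' = q * killed l s' (window a b) y'.
  by rewrite /killed_sum big_ord1 mul0r mulr0 oppr0 expR0 mulr1 addr0.
rewrite -E1; apply: (killed_sum_evolution exists_bbm c2 c0 (lexx 0) eta01 q0 la) => //.
  by rewrite mulr1.
move=> y'; rewrite E1.
have [yw|yw] := boolP (a <= y' <= b).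
  apply: hit_ge_always_mono (h y' yw); rewrite ler_wpM2l ?expR_ge0//.
  rewrite -[leRHS]mulr1 ler_wpM2l// /killed !gs0 !windowE yw.
  by case: (a <= 2 * l - y' <= b) => /=; lra.
apply: hit_ge_always0; rewrite mulr_ge0_le0 ?expR_ge0// mulr_ge0_le0//.
rewrite /killed !gs0 !windowE (negbTE yw).
by case: (a <= 2 * l - y' <= b) => /=; lra.
Qed.

(** [expR (- 5)] collects the [expR (-4)] of the initial weight and a damping [expR (-1)]; the other
    factor comes from [killed_origin_ge]. *)
Definition kappa1 : R := expR (- 5) * (g0 * expR (- (9 / 2)) * 2 / 9).

Lemma kappa1_gt0 : 0 < kappa1.
Proof. by rewrite /kappa1 !mulr_gt0 ?expR_gt0 ?gauss0_gt0. Qed.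

Lemma kappa1_le1 : kappa1 <= 1.
Proof.
have g := gauss0_le R; have g' := gauss0_gt0 R.
have e (x : R) : 0 <= x -> 0 <= expR (- x) <= 1.
  by move=> x0; rewrite expR_ge0 -[leRHS]expR0 ler_expR oppr_le0.
have /andP[a0 a1] := e 5 ltac:(lra); have /andP[b0 b1] := e (9 / 2) ltac:(lra).
rewrite /kappa1 -[leRHS]mul1r; apply: ler_pM => //.
  by rewrite !mulr_ge0// ltW.
have : g0 * expR (- (9 / 2)) <= g0 * 1 by rewrite ler_wpM2l// ltW.
lra.
Qed.

Lemma reach_from_origin (m y : R) : 1 <= m -> m <= y <= 2 * m ->
  hit_ge_always T [:: (0, 0)] (m * m) (- (c * (m * m)) - y)
    (expR (- (c * y)) * (kappa1 / (m * m * (m * m)))).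
Proof.
move=> m1 my; have /andP[c1 c2'] := c12; have m0 : 0 < m by lra.
have t0 : 0 < m * m by rewrite mulr_gt0.
have t1 : 1 <= m * m by nra.
have S0 (p : R * R) : p \in [:: (0, 0)] -> 0 <= p.1 by rewrite inE => /eqP ->.
have tV0 : 0 <= (m * m)^-1 by rewrite invr_ge0 ltW.
have tV1 : (m * m)^-1 <= 1 by rewrite invf_le1.
(* With the barrier at -2 the tilt is at most [expR 4], so [q] times it stays below the damping rate
   [1 / m^2], whose total effect over the time [m^2] is [expR (-1)]. *)
pose q := expR (-4) * (m * m)^-1.
have q0 : 0 <= q by rewrite mulr_ge0// expR_ge0.
have hq : q * expR (- (c * -2)) <= (m * m)^-1.
  rewrite /q mulrAC -expRD -[leRHS]mul1r ler_wpM2r// -[leRHS]expR0 ler_expR; lra.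
have eta01 : 0 <= (m * m)^-1 <= 1 by rewrite tV0.
have h (y' : R) : -1 <= y' <= 0 ->
    hit_ge_always T [:: (0, 0)] 0 (- y') (expR (- (c * y')) * q).
  move=> /andP[y1 y0] P tau B hB.
  have -> : hit [:: (0, 0)] tau B 0 (- y') = setT.
    by apply/seteqP; split=> // w _; apply/(hit_origin _ w hB); lra.
  rewrite probability_setT lee_fin /q mulrA -expRD.
  apply: (@le_trans _ _ (1 * 1)); last by rewrite mulr1.
  by apply: ler_pM; rewrite ?expR_ge0// -[leRHS]expR0 ler_expR; nra.
have l1 : -2 < -1 :> R by lra.
apply: hit_ge_always_mono (window_evolution S0 eta01 q0 l1 hq h y (ltW t0)).
have tV : (m * m)^-1 * (m * m) = 1 by rewrite mulVf// gt_eqF.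
rewrite tV [leRHS]mulrCA ler_wpM2l ?expR_ge0//.
have k := killed_origin_ge m1 my.
have e0 : 0 <= expR (-1) * q by rewrite mulr_ge0 ?expR_ge0.
rewrite [leRHS]mulrA; apply: (le_trans _ (ler_wpM2l e0 k)).
rewrite /q /kappa1 (_ : - 5 = -1 + -4 :> R); last by lra.
rewrite expRD le_eqVlt; apply/orP; left; apply/eqP; field.
by rewrite gt_eqF.
Qed.

(** The points of abscissa [D], ..., [N * D] on the critical line. The iteration makes the shift of
    the first [j] targets a part of the first [j + 1], as [barrier_lower] requires. *)
Definition targets (D : R) (N : nat) : seq (R * R) :=
  iter N (fun S => (D, c * D) :: shift c D S) [::].

Lemma targetsP D N p : p \in targets D N ->
  exists2 i : nat, (0 < i <= N)%N & p = (i%:R * D, c * (i%:R * D)).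
Proof.
elim: N p => [|N IH] p //=; rewrite inE => /predU1P[->|/mapP[p' /IH[i /andP[i0 iN] ->] ->]].
  by exists 1%N; rewrite // mul1r.
exists i.+1; first by rewrite ltnS.
by rewrite /= -natr1; congr (_, _); lra.
Qed.

(** The present target contributes at most [q], and the one [i] steps away at most (9/4) i^(-3/2)
    [q]. The series is at most 3, so the total 1 + 27/4 is below 8 whatever the number of targets.
    Hence [q] can be an eighth of the single-target bound. *)
Lemma killed_sum_window_le (m q eta y : R) j : 1 <= m -> 0 <= eta <= 1 -> 0 <= q ->
  m <= y <= 2 * m ->
  killed_sum (m / 2) (m * m) eta q m (2 * m) j 0 y <= 8 * q.
Proof.
move=> m1 /andP[eta0 _] q0 /andP[my ym]; have m0 : 0 < m by lra.
have t0 : 0 < m * m by rewrite mulr_gt0.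
case: j => [|j]; first by rewrite /killed_sum big_ord0 mulr_ge0.
rewrite /killed_sum big_ord_recl mul0r mulr0 oppr0 expR0 mulr1 addr0.
have k0 : killed (m / 2) 0 (window m (2 * m)) y <= 1.
  rewrite /killed !gs0 !windowE.
  by case: (m <= y <= 2 * m); case: (m <= 2 * (m / 2) - y <= 2 * m) => /=; lra.
have ki (i : 'I_j) : q * expR (- (eta * ((lift ord0 i)%:R * (m * m)))) *
    killed (m / 2) (0 + (lift ord0 i)%:R * (m * m)) (window m (2 * m)) y <=
    q * (9 / 4) * ((i.+1)%:R * Num.sqrt (i.+1)%:R)^-1.
  rewrite /= /bump /= add1n add0r.
  have i0 : 0 < i.+1%:R :> R by [].
  have ti0 : 0 < i.+1%:R * (m * m) by rewrite mulr_gt0.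
  have h1 : m / 2 <= m by lra.
  have h2 : m <= 2 * m by lra.
  have h3 : m / 2 <= y by lra.
  have := killed_window_le ti0 h1 h2 h3.
  rewrite sqrt_square_mul ?(ltW i0) ?(ltW m0)//.
  have si0 : 0 < Num.sqrt i.+1%:R :> R by rewrite sqrtr_gt0.
  have hb : (2 * m - m) * (2 * m - m / 2) * (y - m / 2) /
      (i.+1%:R * (m * m) * (Num.sqrt i.+1%:R * m)) <= 9 / 4 * (i.+1%:R * Num.sqrt i.+1%:R)^-1.
    rewrite ler_pdivrMr; last by rewrite !mulr_gt0.
    have -> : 9 / 4 * (i.+1%:R * Num.sqrt i.+1%:R)^-1 *
        (i.+1%:R * (m * m) * (Num.sqrt i.+1%:R * m)) = (2 * m - m) * (2 * m - m / 2) * (3 / 2 * m).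
      by field; rewrite !gt_eqF.
    apply: ler_wpM2l; last by lra.
    by apply: mulr_ge0; lra.
  move=> /le_trans /(_ hb) kb; rewrite -mulrA -[leRHS]mulrA; apply: ler_wpM2l => //.
  have kn : 0 <= 9 / 4 * (i.+1%:R * Num.sqrt i.+1%:R)^-1 :> R.
    by apply: mulr_ge0; [lra|rewrite invr_ge0 mulr_ge0// sqrtr_ge0].
  set K := killed _ _ _ _ in kb *.
  have [K0|K0] := leP 0 K; last first.
    by apply: le_trans kn; rewrite mulr_ge0_le0 ?expR_ge0// ltW.
  apply: le_trans kb; rewrite ler_piMl// -[leRHS]expR0 ler_expR oppr_le0 mulr_ge0//.
  exact: ltW.
apply: (@le_trans _ _ (q * 1 + \sum_(i < j) q * (9 / 4) * ((i.+1)%:R * Num.sqrt (i.+1)%:R)^-1)).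
  by apply: lerD; [rewrite ler_wpM2l|apply: ler_sum => i _; exact: ki].
rewrite -mulr_sumr.
have hs : \sum_(i < j) ((i.+1)%:R * Num.sqrt (i.+1)%:R)^-1 <= 3 :> R.
  case: j {ki} => [|j]; first by rewrite big_ord0; lra.
  apply: le_trans (sum_inv_three_halves R j) _.
  by rewrite gerBl divr_ge0// sqrtr_ge0.
have : q * (9 / 4) * \sum_(i < j) ((i.+1)%:R * Num.sqrt (i.+1)%:R)^-1 <= q * (9 / 4) * 3.
  by rewrite ler_wpM2l// mulr_ge0//; lra.
lra.
Qed.

Lemma targets_ge0 (D : R) N : 0 <= D -> forall p, p \in targets D N -> 0 <= p.1.
Proof. by move=> D0 p /targetsP[i _ ->]; rewrite mulr_ge0. Qed.

(** 8 comes from [killed_sum_window_le], 10 from [killed_far_ge], and 4 from replacing times between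
    [s] and [2 * s] by [s]. One [expR (-1)] is the damping inside [killed_sum], the other the
    damping of the evolution. *)
Definition kappa2 : R := kappa1 / 8 * expR (-2) * (g0 * expR (- (1 / 2)) / 10) / 4.

Lemma kappa2_gt0 : 0 < kappa2.
Proof. have k1 := kappa1_gt0; rewrite /kappa2; positivity. Qed.

(** The [N] targets give comparable contributions of order m^3 s^(-3/2), each with a weight of order
    m^-4; the factor [N] is the gain over a single target. *)
Lemma reach_targets (m s y : R) N : 1 <= m -> N%:R * (m * m) <= s -> m * m <= s ->
  N%:R * expR (- (m / 2)) * s <= 1 -> m <= y <= 2 * m ->
  hit_ge_always T (targets (m * m) N) s (- (c * s) - y)
    (expR (- (c * y)) * (kappa2 * N%:R / (m * s * Num.sqrt s))).
Proof.
move=> m1 Ns ms Nms my; have /andP[c1 c2'] := c12; have m0 : 0 < m by lra.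
have t0 : 0 < m * m by rewrite mulr_gt0.
have t1 : 1 <= m * m by nra.
have s0 : 0 < s by lra.
have k1 := kappa1_gt0.
pose q := kappa1 / 8 / (m * m * (m * m)).
have q_gt0 : 0 < q by rewrite /q; positivity.
have q0 := ltW q_gt0.
(* Enough for the barrier at [m / 2], since [q <= 1] and [c >= 1]; over the time [s] this damping
   costs at most [expR (-1)] by hypothesis. *)
pose eta := N%:R * expR (- (m / 2)).
have eta0 : 0 <= eta by rewrite mulr_ge0 ?expR_ge0.
have etas : eta * s <= 1 by [].
have eta1 : eta <= 1 by nra.
have eta01 : 0 <= eta <= 1 by rewrite eta0.
have q1 : q <= 1.
  rewrite /q ler_pdivrMr; last by positivity.
  apply: (@le_trans _ _ 1); last by rewrite mul1r; nra.
  by have := kappa1_le1; lra.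
have hq : q * N%:R * expR (- (c * (m / 2))) <= eta.
  rewrite /eta; apply: ler_pM.
  - exact: (mulr_ge0 q0 (ler0n _ _)).
  - exact: expR_ge0.
  - exact: (ler_piMl (ler0n _ _) q1).
  - by rewrite ler_expR lerN2 ler_peMl//; lra.
have l1 : m / 2 < m by lra.
have S0 j (p : R * R) : p \in targets (m * m) j -> 0 <= p.1 by apply: targets_ge0; exact: ltW.
have hsub j : {subset shift c (m * m) (targets (m * m) j) <= targets (m * m) j.+1}.
  by move=> p pj; rewrite /= in_cons pj orbT.
have hwin j (y' : R) : (0 < j <= N)%N -> m <= y' <= 2 * m ->
    hit_ge_always T (targets (m * m) j) 0 (- y') (expR (- (c * y')) *
      killed_sum (m / 2) (m * m) eta q m (2 * m) j 0 y').
  move=> /andP[j0 _] my'.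
  have := reach_from_origin m1 my'.
  move=> h; apply: (@hit_ge_always_mono _ _ _ _ _ _ (expR (- (c * y')) * (kappa1 / (m * m * (m * m))))).
    rewrite ler_wpM2l ?expR_ge0//; apply: le_trans (killed_sum_window_le j m1 eta01 q0 my') _.
    rewrite /q; lra.
  apply: (@hit_ge_always_sub _ _ _ (shift c (m * m) [:: (0, 0)])).
    move=> p; rewrite !inE /= !add0r => /eqP ->.
    by case: j {h} j0 => // j _; rewrite /= in_cons eqxx.
  move=> P tau B hB; rewrite hit_shift add0r.
  by have := h _ _ _ hB; rewrite (_ : - y' - c * (m * m) = - (c * (m * m)) - y')//; lra.
have := barrier_lower exists_bbm c2 c0 (ltW t0) eta01 q0 l1 S0 hq hsub hwin y (ltW s0).
apply: hit_ge_always_mono; rewrite [leRHS]mulrCA ler_wpM2l ?expR_ge0//.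
have ss0 : 0 < Num.sqrt s by rewrite sqrtr_gt0.
pose v := q * expR (-1) * (g0 * expR (- (1 / 2)) * (m * m * m) / 10 / (4 * (s * Num.sqrt s))).
have term (i : 'I_N) : v <= q * expR (- (eta * (i%:R * (m * m)))) *
    killed (m / 2) (s + i%:R * (m * m)) (window m (2 * m)) y.
  have iN : i%:R * (m * m) <= s.
    by apply: le_trans Ns; rewrite ler_wpM2r ?(ltW t0)// ler_nat ltnW.
  have iD0 : 0 <= i%:R * (m * m) by rewrite mulr_ge0// ltW.
  set t := s + i%:R * (m * m).
  have mt : m * m <= t by rewrite /t; lra.
  have tp : 0 < t by lra.
  have k := killed_far_ge m1 mt my.
  have kk : g0 * expR (- (1 / 2)) * (m * m * m) / 10 / (4 * (s * Num.sqrt s)) <=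
     killed (m / 2) t (window m (2 * m)) y.
    apply: le_trans k; rewrite ler_wpM2l//.
      by apply: ltW; positivity.
    rewrite lef_pV2 ?posrE ?mulr_gt0 ?sqrtr_gt0//.
    have t2 : t <= 2 * s by rewrite /t; lra.
    have st : Num.sqrt t <= 2 * Num.sqrt s.
      rewrite -[2 * _](@ger0_norm R) ?mulr_ge0 ?(ltW ss0)// -sqrtr_sqr.
      by apply: ler_wsqrtr; rewrite exprMn sqr_sqrtr ?ltW// expr2; lra.
    have : t * Num.sqrt t <= (2 * s) * (2 * Num.sqrt s).
      by apply: ler_pM; rewrite ?(ltW tp) ?sqrtr_ge0.
    lra.
  have k0 : 0 <= g0 * expR (- (1 / 2)) * (m * m * m) / 10 / (4 * (s * Num.sqrt s)).
    by apply: ltW; positivity.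
  have ei : eta * (i%:R * (m * m)) <= eta * s := ler_wpM2l eta0 iN.
  rewrite /v -(mulrA q) -(mulrA q); apply: (ler_wpM2l q0); apply: ler_pM => //.
  by rewrite ler_expR; lra.
have sumv : N%:R * v <= killed_sum (m / 2) (m * m) eta q m (2 * m) N s y.
  rewrite mulr_natl -[X in _ *+ X](card_ord N) -sumr_const; apply: ler_sum => i _.
  exact: term.
have e1 : expR (-1) <= expR (- (eta * s)) by rewrite ler_expR; lra.
have v0 : 0 <= v by apply: ltW; rewrite /v; positivity.
apply: (@le_trans _ _ (expR (-1) * (N%:R * v))); last first.
  by apply: ler_pM; rewrite ?expR_ge0// mulr_ge0.
rewrite /v /q /kappa2 (_ : -2 = -1 + -1 :> R); last by lra.
rewrite expRD le_eqVlt; apply/orP; left; apply/eqP; field.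
by rewrite !gt_eqF.
Qed.

Definition kappa3 : R := kappa2 * expR (- 5) * (g0 * expR (- 2) * 2 / 5).

Lemma kappa3_gt0 : 0 < kappa3.
Proof. have k2 := kappa2_gt0; rewrite /kappa3; positivity. Qed.

Lemma kappa2_le1 : kappa2 <= 1.
Proof.
have g := gauss0_le R; have g' := gauss0_gt0 R.
have k1 := kappa1_le1; have k1' := kappa1_gt0.
have e (x : R) : 0 <= x -> 0 <= expR (- x) <= 1.
  by move=> x0; rewrite expR_ge0 -[leRHS]expR0 ler_expR oppr_le0.
have /andP[a0 a1] := e 2 ltac:(lra); have /andP[b0 b1] := e (1 / 2) ltac:(lra).
have h1 : kappa1 / 8 * expR (-2) <= 1.
  by rewrite -[leRHS]mul1r; apply: ler_pM => //; lra.
have h2 : g0 * expR (- (1 / 2)) <= 1 * 1 by apply: ler_pM => //; lra.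
have h3 : 0 <= kappa1 / 8 * expR (-2) by apply: ltW; positivity.
have h4 : 0 <= g0 * expR (- (1 / 2)) by apply: ltW; positivity.
rewrite /kappa2 -mulrA -[leRHS]mul1r; apply: ler_pM => //; lra.
Qed.

(** A further killed flow, with barrier 0 over a time [m^2], joins depth 1 to the window between [m]
    and [2 * m], where [reach_targets] takes over. *)
Lemma lower_tail (m s : R) N : 2 <= m -> N%:R * (m * m) <= s -> m * m <= s ->
  N%:R * expR (- (m / 2)) * s <= 1 ->
  hit_ge_always T (targets (m * m) N) (s + m * m) (- (c * (s + m * m)) - 1)
    (kappa3 * N%:R / (m * m * s * Num.sqrt s)).
Proof.
move=> m2 Ns ms Nms; have /andP[c1 c2'] := c12; have m1 : 1 <= m by lra.
have m0 : 0 < m by lra.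
have t0 : 0 < m * m by rewrite mulr_gt0.
have t1 : 1 <= m * m by nra.
have s0 : 0 < s by lra.
have s1 : 1 <= Num.sqrt s by rewrite -[leLHS]sqrtr1 ler_wsqrtr//; lra.
have ss0 : 0 < Num.sqrt s by lra.
have k2 := kappa2_gt0.
pose q := kappa2 * N%:R / (m * s * Num.sqrt s).
have den0 : 0 < m * s * Num.sqrt s by rewrite !mulr_gt0.
have q0 : 0 <= q by rewrite /q divr_ge0 ?(ltW den0)// mulr_ge0// ltW.
have hq : q <= (m * m)^-1.
  rewrite /q ler_pdivrMr// [leRHS]mulrC ler_pdivlMr//.
  have h1 : kappa2 * N%:R <= N%:R by rewrite ler_piMl// kappa2_le1.
  have h2 : kappa2 * N%:R * (m * m) <= s.
    by apply: le_trans Ns; rewrite ler_wpM2r// ltW.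
  apply: (le_trans h2); rewrite -[leLHS]mul1r -[leLHS]mulr1.
  by apply: ler_pM => //; rewrite ?mul1r ?(ltW s0)//; apply: ler_peMl; lra.
have tV0 : 0 <= (m * m)^-1 by rewrite invr_ge0 ltW.
have eta01 : 0 <= (m * m)^-1 <= 1 by rewrite tV0 invf_le1.
pose S := shift c s (targets (m * m) N).
have S0 (p : R * R) : p \in S -> 0 <= p.1.
  apply: shift_ge0; first exact: ltW.
  by apply: targets_ge0; exact: ltW.
have h (y : R) : m <= y <= 2 * m -> hit_ge_always T S 0 (- y) (expR (- (c * y)) * q).
  move=> my P tau B hB; rewrite hit_shift add0r.
  have := reach_targets m1 Ns ms Nms my hB.
  by rewrite (_ : - y - c * s = - (c * s) - y)//; lra.
have hq0 : q * expR (- (c * 0)) <= (m * m)^-1 by rewrite mulr0 oppr0 expR0 mulr1.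
have := window_evolution S0 eta01 q0 m0 hq0 h 1 (ltW t0).
move=> H P tau B hB; have := H _ _ _ hB; rewrite hit_shift.
have -> : m * m + s = s + m * m by rewrite addrC.
have -> : - (c * (m * m)) - 1 - c * s = - (c * (s + m * m)) - 1 by lra.
apply: le_trans; rewrite lee_fin.
have tV : (m * m)^-1 * (m * m) = 1 by rewrite mulVf// gt_eqF.
rewrite tV mulr1.
have y12 : 1 <= (1 : R) <= 2 by apply/andP; split; lra.
have k := killed_descent_ge m2 y12.
have ec : expR (-5) <= expR (-1) * expR (- c).
  by rewrite -expRD ler_expR; lra.
have q0' : 0 <= q * (g0 * expR (-2) * 2 / 5 / m).
  by rewrite mulr_ge0//; apply: ltW; positivity.
rewrite mulrA; apply: (@le_trans _ _ (expR (-5) * (q * (g0 * expR (-2) * 2 / 5 / m)))).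
  rewrite /q /kappa3 le_eqVlt; apply/orP; left; apply/eqP; field.
  by rewrite !gt_eqF.
by apply: ler_pM => //; exact: ler_wpM2l.
Qed.

End lower_tail.

(** * From small to overwhelming hitting probabilities *)

Section climb.
Context d (T : measurableType d) (R : realType).
Variable c : R.
Hypothesis c2 : c ^+ 2 = 2.
Hypothesis c0 : 0 < c.
Local Notation g0 := (@gauss0 R).

Let c12 : 1 <= c <= 2.
Proof.
apply/andP; split; rewrite -(@ler_pXn2r _ 2)// ?nnegrE ?(ltW c0)// c2.
  by rewrite expr1n; lra.
by rewrite expr2; lra.
Qed.

Lemma gs_half_line_ge (t x0 x : R) : 0 < t -> x <= x0 ->
  g0 / Num.sqrt t * expR (- (x0 - x + 1) ^+ 2 / (t *+ 2)) <=
  gs t \1_(`[x0, +oo[%classic) x.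
Proof.
move=> t0 xx0.
apply: (@le_trans _ _ (gs t (window x0 (x0 + 1)) x)); last first.
  apply: le_gs; [exact: bounded_ge0_window|exact: bounded_ge0_indic|move=> z].
  rewrite windowE indicE; case: (boolP (x0 <= z <= x0 + 1)) => [/andP[h _]|_].
    by rewrite mem_set//= in_itv /= andbT.
  exact: ler0n.
have x01 : x0 <= x0 + 1 by lra.
have A0 : 0 <= g0 / Num.sqrt t by rewrite divr_ge0 ?sqrtr_ge0// ltW// gauss0_gt0.
have m0 : 0 <= g0 / Num.sqrt t * expR (- (x0 - x + 1) ^+ 2 / (t *+ 2)).
  by rewrite mulr_ge0// expR_ge0.
have := @gs_window_lower _ t 0 x0 (x0 + 1) x x _ t0 x01 m0 (lexx 0).
have -> : x0 + 1 - x0 = 1 by lra.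
rewrite mul0r add0r mulr1; apply=> z /andP[z1 z2]; rewrite mul0r add0r gaussE//.
rewrite ler_wpM2l// ler_expR !mulNr lerN2 ler_pM2r ?invr_gt0 ?pmulrn_lgt0//.
by rewrite lerXn2r ?nnegrE//; lra.
Qed.

(** The linear solution from [p] times the indicator of a half-line stays below [eta] as long as
    [p * expR L <= eta], so [hit_lower] applies with [f2 = 0], without a barrier. *)
Lemma growth_block (S : seq (R * R)) (s x x0 L eta p : R) :
  (forall a, a \in S -> 0 <= a.1) -> 0 <= s -> 0 < L -> 0 <= eta <= 1 -> 0 <= p ->
  p * expR L <= eta -> x <= x0 ->
  hit_ge_always T S s x0 p ->
  hit_ge_always T S (s + L) x (expR ((1 - eta) * L) * p *
    (g0 / Num.sqrt L * expR (- (x0 - x + 1) ^+ 2 / (L *+ 2)))).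
Proof.
move=> S0 s0 L0 eta01 p0 pL xx0 h.
pose S' := shift c s S.
have S'0 : forall a, a \in S' -> 0 <= a.1 := shift_ge0 s0 S0.
pose ind : R -> R := \1_(`[x0 + c * s, +oo[%classic).
have bind : bounded_ge0 ind by exact: bounded_ge0_indic.
have bf : bounded_ge0 (fun z => p * ind z) := bounded_ge0Z p0 bind.
have mf := bounded_ge0_measurable bf.
have f0 z := bounded_ge0_ge0 z bf.
have m0 : measurable_fun [set: R] (cst (0 : \bar R)%E) by exact: measurable_cst.
have := @hit_lower _ T R S' S'0 eta L _ (cst 0%E) eta01 mf f0 m0 (fun _ => lexx _).
move=> H P tau B hB.
have H1 : (forall r y : R, (0 <= r <= L)%R -> (expR ((1 - eta) * r))%:E *
    heat r (EFin \o (fun z => p * ind z)%R) y <=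
    (expR ((1 - eta) * r))%:E * heat r (cst 0) y + eta%:E)%E.
  move=> r y /andP[r0 rL]; rewrite heat_cst// mule0 add0e gsE// -EFinM lee_fin.
  rewrite (gsZ r y p0 bind); apply: le_trans pL; rewrite mulrC -mulrA; apply: ler_wpM2l => //.
  rewrite -[leRHS]mul1r; apply: ler_pM; rewrite ?expR_ge0 ?gs_ge0//.
    rewrite -(gs_cst r y (ler01 : 0 <= 1 :> R));
      apply: le_gs; [exact: bind|exact: (bounded_ge0_cst ler01)|move=> z].
    by rewrite /ind indicE /=; case: (_ \in _); rewrite ?lexx ?ler01.
  by rewrite ler_expR; case/andP: eta01 => *; nra.
have H2 : forall (P : probability T R) (tau : seq bool -> {RV P >-> R})
    (B : seq bool -> R -> {RV P >-> R}), regular_bbm tau B -> forall y : R,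
    ((EFin \o (fun z => p * ind z)%R) y <= P (hit S' tau B 0 y) + cst 0 y)%E.
  move=> P' tau' B' hB' y; rewrite adde0 /= /ind indicE.
  have [yx|yx] := leP (x0 + c * s) y; last first.
    by rewrite memNset ?mulr0//= in_itv /= andbT; apply/negP; rewrite -ltNge.
  rewrite mem_set; last by rewrite /= in_itv /= andbT.
  rewrite mulr1 /S' hit_shift add0r.
  have xy : x0 <= y - c * s by lra.
  exact: (hit_ge_always_le xy h hB').
have LL : 0 <= L <= L by rewrite lexx ltW.
have := H H1 H2 _ _ _ hB L (x + c * s) LL.
rewrite heat_cst// mule0 adde0 gsE// -EFinM /S' hit_shift.
have -> : L + s = s + L by rewrite addrC.
have -> : x + c * s - c * s = x by lra.
apply: le_trans; rewrite lee_fin (gsZ L _ p0 bind) [leRHS]mulrA.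
apply: ler_wpM2l; first by rewrite mulr_ge0// expR_ge0.
have -> : x0 - x = (x0 + c * s) - (x + c * s) by lra.
by apply: gs_half_line_ge => //; lra.
Qed.

(** As [c^2 = 2], at slope [c - e] and with damping [e^2 / 4] the exponent over a time [L] is (c -
    e) e L + e^2 L / 4 up to constants. The surplus e^2 L / 4 beats the prefactor of order L^(-1/2)
    for large [L]. *)
Lemma growth_rate (e : R) : 0 < e <= 1 / 2 -> exists L, 0 < L /\
  expR ((c - e) * (e * L)) <= expR ((1 - e ^+ 2 / 4) * L) *
    (g0 / Num.sqrt L * expR (- ((c - e) * L + 1) ^+ 2 / (L *+ 2))).
Proof.
move=> /andP[e0 e1]; have /andP[c1 c2'] := c12.
have g := gauss0_gt0 R.
pose a := e ^+ 2 / 4.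
have a0 : 0 < a by rewrite divr_gt0// exprn_gt0.
(* Chosen to use expR x >= x^2 / 2 at x = a L, against the constant [expR 3] and the bound
   [Num.sqrt L <= L]. *)
pose L := 1 + 2 * expR 3 / (g0 * a ^+ 2).
have K0 : 0 < 2 * expR 3 / (g0 * a ^+ 2).
  by rewrite divr_gt0// mulr_gt0 ?expR_gt0// exprn_gt0.
have L1 : 1 <= L by rewrite /L; lra.
have L0 : 0 < L by lra.
exists L; split => //.
have sL : Num.sqrt L <= L.
  rewrite -[leRHS](@ger0_norm R) ?(ltW L0)// -sqrtr_sqr ler_wsqrtr// expr2; nra.
have sL0 : 0 < Num.sqrt L by rewrite sqrtr_gt0.
have -> : expR ((1 - e ^+ 2 / 4) * L) * (g0 / Num.sqrt L *
    expR (- ((c - e) * L + 1) ^+ 2 / (L *+ 2))) =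
  g0 / Num.sqrt L * expR ((1 - e ^+ 2 / 4) * L - ((c - e) * L + 1) ^+ 2 / (L *+ 2)).
  by rewrite mulrCA -expRD mulNr.
have -> : (1 - e ^+ 2 / 4) * L - ((c - e) * L + 1) ^+ 2 / (L *+ 2) =
    (c - e) * (e * L) + (a * L + (1 - c ^+ 2 / 2) * L - (c - e) - (L *+ 2)^-1).
  by rewrite /a; field; lra.
rewrite c2 expRD [leRHS]mulrCA -[leLHS]mulr1; apply: ler_wpM2l; first exact: expR_ge0.
have h3 : - 3 <= (1 - 2 / 2) * L - (c - e) - (L *+ 2)^-1.
  have : (L *+ 2)^-1 <= 1 by rewrite invf_le1 ?pmulrn_lgt0//; lra.
  lra.
have h4 : (a * L) ^+ 2 / 2 <= expR (a * L).
  have := @expR_ge1Dxn _ (a * L) 1 ltac:(rewrite mulr_ge0// ltW//).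
  by rewrite (_ : (2`!)%:R = 2 :> R)//; lra.
have h5 : expR 3 * L <= g0 * ((a * L) ^+ 2 / 2).
  have : 2 * expR 3 <= g0 * a ^+ 2 * L.
    rewrite -ler_pdivrMl ?mulr_gt0 ?exprn_gt0// mulrC /L; lra.
  move=> /(ler_wpM2r (ltW L0)).
  have -> : (a * L) ^+ 2 = a ^+ 2 * L * L by rewrite !expr2; ring.
  lra.
apply: (@le_trans _ _ (g0 / Num.sqrt L * (expR (a * L) * expR (- 3)))); last first.
  apply: ler_wpM2l; first by apply: ltW; positivity.
  by rewrite -expRD ler_expR; lra.
rewrite expRN mulrA ler_pdivlMr ?expR_gt0// mul1r mulrAC ler_pdivlMr//.
apply: (@le_trans _ _ (expR 3 * L)); first by rewrite ler_wpM2l// expR_ge0.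
apply: (le_trans h5); rewrite ler_wpM2l// ltW//.
Qed.

(* Along a line of slope [c - e] the linear equation has a positive growth rate, so a
   hitting probability [exp (-l)] can be raised to a constant within a time linear in
   [l]; this costs [l / (c - e)] in height. *)
Lemma climb (e : R) : 0 < e <= 1 / 2 -> exists p0 L : R, [/\ 0 < p0, p0 <= 1, 0 < L &
  forall (S : seq (R * R)) (s1 s2 z l : R),
  (forall a, a \in S -> 0 <= a.1) -> 0 <= s1 -> 0 <= l ->
  (forall s, s1 <= s <= s2 -> hit_ge_always T S s (- (c * s) + z) (expR (- l))) ->
  forall s, s1 + l / (c - e) / e + L <= s <= s2 ->
  hit_ge_always T S s (- (c * s) + z + l / (c - e) + e * L) p0].
Proof.
move=> e01; have [L [L0 rate]] := growth_rate e01; have /andP[e0 e1] := e01.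
have /andP[c1 c2'] := c12.
pose eta := e ^+ 2 / 4.
have eta0 : 0 < eta by rewrite divr_gt0// exprn_gt0.
have eta1 : eta <= 1 by rewrite /eta expr2; nra.
have eta01 : 0 <= eta <= 1 by rewrite (ltW eta0).
have ce : 0 < c - e by lra.
pose g := (c - e) * (e * L).
have g_gt0 : 0 < g by rewrite !mulr_gt0.
have p1 : eta * expR (- L) <= 1.
  by rewrite -[leRHS]mul1r; apply: ler_pM; rewrite ?expR_ge0 ?(ltW eta0)//
    -[leRHS]expR0 ler_expR; lra.
exists (eta * expR (- L)), L; split => //; first by rewrite mulr_gt0// expR_gt0.
move=> S s1 s2 z l S0 s1_0 l0.
have [n nl] : exists n : nat, l <= n%:R * g.
  exists (Num.bound (l / g)); rewrite -ler_pdivrMr//.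
  by apply: ltW; apply: archi_boundP; rewrite divr_ge0// ltW.
elim: n s1 z l nl s1_0 l0 => [|n IH] s1 z l nl s1_0 l0 h s /andP[ss1 ss2].
  have l00 : l = 0 by apply/eqP; rewrite eq_le l0 andbT -[leRHS](mul0r g).
  move: ss1; rewrite l00 !mul0r !addr0 => ss1.
  have ss : s1 <= s <= s2 by rewrite ss2 andbT; lra.
  apply: (@hit_ge_always_le _ _ _ _ _ (- (c * s) + z)); first by nra.
  apply: hit_ge_always_mono (h s ss); rewrite l00 oppr0 expR0//.
have lce0 : 0 <= l / (c - e) by rewrite divr_ge0// ltW.
have lcee0 : 0 <= l / (c - e) / e by rewrite divr_ge0// ltW.
have eL0 : 0 < e * L by rewrite mulr_gt0.
(* Either the probability has already reached the constant, or the condition of [growth_block] holds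
   and one block of length [L] lowers [l] by [g]. *)
have [pl|pl] := leP (eta * expR (- L)) (expR (- l)).
  have ss : s1 <= s <= s2 by rewrite ss2 andbT; lra.
  apply: (@hit_ge_always_le _ _ _ _ _ (- (c * s) + z)); first by lra.
  exact: (hit_ge_always_mono pl (h s ss)).
have lL : L < l.
  have : expR (- l) < expR (- L).
    by apply: (lt_le_trans pl); rewrite ler_piMl// expR_ge0.
  by rewrite ltr_expR ltrN2.
have gL : g <= L by rewrite /g mulrA ler_piMl ?(ltW L0)//; nra.
have lg0 : 0 <= l - g by lra.
have nl' : l - g <= n%:R * g by move: nl; rewrite -natr1 mulrDl mul1r; lra.
have gce : g / (c - e) = e * L by rewrite /g; field; lra.
have eE : (l - g) / (c - e) = l / (c - e) - e * L by rewrite mulrBl gce.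
have eE' : (l - g) / (c - e) / e = l / (c - e) / e - L.
  by rewrite eE mulrBl (mulrC e) mulfK// gt_eqF.
have s1L : 0 <= s1 + L by lra.
have h' s' : s1 + L <= s' <= s2 ->
    hit_ge_always T S s' (- (c * s') + (z + e * L)) (expR (- (l - g))).
  move=> /andP[s1s' s's2].
  have sL : s1 <= s' - L <= s2 by apply/andP; split; lra.
  have sL0 : 0 <= s' - L by lra.
  have pL : expR (- l) * expR L <= eta.
    by rewrite -ler_pdivlMr ?expR_gt0// -expRN ltW.
  have xx0 : - (c * s') + (z + e * L) <= - (c * (s' - L)) + z by nra.
  have := growth_block S0 sL0 L0 eta01 (expR_ge0 _) pL xx0 (h _ sL).
  have -> : s' - L + L = s' by lra.
  have -> : - (c * (s' - L)) + z - (- (c * s') + (z + e * L)) = (c - e) * L by lra.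
  apply: hit_ge_always_mono; rewrite [expR ((1 - eta) * L) * expR (- l)]mulrC -[leRHS]mulrA.
  have -> : expR (- (l - g)) = expR (- l) * expR g by rewrite -expRD; congr expR; lra.
  by apply: ler_wpM2l; [exact: expR_ge0|exact: rate].
have ss : s1 + L + (l - g) / (c - e) / e + L <= s <= s2.
  by rewrite eE' ss2 andbT; lra.
have := IH _ _ _ nl' s1L lg0 h' s ss.
rewrite eE; congr (hit_ge_always T S s _ _); lra.
Qed.

End climb.

Section exponential_integrals.
Context (R : realType).
Local Notation mu := (@lebesgue_measure R).

Lemma integral_exponential_moment (q : R) : q < 1 ->
  (\int[mu]_t ((expR (q * t))%:E * (exponential_pdf 1 t)%:E) = ((1 - q)^-1)%:E)%E.
Proof.
move=> q1; have q1' : 0 < 1 - q by rewrite subr_gt0.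
transitivity (\int[mu]_t (((1 - q)^-1)%:E * (exponential_pdf (1 - q) t)%:E))%E.
  have E (t : R) : expR (q * t) * exponential_pdf 1 t =
      (1 - q)^-1 * exponential_pdf (1 - q) t.
    have [t0|t0] := ltP t 0; first by rewrite !lt0_exponential_pdf// !mulr0.
    rewrite !exponential_pdfE// mul1r [RHS]mulrA mulVf ?gt_eqF//.
    by rewrite mul1r -expRD; congr expR; lra.
  by apply: eq_integral => t _; rewrite -!EFinM E.
have mp : measurable_fun [set: measurableTypeR R] (EFin \o @exponential_pdf R (1 - q)).
  by apply/measurable_EFinP; exact: measurable_exponential_pdf.
rewrite ge0_integralZl// ?integral_exponential_pdf ?mule1//.
- by move=> x _; rewrite lee_fin exponential_pdf_ge0// ltW.
- by rewrite lee_fin invr_ge0 ltW.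
Qed.

Lemma integral_heat_cst (k : R) : 0 <= k ->
  (\int[mu]_t (heat t (cst k%:E) 0 * (exponential_pdf 1 t)%:E) = k%:E)%E.
Proof.
move=> k0; transitivity (\int[mu]_t (k%:E *
   ((expR (0 * t))%:E * (exponential_pdf 1 t)%:E)))%E.
  by apply: eq_integral => t _; rewrite heat_cst// mul0r expR0 mul1e.
have mp : measurable_fun [set: R] (fun t : R => (expR (0 * t))%:E * (exponential_pdf 1 t)%:E)%E.
  apply: emeasurable_funM; apply/measurable_EFinP; last exact: measurable_exponential_pdf.
  by apply: measurableT_comp => //; exact: measurable_funM.
rewrite (@ge0_integralZl _ _ _ mu setT measurableT)//.
- by rewrite integral_exponential_moment// subr0 invr1 mule1.
- by move=> x _; rewrite mule_ge0// lee_fin ?expR_ge0// exponential_pdf_ge0.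
Qed.

End exponential_integrals.

Section root_bound.
Context d (T : measurableType d) (R : realType) (P : probability T R).
Variables (tau : seq bool -> {RV P >-> R}) (B : seq bool -> R -> {RV P >-> R}).
Hypothesis hB : regular_bbm tau B.
Local Notation G := (driving_sigma tau (fun u => B u)).
Local Notation mu := (@lebesgue_measure R).

(** The splitting of the root in the form used for inequalities; only lifetimes [r >= 0] count
    because the exponential density vanishes elsewhere. *)
Lemma root_bound (E : bool -> set (R * R * T)) (K : R -> R -> \bar R) (A : set T) :
  (forall b J, descendants b `<=` J -> measurable
    (E b : set (R * R * g_sigma_algebraType (\bigcup_(i in J) G i)))) ->
  measurable_fun [set: R * R] (fun z => K z.1 z.2) -> (forall r y, (0 <= K r y)%E) ->
  (forall r y, 0 <= r ->
    (P [set w | E false (r, y, w)] * P [set w | E true (r, y, w)] <= K r y)%E) ->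
  measurable A ->
  A `<=` [set w | forall b, E b (tau [::] w, B [::] (tau [::] w) w, w)] ->
  (P A <= \int[mu]_t (heat t (K t) 0 * (exponential_pdf 1 t)%:E))%E.
Proof.
move=> mE mK K0 HK mA AE.
have mid : measurable_fun setT
    (id : T -> g_sigma_algebraType (\bigcup_(i in setT) G i)).
  move=> _ C sC; rewrite setTI.
  apply: g_sigma_algebra_sub_measurable sC => D [i _] GD.
  apply: (driving_sigma_measurable _ _ GD) => [u|u t _]; exact: measurable_funPT.
have mET b : measurable (E b : set (R * R * T)).
  have m1 : measurable_fun [set: (R * R) * T] (fun z => (z.1,
      z.2 : g_sigma_algebraType (\bigcup_(i in setT) G i))).
    apply: measurable_fun_pair; first exact: measurable_fst.
    exact: (measurableT_comp mid measurable_snd).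
  have := m1 measurableT _ (mE b setT (@subsetT _ _)); rewrite setTI; congr (measurable _).
  by apply/seteqP; split=> -[].
have mB : measurable_fun setT (fun w => B [::] (tau [::] w) w).
  apply: (eq_measurable_fun (fun w => B [::] (Num.max (tau [::] w) 0) w)).
    by move=> w _; rewrite max_l// ltW// (lifetime_gt0 hB).
  apply: (@measurable_process_comp _ T _ (B [::]) _ T (tau [::]) id) => //.
  by move=> w; exact: (motion_continuous hB).
have mI b : measurable [set w | E b (tau [::] w, B [::] (tau [::] w) w, w)].
  have m3 : measurable_fun [set: T] (fun w => (tau [::] w, B [::] (tau [::] w) w, w)).
    by apply: measurable_fun_pair => //; exact: measurable_fun_pair.
  by have := m3 measurableT _ (mET b); rewrite setTI.
pose H r y := (P [set w | E false (r, y, w)] * P [set w | E true (r, y, w)])%E.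
have H0 r y : (0 <= H r y)%E by exact: mule_ge0.
have mH : measurable_fun [set: R * R] (fun z => H z.1 z.2).
  have mS b : measurable_fun [set: R * R] (fun z => P [set w | E b (z.1, z.2, w)]).
    have := @measurable_fun_xsection _ _ _ _ _ P _ (mET b).
    congr (measurable_fun _); apply/funext => -[t y] /=.
    by rewrite xsectionE.
  exact: emeasurable_funM.
have slice (k : R -> R -> \bar R) r : measurable_fun [set: R * R] (fun z => k z.1 z.2) ->
    measurable_fun [set: R] (k r).
  by move=> mk; apply: (@measurableT_comp _ _ _ _ _ _ (fun z : R * R => k z.1 z.2) setT (pair r)).
have mint (k : R -> R -> \bar R) : measurable_fun [set: R * R] (fun z => k z.1 z.2) ->
    (forall r y, 0 <= k r y)%E ->
    measurable_fun [set: R] (fun t => heat t (k t) 0 * (exponential_pdf 1 t)%:E)%E.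
  move=> mk k0; apply: emeasurable_funM.
    by apply: (@measurable_heat R _ R id (cst 0) (fun z => k z.1 z.2)).
  by apply/measurable_EFinP; exact: measurable_exponential_pdf.
have pdf0 (t : R) : (0 <= (exponential_pdf 1 t)%:E)%E by rewrite lee_fin exponential_pdf_ge0.
apply: (@le_trans _ _ (\int[mu]_t (heat t (H t) 0 * (exponential_pdf 1 t)%:E))%E).
  rewrite -(root_decomposition hB mE); apply: le_measure; rewrite ?inE => //.
  have -> : [set w | forall b, E b (tau [::] w, B [::] (tau [::] w) w, w)] =
    [set w | E false (tau [::] w, B [::] (tau [::] w) w, w)] `&`
    [set w | E true (tau [::] w, B [::] (tau [::] w) w, w)].
    by apply/seteqP; split=> w /= => [h|[h1 h2] []].
  exact: measurableI.
apply: (@ge0_le_integral _ _ _ mu setT measurableT).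
- by move=> t _; apply: mule_ge0 => //; exact: heat_ge0.
- exact: (mint H mH H0).
- exact: (mint K mK K0).
move=> t _; have [t0|t0] := ltP t 0.
  by rewrite lt0_exponential_pdf// !mule0.
apply: lee_wpmul2r => //; apply: le_heat => //; [exact: (slice H)|exact: (slice K)|].
by move=> z; exact: HK.
Qed.

End root_bound.

(** * Birth times and birth positions of a whole generation *)

Section generations.
Context {T : Type} {R : realType}.
Implicit Types (tau : seq bool -> T -> R) (B : seq bool -> R -> T -> R).

(** One recursion serves several purposes: (1, 0) bounds birth times from above, (c, -1) the deficit
    with respect to the critical line, and (-7, 0) birth times from below. *)
Definition generation_below (a b : R) (g : nat) tau B (s : R) : set T :=
  [set w | forall v, size v = g ->
    a * birth_time tau v w + b * birth_position tau B v w <= s].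

Lemma generation_below0 a b tau B s w :
  generation_below a b 0 tau B s w <-> 0 <= s.
Proof.
split=> [/(_ [::] erefl)|s0 v /size0nil ->];
  by rewrite birth_time_nil birth_position_nil !mulr0 addr0.
Qed.

Lemma generation_belowS a b g tau B s w :
  generation_below a b g.+1 tau B s w <-> forall i,
    generation_below a b g (subtree tau i) (subtree B i)
      (s - a * tau [::] w - b * B [::] (tau [::] w) w) w.
Proof.
split=> [h i v vg|h [//|i v] [vg]].
  have := h (i :: v); rewrite /= vg => /(_ erefl).
  rewrite birth_time_cons birth_position_cons; lra.
have := h i v vg; rewrite birth_time_cons birth_position_cons; lra.
Qed.

End generations.

Section generation_measurable.
Context d (T : measurableType d) (R : realType).
Variables (tau : seq bool -> T -> R) (B : seq bool -> R -> T -> R).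
Hypothesis mtau : forall u, measurable_fun setT (tau u).
Hypothesis mB : forall u t, 0 <= t -> measurable_fun setT (B u t).
Hypothesis cB : forall u w, {within `[0, +oo[, continuous (fun t => B u t w)}.
Hypothesis tau_gt0 : forall u w, 0 < tau u w.

Lemma measurable_generation_below a b g d' (T' : measurableType d') (s : T' -> R)
    (f : T' -> T) : measurable_fun setT s -> measurable_fun setT f ->
  measurable [set z | generation_below a b g tau B (s z) (f z)].
Proof.
move=> ms mf.
have -> : [set z | generation_below a b g tau B (s z) (f z)] =
    ~` (\bigcup_(v : seq bool) [set z | (size v == g) &&
      (s z < a * birth_time tau v (f z) + b * birth_position tau B v (f z))]).
  apply/seteqP; split=> z /=.
    by move=> h [v _ /= /andP[/eqP vg]]; rewrite ltNge h.
  move=> h v vg; rewrite leNgt; apply/negP => h'; apply: h; exists v => //=.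
  by rewrite vg eqxx.
apply: measurableC; apply: countable_bigcupT_measurable => [|v]; first exact: countableP.
rewrite -[X in measurable X]setTI.
have : measurable_fun [set: T'] (fun z => (size v == g) &&
    (s z < a * birth_time tau v (f z) + b * birth_position tau B v (f z))).
  apply: measurable_and; first exact: measurable_cst.
  apply: measurable_fun_ltr => //; apply: measurable_funD; apply: measurable_funM => //.
    exact: (measurableT_comp (measurable_birth_time mtau v) mf).
  exact: (measurableT_comp (measurable_birth_position mtau mB cB tau_gt0 v) mf).
by move=> /(_ measurableT [set true]); apply.
Qed.

End generation_measurable.

Section exploration.
Context d (T : measurableType d) (R : realType).

Lemma measurable_generation_event (P : probability T R) (tau : seq bool -> {RV P >-> R})
    (B : seq bool -> R -> {RV P >-> R}) a b g s : regular_bbm tau B ->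
  measurable (generation_below a b g (fun u => tau u) (fun u => B u) s).
Proof.
move=> hB; apply: (@measurable_generation_below _ T R tau B _ _ _ _ a b g _ _ (cst s) id) => //.
- by move=> u w; exact: (motion_continuous hB).
- by move=> u w; exact: (lifetime_gt0 hB).
Qed.

Lemma measurable_generation_descendants (P : probability T R)
    (tau : seq bool -> {RV P >-> R}) (B : seq bool -> R -> {RV P >-> R}) (i : bool) J
    a b g d' (T' : measurableType d') (s : T' -> R)
    (f : T' -> g_sigma_algebraType (\bigcup_(i in J) driving_sigma tau (fun u => B u) i)) :
  regular_bbm tau B -> descendants i `<=` J ->
  measurable_fun setT s -> measurable_fun setT f ->
  measurable [set z | generation_below a b g (subtree (fun u => tau u) i)
    (subtree (fun u => B u) i) (s z) (f z)].
Proof.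
move=> hB iJ ms mf.
apply: (@measurable_generation_below _ (g_sigma_algebraType
  (\bigcup_(i in J) driving_sigma tau (fun u => B u) i)) R) => //.
- by move=> u; apply/sigma_rvP => A GA; apply: sub_sigma_algebra; exists (inl (i :: u)) => //;
    apply: iJ; exists u.
- move=> u t t0; apply/sigma_rvP => A GA; apply: sub_sigma_algebra; exists (inr (i :: u)).
    by apply: iJ; exists u.
  by apply: sub_sigma_algebra; exists t => //=; rewrite in_itv /= andbT.
- by move=> u w; exact: (motion_continuous hB).
- by move=> u w; exact: (lifetime_gt0 hB).
Qed.

(* Exponential Chebyshev and a union bound over the generation: each step along
   a line of descent multiplies [exp (a b_v + b X_v)] by an independent factor of
   mean [1 / (1 - a - b^2 / 2)]. *)
Lemma generation_tail (a b : R) g (P : probability T R) (tau : seq bool -> {RV P >-> R})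
    (B : seq bool -> R -> {RV P >-> R}) s : a + b ^+ 2 / 2 < 1 -> regular_bbm tau B ->
  (P (~` generation_below a b g (fun u => tau u) (fun u => B u) s) <=
   ((2 / (1 - (a + b ^+ 2 / 2))) ^+ g * expR (- s))%:E)%E.
Proof.
move=> ab1; have q0 : 0 < 1 - (a + b ^+ 2 / 2) by rewrite subr_gt0.
set q := a + _ in q0 *.
elim: g P tau B s => [|g IH] P tau B s hB.
  rewrite expr0 mul1r; have [s0|s0] := leP 0 s.
    rewrite (_ : ~` _ = set0) ?measure0 ?lee_fin ?expR_ge0//.
    by apply/seteqP; split=> // w /= [v /size0nil ->]; rewrite birth_time_nil birth_position_nil !mulr0 addr0.
  apply: (le_trans (probability_le1 P _)).
    by apply: measurableC; exact: measurable_generation_event.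
  by rewrite lee_fin -[leLHS]expR0 ler_expR oppr_ge0 ltW.
pose A i := ~` [set w | generation_below a b g (subtree (fun u => tau u) i)
  (subtree (fun u => B u) i) (s - a * tau [::] w - b * B [::] (tau [::] w) w) w].
have mB : measurable_fun setT (fun w => B [::] (tau [::] w) w).
  apply: (eq_measurable_fun (fun w => B [::] (Num.max (tau [::] w) 0) w)).
    by move=> w _; rewrite max_l// ltW// (lifetime_gt0 hB).
  apply: (@measurable_process_comp _ T _ (B [::]) _ T (tau [::]) id) => //.
  by move=> w; exact: (motion_continuous hB).
have mA i : measurable (A i).
  apply: measurableC; have hBi := regular_subtree i hB.
  apply: (@measurable_generation_below _ T R (subtree (fun u => tau u) i)
    (subtree (fun u => B u) i) _ _ _ _ a b g _ T) => //.
  - by move=> u w; exact: (motion_continuous hBi).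
  - by move=> u w; exact: (lifetime_gt0 hBi).
  - by apply: measurable_funB; [apply: measurable_funB => //|]; apply: measurable_funM.
pose k := (2 / (1 - q)) ^+ g * expR (- s).
have k0 : 0 <= k by rewrite mulr_ge0 ?expR_ge0// exprn_ge0// divr_ge0// ltW.
have PA i : (P (A i) <= (k * (1 - q)^-1)%:E)%E.
  (* Only the subtree [i] is constrained; for the other one the event is [setT], with factor 1. *)
  pose E j : set (R * R * T) := [set z | j = i -> ~ generation_below a b g
    (subtree (fun u => tau u) i) (subtree (fun u => B u) i) (s - a * z.1.1 - b * z.1.2) z.2].
  pose K (r y : R) := ((k * expR (a * r))%:E * (expR (b * y))%:E : \bar R)%E.
  apply: (@le_trans _ _ (\int[lebesgue_measure]_t (heat t (K t) 0 * (exponential_pdf 1 t)%:E))%E).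
    apply: (@root_bound _ _ _ _ _ _ hB E K) => //.
    - move=> j J jJ; rewrite /E; have [ji|ji] := eqVneq j i; last first.
        rewrite (_ : [set _ | _] = setT)//; apply/seteqP; split=> // z _ /= h.
        by move: ji; rewrite h eqxx.
      have -> : [set z : R * R * T | j = i -> ~ generation_below a b g
          (subtree (fun u => tau u) i) (subtree (fun u => B u) i)
          (s - a * z.1.1 - b * z.1.2) z.2] =
        ~` [set z | generation_below a b g (subtree (fun u => tau u) i)
          (subtree (fun u => B u) i) (s - a * z.1.1 - b * z.1.2) z.2].
        by apply/seteqP; split=> z /= h; [exact: h|move=> _].
      apply: measurableC.
      apply: (@measurable_generation_descendants P tau B i J a b g _
        (R * R * g_sigma_algebraType (\bigcup_(i in J) driving_sigma tau (fun u => B u) i))%type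
        (fun z => s - a * z.1.1 - b * z.1.2) (fun z => z.2)) => //; first by rewrite -ji.
      have m1 : measurable_fun setT (fun z : R * R * g_sigma_algebraType
          (\bigcup_(i in J) driving_sigma tau (fun u => B u) i) => z.1.1).
        exact: (measurableT_comp measurable_fst measurable_fst).
      have m2 : measurable_fun setT (fun z : R * R * g_sigma_algebraType
          (\bigcup_(i in J) driving_sigma tau (fun u => B u) i) => z.1.2).
        exact: (measurableT_comp measurable_snd measurable_fst).
        by apply: measurable_funB; [apply: measurable_funB => //|]; apply: measurable_funM.
      exact: measurable_snd.
    - rewrite /K; apply: emeasurable_funM; apply/measurable_EFinP.
        apply: measurable_funM => //; apply: measurableT_comp => //.
        by apply: measurable_funM => //; exact: measurable_fst.
      apply: measurableT_comp => //.
      by apply: measurable_funM => //; exact: measurable_snd.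
    - by move=> r y; rewrite /K -EFinM lee_fin; exact: (mulr_ge0 (mulr_ge0 k0 (expR_ge0 _)) (expR_ge0 _)).
    - move=> r y r0.
      have Ei : (P [set w | E i (r, y, w)] <= K r y)%E.
        have -> : [set w | E i (r, y, w)] = ~` generation_below a b g
            (subtree (fun u => tau u) i) (subtree (fun u => B u) i) (s - a * r - b * y).
          by apply/seteqP; split=> w /=; rewrite /E /=; [apply|move=> h _].
        apply: (le_trans (IH _ _ _ (s - a * r - b * y) (regular_subtree i hB))).
        rewrite /K -EFinM lee_fin /k -!mulrA ler_wpM2l ?exprn_ge0 ?divr_ge0 ?(ltW q0)//.
        by rewrite -!expRD ler_expR; lra.
      have ET : [set w | E (~~ i) (r, y, w)] = setT.
        by apply/seteqP; split=> // w _ /=; rewrite /E /=; case: (i).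
      move: Ei ET; case: (i) => Ei /= ET; rewrite ET probability_setT ?mul1e ?mule1//.
    - by move=> w Aw j _.
  have -> : (\int[lebesgue_measure]_t (heat t (K t) 0 * (exponential_pdf 1 t)%:E) =
      \int[lebesgue_measure]_t (k%:E * ((expR (q * t))%:E * (exponential_pdf 1 t)%:E)))%E.
    apply: eq_integral => t _; have [t0|t0] := ltP t 0.
      by rewrite lt0_exponential_pdf// !mule0.
    rewrite muleA; congr (_ * _)%E; rewrite /K.
    have -> : (fun y : R => (k * expR (a * t))%:E * (expR (b * y))%:E)%E =
        (fun y : R => (k * expR (a * t))%:E * ((expR (b * y))%:E * cst 1%:E y))%E.
      by apply/funext => y; rewrite mule1.
    rewrite heatZ//; first last.
    - by move=> z; rewrite mule1 lee_fin expR_ge0.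
    - by rewrite mulr_ge0 ?expR_ge0.
    - have m : measurable_fun [set: R] (fun x : R => (expR (b * x))%:E * cst 1%:E x)%E.
        apply: emeasurable_funM; last exact: measurable_cst.
        by apply/measurable_EFinP; apply: measurableT_comp => //; exact: measurable_funM.
      exact: m.
    rewrite heat_tilt// ?heat_cst//.
    rewrite mule1 -!EFinM -(mulrA k) -expRD.
    suff -> : a * t + (b * 0 + b ^+ 2 * t / 2) = q * t by [].
    by rewrite /q; lra.
  have mp : measurable_fun [set: R] (fun t : R => (expR (q * t))%:E * (exponential_pdf 1 t)%:E)%E.
    apply: emeasurable_funM; apply/measurable_EFinP; last exact: measurable_exponential_pdf.
    by apply: measurableT_comp => //; exact: measurable_funM.
  rewrite (@ge0_integralZl _ _ _ _ setT measurableT)//.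
  - by rewrite (integral_exponential_moment ab1) -EFinM; exact: lexx.
  - by move=> x _; rewrite mule_ge0// lee_fin ?expR_ge0// exponential_pdf_ge0.
apply: (@le_trans _ _ (P (A false `|` A true))).
  apply: le_measure; rewrite ?inE.
  - by apply: measurableC; exact: measurable_generation_event.
  - exact: measurableU.
  move=> w h; apply: contrapT => h'; apply: h; apply/generation_belowS => i.
  by apply: contrapT => hi; apply: h'; case: i hi => hi; [right|left].
apply: (le_trans (measureU2 _ (mA false) (mA true))).
apply: (le_trans (leeD (PA false) (PA true))).
rewrite -EFinD lee_fin /k exprS; lra.
Qed.

End exploration.

Section boost.
Context d (T : measurableType d) (R : realType).
Variable c : R.

(** [a] is a budget of time and [b] a budget of height lost to the line of slope [c]; both are spent
    additively along a line of descent. *)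
Definition generation_controlled (g : nat) (a b : R) (tau : seq bool -> T -> R)
    (B : seq bool -> R -> T -> R) : set T :=
  generation_below 1 0 g tau B a `&` generation_below c (-1) g tau B b.

Lemma generation_controlledS g a b tau B w :
  generation_controlled g.+1 a b tau B w -> forall i,
  generation_controlled g (a - tau [::] w) (b - c * tau [::] w + B [::] (tau [::] w) w)
    (subtree tau i) (subtree B i) w.
Proof.
move=> [/generation_belowS h1 /generation_belowS h2] i; split.
  by have := h1 i; rewrite mul1r mul0r subr0.
by have := h2 i; rewrite mulN1r opprK.
Qed.

Lemma generation_controlled_ge0 g a b tau B w : (forall u, 0 < tau u w) ->
  generation_controlled g a b tau B w -> 0 <= a.
Proof.
move=> tau0 [/(_ (nseq g true) (size_nseq _ _)) h _].
rewrite mul1r mul0r addr0 in h; apply: le_trans h.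
by apply: sumr_ge0 => k _; exact: ltW.
Qed.

(* The [2 ^ g] particles of generation [g] get independent chances. *)
Lemma boost (S : seq (R * R)) (p0 rho s0 s1 : R) : 0 <= p0 <= 1 ->
  (forall a, a \in S -> 0 <= a.1) -> 0 <= s0 ->
  (forall s, s0 <= s <= s1 -> hit_ge_always T S s (- (c * s) + rho) p0) ->
  forall g (P : probability T R) (tau : seq bool -> {RV P >-> R})
    (B : seq bool -> R -> {RV P >-> R}) t x a b, regular_bbm tau B ->
  t <= s1 -> t - a = s0 -> - (c * t) + rho + b <= x ->
  (P (generation_controlled g a b (fun u => tau u) (fun u => B u) `\` hit S tau B t x) <=
   ((1 - p0) ^+ (2 ^ g))%:E)%E.
Proof.
move=> /andP[p0_ge p0_le] S0 s0_ge h.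
have q0 : 0 <= 1 - p0 by rewrite subr_ge0.
have mA g P (tau : seq bool -> {RV P >-> R}) (B : seq bool -> R -> {RV P >-> R}) t x a b :
    regular_bbm tau B -> measurable (generation_controlled g a b
      (fun u => tau u) (fun u => B u) `\` hit S tau B t x).
  move=> hB; apply: measurableD; last exact: (measurable_hit_event hB).
  by apply: measurableI; exact: measurable_generation_event.
elim=> [|g IH] P tau B t x a b hB ts ta tx.
  rewrite expn0 expr1.
  (* In generation 0 the controlled event is empty unless both budgets are nonnegative. *)
  have [[a0 b0]|nab] := pselect (0 <= a /\ 0 <= b); last first.
    rewrite (_ : _ `\` _ = set0) ?measure0 ?lee_fin//.
    apply/seteqP; split=> // w [[/generation_below0 a0 /generation_below0 b0] _].
    by apply: nab.
  apply: (@le_trans _ _ (P (~` hit S tau B t x))).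
    apply: le_measure; rewrite ?inE; [exact: mA|
      apply: measurableC; exact: (measurable_hit_event hB)|].
    by move=> w [].
  rewrite probability_setC; last exact: (measurable_hit_event hB).
  rewrite EFinB; apply: leeB => //.
  have tt : s0 <= t <= s1 by apply/andP; split; lra.
  have xx : - (c * t) + rho <= x by lra.
  exact: (hit_ge_always_le xx (h t tt) hB).
pose E i : set (R * R * T) := [set z | (generation_controlled g (a - z.1.1)
    (b - c * z.1.1 + z.1.2) (subtree (fun u => tau u) i) (subtree (fun u => B u) i) `\`
  hit S (subtree (fun u => tau u) i) (subtree (fun u => B u) i) (t - z.1.1) (x + z.1.2)) z.2].
have qg : 0 <= (1 - p0) ^+ (2 ^ g.+1) by exact: exprn_ge0.
rewrite -(@integral_heat_cst R _ qg).
apply: (@root_bound _ _ _ _ _ _ hB E (fun _ => cst ((1 - p0) ^+ (2 ^ g.+1))%:E)).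
- move=> i J iJ; rewrite /E.
  pose gJ := g_sigma_algebraType (\bigcup_(i in J) driving_sigma tau (fun u => B u) i).
  have m1 : measurable_fun setT (fun z : R * R * gJ => z.1.1).
    exact: (measurableT_comp measurable_fst measurable_fst).
  have m2 : measurable_fun setT (fun z : R * R * gJ => z.1.2).
    exact: (measurableT_comp measurable_snd measurable_fst).
  have m3 : measurable_fun setT (fun z : R * R * gJ => z.2) by exact: measurable_snd.
  have mg a' b' s : measurable_fun setT s -> measurable [set z : R * R * gJ |
      generation_below a' b' g (subtree (fun u => tau u) i) (subtree (fun u => B u) i) (s z) z.2].
    by move=> ms; exact: (@measurable_generation_descendants _ _ _ P tau B i J a' b' g _ _ _ _ hB iJ ms m3).
  have ma : measurable_fun setT (fun z : R * R * gJ => a - z.1.1) by exact: measurable_funB.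
  have mb : measurable_fun setT (fun z : R * R * gJ => b - c * z.1.1 + z.1.2).
    by apply: measurable_funD => //; apply: measurable_funB => //; exact: measurable_funM.
  have mt : measurable_fun setT (fun z : R * R * gJ => t - z.1.1) by exact: measurable_funB.
  have mx : measurable_fun setT (fun z : R * R * gJ => x + z.1.2) by exact: measurable_funD.
  have := measurableD (measurableI _ _ (mg 1 0 _ ma) (mg c (-1) _ mb))
    (@measurable_hit_descendants _ _ _ P tau B hB i J S _ _ _ _ _ iJ mt mx m3).
  by congr (measurable _); apply/seteqP; split=> z.
- exact: measurable_cst.
- by move=> r y; rewrite lee_fin.
- move=> r y r0.
  (* The lifetime of the root is taken off [t] and [a] alike, so [t - a] stays [s0], and the height
     budget follows its displacement. *)
  have Ei i : (P [set w | E i (r, y, w)] <= ((1 - p0) ^+ (2 ^ g))%:E)%E.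
    have tr : t - r <= s1 by lra.
    have tar : t - r - (a - r) = s0 by lra.
    have xr : - (c * (t - r)) + rho + (b - c * r + y) <= x + y by rewrite mulrBr; lra.
    have := IH _ _ _ _ _ _ _ (regular_subtree i hB) tr tar xr.
    by congr (P _ <= _)%E; apply/seteqP; split=> w.
  rewrite [leRHS](_ : _ = ((1 - p0) ^+ (2 ^ g))%:E * ((1 - p0) ^+ (2 ^ g))%:E)%E; last first.
    by rewrite -EFinM -exprD expnS mul2n addnn.
  exact: lee_pmul.
- exact: mA.
move=> w [gc nh] i; split; first exact: (generation_controlledS gc).
move=> /= hi; apply: nh.
have taui u : 0 < subtree (fun u => tau u) i u w by exact: (lifetime_gt0 hB).
have ta0 := generation_controlled_ge0 taui (generation_controlledS gc i).
have tau0 u : 0 < tau u w by exact: (lifetime_gt0 hB).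
have tn := tau0 [::]; have t0 : 0 <= t by lra.
have taut : tau [::] w <= t by lra.
by apply/(@hit_split _ _ S _ B t x w S0 tau0 t0 taut); exists i.
Qed.

End boost.

Lemma expR_half_le2 (R : realType) : expR (1 / 2) <= 2 :> R.
Proof.
rewrite -[leLHS]invrK -expRN -[leRHS]invrK lef_pV2 ?posrE ?invr_gt0 ?expR_gt0//.
have := @expR_ge1Dx R (- (1 / 2)); lra.
Qed.

Lemma le_cube (R : realDomainType) (x : R) : 1 <= x -> x <= x ^+ 3.
Proof.
move=> x1; have x0 : 0 <= x by lra.
by rewrite exprSr ler_peMl// expr2; nra.
Qed.

Lemma subr1_expn_le (R : realType) (p : R) k : 0 <= p <= 1 ->
  (1 - p) ^+ k <= expR (- (p * k%:R)).
Proof.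
move=> /andP[p0 p1]; rewrite -mulNr mulrC expRM_natl.
rewrite lerXn2r ?nnegrE ?expR_ge0 ?subr_ge0//.
exact: expR_ge1Dx.
Qed.

Lemma lower_rate_arith (R : realType) (k x e1 theta N t s w : R) : 0 < k -> 1 <= x ->
  0 <= t <= s -> s <= 2 * expR x -> 0 < t -> 0 < N ->
  w = 16 * x ^+ 2 -> 64 * 512 / k * x ^+ 4 <= expR (e1 * x) ->
  expR ((3 / 2 - theta) * x) <= N * (512 * x ^+ 2) ->
  expR (- ((theta + e1) * x)) <= k * N / (w * t * Num.sqrt t).
Proof.
move=> k0 x1 /andP[t0' ts] sx t0 N0 -> h1 h2.
have x0 : 0 < x by lra.
have X0 := expR_gt0 x.
have tX : t <= 2 * expR x by lra.
have st : Num.sqrt t <= 2 * expR (x / 2).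
  rewrite -[leRHS]ger0_norm ?mulr_ge0 ?expR_ge0// -sqrtr_sqr ler_wsqrtr//.
  rewrite exprMn -expRM_natl; have -> : 2%:R * (x / 2) = x by field.
  by rewrite expr2; lra.
have s0 : 0 < Num.sqrt t by rewrite sqrtr_gt0.
rewrite ler_pdivlMr; last by rewrite !mulr_gt0// exprn_gt0.
apply: (@le_trans _ _ (expR (- ((theta + e1) * x)) *
    (16 * x ^+ 2 * (2 * expR x) * (2 * expR (x / 2))))).
  apply: ler_wpM2l; first exact: expR_ge0.
  have x2 : 0 <= 16 * x ^+ 2 by rewrite mulr_ge0// exprn_ge0// ltW.
  apply: ler_pM => //; [exact: mulr_ge0|exact: ler_wpM2l].
have -> : expR (- ((theta + e1) * x)) * (16 * x ^+ 2 * (2 * expR x) * (2 * expR (x / 2))) =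
    64 * x ^+ 2 * expR (- (e1 * x)) * expR ((3 / 2 - theta) * x).
  have -> : expR ((3 / 2 - theta) * x) = expR (- (theta * x)) * expR x * expR (x / 2).
    by rewrite -!expRD; congr expR; field.
  have -> : - ((theta + e1) * x) = - (theta * x) + - (e1 * x) by lra.
  by rewrite expRD; ring.
have h3 : 64 * x ^+ 2 * expR (- (e1 * x)) * (512 * x ^+ 2) <= k.
  have : 64 * 512 * x ^+ 4 <= k * expR (e1 * x).
    by rewrite -ler_pdivrMl// mulrA (mulrC k^-1).
  rewrite -ler_pdivrMr ?expR_gt0// -expRN; apply: le_trans; rewrite le_eqVlt; apply/orP; left.
  by apply/eqP; ring.
apply: (@le_trans _ _ (64 * x ^+ 2 * expR (- (e1 * x)) * (N * (512 * x ^+ 2)))).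
  by apply: ler_wpM2l => //; rewrite !mulr_ge0 ?exprn_ge0 ?expR_ge0 ?ltW.
by rewrite mulrCA mulrC ler_wpM2r// ltW.
Qed.

(** With [g] about [delta * x] and [x = log n], there are 2^g >= exp(g/2) particles, a power of [n]
    that exceeds any multiple of [log n]. The factor 12 leaves room for a union over n^9 times. *)
Lemma boost_exponent (R : realType) (delta x p : R) g : 0 < p -> 1 <= x ->
  delta * x < g%:R + 1 -> 12 * expR (1 / 2) / p * x ^+ 3 <= expR (delta / 2 * x) ->
  12 * x <= p * (2 ^ g)%:R.
Proof.
move=> p0 x1 hg h; have x3x := le_cube x1.
have g2 : expR ((delta * x - 1) / 2) <= (2 ^ g)%:R.
  apply: (@le_trans _ _ (expR (1 / 2) ^+ g)).
    by rewrite -expRM_natl ler_expR; lra.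
  rewrite natrX lerXn2r ?nnegrE ?expR_ge0//; exact: expR_half_le2.
have E : expR ((delta * x - 1) / 2) = expR (delta / 2 * x) / expR (1 / 2).
  by rewrite -expRN -expRD; congr expR; lra.
apply: (@le_trans _ _ (p * expR ((delta * x - 1) / 2))); last by rewrite ler_wpM2l// ltW.
rewrite E mulrA ler_pdivlMr ?expR_gt0//.
have : 12 * expR (1 / 2) * x ^+ 3 <= p * expR (delta / 2 * x).
  by rewrite -ler_pdivrMl// mulrA (mulrC p^-1).
apply: le_trans; rewrite mulrAC; apply: ler_wpM2l => //.
Qed.

Lemma lower_tail_arith (R : realType) (x n s N w : R) : 1 <= x -> n = expR x ->
  256 * x ^+ 3 <= expR (1 * x) -> n / 8 <= s <= 2 * n -> 1 <= N ->
  w = 16 * x ^+ 2 -> N * w <= n / 16 ->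
  [/\ 2 <= 4 * x, 0 < s - w, s - w <= s, N * w <= s - w &
      w <= s - w /\ N * expR (- (4 * x / 2)) * (s - w) <= 1].
Proof.
move=> x1 nE h /andP[s1 s2] N1 wE hN.
have x2 : 1 <= x ^+ 2 by rewrite expr2; nra.
have n0 : 0 < n by rewrite nE expR_gt0.
have hx : 256 * x ^+ 2 <= n.
  move: h; rewrite mul1r -nE; apply: le_trans.
  by apply: ler_wpM2l; [lra|rewrite exprS ler_peMl//; lra].
have w0 : 1 <= w by rewrite wE; lra.
have wn : w <= n / 16 by rewrite wE; lra.
split; [lra|lra|lra|lra|split; first lra].
have -> : expR (- (4 * x / 2)) = (n * n)^-1.
  by rewrite nE -expRD -expRN; congr expR; lra.
rewrite mulrAC ler_pdivrMr ?mulr_gt0// mul1r.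
have N16 : N <= n / 2.
  apply: le_trans (_ : n / 16 <= _); last by lra.
  by apply: le_trans hN; rewrite ler_peMr//; lra.
apply: (@le_trans _ _ (n / 2 * (2 * n))); last by lra.
by apply: ler_pM => //; lra.
Qed.

Lemma tilted_speed (R : realType) (c theta e x : R) : 1 <= c <= 2 -> 0 <= theta <= 2 ->
  0 < e <= 1 -> 0 < x ->
  (theta + e / 16) * x / (c - e / 16) <= (theta / c + e / 2) * x /\
  (theta + e / 16) * x / (c - e / 16) <= 6 * x.
Proof.
move=> /andP[c1 c2] /andP[t0 t2] /andP[e0 e1] x0.
have c0 : 0 < c by lra.
have ce : 0 < c - e / 16 by lra.
have q0 : 0 <= theta / c by rewrite divr_ge0// ltW.
have q2 : theta / c <= 2 by rewrite ler_pdivrMr//; lra.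
have qc : theta / c * c = theta by rewrite divfK// gt_eqF.
have h : (theta + e / 16) * x / (c - e / 16) <= (theta / c + e / 2) * x.
  rewrite ler_pdivrMr// mulrAC ler_wpM2r ?ltW//.
  have q1 : theta / c * e <= 2 * e by rewrite ler_wpM2r// ltW.
  have q3 : e * (1 / 2) <= e * (c - e / 16) by rewrite ler_wpM2l ?(ltW e0)//; lra.
  have -> : (theta / c + e / 2) * (c - e / 16) =
      theta / c * c - theta / c * e / 16 + e * (c - e / 16) / 2 by ring.
  by rewrite qc; lra.
split => //; apply: (le_trans h); rewrite ler_wpM2r ?(ltW x0)//; lra.
Qed.

Lemma climbing_time (R : realType) (n l e K x : R) : 0 < e -> 0 < K -> 1 <= x ->
  l <= 6 * x -> 8 * (6 / e + K) * x <= n -> n / 8 + l / e + K <= n / 4.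
Proof.
move=> e0 K0 x1 h1 h2.
have : l / e <= 6 / e * x by rewrite (mulrAC 6) ler_wpM2r// invr_ge0 ltW.
have : K <= K * x by rewrite ler_peMr// ltW.
lra.
Qed.

Lemma total_displacement (R : realType) (ct q x e l eK g : R) :
  l <= (q + e / 2) * x -> eK <= e * x / 4 -> g <= e / 4 * x ->
  - ct + (- 1 + l + eK) + g <= - ct + (q + e) * x.
Proof. lra. Qed.

Lemma generation_time (R : realType) (n t g x e : R) : n / 2 <= t -> g <= e / 4 * x ->
  0 < e <= 1 -> 0 < x -> 64 * x <= n -> n / 4 <= t - g.
Proof.
move=> h1 h2 /andP[e0 e1] x0 h3.
have : e / 4 * x <= 1 / 4 * x by rewrite ler_wpM2r ?(ltW x0)//; lra.
lra.
Qed.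

Lemma le_delta (R : realType) (e : R) : 0 < e -> 16 * (e / 64) <= e / 4.
Proof. lra. Qed.

(** * Lower bounds failing with probability at most n^-12 *)

Section lower_estimate.
Context d (T : measurableType d) (R : realType).
Hypothesis exists_bbm : exists (P : probability T R) (tau : seq bool -> {RV P >-> R})
  (B : seq bool -> R -> {RV P >-> R}), regular_bbm tau B.
Variable c : R.
Hypothesis c2 : c ^+ 2 = 2.
Hypothesis c0 : 0 < c.
Local Notation L := (fun n : nat => ln (n%:R : R)).

Let c12 : 1 <= c <= 2.
Proof.
apply/andP; split; rewrite -(@ler_pXn2r _ 2)// ?nnegrE ?(ltW c0)// c2.
  by rewrite expr1n; lra.
by rewrite expr2; lra.
Qed.

(* With [m = 4 log n] the condition [N exp(-m/2) s <= 1] of [lower_tail] holds as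
   soon as [N s <= n^2]. *)
Definition spacing (n : nat) : R := 4 * L n * (4 * L n).

Lemma spacingE n : spacing n = 16 * L n ^+ 2.
Proof. by rewrite /spacing expr2; ring. Qed.

Lemma spacing_ge0 n : 0 <= spacing n.
Proof. by rewrite spacingE mulr_ge0// sqr_ge0. Qed.

(** With [N] targets the probability is about N n^(-3/2), here written n^(-theta): [theta = 3 / 2]
    for one target, [theta = 1 / 2] for about n / log^2 n of them. Powers of [log n] are absorbed by
    [e1]. *)
Lemma lower_tail_uniform (theta e1 : R) : 0 < e1 -> exists n0 : nat, forall n N,
  (n0 <= n)%N -> (0 < N)%N -> N%:R * spacing n <= n%:R / 16 ->
  expR ((3 / 2 - theta) * L n) <= N%:R * (512 * L n ^+ 2) ->
  forall s, n%:R / 8 <= s <= 2 * n%:R ->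
  hit_ge_always T (targets c (spacing n) N) s (- (c * s) - 1)
    (expR (- ((theta + e1) * L n))).
Proof.
move=> e10; have := @lower_tail _ T R exists_bbm c c2 c0.
move: (kappa3 R) (kappa3_gt0 R) => k k0 tail.
have [x1 [x10 h1]] := cube_le_expR ltr01 (ltac:(lra) : 0 <= 256 :> R).
have e12 : 0 < e1 / 2 by rewrite divr_gt0.
have K0 : 0 <= 64 * 512 / k by apply: mulr_ge0; [lra|rewrite invr_ge0; exact: ltW].
have [x2 [x20 h2]] := cube_le_expR e12 K0.
have [x3 [x30 h3]] := cube_le_expR e12 (ler01 : 0 <= 1 :> R).
exists (Num.bound (expR (Num.max (Num.max 1 x1) (Num.max x2 x3)))) => n N.
move=> /ln_ge_of_bound []; set x := ln _; rewrite !ge_max.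
move=> /andP[/andP[x_ge1 xx1] /andP[xx2 xx3]] nE N0 Nn hN s s12.
have N1 : 1 <= N%:R :> R by rewrite ler1n.
have [m2 t0 ts Nt [mt NE]] := lower_tail_arith x_ge1 nE (h1 x xx1) s12 N1 (spacingE n) Nn.
have := tail (4 * x) (s - spacing n) N m2 Nt mt NE.
have tE : s - spacing n + 4 * x * (4 * x) = s by rewrite subrK.
rewrite tE; apply: hit_ge_always_mono; have /andP[_ s2] := s12.
apply: (@lower_rate_arith R k x e1 theta _ (s - spacing n) s) => //.
- by rewrite ltW.
- by rewrite -nE.
- by rewrite ltr0n.
- exact: spacingE.
have x0 : 0 <= x by exact: le_trans x_ge1.
rewrite exprSr mulrA [e1 * x](_ : _ = e1 / 2 * x + e1 / 2 * x); last by rewrite -mulrDl -splitr.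
rewrite expRD; apply: ler_pM.
- by rewrite mulr_ge0 ?exprn_ge0.
- exact: x0.
- exact: h2.
- by apply: le_trans (h3 x xx3); rewrite mul1r; exact: le_cube.
Qed.

(** [lower_tail_uniform] holds at times in [n/8, 2n]; [climb] makes the probability constant from
    n/4 on, for about theta / c times log n in height; [boost] spends a further 16 g of time, which
    leads to [t >= n / 2]. *)
Lemma lower_estimate (theta e : R) : 0 <= theta <= 2 -> 0 < e <= 1 ->
  exists (delta : R) (n0 : nat), 0 < delta /\ forall n N,
  (n0 <= n)%N -> (0 < N)%N -> N%:R * spacing n <= n%:R / 16 ->
  expR ((3 / 2 - theta) * L n) <= N%:R * (512 * L n ^+ 2) ->
  forall (P : probability T R) (tau : seq bool -> {RV P >-> R})
    (B : seq bool -> R -> {RV P >-> R}) t, regular_bbm tau B ->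
  n%:R / 2 <= t <= 2 * n%:R ->
  let g := Num.truncn (delta * L n) in
  (P (generation_controlled c g (16 * g%:R) (16 * g%:R) (fun u => tau u) (fun u => B u) `\`
      hit (targets c (spacing n) N) tau B t (- (c * t) + (theta / c + e) * L n)) <=
   (expR (- (12 * L n)))%:E)%E.
Proof.
move=> th02 e01; have /andP[e0 e1] := e01.
pose e' := e / 16.
have e'0 : 0 < e' by rewrite divr_gt0.
have e'1 : 0 < e' <= 1 / 2 by rewrite e'0 /e'; lra.
have [n1 H1] := lower_tail_uniform theta e'0.
have [p0 [K [p00 p01 K0 H2]]] := @climb _ T R c c2 c0 e' e'1.
(* The loss 16 g, in time and in height, then stays below e/4 times log n. *)
pose delta := e / 64.
have delta0 : 0 < delta by rewrite divr_gt0.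
have d2 : 0 < delta / 2 by rewrite divr_gt0.
have [x1 [_ h1]] := cube_le_expR ltr01 (ltac:(lra) : 0 <= 64 :> R).
have K2 : 0 <= 8 * (6 / e' + K) by rewrite mulr_ge0// addr_ge0 ?divr_ge0// ltW.
have [x2 [_ h2]] := cube_le_expR ltr01 K2.
have K3 : 0 <= 12 * expR (1 / 2) / p0 by rewrite divr_ge0 ?mulr_ge0 ?expR_ge0// ltW.
have [x3 [_ h3]] := cube_le_expR d2 K3.
pose x0 := Num.max (Num.max 1 (4 * (e' * K) / e)) (Num.max x1 (Num.max x2 x3)).
exists delta, (maxn n1 (Num.bound (expR x0))); split => // n N.
rewrite geq_max => /andP[nn1 /ln_ge_of_bound []].
rewrite /x0 !ge_max => /andP[/andP[xx1 xx5] /andP[xx2 /andP[xx3 xx4]]] nE N0 Nn hN P tau B t hB.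
move=> /andP[t1 t2]; have := H1 n N nn1 N0 Nn hN.
set x := ln (n%:R) in xx1 xx2 xx3 xx4 xx5 nE hN * => hs; set g := Num.truncn _.
have x_gt0 : 0 < x by exact: lt_le_trans xx1.
have e'Kx : e' * K <= e * x / 4.
  by move: xx5; rewrite ler_pdivrMr// ler_pdivlMr// mulrC (mulrC x).
have large k : 0 <= k -> k * x ^+ 3 <= expR (1 * x) -> k * x <= n%:R.
  by rewrite mul1r -nE => k0; apply: le_trans; rewrite ler_wpM2l// le_cube.
have l0 : 0 <= (theta + e') * x.
  by rewrite mulr_ge0 ?(ltW x_gt0)// addr_ge0 ?(ltW e'0)//; case/andP: th02.
have [lE lc] := tilted_speed c12 th02 e01 x_gt0.
have n8 : 0 <= n%:R / 8 :> R by rewrite divr_ge0.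
have S0 : forall a, a \in targets c (spacing n) N -> 0 <= a.1.
  by apply: targets_ge0; exact: spacing_ge0.
have hs' s : n%:R / 8 <= s <= 2 * n%:R -> hit_ge_always T (targets c (spacing n) N) s
  (- (c * s) + (-1)) (expR (- ((theta + e') * x))) by exact: hs.
have H := H2 _ _ _ _ _ S0 n8 l0 hs'.
have n4 := climbing_time e'0 K0 xx1 lc (large _ K2 (h2 x xx3)).
pose rho := -1 + (theta + e') * x / (c - e') + e' * K.
have H' s : n%:R / 4 <= s <= 2 * n%:R ->
    hit_ge_always T (targets c (spacing n) N) s (- (c * s) + rho) p0.
  move=> /andP[s1 s2]; have := H s; rewrite /rho !addrA; apply.
  by rewrite s2 andbT (le_trans n4).
have dx0 : 0 <= delta * x by rewrite mulr_ge0 ?(ltW delta0) ?(ltW x_gt0).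
have g_le : g%:R <= delta * x by rewrite /g truncn_le.
have g_gt : delta * x < g%:R + 1 by rewrite natr1 /g truncnS_gt.
have dx : 16 * g%:R <= e / 4 * x.
  apply: (le_trans (ler_wpM2l (ler0n _ 16) g_le)); rewrite /delta mulrA.
  by rewrite ler_wpM2r ?(ltW x_gt0)// (le_delta e0).
have gn := generation_time t1 dx e01 x_gt0 (large _ (ler0n _ 64) (h1 x xx2)).
have pp : 0 <= p0 <= 1 by rewrite ltW.
have s00 : 0 <= t - 16 * g%:R by apply: le_trans gn; rewrite divr_ge0.
have H'' s : t - 16 * g%:R <= s <= 2 * n%:R ->
    hit_ge_always T (targets c (spacing n) N) s (- (c * s) + rho) p0.
  by move=> /andP[s1 s2]; apply: H'; rewrite s2 andbT (le_trans gn).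
have xle : - (c * t) + rho + 16 * g%:R <= - (c * t) + (theta / c + e) * x.
  exact: total_displacement lE e'Kx dx.
have := @boost _ T R c _ _ _ _ _ pp S0 s00 H'' g P tau B t _ _ _ hB t2 erefl xle.
move=> /le_trans; apply; rewrite lee_fin.
apply: (le_trans (subr1_expn_le _ pp)); rewrite ler_expR lerN2.
exact: (boost_exponent p00 xx1 g_gt (h3 x xx4)).
Qed.

End lower_estimate.

(** * Almost sure bounds at discrete times *)

Section borel_cantelli_rates.
Context d (T : measurableType d) (R : realType) (P : probability T R).
Variable F : nat -> set T.
Hypothesis mF : forall n, measurable (F n).

Definition eventually_avoids (F : nat -> set T) (w : T) : Prop :=
  exists m, forall n, (m <= n)%N -> ~ F n w.

Lemma borel_cantelli_geometric (K r : R) n0 : 0 <= K -> 0 < r < 1 ->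
  (forall n, (n0 <= n)%N -> (P (F n) <= (K * r ^+ n)%:E)%E) ->
  {ae P, forall w, eventually_avoids F w}.
Proof.
move=> K0 /andP[r0 r1] h.
have r1' : 0 < 1 - r by rewrite subr_gt0.
(* The term [r ^- n0] makes the bound trivial for [n < n0], so the whole series is dominated. *)
pose K' := K + r ^- n0.
have K'0 : 0 <= K' by rewrite addr_ge0// invr_ge0 exprn_ge0// ltW.
have h' n : (P (F n) <= (K' * r ^+ n)%:E)%E.
  have rn : 0 <= r ^+ n by rewrite exprn_ge0// ltW.
  have [nn|nn] := leqP n0 n.
    by apply: (le_trans (h n nn)); rewrite lee_fin ler_wpM2r// lerDl invr_ge0 exprn_ge0// ltW.
  apply: (le_trans (probability_le1 P (mF n))); rewrite lee_fin.
  rewrite mulrDl; apply: (@le_trans _ _ (r ^- n0 * r ^+ n)); last by rewrite lerDr mulr_ge0.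
  rewrite mulrC ler_pdivlMr ?exprn_gt0// mul1r ler_wiXn2l ?ltW//; exact: ltnW.
have s : (\sum_(n <oo) P (F n) < +oo)%E.
  apply: (@le_lt_trans _ _ (K' * (1 - r)^-1)%:E); last by rewrite ltry.
  apply: lime_le; first by apply: is_cvg_nneseries.
  apply: nearW => n; apply: (@le_trans _ _ (\sum_(0 <= i < n) (K' * r ^+ i)%:E)%E).
    by apply: lee_sum => i _.
  rewrite sumEFin lee_fin; have rn : `|r| < 1 by rewrite gtr0_norm.
  exact: (geometric_le_lim n K'0 r0 rn).
have := lim_sup_set_cvg0 mF s; have mL : measurable (lim_sup_set F).
  by apply: bigcap_measurable => // k _; exact: bigcup_measurable.
move=> L0; exists (lim_sup_set F); split => // w /= nw.
move=> n _; apply: contrapT => nF; apply: nw; exists n => k nk Fk; apply: nF.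
by exists k.
Qed.

End borel_cantelli_rates.

(* Summed over the dyadic block [2^k <= n < 2^(k+1)] the bounds become geometric in
   [k]. *)
Lemma borel_cantelli_power d (T : measurableType d) (R : realType) (P : probability T R)
    (F : nat -> set T) (a : R) n0 : (forall n, measurable (F n)) -> 0 < a ->
  (forall n, (n0 <= n)%N -> (P (F n) <= (expR (- ((1 + a) * ln n%:R)))%:E)%E) ->
  {ae P, forall w, eventually_avoids F w}.
Proof.
move=> mF a0 h.
pose G k : set T := \big[setU/set0]_(n <- iota (2 ^ k) (2 ^ k)) F n.
have mG k : measurable (G k) by apply: bigsetU_measurable.
pose l2 := ln (2 : R).
have l20 : 0 < l2 by rewrite ln_gt0// ltr1n.
pose r := expR (- (a * l2)).
have r01 : 0 < r < 1 by rewrite expR_gt0 /= -expR0 ltr_expR oppr_lt0 mulr_gt0.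
have hG k : (n0 <= k)%N -> (P (G k) <= (1 * r ^+ k)%:E)%E.
  move=> nk; have k2 : (k < 2 ^ k)%N by exact: ltn_expl.
  apply: (le_trans (probability_bigsetU_le P _)) => //.
  apply: (@le_trans _ _ (\sum_(i <- iota (2 ^ k) (2 ^ k)) (expR (- ((1 + a) * (k%:R * l2))))%:E)%E).
    rewrite big_seq [leRHS]big_seq; apply: lee_sum => n; rewrite mem_iota => /andP[n1 n2].
    apply: (le_trans (h n _)).
      by apply: (leq_trans nk); apply: (leq_trans (ltnW k2)).
    rewrite lee_fin ler_expR lerN2 ler_wpM2l//; first by rewrite addr_ge0// ltW.
    rewrite /l2 mulr_natl -lnXn// ler_ln ?posrE ?exprn_gt0// ?ltr0n.
      by rewrite -natrX ler_nat.
    by apply: leq_trans n1; rewrite expn_gt0.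
  rewrite sumEFin lee_fin big_const_seq count_predT size_iota iter_addr addr0 mul1r.
  have -> : r ^+ k = expR (k%:R * l2) * expR (- ((1 + a) * (k%:R * l2))).
    by rewrite /r -expRM_natl -expRD; congr expR; ring.
  by rewrite expRM_natl /l2 lnK ?posrE// -natrX -[leLHS]mulr_natl.
have := borel_cantelli_geometric mG ler01 r01 hG.
apply: filterS => w [m hm]; exists (2 ^ m)%N => n mn Fn.
have n0' : (0 < n)%N by apply: leq_trans mn; rewrite expn_gt0.
have /andP[k1 k2] := trunc_log_bounds (ltnSn 1) n0'.
apply: (hm (trunc_log 2 n)).
  exact: trunc_log_max.
rewrite /G -bigcup_seq; exists n => //=.
by rewrite mem_iota k1 /= addnn -mul2n -expnS.
Qed.

Section almost_sure.
Context d (T : measurableType d) (R : realType) (P : probability T R).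
Variables (tau : seq bool -> {RV P >-> R}) (B : seq bool -> R -> {RV P >-> R}).
Hypothesis hB : regular_bbm tau B.
Variable c : R.
Hypothesis c2 : c ^+ 2 = 2.
Hypothesis c0 : 0 < c.
Local Notation L := (fun n : nat => ln (n%:R : R)).

Let c12 : 1 <= c <= 3 / 2.
Proof.
apply/andP; split; rewrite -(@ler_pXn2r _ 2)// ?nnegrE ?(ltW c0)// c2.
  by rewrite expr1n; lra.
by rewrite expr2; lra.
Qed.

Let exists_bbm : exists (P : probability T R) (tau : seq bool -> {RV P >-> R})
  (B : seq bool -> R -> {RV P >-> R}), regular_bbm tau B.
Proof. by exists P, tau, B. Qed.

Lemma generation_below_scale a b k g s w : 0 < k ->
  generation_below (k * a) (k * b) g (fun u => tau u) (fun u => B u) (k * s) w ->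
  generation_below a b g (fun u => tau u) (fun u => B u) s w.
Proof.
by move=> k0 h v /h; rewrite -!mulrA -mulrDr ler_pM2l.
Qed.

Let expR4 : 8 * expR (- 4) <= 1 :> R.
Proof.
have h := @expR_ge1Dxn R 4 1 ltac:(lra).
rewrite expRN ler_pdivrMr ?expR_gt0// mul1r; apply: le_trans h.
rewrite (_ : (2`!)%:R = 2 :> R)// expr2; lra.
Qed.

(** Chebyshev with exponent 1/2: each generation contributes the factor 2 / (1 - 1/2) = 4, and the
    threshold 16 g contributes exp(-8). *)
Lemma birth_time_tail g : (P (~` generation_below 1 0 g (fun u => tau u) (fun u => B u)
  (16 * g%:R)) <= (1 * (1 / 2) ^+ g)%:E)%E.
Proof.
have ab : 1 / 2 * 1 + (1 / 2 * 0) ^+ 2 / 2 < 1 :> R by rewrite mulr0 expr0n /=; lra.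
apply: (@le_trans _ _ (P (~` generation_below (1 / 2 * 1) (1 / 2 * 0) g (fun u => tau u)
    (fun u => B u) (1 / 2 * (16 * g%:R))))).
  apply: le_measure; rewrite ?inE.
  - by apply: measurableC; exact: measurable_generation_event.
  - by apply: measurableC; exact: measurable_generation_event.
  by apply: subsetC => w; apply: generation_below_scale.
apply: (le_trans (generation_tail g _ ab hB)); rewrite lee_fin [leRHS]mul1r.
have -> : - (1 / 2 * (16 * g%:R)) = g%:R * (- 8) :> R by field.
rewrite expRM_natl -exprMn lerXn2r ?nnegrE//.
- by rewrite mulr_ge0 ?expR_ge0// divr_ge0// mulr0 expr0n /=; lra.
- have -> : - 8 = - 4 + - 4 :> R by lra.
  have -> : 2 / (1 - (1 / 2 * 1 + (1 / 2 * 0) ^+ 2 / 2)) = 4 :> R.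
    by rewrite mulr0 expr0n /=; field.
  have := expR_ge0 (- 4 : R); rewrite expRD; have := expR4; nra.
Qed.

(** Again exponent 1/2: [c / 2 + 1 / 8 <= 7 / 8] bounds the factor per generation by 16, and 16
    exp(-8) is below 1/2. *)
Lemma birth_position_tail g : (P (~` generation_below c (-1) g (fun u => tau u)
  (fun u => B u) (16 * g%:R)) <= (1 * (1 / 2) ^+ g)%:E)%E.
Proof.
have /andP[c1 c3] := c12.
have q : 1 / 2 * c + (1 / 2 * - 1) ^+ 2 / 2 <= 7 / 8 by rewrite expr2; lra.
have ab : 1 / 2 * c + (1 / 2 * - 1) ^+ 2 / 2 < 1 by apply: (le_lt_trans q); lra.
apply: (@le_trans _ _ (P (~` generation_below (1 / 2 * c) (1 / 2 * -1) g (fun u => tau u)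
    (fun u => B u) (1 / 2 * (16 * g%:R))))).
  apply: le_measure; rewrite ?inE.
  - by apply: measurableC; exact: measurable_generation_event.
  - by apply: measurableC; exact: measurable_generation_event.
  by apply: subsetC => w; apply: generation_below_scale.
apply: (le_trans (generation_tail g _ ab hB)); rewrite lee_fin [leRHS]mul1r.
have -> : - (1 / 2 * (16 * g%:R)) = g%:R * (- 8) :> R by field.
set Q := _ + _ in q ab *.
have Q1 : 2 / (1 - Q) <= 16 by rewrite ler_pdivrMr ?subr_gt0//; lra.
have Q0 : 0 <= 2 / (1 - Q) by rewrite divr_ge0// subr_ge0 ltW.
rewrite expRM_natl -exprMn lerXn2r ?nnegrE//; first by rewrite mulr_ge0 ?expR_ge0.
apply: (@le_trans _ _ (16 * expR (- 8))); first by rewrite ler_wpM2r ?expR_ge0.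
have -> : - 8 = - 4 + - 4 :> R by lra.
have := expR_ge0 (- 4 : R); rewrite expRD; have := expR4; nra.
Qed.

Lemma controlled_eventually : {ae P, forall w, exists g0, forall g, (g0 <= g)%N ->
  generation_controlled c g (16 * g%:R) (16 * g%:R) (fun u => tau u) (fun u => B u) w}.
Proof.
have m a b g : measurable (~` generation_below a b g (fun u => tau u) (fun u => B u) (16 * g%:R)).
  by apply: measurableC; exact: measurable_generation_event.
have half : 0 < (1 / 2 : R) < 1 by lra.
have h1 := borel_cantelli_geometric (m 1 0) ler01 half (fun g (_ : (0 <= g)%N) => birth_time_tail g).
have h2 := borel_cantelli_geometric (m c (-1)) ler01 half (fun g (_ : (0 <= g)%N) => birth_position_tail g).
move: h1 h2; apply: filterS2 => w [g1 h1] [g2 h2]; exists (maxn g1 g2) => g.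
rewrite geq_max => /andP[gg1 gg2]; split; apply: contrapT.
  exact: h1.
exact: h2.
Qed.

(** The weight -7 gives the factor 2/8 per generation, and 4^(-10) exp(7) <= 2^-6 per unit of [n].
    Consequently particles alive by time n + 1 belong to generations below 10 n, for large [n]. *)
Lemma birth_time_late : {ae P, forall w, exists n0, forall n, (n0 <= n)%N ->
  forall v, size v = (10 * n)%N -> n%:R + 2 <= birth_time (fun u => tau u) v w}.
Proof.
have ab : - 7 + 0 ^+ 2 / 2 < 1 :> R by rewrite expr0n /=; lra.
have m n : measurable (~` generation_below (- 7) 0 (10 * n) (fun u => tau u) (fun u => B u)
    (- 7 * (n%:R + 2))).
  by apply: measurableC; exact: measurable_generation_event.
have half : 0 < (1 / 2 : R) < 1 by lra.
have h n : (0 <= n)%N -> (P (~` generation_below (- 7) 0 (10 * n) (fun u => tau u)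
    (fun u => B u) (- 7 * (n%:R + 2))) <= (expR 14 * (1 / 2) ^+ n)%:E)%E.
  move=> _; apply: (le_trans (generation_tail (10 * n) _ ab hB)); rewrite lee_fin.
  have -> : - (- 7 * (n%:R + 2)) = 14 + n%:R * 7 :> R by ring.
  rewrite expRD mulrCA ler_wpM2l ?expR_ge0// exprM expRM_natl -exprMn.
  rewrite lerXn2r ?nnegrE//; first by rewrite mulr_ge0 ?expR_ge0// exprn_ge0// expr0n /= divr_ge0//; lra.
  have -> : 2 / (1 - (- 7 + 0 ^+ 2 / 2)) = (2 ^- 2 : R) by rewrite expr0n /=; field.
  have e1 : expR 1 <= 4 :> R.
    have -> : 1 = 1 / 2 + 1 / 2 :> R by lra.
    rewrite expRD; have := expR_half_le2 R; have := expR_ge0 (1 / 2 : R); nra.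
  have -> : 7 = 7%:R * 1 :> R by rewrite mulr1.
  rewrite expRM_natl.
  have : expR 1 ^+ 7 <= 4 ^+ 7 :> R by rewrite lerXn2r ?nnegrE ?expR_ge0.
  have -> : (4 : R) = 2 ^+ 2 by rewrite expr2; lra.
  rewrite -exprM => h7; rewrite -exprVn -exprM.
  apply: (@le_trans _ _ (2^-1 ^+ (2 * 10) * 2 ^+ (2 * 7))).
    by apply: ler_wpM2l => //; rewrite exprn_ge0// invr_ge0.
  rewrite (_ : (2 * 10 = 2 * 7 + 6)%N)// exprD mulrAC -exprMn mulVf ?pnatr_eq0// expr1n mul1r.
  by rewrite !exprS expr0; lra.
have := borel_cantelli_geometric m (expR_ge0 14) half h.
apply: filterS => w [n0 hn]; exists n0 => n nn v vs.
have := hn n nn; move/contrapT => /(_ v vs); rewrite mul0r addr0; lra.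
Qed.

Lemma truncn_ln_large (delta : R) g0 : 0 < delta -> exists n0 : nat, forall n,
  (n0 <= n)%N -> (g0 <= Num.truncn (delta * L n))%N.
Proof.
move=> d0; exists (Num.bound (expR (g0%:R / delta))) => n /ln_ge_of_bound [h _].
have h' : g0%:R <= delta * L n by rewrite mulrC -ler_pdivrMr.
by rewrite truncn_ge_nat// (le_trans _ h').
Qed.

(** A failure probability n^-12 over at most n^9 times leaves the summable n^-3. The generation is
    eventually controlled almost surely, so the only failure left to exclude is that of hitting. *)
Lemma lower_eventually (theta e : R) (N : nat -> nat) (times : nat -> seq R) n1 :
  0 <= theta <= 2 -> 0 < e <= 1 ->
  (forall n, (n1 <= n)%N -> [/\ (0 < N n)%N, (N n)%:R * spacing R n <= n%:R / 16 &
    expR ((3 / 2 - theta) * L n) <= (N n)%:R * (512 * L n ^+ 2)]) ->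
  (forall n t, (n1 <= n)%N -> t \in times n -> n%:R / 2 <= t <= 2 * n%:R) ->
  (forall n, (n1 <= n)%N -> (size (times n))%:R <= expR (9 * L n)) ->
  {ae P, forall w, exists n0, forall n, (n0 <= n)%N -> forall t, t \in times n ->
    hit (targets c (spacing R n) (N n)) tau B t (- (c * t) + (theta / c + e) * L n) w}.
Proof.
move=> th e01 hN ht hs.
have [delta [n2 [d0 H]]] := lower_estimate exists_bbm c2 c0 th e01.
pose g n := Num.truncn (delta * L n).
pose A n t := generation_controlled c (g n) (16 * (g n)%:R) (16 * (g n)%:R)
  (fun u => tau u) (fun u => B u) `\`
  hit (targets c (spacing R n) (N n)) tau B t (- (c * t) + (theta / c + e) * L n).
have mA n t : measurable (A n t).
  apply: measurableD; last exact: (measurable_hit_event hB).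
  by apply: measurableI; exact: measurable_generation_event.
pose F n := \big[setU/set0]_(t <- times n) A n t.
have mF n : measurable (F n) by apply: bigsetU_measurable.
have PF n : (maxn n1 n2 <= n)%N -> (P (F n) <= (expR (- ((1 + 2) * L n)))%:E)%E.
  rewrite geq_max => /andP[n1n n2n]; have [N0 Nn hNn] := hN n n1n.
  apply: (le_trans (probability_bigsetU_le P _)) => //.
  apply: (@le_trans _ _ (\sum_(t <- times n) (expR (- (12 * L n)))%:E)%E).
    rewrite big_seq [leRHS]big_seq; apply: lee_sum => t tn.
    exact: (H n (N n) n2n N0 Nn hNn _ _ _ _ hB (ht n t n1n tn)).
  rewrite sumEFin lee_fin big_const_seq count_predT iter_addr addr0 -[leLHS]mulr_natl.
  apply: (@le_trans _ _ (expR (9 * L n) * expR (- (12 * L n)))).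
    by rewrite ler_wpM2r ?expR_ge0// hs.
  by rewrite -expRD ler_expR le_eqVlt; apply/orP; left; apply/eqP; ring.
have := borel_cantelli_power mF (ltac:(lra) : 0 < 2 :> R) PF.
apply: filterS2 controlled_eventually => w [g0 hg] [m hm].
have [n3 hn3] := truncn_ln_large g0 d0.
exists (maxn m n3) => n; rewrite geq_max => /andP[mn n3n] t tn.
apply: contrapT => nh; apply: (hm n mn); rewrite /F -bigcup_seq; exists t => //.
by split => //; apply: hg; exact: hn3.
Qed.

Lemma square_ln_small : exists n0 : nat, forall n, (n0 <= n)%N ->
  1 <= L n /\ 256 * L n ^+ 2 <= n%:R.
Proof.
have [x1 [x10 h1]] := cube_le_expR ltr01 (ltac:(lra) : 0 <= 256 :> R).
exists (Num.bound (expR (Num.max 1 x1))) => n /ln_ge_of_bound [].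
rewrite ge_max => /andP[x_1 x_x1] nE; split => //.
have := h1 _ x_x1; rewrite mul1r -nE; apply: le_trans.
have x0 : 0 <= L n by lra.
by apply: ler_wpM2l; [lra|rewrite [leRHS]exprS ler_peMl// exprn_ge0].
Qed.

Lemma lower_all_times (e : R) (times : nat -> seq R) : 0 < e <= 1 ->
  (forall n s, s \in times n -> n%:R <= s <= n%:R + 1) ->
  (exists n1, forall n, (n1 <= n)%N -> (size (times n))%:R <= expR (9 * L n)) ->
  {ae P, forall w, exists n0, forall n, (n0 <= n)%N -> forall s, s \in times n ->
    exists u, alive (fun u => tau u) s w u /\
      c * s - (3 / 2 / c + e) * L n <= position (fun u => tau u) (fun u => B u) u s w}.
Proof.
move=> e01 htimes [n1 hsize]; have [n2 hL] := square_ln_small.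
have th : 0 <= (3 / 2 : R) <= 2 by lra.
(* With [N = 1] the single target lies [spacing n] ahead, so the clock starts that much earlier. *)
pose times' n := [seq s - spacing R n | s <- times n].
have hN n : (maxn n1 n2 <= n)%N -> [/\ (0 < 1)%N, 1%:R * spacing R n <= n%:R / 16 &
    expR ((3 / 2 - 3 / 2) * L n) <= 1%:R * (512 * L n ^+ 2)].
  rewrite geq_max => /andP[_ /hL [L1 Ln]]; split => //.
    by rewrite spacingE mul1r; lra.
  by rewrite subrr mul0r expR0 mul1r expr2; nra.
have ht n t : (maxn n1 n2 <= n)%N -> t \in times' n -> n%:R / 2 <= t <= 2 * n%:R.
  rewrite geq_max => /andP[_ /hL [L1 Ln]] /mapP[s /htimes /andP[s1 s2] ->].
  have L2 : 1 <= L n ^+ 2 by rewrite expr2; nra.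
  by rewrite spacingE; apply/andP; split; lra.
have hs n : (maxn n1 n2 <= n)%N -> (size (times' n))%:R <= expR (9 * L n).
  by rewrite geq_max size_map => /andP[/hsize].
have := @lower_eventually (3 / 2) e (fun=> 1%N) times' _ th e01 hN ht hs.
apply: filterS => w [n0 h]; exists n0 => n nn s sn.
have [a [u [/targetsP [i i1 ->]]]] := h n nn (s - spacing R n) (map_f _ sn).
have -> : i = 1%N by apply/eqP; rewrite eqn_leq andbC.
rewrite mul1r [_ + (s - _)]addrC subrK => al hp; exists u; split => //.
by move: hp; rewrite [X in X <= _]/= mulrBr; lra.
Qed.

Lemma lower_some_time (e : R) : 0 < e <= 1 ->
  {ae P, forall w, exists n0, forall n, (n0 <= n)%N -> exists s u,
    [/\ n%:R <= s <= 2 * n%:R, alive (fun u => tau u) s w u &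
      c * s - (1 / 2 / c + e) * L n <= position (fun u => tau u) (fun u => B u) u s w]}.
Proof.
move=> e01; have [n2 hL] := square_ln_small.
have th : 0 <= (1 / 2 : R) <= 2 by lra.
(* As many targets as fit into n/16 at distance 16 log^2 n, hence 256; the rate condition for
   [theta = 1 / 2] asks for a number of this order. *)
pose N n := Num.truncn (n%:R / (256 * L n ^+ 2)).
have N_le n : (n2 <= n)%N -> (N n)%:R * spacing R n <= n%:R / 16.
  move=> /hL [L1 Ln]; have L2 : 1 <= L n ^+ 2 by rewrite expr2; nra.
  have : (N n)%:R <= n%:R / (256 * L n ^+ 2)
    by rewrite /N truncn_le; apply: mulr_ge0; [exact: ler0n|rewrite invr_ge0; lra].
  by rewrite ler_pdivlMr; [rewrite spacingE; lra|lra].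
have N_gt0 n : (n2 <= n)%N -> (0 < N n)%N.
  move=> /hL [L1 Ln]; have L2 : 1 <= L n ^+ 2 by rewrite expr2; nra.
  by rewrite /N truncn_gt0 ler_pdivlMr; [rewrite mul1r|lra].
have hN n : (n2 <= n)%N -> [/\ (0 < N n)%N, (N n)%:R * spacing R n <= n%:R / 16 &
    expR ((3 / 2 - 1 / 2) * L n) <= (N n)%:R * (512 * L n ^+ 2)].
  move=> n2n; split; [exact: N_gt0|exact: N_le|].
  have N1 : 1 <= (N n)%:R :> R by rewrite ler1n N_gt0.
  have [L1 Ln] := hL n n2n; have L2 : 1 <= L n ^+ 2 by rewrite expr2; nra.
  have : n%:R / (256 * L n ^+ 2) < (N n)%:R + 1 by rewrite natr1 /N truncnS_gt.
  rewrite ltr_pdivrMr; last lra.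
  have -> : (3 / 2 - 1 / 2) * L n = L n by lra.
  have n0 : 0 < n%:R :> R by lra.
  rewrite lnK ?posrE//; nra.
have ht n t : (n2 <= n)%N -> t \in [:: n%:R : R] -> n%:R / 2 <= t <= 2 * n%:R.
  move=> /hL [L1 Ln]; rewrite inE => /eqP ->.
  have L2 : 1 <= L n ^+ 2 by rewrite expr2; nra.
  by apply/andP; split; lra.
have hs n : (n2 <= n)%N -> (size [:: n%:R : R])%:R <= expR (9 * L n).
  by move=> /hL [L1 Ln] /=; rewrite -[leLHS]expR0 ler_expR; lra.
have := @lower_eventually (1 / 2) e N (fun n => [:: n%:R]) _ th e01 hN ht hs.
apply: filterS => w [n0 h]; exists (maxn n0 n2) => n; rewrite geq_max => /andP[nn n2n].
have [a [u [/targetsP [i /andP[i0 iN] ->]]]] := h n nn n%:R (mem_head _ _).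
move=> /= al hp; exists (i%:R * spacing R n + n%:R), u; split => //.
  have s0 := spacing_ge0 R n; have NN := N_le n n2n.
  have : i%:R * spacing R n <= (N n)%:R * spacing R n by rewrite ler_wpM2r// ler_nat.
  have : 0 <= i%:R * spacing R n by rewrite mulr_ge0.
  have : 0 <= n%:R :> R by [].
  by move=> ? ? ?; apply/andP; split; lra.
by rewrite mulrDr; lra.
Qed.

(** With [delta = c e / 2] the upper tail is n to the power (1/2 - c e) + c e / 2 - 3/2 = -1 - c e /
    2, summable over all [n]. All the times of a unit interval form one set of targets. *)
Lemma upper_all_times (e : R) (times : nat -> seq R) : 0 < e <= 1 ->
  (forall n r, r \in times n -> n%:R <= r <= n%:R + 1) ->
  (exists n1, forall n, (n1 <= n)%N -> (size (times n))%:R <= expR (9 * L n)) ->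
  {ae P, forall w, exists n0, forall n, (n0 <= n)%N -> forall s, s \in times n ->
    forall u, alive (fun u => tau u) s w u ->
      position (fun u => tau u) (fun u => B u) u s w <= c * n%:R - (1 / 2 / c - e) * L n}.
Proof.
move=> /andP[e0 e1] htimes [n1 hsize]; have /andP[c1 c3] := c12.
have ce : 0 < c * e / 2 <= 1 by rewrite divr_gt0 ?mulr_gt0//=; nra.
have [n2 H] := upper_tail exists_bbm c2 c0 ce.
have [n3 hL] := square_ln_small.
pose S n := [seq (s - n%:R, 0 : R) | s <- times n].
pose y n := - (1 / 2 / c - e) * L n.
pose F n := hit (S n) tau B n%:R (- (c * n%:R) - y n).
have mF n : measurable (F n) by exact: (measurable_hit_event hB).
have ce2 : 0 < c * e / 2 by case/andP: ce.
have PF n : (maxn n1 (maxn n2 n3) <= n)%N ->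
    (P (F n) <= (expR (- ((1 + c * e / 2) * L n)))%:E)%E.
  rewrite !geq_max => /and3P[n1n n2n n3n]; have [L1 Ln] := hL n n3n.
  have S0 a : a \in S n -> 0 <= a.1 <= 1 /\ 0 <= a.2.
    by move=> /mapP[s /htimes /andP[s1 s2] ->] /=; split => //; lra.
  have sS : (size (S n))%:R <= expR (9 * L n) by rewrite size_map hsize.
  have yn : `|y n| <= 2 * L n.
    rewrite /y normrM (ger0_norm (_ : 0 <= L n)); last lra.
    rewrite ler_wpM2r//; first lra.
    have q1 : 1 / 2 / c <= 1 by rewrite ler_pdivrMr//; lra.
    have q0 : 0 <= 1 / 2 / c by rewrite !divr_ge0// ltW.
    by rewrite ler_norml; lra.
  apply: (le_trans (H n (S n) (y n) n2n S0 sS yn _ _ _ hB)).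
  rewrite lee_fin ler_expR /y.
  have -> : c * (- (1 / 2 / c - e) * L n) = - (1 / 2) * L n + c * e * L n by field; lra.
  lra.
have := borel_cantelli_power mF ce2 PF.
apply: filterS => w [n0 h]; exists n0 => n nn s sn u al.
rewrite leNgt; apply/negP => pu; apply: (h n nn).
exists (s - n%:R, 0), u; split.
- exact: (map_f (fun s => (s - n%:R, 0 : R))).
- by rewrite /= subrK.
- by rewrite /= subrK /y; lra.
Qed.

(** With 3/2 in place of 1/2 the bound is only n^(-c e / 2): not summable over [n], but geometric
    along [n = 2^k]. *)
Lemma upper_some_times (e : R) : 0 < e <= 1 ->
  {ae P, forall w, exists k0, forall k, (k0 <= k)%N ->
    forall u, alive (fun u => tau u) (2 ^ k)%N%:R w u ->
      position (fun u => tau u) (fun u => B u) u (2 ^ k)%N%:R w <=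
      c * (2 ^ k)%N%:R - (3 / 2 / c - e) * L (2 ^ k)%N}.
Proof.
move=> /andP[e0 e1]; have /andP[c1 c3] := c12.
have ce : 0 < c * e / 2 <= 1 by rewrite divr_gt0 ?mulr_gt0//=; nra.
have [n2 H] := upper_tail exists_bbm c2 c0 ce.
have [n3 hL] := square_ln_small.
pose y n := - (3 / 2 / c - e) * L n.
pose F k := hit [:: (0, 0)] tau B (2 ^ k)%N%:R (- (c * (2 ^ k)%N%:R) - y (2 ^ k)%N).
have mF n : measurable (F n) by exact: (measurable_hit_event hB).
have ce2 : 0 < c * e / 2 by case/andP: ce.
pose r := expR (- (c * e / 2 * ln 2)).
have l20 : 0 < ln (2 : R) by rewrite ln_gt0// ltr1n.
have r01 : 0 < r < 1 by rewrite expR_gt0 /= -expR0 ltr_expR oppr_lt0 mulr_gt0.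
have PF k : (maxn n2 n3 <= k)%N -> (P (F k) <= (1 * r ^+ k)%:E)%E.
  move=> kn; have k2 : (k < 2 ^ k)%N by exact: ltn_expl.
  have := leq_trans kn (ltnW k2); rewrite geq_max => /andP[n2n n3n].
  have [L1 Ln] := hL _ n3n; set n := (2 ^ k)%N in n2n n3n L1 Ln *.
  have S0 (a : R * R) : a \in [:: (0, 0)] -> 0 <= a.1 <= 1 /\ 0 <= a.2.
    by rewrite inE => /eqP -> /=; rewrite lexx ler01.
  have sS : (size [:: (0 : R, 0 : R)])%:R <= expR (9 * L n).
    by rewrite -[leLHS]expR0 ler_expR; lra.
  have yn : `|y n| <= 2 * L n.
    rewrite /y normrM (ger0_norm (_ : 0 <= L n)); last lra.
    rewrite ler_wpM2r//; first lra.
    have q1 : 3 / 2 / c <= 2 by rewrite ler_pdivrMr//; lra.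
    have q0 : 0 <= 3 / 2 / c by rewrite !divr_ge0// ltW.
    by rewrite ler_norml; lra.
  apply: (le_trans (H n _ (y n) n2n S0 sS yn _ _ _ hB)).
  have -> : 1 * r ^+ k = expR (- (c * e / 2 * L n)).
    rewrite mul1r /r -expRM_natl /n natrX lnXn// -mulr_natl; congr expR; ring.
  rewrite lee_fin ler_expR /y.
  have -> : c * (- (3 / 2 / c - e) * L n) = - (3 / 2) * L n + c * e * L n by field; lra.
  lra.
have := borel_cantelli_geometric mF ler01 r01 PF.
apply: filterS => w [n0 h]; exists n0 => n nn u al.
rewrite leNgt; apply/negP => pu; apply: (h n nn).
exists (0, 0), u; split; first exact: mem_head.
- by rewrite /= add0r.
- by rewrite /= add0r /y; lra.
Qed.

End almost_sure.

(** * Continuity of the particle paths *)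

Section chaining.
Context (R : realType).
Variable f : R -> R.
Hypothesis cf : {within `[0, +oo[, continuous f}.
Variables (m : nat) (K : nat).
Local Notation h j := ((16 ^ j)%N%:R : R).
Hypothesis increments : forall j k, (m <= j)%N -> (k < K * 16 ^ j)%N ->
  `|f (k.+1%:R / h j) - f (k%:R / h j)| <= 2 ^- j.

Let h0 j : 0 < h j. Proof. by rewrite ltr0n expn_gt0. Qed.

Let floor (j : nat) (r : R) : nat := Num.truncn (r * h j).

Let floor_le j r : 0 <= r -> (floor j r)%:R <= r * h j.
Proof. by move=> r0; rewrite /floor truncn_le mulr_ge0// ltW. Qed.

Let floor_gt j r : r * h j < (floor j r).+1%:R.
Proof. exact: truncnS_gt. Qed.

Let floor_lt j r : 0 <= r < K%:R -> (floor j r < K * 16 ^ j)%N.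
Proof.
move=> /andP[r0 rK]; rewrite -(@ltr_nat R) natrM.
by apply: (le_lt_trans (floor_le j r0)); rewrite ltr_pM2r.
Qed.

Let consecutive j k i : (m <= j)%N -> (k + i <= K * 16 ^ j)%N ->
  `|f ((k + i)%:R / h j) - f (k%:R / h j)| <= i%:R * 2 ^- j.
Proof.
move=> mj; elim: i => [|i IH] ki; first by rewrite addn0 subrr normr0 mul0r.
rewrite addnS -[X in _ <= X / _]natr1 mulrDl mul1r.
have -> : f ((k + i).+1%:R / h j) - f (k%:R / h j) =
  (f ((k + i)%:R / h j) - f (k%:R / h j)) + (f ((k + i).+1%:R / h j) - f ((k + i)%:R / h j)).
  by ring.
apply: (le_trans (ler_normD _ _)); apply: lerD.
  by apply: IH; apply: leq_trans ki; rewrite leq_add2l.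
by apply: increments => //; rewrite -addnS.
Qed.

(** A cell of level [j] contains 16 cells of the next level, so the finer approximation of [r] is at
    most 15 steps away. *)
Let refine j r : 0 <= r < K%:R -> (m <= j)%N ->
  `|f ((floor j.+1 r)%:R / h j.+1) - f ((floor j r)%:R / h j)| <= 15 * 2 ^- j.+1.
Proof.
move=> rK mj; have /andP[r0 _] := rK.
have hS : h j.+1 = 16 * h j by rewrite expnS natrM.
have k1 : (16 * floor j r <= floor j.+1 r)%N.
  rewrite truncn_ge_nat; last by rewrite mulr_ge0// ltW.
  by rewrite natrM hS mulrCA ler_wpM2l// floor_le.
have k2 : (floor j.+1 r < 16 * floor j r + 16)%N.
  rewrite -(@ltr_nat R); apply: (le_lt_trans (floor_le _ r0)).
  rewrite hS mulrCA natrD natrM -[X in _ + X]mulr1 -mulrDr ltr_pM2l//.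
  by rewrite natr1 floor_gt.
have -> : (floor j r)%:R / h j = (16 * floor j r)%:R / h j.+1.
  by rewrite natrM hS -mulf_div divff ?mul1r// pnatr_eq0.
have mj' : (m <= j.+1)%N by exact: leqW.
have kK : (16 * floor j r + (floor j.+1 r - 16 * floor j r) <= K * 16 ^ j.+1)%N.
  by rewrite subnKC// ltnW// floor_lt.
have := consecutive mj' kK; rewrite subnKC// => /le_trans; apply.
rewrite ler_wpM2r ?invr_ge0 ?exprn_ge0// ler_nat.
by rewrite leq_subLR -ltnS -addnS.
Qed.

Let approx_le r j : 0 <= r < K%:R -> (m <= j)%N ->
  `|f ((floor j r)%:R / h j) - f ((floor m r)%:R / h m)| <= 15 * (2 ^- m - 2 ^- j).
Proof.
move=> rK; elim: j => [|j IH]; first by rewrite leqn0 => /eqP ->; rewrite !subrr normr0 mulr0.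
rewrite leq_eqVlt => /predU1P[->|]; first by rewrite !subrr normr0 mulr0.
rewrite ltnS => mj; have := IH mj; have := refine rK mj.
set a := f _; set b := f _; set c := f _ => h1 h2.
have -> : a - c = (a - b) + (b - c) by ring.
apply: (le_trans (ler_normD _ _)); apply: (le_trans (lerD h1 h2)).
by rewrite exprS invfM; lra.
Qed.

Let approx_cvg r : 0 <= r -> (fun j => f ((floor j r)%:R / h j)) @ \oo --> f r.
Proof.
move=> r0; have an : (fun j => (floor j r)%:R / h j) @ \oo --> r.
  apply/cvgrPdist_le => e e0; near=> j.
  have l1 := floor_le j r0; have l2 := floor_gt j r.
  have l3 : (floor j r)%:R / h j <= r by rewrite ler_pdivrMr.
  rewrite ger0_norm ?subr_ge0// lerBlDl -lerBlDr.
  rewrite ler_pdivlMr// mulrBl lerBlDr; apply: (le_trans (ltW l2)).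
  rewrite -natr1 lerD2l -ler_pdivrMl// mulr1.
  apply: (@le_trans _ _ j.+1%:R); last by rewrite ler_nat ltn_expl.
  rewrite -[leRHS]invrK lef_pV2 ?posrE ?invr_gt0//.
  by apply: ltW; near: j; exact: (near_infty_natSinv_lt (PosNum e0)).
have /subspace_continuousP /(_ r) := cf.
rewrite /= in_itv /= andbT => /(_ r0) cr.
apply: (cvg_comp _ _ _ cr) => U rU.
have : \forall n \near \oo, `[0, +oo[%classic ((floor n r)%:R / h n : R) ->
  U ((floor n r)%:R / h n) by exact: an rU.
by apply: filterS => n; apply; rewrite /= in_itv /= andbT divr_ge0// ltW.
Unshelve. all: by end_near. Qed.

Let approx_limit r : 0 <= r < K%:R -> `|f r - f ((floor m r)%:R / h m)| <= 15 * 2 ^- m.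
Proof.
move=> rK; have /andP[r0 _] := rK.
have cv : (fun j => `|f ((floor j r)%:R / h j) - f ((floor m r)%:R / h m)|) @ \oo -->
    `|f r - f ((floor m r)%:R / h m)|.
  apply: cvg_norm; apply: cvgB; [exact: approx_cvg|exact: cvg_cst].
have <- := cvg_lim (@Rhausdorff R) cv.
apply: limr_le; first exact: (cvgP _ cv).
near=> j; have mj : (m <= j)%N by near: j; exists m.
apply: (le_trans (approx_le rK mj)); rewrite ler_wpM2l// lerBlDr lerDl.
by rewrite invr_ge0 exprn_ge0.
Unshelve. all: by end_near. Qed.

(** 31 = 15 + 1 + 15: refining either point costs 15 times the sum of 2^-j over j > m, and the
    approximations at level [m] are at most one step apart. *)
Lemma chaining r r' : 0 <= r < K%:R -> 0 <= r' < K%:R -> `|r - r'| <= (h m)^-1 ->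
  `|f r - f r'| <= 31 * 2 ^- m.
Proof.
wlog rr' : r r' / r <= r'.
  move=> H rK rK' hr; have [rr'|rr'] := leP r r'; first exact: H.
  by rewrite distrC; apply: H => //; [exact: ltW|rewrite distrC].
move=> rK rK' hr; have /andP[r0 _] := rK; have /andP[r0' _] := rK'.
have k1 : (floor m r <= floor m r')%N.
  rewrite truncn_ge_nat ?mulr_ge0//.
  by apply: (le_trans (floor_le m r0)); rewrite ler_wpM2r// ltW.
have k2 : (floor m r' <= floor m r + 1)%N.
  rewrite addn1 -ltnS -(@ltr_nat R) -natr1; apply: (le_lt_trans (floor_le m r0')).
  apply: (@le_lt_trans _ _ (r * h m + 1)); last by rewrite ltrD2r floor_gt.
  rewrite -lerBlDl -mulrBl -ler_pdivlMr// mul1r.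
  by move: hr; rewrite distrC ger0_norm// subr_ge0.
have mid : `|f ((floor m r')%:R / h m) - f ((floor m r)%:R / h m)| <= 2 ^- m.
  have kK : (floor m r + (floor m r' - floor m r) <= K * 16 ^ m)%N.
    by rewrite subnKC// ltnW// floor_lt.
  have := consecutive (leqnn m) kK; rewrite subnKC// => /le_trans; apply.
  rewrite ler_piMl ?invr_ge0 ?exprn_ge0// -[leRHS]/(1%:R) ler_nat.
  by rewrite leq_subLR.
have := approx_limit rK; have := approx_limit rK'; move: mid.
set a := f _; set b := f _; set x := f _; set y := f _.
rewrite !ler_norml => /andP[? ?] /andP[? ?] /andP[? ?]; apply/andP; split; lra.
Qed.

End chaining.

Section ancestors.
Context {T : Type} {R : realType}.
Implicit Types (tau : seq bool -> T -> R) (B : seq bool -> R -> T -> R) (w : T).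

Lemma birth_time_ge0 tau u w : (forall v, 0 < tau v w) -> 0 <= birth_time tau u w.
Proof. by move=> tau0; apply: sumr_ge0 => k _; exact: ltW. Qed.

Lemma birth_time_take tau k u w : (forall v, 0 < tau v w) ->
  birth_time tau (take k u) w <= birth_time tau u w.
Proof.
elim: u k tau => [|b u IH] [|k] tau tau0 //=.
  by rewrite birth_time_nil birth_time_ge0.
by rewrite !birth_time_cons lerD2l; apply: IH => v; exact: tau0.
Qed.

Lemma alive_at_birth tau u w : (forall v, 0 < tau v w) -> alive tau 0 w u -> u = [::].
Proof.
case: u => // b u tau0; rewrite /alive /= => /andP[]; rewrite birth_time_cons.
have := birth_time_ge0 u (fun v => tau0 (b :: v) : 0 < subtree tau b v w).
have := tau0 [::] => h1 h2 h3; exfalso; lra.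
Qed.

Lemma ancestor_close tau B u w (h eta K t t' : R) :
  (forall v, 0 < tau v w) -> (forall v, B v 0 w = 0) ->
  (forall v r r', (size v <= size u)%N -> 0 <= r < K -> 0 <= r' < K -> `|r - r'| <= h ->
    `|B v r w - B v r' w| <= eta) ->
  0 <= t -> t <= t' -> t' - t <= h -> t' < K -> alive tau t' w u ->
  exists2 v, alive tau t w v &
    `|position tau B u t' w - position tau B v t w| <= (size u).+1%:R * eta.
Proof.
elim: u tau B t t' => [|b u IH] tau B t t' tau0 B0 osc t0 tt' th tK.
  rewrite alive_nil => /andP[t'0 t't]; exists [::].
    by rewrite alive_nil t0 (le_lt_trans tt').
  rewrite !position_nil mul1r; apply: osc => //; [by rewrite t'0|by rewrite t0 (le_lt_trans tt')|].
  by rewrite ger0_norm// subr_ge0.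
rewrite alive_cons => au.
have tau0' v : 0 < subtree tau b v w by exact: tau0.
have t'tau : 0 <= t' - tau [::] w.
  by case/andP: (au) => h1 _; exact: le_trans (birth_time_ge0 u tau0') h1.
have taut' : tau [::] w <= t' by lra.
have osc' v r r' : (size v <= size u)%N -> 0 <= r < K -> 0 <= r' < K -> `|r - r'| <= h ->
    `|subtree B b v r w - subtree B b v r' w| <= eta.
  by move=> vu; apply: osc.
have B0' v : subtree B b v 0 w = 0 by exact: B0.
have tn := tau0 [::].
have tK' : t' - tau [::] w < K by lra.
have [tt|tt] := ltP t (tau [::] w); last first.
  have s0 : 0 <= t - tau [::] w by lra.
  have s1 : t - tau [::] w <= t' - tau [::] w by lra.
  have s2 : t' - tau [::] w - (t - tau [::] w) <= h by lra.
  have [v av hv] := IH _ _ _ _ tau0' B0' osc' s0 s1 s2 tK' au.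
  exists (b :: v); first by rewrite alive_cons.
  rewrite !position_cons opprD addrACA subrr add0r; apply: (le_trans hv).
  have eta0 : 0 <= eta.
    by apply: le_trans (osc [::] t t _ _ _ _); rewrite ?normr_ge0 ?subrr ?normr0 ?t0//; lra.
  by rewrite ler_wpM2r// ler_nat.
(* The root is still alive at [t]: the subtree is followed from its own time 0, when only its first
   particle lives. *)
have s2 : t' - tau [::] w - 0 <= h by lra.
have [v av hv] := IH _ _ 0 _ tau0' B0' osc' (lexx 0) t'tau s2 tK' au.
have vn := alive_at_birth tau0' av; move: hv; rewrite vn position_nil B0' subr0 => hv.
exists [::]; first by rewrite alive_nil t0.
rewrite position_cons position_nil.
have hB : `|B [::] (tau [::] w) w - B [::] t w| <= eta.
  apply: osc => //; [by rewrite (ltW tn) (le_lt_trans taut')|by rewrite t0 (le_lt_trans tt')|].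
  by rewrite ger0_norm; lra.
rewrite addrAC -natr1 mulrDl mul1r addrC; apply: (le_trans (ler_normD _ _)).
exact: lerD.
Qed.

End ancestors.

(** * Gaussian tails and a uniform modulus of continuity *)

Section gaussian_tail.
Context d (T : measurableType d) (R : realType) (P : probability T R).

(** Exponential Markov inequality with parameter [a]. Writing the event as [a ^+ 2 * v <= a * X]
    treats both tails, according to the sign of [a]. *)
Lemma gaussian_chernoff (X : {mfun T >-> R}) (v a : R) : 0 < v ->
  (forall A, measurable A -> P (X @^-1` A) = normal_prob 0 (Num.sqrt v) A) ->
  (P [set w | (a ^+ 2 * v <= a * X w)%R] <= (expR (- (a ^+ 2 * v / 2)))%:E)%E.
Proof.
move=> v0 lawX.
have mX : measurable_fun setT (fun w => a * X w) by exact: measurable_funM.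
have mA : measurable [set w | a ^+ 2 * v <= a * X w].
  have := measurable_fun_ler (measurable_cst (a ^+ 2 * v)) mX.
  by move=> /(_ measurableT [set true]); rewrite setTI; apply.
pose g (x : R) : \bar R := ((expR (a * x))%:E * cst 1%:E x)%E.
have mg : measurable_fun [set: R] g.
  apply: emeasurable_funM; last exact: measurable_cst.
  by apply/measurable_EFinP; apply: measurableT_comp => //; exact: measurable_funM.
have g0 x : (0 <= g x)%E by rewrite /g mule1 lee_fin expR_ge0.
have E : (\int[P]_w g (0 + X w)%R = (expR (a ^+ 2 * v / 2))%:E)%E.
  rewrite (integral_heat 0 v0 lawX mg g0) /g (@heat_tilt R a v 0 (cst 1%:E))//; first last.
    by rewrite ltW.
  by rewrite heat_cst// mule1 mulr0 add0r.
rewrite -(setIT [set _ | _]) -integral_indic//.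
have mgX : measurable_fun setT (fun w => g (0 + X w)%R).
  apply: (measurableT_comp mg); exact: measurable_funD.
apply: (@le_trans _ _ (\int[P]_w ((expR (- (a ^+ 2 * v)))%:E * g (0 + X w)%R))%E).
  apply: ge0_le_integral => //.
  - exact/measurable_EFinP.
  - by apply: emeasurable_funM.
  move=> w _; rewrite /g add0r mule1 -EFinM lee_fin -expRD indicE.
  case: (boolP (_ \in _)) => [|_]; last exact: expR_ge0.
  by rewrite inE /= => h; rewrite -[leLHS]expR0 ler_expR; lra.
rewrite ge0_integralZl//.
rewrite E -EFinM lee_fin -expRD ler_expR; lra.
Qed.

Lemma increment_tail (W : R -> {RV P >-> R}) (s t eta : R) : brownian_motion W ->
  0 <= s -> s < t -> 0 <= eta ->
  (P [set w | (eta < `|W t w - W s w|)%R] <= (2 * expR (- (eta ^+ 2 / (t - s) / 2)))%:E)%E.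
Proof.
move=> hW s0 st eta0; pose v := t - s; have v0 : 0 < v by rewrite subr_gt0.
have mX : measurable_fun setT (W t \- W s) by exact: measurable_funB.
pose X : {mfun T >-> R} := mfun_Sub (mem_set mX).
have XE w : X w = W t w - W s w by [].
have lawX A : measurable A -> P (X @^-1` A) = normal_prob 0 (Num.sqrt v) A.
  exact: (bm_normal_increments hW s0 st).
have aE (a : R) : a ^+ 2 = (eta / v) ^+ 2 -> a ^+ 2 * v = eta ^+ 2 / v.
  by move=> ->; rewrite expr_div_n expr2 [v ^+ 2]expr2; field; rewrite gt_eqF.
have h1 := @gaussian_chernoff X v (eta / v) v0 lawX.
have h2 := @gaussian_chernoff X v (- (eta / v)) v0 lawX.
rewrite aE// in h1; rewrite aE ?sqrrN// in h2.
have mA (a : R) : measurable [set w | eta ^+ 2 / v <= a * X w].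
  have maX : measurable_fun setT (fun w => a * X w) by exact: measurable_funM.
  have := measurable_fun_ler (measurable_cst (eta ^+ 2 / v)) maX.
  by move=> /(_ measurableT [set true]); rewrite setTI; apply.
apply: (@le_trans _ _ (P ([set w | eta ^+ 2 / v <= eta / v * X w] `|`
    [set w | eta ^+ 2 / v <= - (eta / v) * X w]))).
  apply: le_measure; rewrite ?inE.
  - have mn : measurable_fun setT (fun w => `|W t w - W s w|) by exact: measurableT_comp.
    have := measurable_fun_ltr (measurable_cst eta) mn.
    by move=> /(_ measurableT [set true]); rewrite setTI; apply.
  - exact: measurableU.
  move=> w /=; rewrite -XE lter_normr => /orP[h|h]; [left|right].
    rewrite [leRHS]mulrAC; apply: ler_wpM2r; first by rewrite invr_ge0 ltW.
    by rewrite expr2 ler_wpM2l// ltW.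
  rewrite mulNr -mulrN [leRHS]mulrAC; apply: ler_wpM2r; first by rewrite invr_ge0 ltW.
  by rewrite expr2 ler_wpM2l// ltW.
apply: (le_trans (measureU2 _ (mA _) (mA _))); apply: (le_trans (leeD h1 h2)).
by rewrite -EFinD lee_fin /v; lra.
Qed.

End gaussian_tail.

Fixpoint labels (N : nat) : seq (seq bool) :=
  if N is N'.+1 then
    [::] :: [seq false :: u | u <- labels N'] ++ [seq true :: u | u <- labels N']
  else [::].

Lemma mem_labels N u : (size u < N)%N -> u \in labels N.
Proof.
elim: N u => // N IH [|[] u] //= uN; rewrite inE mem_cat; apply/orP; right.
  by apply/orP; right; apply: map_f; exact: IH.
by apply/orP; left; apply: map_f; exact: IH.
Qed.

Lemma size_labels N : (size (labels N) < 2 ^ N)%N.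
Proof.
elim: N => // N IH; rewrite /= size_cat !size_map expnS mul2n -addnn.
by rewrite -addSn -addnS; apply: leq_add.
Qed.

(** With [q = 2^j] the counting factors together are at most exp(17 q), against the Gaussian
    exp(-q^2 / 2); for j >= 6, that is q >= 64, the latter wins. *)
Lemma modulus_arith (R : realType) j : (6 <= j)%N ->
  (2 ^ (10 * 2 ^ j))%N%:R * (((2 ^ j + 2) * 16 ^ j)%N%:R *
    (2 * expR (- ((2 ^- j) ^+ 2 / (16 ^ j)%N%:R^-1 / 2)))) <= 1 * (1 / 2) ^+ j :> R.
Proof.
move=> j6; pose q : R := (2 ^ j)%N%:R.
have q64 : 64 <= q by rewrite /q -[64]/((2 ^ 6)%N%:R) ler_nat leq_exp2l.
have q0 : 0 < q by lra.
have e2 : 2 <= expR 1 :> R by have := @expR_ge1Dx R 1; lra.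
have p2 k : (2 ^ k)%N%:R <= expR k%:R :> R.
  by rewrite natrX -[X in expR X]mulr1 expRM_natl lerXn2r ?nnegrE ?expR_ge0.
have b1 : (2 ^ (10 * 2 ^ j))%N%:R <= expR (10 * q) :> R.
  by apply: (le_trans (p2 _)); rewrite natrM.
have b2 : (2 ^ j + 2)%N%:R <= expR (2 * q) :> R.
  rewrite natrD -/q; apply: (@le_trans _ _ (expR (q + 1))).
    by have := @expR_ge1Dx R (q + 1); lra.
  by rewrite ler_expR; lra.
have jq : j%:R <= q by rewrite /q ler_nat ltnW// ltn_expl.
have E16 : (16 ^ j)%N%:R = q ^+ 4 :> R.
  by rewrite /q -natrX -expnM mulnC expnM.
have b3 : (16 ^ j)%N%:R <= expR (4 * q) :> R.
  rewrite (_ : (16 ^ j = 2 ^ (4 * j))%N); last by rewrite expnM.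
  by apply: (le_trans (p2 _)); rewrite natrM ler_expR ler_wpM2l.
have b4 : 2 <= expR q by apply: (le_trans e2); rewrite ler_expR; lra.
have b5 : expR (- q) <= (1 / 2) ^+ j.
  rewrite expr_div_n expr1n mul1r expRN lef_pV2 ?posrE ?expR_gt0 ?exprn_gt0//.
  by rewrite -natrX; have := @expR_ge1Dx R q; rewrite /q; lra.
have -> : (2 ^- j) ^+ 2 / (16 ^ j)%N%:R^-1 / 2 = q ^+ 2 / 2.
  rewrite E16 invrK; have -> : 2 ^- j = q^-1 by rewrite /q natrX.
  by field; rewrite gt_eqF.
rewrite natrM mul1r.
apply: (@le_trans _ _ (expR (10 * q) * ((expR (2 * q) * expR (4 * q)) *
    (expR q * expR (- (q ^+ 2 / 2)))))).
  apply: ler_pM => //.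
  apply: ler_pM; [by rewrite mulr_ge0 ?ler0n|by rewrite mulr_ge0 ?expR_ge0| |].
    by apply: ler_pM; rewrite ?ler0n.
  by rewrite ler_wpM2r ?expR_ge0.
rewrite -!expRD; apply: le_trans b5; rewrite ler_expR.
have : 64 * q <= q ^+ 2 by rewrite expr2 ler_wpM2r// ltW.
lra.
Qed.

Section modulus.
Context d (T : measurableType d) (R : realType) (P : probability T R).
Variables (tau : seq bool -> {RV P >-> R}) (B : seq bool -> R -> {RV P >-> R}).
Hypothesis hB : regular_bbm tau B.

(* An increment over a step [16^-j] exceeds [2^-j] with probability at most
   [2 exp (-4^j / 2)], which beats the number [2 ^ (10 * 2 ^ j)] of labels. *)
Lemma modulus_of_continuity : {ae P, forall w, exists j0, forall m, (j0 <= m)%N ->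
  forall u, (size u < 10 * 2 ^ m)%N -> forall r r' : R,
  0 <= r < (2 ^ m + 2)%N%:R -> 0 <= r' < (2 ^ m + 2)%N%:R ->
  `|r - r'| <= (16 ^ m)%N%:R^-1 -> `|B u r w - B u r' w| <= 31 * 2 ^- m}.
Proof.
pose A j u k : set T :=
  [set w | 2 ^- j < `|B u (k.+1%:R / (16 ^ j)%N%:R) w - B u (k%:R / (16 ^ j)%N%:R) w|].
have mA j u k : measurable (A j u k).
  have mn : measurable_fun setT (fun w => `|B u (k.+1%:R / (16 ^ j)%N%:R) w -
      B u (k%:R / (16 ^ j)%N%:R) w|).
    by apply: measurableT_comp => //; exact: measurable_funB.
  have := measurable_fun_ltr (measurable_cst (2 ^- j : R)) mn.
  by move=> /(_ measurableT [set true]); rewrite setTI; apply.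
have PA j u k : (P (A j u k) <=
    (2 * expR (- ((2 ^- j) ^+ 2 / (16 ^ j)%N%:R^-1 / 2)))%:E)%E.
  have h0 : 0 < (16 ^ j)%N%:R :> R by rewrite ltr0n expn_gt0.
  have s0 : 0 <= k%:R / (16 ^ j)%N%:R :> R by rewrite divr_ge0// ltW.
  have st : k%:R / (16 ^ j)%N%:R < k.+1%:R / (16 ^ j)%N%:R :> R.
    by rewrite ltr_pM2r ?invr_gt0// ltr_nat.
  have e0 : 0 <= 2 ^- j :> R by rewrite invr_ge0 exprn_ge0.
  have := increment_tail (bbm_motion (regular_is_bbm hB) u) s0 st e0.
  have -> : k.+1%:R / (16 ^ j)%N%:R - k%:R / (16 ^ j)%N%:R = (16 ^ j)%N%:R^-1 :> R.
    by rewrite -natr1 mulrDl mul1r addrAC subrr add0r.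
  by [].
pose F2 j u : set T := \big[setU/set0]_(k <- iota 0 ((2 ^ j + 2) * 16 ^ j)) A j u k.
pose F j : set T := \big[setU/set0]_(u <- labels (10 * 2 ^ j)) F2 j u.
have mF2 j u : measurable (F2 j u) by apply: bigsetU_measurable.
have mF j : measurable (F j) by apply: bigsetU_measurable.
have half : 0 < (1 / 2 : R) < 1 by lra.
have PF j : (6 <= j)%N -> (P (F j) <= (1 * (1 / 2) ^+ j)%:E)%E.
  move=> j6; pose e : R := 2 * expR (- ((2 ^- j) ^+ 2 / (16 ^ j)%N%:R^-1 / 2)).
  have e0 : 0 <= e by rewrite mulr_ge0// expR_ge0.
  have PF2 u : (P (F2 j u) <= (((2 ^ j + 2) * 16 ^ j)%N%:R * e)%:E)%E.
    apply: (le_trans (probability_bigsetU_le P _)) => //.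
    apply: (@le_trans _ _ (\sum_(k <- iota 0 ((2 ^ j + 2) * 16 ^ j)) e%:E)%E).
      by apply: lee_sum => k _; exact: PA.
    by rewrite sumEFin lee_fin big_const_seq count_predT size_iota iter_addr addr0 mulr_natl.
  have k0 : 0 <= ((2 ^ j + 2) * 16 ^ j)%N%:R * e by rewrite mulr_ge0.
  apply: (le_trans (probability_bigsetU_le P _)) => //.
  apply: (@le_trans _ _ (\sum_(u <- labels (10 * 2 ^ j)) (((2 ^ j + 2) * 16 ^ j)%N%:R * e)%:E)%E).
    by apply: lee_sum => u _; exact: PF2.
  rewrite sumEFin lee_fin big_const_seq count_predT iter_addr addr0 -[leLHS]mulr_natl.
  apply: le_trans (modulus_arith R j6); apply: ler_wpM2r => //.
  by rewrite ler_nat ltnW// size_labels.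
have := borel_cantelli_geometric mF ler01 half PF.
apply: filterS => w [j0 hj]; exists j0 => m jm u um r r' rK rK' rr'.
apply: (@chaining R (fun t => B u t w) _ m (2 ^ m + 2)%N) => //.
  exact: (motion_continuous hB).
move=> j k mj kK; rewrite leNgt; apply/negP => h; apply: (hj j (leq_trans jm mj)).
have mj2 : (2 ^ m <= 2 ^ j)%N by rewrite leq_exp2l.
rewrite /F -bigcup_seq; exists u => /=.
  by apply: mem_labels; apply: (leq_trans um); rewrite leq_mul2l.
rewrite /F2 -bigcup_seq; exists k => //=; rewrite mem_iota /= add0n.
by apply: (leq_trans kK); rewrite leq_mul2r leq_add2r mj2 orbT.
Qed.

(* [2 ^ mesh n] lies between [n^2] and [2 n^2]: the grid of step [16 ^- mesh n] has fewer
   than [n^9] points per unit of time, and an oscillation of order [2 ^- mesh n] for each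
   of the [10 n] ancestors of a particle adds up to less than [1]. *)
Definition mesh (n : nat) : nat := (trunc_log 2 (n ^ 2)).+1.

Definition grid (n : nat) : seq R :=
  [seq n%:R + i%:R / (16 ^ mesh n)%N%:R | i <- iota 0 (16 ^ mesh n).+1].

Lemma mesh_gt n : (0 < n)%N -> (n ^ 2 < 2 ^ mesh n)%N.
Proof. by move=> n0; rewrite trunc_log_ltn. Qed.

Lemma grid_itv n s : s \in grid n -> n%:R <= s <= n%:R + 1.
Proof.
move=> /mapP[i]; rewrite mem_iota add0n ltnS => /andP[_ iN] ->.
have h0 : 0 < (16 ^ mesh n)%N%:R :> R by rewrite ltr0n expn_gt0.
by rewrite lerDl lerD2l divr_ge0 ?(ltW h0)//= ler_pdivrMr// mul1r ler_nat.
Qed.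

Lemma size_grid : exists n1, forall n, (n1 <= n)%N ->
  (size (grid n))%:R <= expR (9 * ln (n%:R : R)).
Proof.
exists 17%N => n n17; have n0 : (0 < n)%N by apply: leq_trans n17.
rewrite size_map size_iota expRM_natl lnK ?posrE ?ltr0n// -natrX ler_nat.
have n20 : (0 < n ^ 2)%N by rewrite expn_gt0 n0.
have /andP[h1 _] := trunc_log_bounds (ltnSn 1) n20.
have h2 : (16 ^ mesh n <= 16 * n ^ 8)%N.
  rewrite (_ : (16 ^ mesh n = (2 ^ mesh n) ^ 4)%N); last by rewrite -expnM mulnC expnM.
  rewrite (_ : (16 * n ^ 8 = (2 * n ^ 2) ^ 4)%N); last by rewrite expnMn -expnM.
  by rewrite leq_exp2r// /mesh expnS leq_mul2l.
apply: (@leq_ltn_trans (16 * n ^ 8)%N) => //; rewrite (expnS n 8) ltn_mul2r expn_gt0 n0 /=.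
exact: leq_trans n17.
Qed.

Lemma grid_near n (t : R) : n%:R <= t <= n%:R + 1 ->
  (exists s, [/\ s \in grid n, s <= t & t - s <= (16 ^ mesh n)%N%:R^-1]) /\
  (exists s, [/\ s \in grid n, t <= s & s - t <= (16 ^ mesh n)%N%:R^-1]).
Proof.
move=> /andP[nt tn]; have h0 : 0 < (16 ^ mesh n)%N%:R :> R by rewrite ltr0n expn_gt0.
have mem i : (i <= 16 ^ mesh n)%N -> n%:R + i%:R / (16 ^ mesh n)%N%:R \in grid n.
  move=> iN; apply: (map_f (fun i => n%:R + i%:R / (16 ^ mesh n)%N%:R : R)).
  by rewrite mem_iota add0n ltnS.
have t0 : 0 <= (t - n%:R) * (16 ^ mesh n)%N%:R by rewrite mulr_ge0 ?subr_ge0// ltW.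
pose i := Num.truncn ((t - n%:R) * (16 ^ mesh n)%N%:R).
have i1 : i%:R / (16 ^ mesh n)%N%:R <= t - n%:R by rewrite ler_pdivrMr// /i truncn_le.
have i2 : t - n%:R < i%:R / (16 ^ mesh n)%N%:R + (16 ^ mesh n)%N%:R^-1.
  have -> : i%:R / (16 ^ mesh n)%N%:R + (16 ^ mesh n)%N%:R^-1 = i.+1%:R / (16 ^ mesh n)%N%:R :> R.
    by rewrite -natr1 mulrDl mul1r.
  by rewrite ltr_pdivlMr// /i truncnS_gt.
have iN : (i <= 16 ^ mesh n)%N.
  rewrite -(@ler_nat R); apply: (@le_trans _ _ ((t - n%:R) * (16 ^ mesh n)%N%:R)).
    by rewrite /i truncn_le.
  by rewrite ler_piMl ?(ltW h0)//; lra.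
split; first by exists (n%:R + i%:R / (16 ^ mesh n)%N%:R); split; [exact: mem|lra|lra].
move: iN; rewrite leq_eqVlt => /predU1P[iN|iN].
  exists (n%:R + i%:R / (16 ^ mesh n)%N%:R); rewrite mem ?iN//.
  move: i1; rewrite iN divff ?gt_eqF// => i1; split => //.
  have : 0 < (16 ^ mesh n)%N%:R^-1 :> R by rewrite invr_gt0.
  lra.
exists (n%:R + i.+1%:R / (16 ^ mesh n)%N%:R); rewrite mem//.
by rewrite -natr1 mulrDl mul1r; split => //; lra.
Qed.

Lemma close_ancestors : {ae P, forall w, exists n0, forall n, (n0 <= n)%N ->
  forall (t t' : R) u, n%:R <= t -> t <= t' -> t' <= n%:R + 1 ->
  t' - t <= (16 ^ mesh n)%N%:R^-1 -> alive (fun u => tau u) t' w u ->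
  exists2 v, alive (fun u => tau u) t w v &
    `|position (fun u => tau u) (fun u => B u) u t' w -
      position (fun u => tau u) (fun u => B u) v t w| <= 1}.
Proof.
apply: filterS2 (birth_time_late hB) modulus_of_continuity => w [n1 hn1] [j0 hj0].
(* [2 ^ j0 <= n] ensures [j0 <= mesh n]; 310 = 10 * 31 makes 10 n oscillations of size 31 / n^2 add
   up to at most 1. *)
exists (maxn n1 (maxn (2 ^ j0) 310)) => n; rewrite !geq_max => /and3P[nn1 nj0 n310].
move=> t t' u nt tt' t'n th au.
have n0 : (0 < n)%N by apply: leq_trans n310.
have tau0 v : 0 < tau v w by exact: (lifetime_gt0 hB).
have un : (size u < 10 * n)%N.
  rewrite ltnNge; apply/negP => un; have := hn1 n nn1 (take (10 * n) u).
  rewrite size_take_min (minn_idPl un) => /(_ erefl).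
  have := @birth_time_take _ _ (fun u => tau u) (10 * n) u w tau0.
  case/andP: au => h _ h1 h2; have := le_trans (le_trans h2 h1) (le_trans h t'n); lra.
have m2 := mesh_gt n0.
have nm : (n <= 2 ^ mesh n)%N.
  by apply: leq_trans (ltnW m2); rewrite expnS expn1 leq_pmulr.
have jm : (j0 <= mesh n)%N by rewrite -(@leq_exp2l 2)// (leq_trans nj0).
have nm' : n%:R <= (2 ^ mesh n)%N%:R :> R by rewrite ler_nat.
have osc v r r' : (size v <= size u)%N -> 0 <= r < (2 ^ mesh n + 2)%N%:R ->
    0 <= r' < (2 ^ mesh n + 2)%N%:R -> `|r - r'| <= (16 ^ mesh n)%N%:R^-1 ->
    `|B v r w - B v r' w| <= 31 * 2 ^- mesh n.
  move=> vu; apply: hj0 => //; apply: (leq_ltn_trans vu); apply: (leq_trans un).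
  by rewrite leq_mul2l nm orbT.
have t0 : 0 <= t by apply: le_trans nt; exact: ler0n.
have t'K : t' < (2 ^ mesh n + 2)%N%:R by rewrite natrD; lra.
have B0 v : B v 0 w = 0 by exact: (motion_start hB).
have [v av hv] := @ancestor_close _ _ (fun u => tau u) (fun u => B u) u w _ _ _ t t'
  tau0 B0 osc t0 tt' th t'K au.
exists v => //; apply: (le_trans hv).
rewrite mulrA ler_pdivrMr ?exprn_gt0// mul1r -natrX.
apply: (@le_trans _ _ (n ^ 2)%N%:R); last by rewrite ler_nat ltnW.
have -> : 31 = 31%:R :> R by [].
rewrite -natrM ler_nat expnS expn1; apply: (@leq_trans (10 * n * 31)%N).
  by rewrite leq_mul2r.
by rewrite mulnAC leq_mul2r orbC (leq_trans _ n310).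
Qed.

End modulus.

(** * Modification on a null set *)

Section modification.
Context d (T : measurableType d) (R : realType) (P : probability T R).
Variable N : set T.
Hypothesis mN : measurable N.
Hypothesis N0 : P N = 0%E.

Definition agree_off (A A' : set T) : Prop := forall w, ~ N w -> A w <-> A' w.

Lemma agree_off_probability A A' : measurable A -> measurable A' -> agree_off A A' ->
  P A = P A'.
Proof.
move=> mA mA' AA'; rewrite -(measureU0 mA mN N0) -(measureU0 mA' mN N0); congr (P _).
by apply/seteqP; split=> w [h|Nw]; [|by right| |by right];
  have [Nw|nNw] := pselect (N w); [by right|by left; apply/AA'|by right|by left; apply/AA'].
Qed.

Lemma agree_off_preimage (X X' : T -> R) (C : set R) :
  (forall w, ~ N w -> X w = X' w) -> agree_off (X @^-1` C) (X' @^-1` C).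
Proof. by move=> XX' w /XX' /= ->. Qed.

(** This relation passes from generators to sigma-algebras, because the events with a representative
    in a sigma-algebra themselves form one, and it transports independence from [G] to [G']. *)
Definition agrees_off (G G' : set (set T)) : Prop :=
  forall A', G' A' -> exists A, G A /\ agree_off A A'.

Lemma agrees_off_rv (X X' : T -> R) : (forall w, ~ N w -> X w = X' w) ->
  agrees_off (sigma_rv X) (sigma_rv X').
Proof.
move=> XX' _ [C mC <-]; exists (X @^-1` C); split.
  by exists C => //; rewrite setTI.
by rewrite setTI; exact: agree_off_preimage.
Qed.

Lemma agrees_off_process (W W' : R -> T -> R) :
  (forall t w, ~ N w -> W t w = W' t w) ->
  agrees_off (sigma_process W) (sigma_process W').
Proof.
move=> WW'; apply: smallest_sub.
  split.
  - by exists set0; split => //; exact: (@measurable0 _ (g_sigma_algebraType _)).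
  - move=> A' [A [GA AA']]; exists (setT `\` A); split.
      by rewrite setTD; exact: (@measurableC _ (g_sigma_algebraType _)).
    by move=> w nNw; split=> -[_ h]; split => // /(AA' w nNw).
  - move=> F' /choice [F hF]; exists (\bigcup_k F k); split.
      by apply: (@bigcup_measurable _ (g_sigma_algebraType _)) => k _; have [] := hF k.
    by move=> w nNw; split=> -[k _ h]; exists k => //; have [_ FF] := hF k; apply/(FF w nNw).
move=> A' [t t0 /(agrees_off_rv (WW' t)) [A [GA AA']]]; exists A; split => //.
by apply: sub_sigma_algebra; exists t.
Qed.

Lemma bigsetI_seqP (I : eqType) (l : seq I) (A : I -> set T) w :
  (\big[setI/setT]_(i <- l) A i) w <-> forall i, i \in l -> A i w.
Proof.
elim: l => [|j l IH]; first by rewrite big_nil.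
rewrite big_cons; split=> [[Aj /IH h] i|h].
  by rewrite inE => /predU1P[->|/h].
by split; [apply: h; exact: mem_head|apply/IH => i il; apply: h; rewrite inE il orbT].
Qed.

Lemma mutually_independent_agrees_off (I : eqType) (G G' : I -> set (set T)) :
  (forall i, G i `<=` measurable) -> (forall i, G' i `<=` measurable) ->
  (forall i, agrees_off (G i) (G' i)) ->
  mutually_independent P G -> mutually_independent P G'.
Proof.
move=> mG mG' GG' ind l A' ul GA'.
have /choice [A hA] : forall i, exists A, i \in l -> G i A /\ agree_off A (A' i).
  move=> i; case: (boolP (i \in l)) => il; last by exists set0.
  by have [A [GA AA']] := GG' i _ (GA' i il); exists A.
have -> : P (\big[setI/setT]_(i <- l) A' i) = P (\big[setI/setT]_(i <- l) A i).
  apply: agree_off_probability.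
  - rewrite big_seq; apply: bigsetI_measurable => i il.
    exact: mG' (GA' i il).
  - rewrite big_seq; apply: bigsetI_measurable => i il.
    by apply: (mG i); have [] := hA i il.
  - move=> w nNw; split=> /bigsetI_seqP h; apply/bigsetI_seqP => i il;
      have [_ AA'] := hA i il; apply/(AA' w nNw); exact: h.
rewrite ind//; last by move=> i il; have [] := hA i il.
apply: eq_big_seq => i il; have [GA AA'] := hA i il.
by apply: agree_off_probability => //; [exact: mG GA|exact: mG' (GA' i il)].
Qed.

Lemma measurable_modified (k : R) (X : T -> R) : measurable_fun setT X ->
  measurable_fun setT (fun w => if w \in N then k else X w).
Proof.
move=> mX; apply: measurable_fun_ifT => //.
apply: (measurable_fun_bool true); rewrite setTI.
by rewrite (_ : _ @^-1` _ = N)//; apply/seteqP; split=> w /=; [exact: set_mem|exact: mem_set].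
Qed.

Definition modified (k : R) (X : {RV P >-> R}) : {RV P >-> R} :=
  mfun_Sub (mem_set (measurable_modified k (measurable_funPT X))).

Lemma modifiedE k (X : {RV P >-> R}) w : modified k X w = if w \in N then k else X w.
Proof. by []. Qed.

Lemma modified_off k (X : {RV P >-> R}) w : ~ N w -> X w = modified k X w.
Proof. by move=> nNw; rewrite modifiedE memNset. Qed.

Variables (tau : seq bool -> {RV P >-> R}) (B : seq bool -> R -> {RV P >-> R}).
Hypothesis hBBM : branching_brownian_motion tau B.
Hypothesis tau0 : forall u w, ~ N w -> 0 < tau u w.
Hypothesis B0 : forall u w, ~ N w -> B u 0 w = 0.
Hypothesis cB : forall u w, ~ N w -> {within `[0, +oo[, continuous (fun t => B u t w)}.

(** On the null set the lifetimes become 1 and the motions vanish, values for which positivity, the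
    start at 0 and continuity hold. *)
Let tau' u := modified 1 (tau u).
Let B' u r := modified 0 (B u r).

Lemma brownian_motion_modified u : brownian_motion (B' u).
Proof.
have [_ ind norm _] := bbm_motion hBBM u.
have inc s t w : ~ N w -> (B u t \- B u s) w = (B' u t \- B' u s) w.
  by move=> nNw /=; congr (_ - _); exact: modified_off.
split.
- apply: aeW => w; rewrite modifiedE; case: ifP => // /negbT wN.
  by apply: B0 => Nw; move: wN; rewrite mem_set.
- move=> t t0 ht.
  apply: (mutually_independent_agrees_off _ _ _ (ind t t0 ht)) => i.
  + by apply: sigma_rv_measurable; exact: measurable_funB.
  + by apply: sigma_rv_measurable; exact: measurable_funB.
  + by apply: agrees_off_rv => w; exact: inc.
- move=> s t s0 st A mA; rewrite -(norm s t s0 st A mA).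
  apply: agree_off_probability.
  + by rewrite -[X in measurable X]setTI; exact: measurable_funB.
  + by rewrite -[X in measurable X]setTI; exact: measurable_funB.
  + by apply: agree_off_preimage => w nNw; rewrite inc.
- apply: aeW => w; have [Nw|nNw] := pselect (N w).
    rewrite (_ : (fun t : R => _) = cst 0); last first.
      by apply/funext => t; rewrite modifiedE mem_set.
    by apply: continuous_subspaceT => x; exact: cvg_cst.
  rewrite (_ : (fun t : R => _) = (fun t => B u t w)); first exact: cB.
  by apply/funext => t; rewrite -modified_off.
Qed.

Lemma regular_modified : regular_bbm tau' B'.
Proof.
have [ltau _ ind] := hBBM; split; first split.
- move=> u A mA; rewrite -(ltau u A mA); apply: agree_off_probability.
  + by rewrite -[X in measurable X]setTI; exact: measurable_funPT.
  + by rewrite -[X in measurable X]setTI; exact: measurable_funPT.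
  + by apply: agree_off_preimage => w nNw; rewrite -modified_off.
- exact: brownian_motion_modified.
- apply: (mutually_independent_agrees_off _ _ _ ind).
  + by move=> i; apply: driving_sigma_measurable => [u|u t _]; exact: measurable_funPT.
  + by move=> i; apply: driving_sigma_measurable => [u|u t _]; exact: measurable_funPT.
  + case=> u /=; first by apply: agrees_off_rv => w; exact: modified_off.
    by apply: agrees_off_process => t w; exact: modified_off.
- move=> u w; rewrite modifiedE; case: ifP => // /negbT wN.
  by apply: tau0 => Nw; move: wN; rewrite mem_set.
- move=> u w; rewrite modifiedE; case: ifP => // /negbT wN.
  by apply: B0 => Nw; move: wN; rewrite mem_set.
- move=> u w; have [Nw|nNw] := pselect (N w).
    rewrite (_ : (fun t : R => _) = cst 0); last first.
      by apply/funext => t; rewrite modifiedE mem_set.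
    by apply: continuous_subspaceT => x; exact: cvg_cst.
  rewrite (_ : (fun t : R => _) = (fun t => B u t w)); first exact: cB.
  by apply/funext => t; rewrite -modified_off.
Qed.

End modification.

Section regularization.
Context d (T : measurableType d) (R : realType) (P : probability T R).
Variables (tau : seq bool -> {RV P >-> R}) (B : seq bool -> R -> {RV P >-> R}).
Hypothesis hBBM : branching_brownian_motion tau B.

Lemma ae_forall_labels (Q : seq bool -> T -> Prop) :
  (forall u, {ae P, forall w, Q u w}) -> {ae P, forall w, forall u, Q u w}.
Proof.
move=> hQ; pose Q' (n : nat) w := if unpickle n is Some u then Q u w else True.
have hQ' n : {ae P, forall w, Q' n w}.
  by rewrite /Q'; case: (unpickle n) => [u|]; [exact: hQ|apply: aeW].
have := ae_foralln hQ'.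
by apply: filterS => w h u; have := h (pickle u); rewrite /Q' pickleK.
Qed.

Lemma lifetime_ae_gt0 u : {ae P, forall w, 0 < tau u w}.
Proof.
have m (A : set R) : measurable A -> measurable (tau u @^-1` A).
  by move=> mA; rewrite -[X in measurable X]setTI; exact: measurable_funPT.
have law A : measurable A -> P (tau u @^-1` A) = exponential_prob 1 A.
  exact: (bbm_lifetime hBBM u).
exists (tau u @^-1` `]-oo, 0[ `|` tau u @^-1` [set 0]); split.
- by apply: measurableU; apply: m.
- rewrite measureU0; [|exact: m|exact: m|].
    apply: (etrans (law _ (measurable_itv _))).
    rewrite /exponential_prob integral0_eq// => x; rewrite /= in_itv /= => x0.
    by rewrite lt0_exponential_pdf.
  apply: (etrans (law _ (measurable_set1 _))).
  by rewrite /exponential_prob integral_set1.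
- move=> w /= /negP; rewrite -leNgt le_eqVlt => /orP[/eqP h|h]; [right|left] => //.
Qed.

Lemma max_position_ext (X : Type) (tau1 tau2 : seq bool -> X -> R)
    (B1 B2 : seq bool -> R -> X -> R) t w :
  (forall u, tau1 u w = tau2 u w) -> (forall u r, B1 u r w = B2 u r w) ->
  max_position tau1 B1 t w = max_position tau2 B2 t w.
Proof.
move=> ht hb; have bt u : birth_time tau1 u w = birth_time tau2 u w.
  by apply: eq_bigr => k _.
have bp u : birth_position tau1 B1 u w = birth_position tau2 B2 u w.
  by apply: eq_bigr => k _; rewrite ht hb.
rewrite /max_position; congr sup; apply/seteqP; split=> x [u au <-]; exists u.
- by move: au; rewrite /alive /= bt ht.
- by rewrite /position bt bp hb.
- by move: au; rewrite /alive /= bt ht.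
- by rewrite /position bt bp hb.
Qed.

(** Labels are countable, so one null set serves them all. Off it nothing changes, and the maxima
    agree at all times simultaneously. *)
Lemma regularization : exists (tau' : seq bool -> {RV P >-> R})
    (B' : seq bool -> R -> {RV P >-> R}), regular_bbm tau' B' /\
  {ae P, forall w, forall t, max_position tau B t w = max_position tau' B' t w}.
Proof.
have h1 := ae_forall_labels lifetime_ae_gt0.
have h2 := ae_forall_labels (fun u => bm_start (bbm_motion hBBM u)).
have h3 := ae_forall_labels (fun u => bm_continuous (bbm_motion hBBM u)).
have : {ae P, forall w, (forall u, 0 < tau u w) /\ (forall u, B u 0 w = 0) /\
    forall u, {within `[0, +oo[, continuous (fun t : R => B u t w)}}.
  by move: h1 h2 h3; apply: filterS3 => w ? ? ?; split; [|split].
move=> [N [mN N0 hN]].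
have good w : ~ N w -> (forall u, 0 < tau u w) /\ (forall u, B u 0 w = 0) /\
    forall u, {within `[0, +oo[, continuous (fun t : R => B u t w)}.
  by move=> nNw; apply: contrapT => h; apply: nNw; exact: hN.
exists (fun u => modified mN 1 (tau u)), (fun u r => modified mN 0 (B u r)); split.
  apply: (regular_modified mN N0 hBBM) => u w nNw; by have [h [h' h'']] := good w nNw.
exists N; split => // w /= h; apply: contrapT => nNw; apply: h => t.
by apply: max_position_ext => [u|u r]; exact: modified_off.
Qed.

End regularization.

(** * The limits *)

Lemma limf_esup_pinftyE (R : realType) (f : R -> R) (l : R) :
  (forall e, 0 < e -> exists t0, forall t, t0 <= t -> f t <= l + e) ->
  (forall e t0, 0 < e -> exists2 t, t0 <= t & l - e <= f t) ->
  limf_esup (fun t => (f t)%:E) (pinfty_nbhs R) = l%:E.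
Proof.
move=> h1 h2; apply/eqP; rewrite eq_le; apply/andP; split.
  apply/lee_addgt0Pr => e e0; have [t0 ht0] := h1 e e0.
  apply: (@le_trans _ _ (ereal_sup ((fun t => (f t)%:E) @` `]t0, +oo[%classic))).
    apply: ereal_inf_lbound; exists `]t0, +oo[%classic => //.
    by exists t0; split; [exact: num_real|move=> x; rewrite /= in_itv /= andbT].
  apply: ge_ereal_sup => _ [t /= + <-]; rewrite in_itv /= andbT => t0t.
  by rewrite -EFinD lee_fin ht0// ltW.
apply: le_ereal_inf_tmp => _ [V [t0 [_ Vt0]] <-].
apply/lee_subgt0Pr => e e0; have [t tt0 ht] := h2 e (t0 + 1) e0.
apply: (@le_trans _ _ (f t)%:E); first by rewrite -EFinB lee_fin.
apply: ereal_sup_ubound; exists t => //; apply: Vt0; lra.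
Qed.

Section path_bounds.
Context d (T : measurableType d) (R : realType) (P : probability T R).
Variables (tau : seq bool -> {RV P >-> R}) (B : seq bool -> R -> {RV P >-> R}).
Hypothesis hB : regular_bbm tau B.
Variable c : R.
Hypothesis c2 : c ^+ 2 = 2.
Hypothesis c0 : 0 < c.
Local Notation L n := (ln (n%:R : R)).
Local Notation M := (max_position (fun u => tau u) (fun u => B u)).
Local Notation pos := (position (fun u => tau u) (fun u => B u)).
Local Notation living := (alive (fun u => tau u)).

(** The almost sure information from which both limits follow deterministically. The additive 1 is
    the possible displacement of a particle from its ancestor between grid times. *)
Definition controlled_path (e : R) (w : T) : Prop := exists n0, forall n, (n0 <= n)%N ->
  [/\ forall t, n%:R <= t <= n%:R + 1 ->
        c * t - (3 / 2 / c + e) * L n - 1 <= M t w <= c * n%:R - (1 / 2 / c - e) * L n + 1,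
      exists s, n%:R <= s /\ c * s - (1 / 2 / c + e) * L n <= M s w &
      M (2 ^ n)%N%:R w <= c * (2 ^ n)%N%:R - (3 / 2 / c - e) * L (2 ^ n)%N].

Lemma max_position_le t w (x : R) : (exists u, living t w u) ->
  (forall u, living t w u -> pos u t w <= x) -> M t w <= x.
Proof.
move=> [u au] h; apply: ge_sup; first by exists (pos u t w), u.
by move=> _ [v av <-]; exact: h.
Qed.

Lemma max_position_ge t w u (x y : R) : living t w u -> y <= pos u t w ->
  (forall u, living t w u -> pos u t w <= x) -> y <= M t w.
Proof.
move=> au yu h; apply: (le_trans yu); apply: ub_le_sup; last by exists u.
by exists x => _ [v av <-]; exact: h.
Qed.

(** [max_position] is a supremum, informative only for a nonempty bounded set of positions. The
    uniform bounds, extended from the grid to all times, provide both properties, after which the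
    estimates at special times concern the maximum. *)
Lemma controlled_path_ae e : 0 < e <= 1 -> {ae P, forall w, controlled_path e w}.
Proof.
move=> e01; have sg : exists n1, forall n, (n1 <= n)%N -> (size (grid R n))%:R <= expR (9 * L n).
  exact: size_grid.
have up := upper_all_times hB c2 c0 e01 (@grid_itv R) sg.
have lo := lower_all_times hB c2 c0 e01 (@grid_itv R) sg.
have us := upper_some_times hB c2 c0 e01.
have ls := lower_some_time hB c2 c0 e01.
have ca := close_ancestors hB.
have h3 : {ae P, forall w, (exists n0, forall n, (n0 <= n)%N -> forall t, n%:R <= t <= n%:R + 1 ->
    (forall u, living t w u -> pos u t w <= c * n%:R - (1 / 2 / c - e) * L n + 1) /\
    exists2 u, living t w u & c * t - (3 / 2 / c + e) * L n - 1 <= pos u t w)}.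
  move: up lo ca; apply: filterS3 => w [n1 h1] [n2 h2] [n3 h3].
  exists (maxn n1 (maxn n2 n3)) => n; rewrite !geq_max => /and3P[nn1 nn2 nn3] t tn.
  have /andP[t1 t2] := tn.
  (* The upper bound goes back to an ancestor at the preceding grid time; the lower bound takes a
     high particle at the following grid time and its ancestor at [t]. *)
  have [[s [sg1 st ts]] [s' [sg2 ts' s't]]] := grid_near tn; split.
    move=> u au; have /andP[s1 _] := grid_itv sg1.
    have [v av] := h3 n nn3 s t u s1 st t2 ts au.
    rewrite ler_norml => /andP[_ h]; have := h1 n nn1 s sg1 v av; lra.
  have /andP[_ s2] := grid_itv sg2.
  have [u [au hu]] := h2 n nn2 s' sg2.
  have [v av] := h3 n nn3 t s' u t1 ts' s2 s't au.
  rewrite ler_norml => /andP[_ h]; exists v => //.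
  have : c * t <= c * s' by rewrite ler_wpM2l// ltW.
  lra.
move: h3 us ls; apply: filterS3 => w [n1 h1] [n2 h2] [n3 h3].
have locate (t : R) : n1%:R <= t -> exists2 n, (n1 <= n)%N & n%:R <= t <= n%:R + 1.
  move=> t1; have t0 : 0 <= t by apply: le_trans t1; exact: ler0n.
  exists (Num.truncn t); first by rewrite truncn_ge_nat.
  by rewrite truncn_le t0 natr1 ltW// truncnS_gt.
exists (maxn n1 (maxn n2 n3)) => n; rewrite !geq_max => /and3P[nn1 nn2 nn3]; split.
- move=> t tn; have [ub [u au hu]] := h1 n nn1 t tn; apply/andP; split.
    exact: (max_position_ge au hu ub).
  by apply: max_position_le => //; exists u.
- have [s [u [/andP[s1 s2] au hu]]] := h3 n nn3; exists s; split => //.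
  have [m m1 sm] : exists2 m, (n1 <= m)%N & m%:R <= s <= m%:R + 1.
    by apply: locate; apply: le_trans s1; rewrite ler_nat.
  have [ub _] := h1 m m1 s sm.
  exact: (max_position_ge au hu ub).
- have [m m1 sm] : exists2 m, (n1 <= m)%N & m%:R <= ((2 ^ n)%N%:R : R) <= m%:R + 1.
    by apply: locate; rewrite ler_nat; apply: (leq_trans nn1); rewrite ltnW// ltn_expl.
  have [_ [u au _]] := h1 m m1 _ sm.
  by apply: max_position_le; [exists u|exact: h2].
Qed.

Lemma controlled_path_all : {ae P, forall w, forall e, 0 < e -> controlled_path e w}.
Proof.
have h (n : nat) : {ae P, forall w, controlled_path n.+1%:R^-1 w}.
  by apply: controlled_path_ae; rewrite invr_gt0 ltr0n /= invf_le1// ler1n.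
have := ae_foralln h; apply: filterS => w hw e e0.
have [k ke] : exists k : nat, k.+1%:R^-1 <= e.
  exists (Num.bound e^-1); rewrite -[leRHS]invrK lef_pV2 ?posrE ?invr_gt0//.
  have /ltW h' : e^-1 < (Num.bound e^-1)%:R by apply: archi_boundP; rewrite invr_ge0 ltW.
  by apply: (le_trans h'); rewrite ler_nat.
have [n0 hn] := hw k; exists (maxn n0 1) => n; rewrite geq_max => /andP[nn0 n1].
have := hn n nn0; move: (k.+1%:R^-1) ke => e' e'e [h1 [s [ns h2]] h3].
have Ln m : (0 < m)%N -> 0 <= L m by move=> m0; rewrite ln_ge0// ler1n.
have le_e m : (0 < m)%N -> e' * L m <= e * L m by move=> m0; rewrite ler_wpM2r// Ln.
have en := le_e n n1; split.
- move=> t tn; have /andP[a1 a2] := h1 t tn; apply/andP; split.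
    by apply: le_trans a1; rewrite !mulrDl; lra.
  by apply: (le_trans a2); rewrite !mulrBl; lra.
- by exists s; split => //; apply: le_trans h2; rewrite !mulrDl; lra.
- apply: (le_trans h3); have := le_e (2 ^ n)%N; rewrite expn_gt0 => /(_ isT).
  by rewrite !mulrBl; lra.
Qed.

Lemma ln_truncn (t : R) : 1 <= t -> let n := Num.truncn t in
  [/\ (0 < n)%N, n%:R <= t <= n%:R + 1 & L n <= ln t <= L n + 1].
Proof.
move=> t1 n; have t0 : 0 <= t by lra.
have n0 : (0 < n)%N by rewrite truncn_gt0.
have nt : n%:R <= t by rewrite truncn_le.
have tn : t <= n%:R + 1 by rewrite natr1 ltW// truncnS_gt.
have n0' : 0 < n%:R :> R by rewrite ltr0n.
have n1 : 1 <= n%:R :> R by rewrite ler1n.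
split => //; first by rewrite nt.
apply/andP; split; first by rewrite ler_ln ?posrE//; lra.
rewrite -[X in _ + X](@expRK R 1) -lnM ?posrE ?expR_gt0// ler_ln ?posrE ?mulr_gt0 ?expR_gt0//; last lra.
have := @expR_ge1Dx R 1 => h; apply: (le_trans tn).
apply: (@le_trans _ _ (n%:R * 2)); first by lra.
by apply: ler_wpM2l; [exact: ltW|lra].
Qed.

Lemma controlled_path_limits w : (forall e, 0 < e -> controlled_path e w) ->
  limf_einf (fun t : R => ((M t w - c * t) / ln t)%:E) (pinfty_nbhs R) = (- (3 / 2 / c))%:E /\
  limf_esup (fun t : R => ((M t w - c * t) / ln t)%:E) (pinfty_nbhs R) = (- (1 / 2 / c))%:E.
Proof.
move=> hw; pose f t := (M t w - c * t) / ln t.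
have q0 : 0 <= 1 / 2 / c by rewrite !divr_ge0// ltW.
have q1 : 1 / 2 / c <= 1.
  have c1 : 1 <= c by rewrite -(@ler_pXn2r _ 2)// ?nnegrE ?(ltW c0)// c2 expr1n; lra.
  by rewrite ler_pdivrMr//; lra.
have q3 : 3 / 2 / c = 3 * (1 / 2 / c) by rewrite !mulrA; congr (_ / _); lra.
have lnlarge (x : R) : exists t0, forall t, t0 <= t -> x <= ln t.
  exists (expR x) => t xt; rewrite -[leLHS]expRK ler_ln ?posrE ?expR_gt0//.
  exact: lt_le_trans (expR_gt0 x) xt.
have sandwich e : 0 < e -> exists t0, forall t, t0 <= t ->
    [/\ 0 < ln t, f t <= - (1 / 2 / c) + e & - (3 / 2 / c) - e <= f t].
  move=> e0; have e20 : 0 < e / 2 by rewrite divr_gt0.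
  have [n0 hn] := hw (e / 2) e20.
  (* This makes [e * ln t] at least 6, which absorbs the additive constants left by the integer part
     of [t] and by the displacement 1. *)
  have [t1 ht1] := lnlarge (1 + 6 / e + e).
  exists (Num.max (n0%:R + 1) (Num.max 1 t1)) => t; rewrite !ge_max => /and3P[tn0 t_1 tt1].
  have [n00 tn /andP[l1 l2]] := ln_truncn t_1.
  have nn0 : (n0 <= Num.truncn t)%N by rewrite truncn_ge_nat; lra.
  have [h _ _] := hn _ nn0; have /andP[a1 a2] := h t tn; have /andP[tn1 tn2] := tn.
  have lt := ht1 t tt1; have e60 : 0 < 6 / e by rewrite divr_gt0.
  have lt0 : 0 < ln t by lra.
  have le6 : 6 <= e * ln t by rewrite -ler_pdivrMl// mulrC; lra.
  have cn : c * (Num.truncn t)%:R <= c * t by rewrite ler_wpM2l// ltW.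
  split => //.
    rewrite /f ler_pdivrMr// mulrDl mulNr.
    move: a2 l1 l2; set l := ln _%:R => a2 l1 l2.
    have p1 : 1 / 2 / c * ln t <= 1 / 2 / c * (l + 1) by rewrite ler_wpM2l.
    have p2 : e / 2 * l <= e / 2 * ln t by rewrite ler_wpM2l// ltW.
    move: a2; rewrite mulrBl; lra.
  rewrite /f ler_pdivlMr// mulrBl mulNr.
  move: a1 l1 l2; set l := ln _%:R => a1 l1 l2.
  have p1 : 3 / 2 / c * l <= 3 / 2 / c * ln t by rewrite ler_wpM2l// q3; lra.
  have p2 : e / 2 * l <= e / 2 * ln t by rewrite ler_wpM2l// ltW.
  move: a1; rewrite mulrDl; lra.
split.
  rewrite /limf_einf (_ : (fun t => - _)%E = (fun t => (- f t)%:E)); last by apply/funext.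
  rewrite (@limf_esup_pinftyE _ _ (3 / 2 / c)).
  - by rewrite EFinN.
  - move=> e e0; have [t0 ht0] := sandwich e e0; exists t0 => t tt0.
    have [_ _ h] := ht0 t tt0; lra.
  - move=> e t0 e0; have [t1 ht1] := sandwich e e0; have [n0 hn] := hw e e0.
    (* The powers of 2 are the times at which the maximum is known to be low. *)
    pose n := maxn n0 (maxn (Num.truncn t0).+1 (Num.truncn t1).+1).
    have big (x : R) : ((Num.truncn x).+1 <= n)%N -> x <= (2 ^ n)%N%:R.
      move=> h; apply: ltW; apply: (lt_le_trans (truncnS_gt x)); rewrite ler_nat.
      by apply: (leq_trans h); rewrite ltnW// ltn_expl.
    have [_ _ h3] := hn n (leq_maxl _ _).
    exists (2 ^ n)%N%:R; first by apply: big; rewrite /n !leq_max leqnn !orbT.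
    have [l0 _ _] := ht1 (2 ^ n)%N%:R (big t1 ltac:(by rewrite /n !leq_max leqnn !orbT)).
    have : f (2 ^ n)%N%:R <= - (3 / 2 / c) + e.
      rewrite /f ler_pdivrMr// mulrDl mulNr; move: h3; rewrite mulrBl; lra.
    lra.
apply: limf_esup_pinftyE.
- move=> e e0; have [t0 ht0] := sandwich e e0; exists t0 => t tt0.
  by have [] := ht0 t tt0.
- move=> e t0 e0; have [t1 ht1] := sandwich e e0; have [n0 hn] := hw e e0.
  pose n := maxn n0 (maxn (Num.truncn t0).+1 (Num.truncn t1).+1).
  have big (x s : R) : ((Num.truncn x).+1 <= n)%N -> n%:R <= s -> x <= s.
    move=> h ns; apply: ltW; apply: (lt_le_trans (truncnS_gt x)).
    by apply: le_trans ns; rewrite ler_nat.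
  have [_ [s [ns h2]] _] := hn n (leq_maxl _ _).
  exists s; first by apply: (big _ _ _ ns); rewrite /n !leq_max leqnn !orbT.
  have t1n : ((Num.truncn t1).+1 <= n)%N by rewrite /n !leq_max leqnn !orbT.
  have [l0 _ _] := ht1 s (big _ _ t1n ns).
  have n0' : 0 < n%:R :> R by rewrite ltr0n; apply: leq_trans t1n.
  have Ls : L n <= ln s by rewrite ler_ln ?posrE//; exact: lt_le_trans ns.
  have p : (1 / 2 / c + e) * L n <= (1 / 2 / c + e) * ln s.
    by rewrite ler_wpM2l// addr_ge0// ltW.
  change (- (1 / 2 / c) - e <= f s); rewrite /f ler_pdivlMr// mulrBl mulNr.
  move: p h2; rewrite [_ * ln s]mulrDl; lra.
Qed.

End path_bounds.

Theorem theorem2 (R : realType) (d : measure_display) (T : measurableType d)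
    (P : probability T R) (tau : seq bool -> {RV P >-> R})
    (B : seq bool -> R -> {RV P >-> R})
    (hBBM : branching_brownian_motion tau B) :
  {ae P, forall w,
    limf_einf
      (fun t : R => ((max_position tau B t w - Num.sqrt 2 * t) / ln t)%:E)
      (pinfty_nbhs R)
    = (- (3 / (2 * Num.sqrt 2)))%:E} /\
  {ae P, forall w,
    limf_esup
      (fun t : R => ((max_position tau B t w - Num.sqrt 2 * t) / ln t)%:E)
      (pinfty_nbhs R)
    = (- (1 / (2 * Num.sqrt 2)))%:E}.
Proof.
pose c : R := Num.sqrt 2.
have c2 : c ^+ 2 = 2 by rewrite sqr_sqrtr.
have c0 : 0 < c by rewrite sqrtr_gt0.
have E (x : R) : x / (2 * c) = x / 2 / c by rewrite invfM mulrA.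
(* The estimates are applied to the regular version, whose maximum is almost surely the same
   function of time. *)
have [tau' [B' [hB hM]]] := regularization hBBM.
have H : {ae P, forall w,
    limf_einf (fun t : R => ((max_position tau B t w - c * t) / ln t)%:E)
      (pinfty_nbhs R) = (- (3 / (2 * c)))%:E /\
    limf_esup (fun t : R => ((max_position tau B t w - c * t) / ln t)%:E)
      (pinfty_nbhs R) = (- (1 / (2 * c)))%:E}.
  move: hM (controlled_path_all hB c2 c0); apply: filterS2 => w Mw hw.
  rewrite !E; have [h1 h2] := controlled_path_limits c2 c0 hw.
  split; [rewrite -h1; congr limf_einf|rewrite -h2; congr limf_esup];
    by apply/funext => t; rewrite Mw.
by split; apply: filterS H => w [].
Qed.
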